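(* Let $P:\mathbb{C}^2\to\mathbb{C}^2$ be a holomorphic skew-product $P(z,w)=(p(z),q(z,w))$ such that, near the origin, $$p(z)=z-z^2+az^3+O(z^4),\qquad q(z,w)=w+w^2+bz^2+b_{0,3}w^3+b_{3,0}z^3+O(\|(z,w)\|^4),$$ with $a,b,b_{0,3},b_{3,0}\in\mathbb{C}$, and let $q_0:=q(0,\cdot)$. Assume that $b$ is real with $b>\frac14$, set $$c:=\frac{\sqrt{4b-1}}{2},\qquad \alpha_0:=e^{\pi/c},\qquad \beta_0:=(b_{0,3}-a)(\alpha_0-1),$$ and assume $\beta_0\in\mathbb{R}$. Let $(n_k)_{k\ge0}$ be an $(\alpha_0,\beta_0)$-admissible sequence with phase sequence $(\sigma_k)_{k\ge0}$. Then, as $k\to+\infty$, $$P^{n_{k+1}-n_k}(p^{n_k}(z),w)=\bigl(0,\mathcal{L}(\alpha_0,\Gamma+\sigma_k;z,w)\bigr)+o(1),$$ with uniform convergence on compact subsets of $\mathcal{B}_p\times\mathcal{B}_{q_0}$, where $\Gamma$ is the constant $$\Gamma:=(e^{\pi/c}-1)\left(\frac{a-b_{0,3}+b_{3,0}}{2b}+a+\frac12(1-b_{0,3})+(b_{0,3}-1)\ln c\right)+(b_{0,3}-a)\frac{\pi}{c}+e^{\pi/c}(1-b_{0,3})\int_0^{\pi/c}e^{-u}\ln\sin(cu)\,du,$$ which depends only on $a,b,b_{0,3},b_{3,0}$.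
   Context: Admissible sequences. Given real $\alpha>1$ and $\beta\in\mathbb{R}$, a strictly increasing sequence of positive integers $(n_k)_{k\ge0}$ is $(\alpha,\beta)$-admissible if its phase sequence $\sigma_k:=n_{k+1}-\alpha n_k-\beta\ln n_k$ is bounded. Fatou coordinates. Let $f$ be an entire function with $f(z)=z+a_2z^2+a_3z^3+O(z^4)$, $a_2\ne0$. For small $r>0$ let $\mathcal{P}_f^\iota=\{|a_2z+r|<r\}$ (incoming petal) and $\mathcal{P}^o_f=\{|a_2z-r|<r\}$ (outgoing petal). The parabolic basin is $\mathcal{B}_f=\bigcup_{n\ge0}f^{-n}(\mathcal{P}^\iota_f)$. The incoming and outgoing Fatou coordinates $\phi^{\iota}_f:\mathcal{P}^\iota_f\to\mathbb{C}$ and $\phi^o_f:\mathcal{P}^o_f\to\mathbb{C}$ are the univalent holomorphic maps satisfying $\phi_f^{\iota/o}\circ f=\phi_f^{\iota/o}+1$ and normalized by $$\phi_f^\iota(z)=-\frac1{a_2z}-\mathfrak{b}\log\left(-\frac1{a_2z}\right)+o(1),\qquad \phi_f^o(z)=-\frac1{a_2z}-\mathfrak{b}\log\left(\frac1{a_2z}\right)+o(1)$$ as $z\to0$ in the corresponding petal, where $\mathfrak{b}:=1-\frac{a_3}{a_2^2}$. Via the functional equation, $\phi_f^\iota$ extends to $\mathcal{B}_f$, and the inverse of $\phi_f^o$ extends to an entire function $(\phi_f^o)^{-1}:\mathbb{C}\to\mathbb{C}$ with $f\circ(\phi_f^o)^{-1}(Z)=(\phi_f^o)^{-1}(Z+1)$.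 Generalized Lavaurs map of phase $\sigma\in\mathbb{C}$ and parameter $\alpha\in\mathbb{C}$: for $(z,w)\in\mathcal{B}_p\times\mathcal{B}_{q_0}$, $$\mathcal{L}(\alpha,\sigma;z,w):=(\phi^o_{q_0})^{-1}\left(\alpha\,\phi^\iota_{q_0}(w)+(1-\alpha)\,\phi^\iota_p(z)+\sigma\right).$$ *)

(* Defs.v *)
(** Real and complex numbers are those of Stdlib and Coquelicot. *)
From Stdlib Require Import Reals List.
From Coquelicot Require Import Coquelicot.

Open Scope R_scope.

Definition C2 : NormedModule C_AbsRing :=
  prod_NormedModule C_AbsRing C_NormedModule C_NormedModule.

Definition holomorphic_at (f : C -> C) (z : C) : Prop :=
  @ex_derive C_AbsRing C_NormedModule f z.

Definition entire (f : C -> C) : Prop := forall z : C, holomorphic_at f z.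

(** Complex Fréchet differentiability: the differential is [C]-linear. *)
Definition holomorphic2 (F : C2 -> C2) : Prop :=
  forall x : C2, @ex_filterdiff C_AbsRing C2 C2 F (locally x).

(** [g x = O(||x||^n)] as [x] tends to [0]. *)
Definition bigO_pow {U : NormedModule C_AbsRing} (g : U -> C) (n : nat) : Prop :=
  exists M d : R, 0 < d /\
    forall x : U, norm x < d -> Cmod (g x) <= M * norm x ^ n.

Definition compact_set {U : UniformSpace} (K : U -> Prop) : Prop :=
  forall (I : Type) (O : I -> U -> Prop),
    (forall i, open (O i)) ->
    (forall x, K x -> exists i, O i x) ->
    exists l : list I, forall x, K x -> exists i, In i l /\ O i x.

(** Principal determination, with argument in [(-PI, PI]]. *)
Definition Carg (z : C) : R :=
  if Rle_dec 0 (Im z) then acos (Re z / Cmod z) else - acos (Re z / Cmod z).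

Definition Clog (z : C) : C := (ln (Cmod z), Carg z).

Section Fatou.

Local Open Scope C_scope.

(** In this section, [f z = z + a2 z^2 + a3 z^3 + O(z^4)] with [a2 <> 0], and [r]
    is the parameter of the petals. *)
Variables (f : C -> C) (a2 a3 : C) (r : R).

Definition incoming_petal (z : C) : Prop := (Cmod (a2 * z + r) < r)%R.

Definition outgoing_petal (z : C) : Prop := (Cmod (a2 * z - r) < r)%R.

Definition basin (z : C) : Prop :=
  exists n : nat, incoming_petal (Nat.iter n f z).

Definition resit : C := 1 - a3 / a2 ^ 2.

(** The incoming Fatou coordinate, together with its extension to the basin:
    [phi] is univalent on the petal, and the functional equation on the whole
    basin determines it there from its restriction to the petal. The values of
    [phi] outside the basin are irrelevant. *)
Record incoming_fatou (phi : C -> C) : Prop := {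
  incoming_holomorphic :
    forall z, incoming_petal z -> holomorphic_at phi z;
  incoming_injective :
    forall z1 z2, incoming_petal z1 -> incoming_petal z2 ->
      phi z1 = phi z2 -> z1 = z2;
  incoming_equation : forall z, basin z -> phi (f z) = phi z + 1;
  incoming_normalized :
    filterlim
      (fun z => phi z - (- (1 / (a2 * z)) - resit * Clog (- (1 / (a2 * z)))))
      (within incoming_petal (locally (0 : C))) (locally (0 : C))
}.

(** The outgoing Fatou coordinate; its values outside the petal are
    irrelevant. *)
Record outgoing_fatou (phi : C -> C) : Prop := {
  outgoing_holomorphic :
    forall z, outgoing_petal z -> holomorphic_at phi z;
  outgoing_injective :
    forall z1 z2, outgoing_petal z1 -> outgoing_petal z2 ->
      phi z1 = phi z2 -> z1 = z2;
  outgoing_equation :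
    forall z, outgoing_petal z -> outgoing_petal (f z) -> phi (f z) = phi z + 1;
  outgoing_normalized :
    filterlim
      (fun z => phi z - (- (1 / (a2 * z)) - resit * Clog (1 / (a2 * z))))
      (within outgoing_petal (locally (0 : C))) (locally (0 : C))
}.

(** [psi] is the entire extension of the inverse of the outgoing Fatou
    coordinate [phi]. *)
Record outgoing_inverse (phi psi : C -> C) : Prop := {
  outgoing_inverse_entire : entire psi;
  outgoing_inverse_left : forall z, outgoing_petal z -> psi (phi z) = z;
  outgoing_inverse_equation : forall Z, f (psi Z) = psi (Z + 1)
}.

End Fatou.

(** [psi_o], [phi_q] and [phi_p] stand for the entire extension of the inverse of
    the outgoing Fatou coordinate of [q_0] and for the incoming Fatou coordinates
    of [q_0] and [p]. *)
Definition lavaurs (psi_o phi_q phi_p : C -> C) (alpha sigma z w : C) : C :=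
  psi_o (alpha * phi_q w + (1 - alpha) * phi_p z + sigma)%C.

Definition phase (alpha beta : R) (n : nat -> nat) (k : nat) : R :=
  INR (n (S k)) - alpha * INR (n k) - beta * ln (INR (n k)).

Definition admissible (alpha beta : R) (n : nat -> nat) : Prop :=
  (forall k, (0 < n k)%nat) /\
  (forall k, (n k < n (S k))%nat) /\
  exists M : R, forall k, Rabs (phase alpha beta n k) <= M.

Definition cst_c (b : R) : R := sqrt (4 * b - 1) / 2.

Definition alpha0 (b : R) : R := exp (PI / cst_c b).

(** The integrand is singular at both endpoints, hence the improper integral. *)
Definition Gamma_integral (b : R) : R :=
  RInt_gen (fun u => exp (- u) * ln (sin (cst_c b * u)))
    (at_right 0) (at_left (PI / cst_c b)).

Definition Gamma (a : C) (b : R) (b03 b30 : C) : C :=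
  ((alpha0 b - 1)
     * ((a - b03 + b30) / (2 * b) + a + 1 / 2 * (1 - b03)
        + (b03 - 1) * ln (cst_c b))
   + (b03 - a) * (PI / cst_c b)%R
   + alpha0 b * (1 - b03) * Gamma_integral b)%C.

(* Main.v *)
Require Import Defs.
From Stdlib Require Import Reals Lra Lia Psatz List Classical ClassicalEpsilon.
From Coquelicot Require Import Coquelicot.

Open Scope R_scope.

(** In the coordinate [X = - 1 / w] both maps are close to a translation by [1]. Write
    [m = n_k], [N = n_(k+1)]; at time [n] between [m] and [N] the base coordinate is
    [/ (n + (1 - a) ln n + phi_p z + o(1))], and the fiber coordinate goes through three
    stages, with [L] of order [m ^ (1 / 4)].

    For the first [L] steps the base is so small that [X - (1 - b03) log X], an
    approximate Fatou coordinate of [q_0], still increases by [1] at each step; hence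
    [X = L + (1 - b03) ln L + phi_q w + o(1)] at time [m + L].

    During the long transit [w / z] nearly follows the Riccati equation whose solutions are
    [w / z + 1 / 2 = - c cot (c ln (n / m))], which joins the incoming petal ([n = m]) to the
    outgoing one ([n = exp (PI / c) m]). Let [theta] be proportional to [ln (n / m)], with
    values [0] at [m] and [PI] at [N], and measure by [eps] the tangent of the deviation of
    [atan ((w / z + 1 / 2) / c)] from [theta - PI / 2]. Then [eps] is [O(ln m / m)] and its
    increments agree, up to terms summing to [o(1 / m)], with those of an explicit function
    of [n], [theta] and [z]. One of its terms is [c (1 - b03) Phi theta / m], [Phi] being a
    primitive of [exp (- theta / c) ln (sin theta) / c]; it produces the integral in [Gamma].

    At both ends [m eps] is an affine function of [X] up to [o(1)], so that at time
    [N - L] one finds [X = - L + (1 - b03) ln L + Lambda + o(1)], where [Lambda] is the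
    argument of the outgoing parametrization in the Lavaurs map. The last [L] steps are
    treated as the first ones, with the outgoing Fatou coordinate. Uniformity on compact
    sets is obtained by letting the starting point depend on [k]. *)

(** * Complex logarithm *)

(** The product [m eps] is wanted up to [o(1)] while the transit has about [m] steps, so the terms
    of order [1 / n ^ 2] in the increments of [eps] add up to something visible: they must be summed
    exactly, and only errors of total [o(1 / m)] may be bounded. This forces the explicit potential.
    Its singular part comes from [cot theta], of order [m / rho] at distance [rho] from an end; the
    errors [ln m / (m rho ^ 2)] add up to [ln m / (m L)], so [L] must be much larger than [ln m].
    Conversely the base perturbs each step of [X] by about [(z X) ^ 2], hence a petal stage by at
    most [L ^ 3 / m ^ 2], and linearizing tangents at the junctions costs [L ^ 2 / m]. The exponent
    [1 / 4] meets the three constraints. The angle is rescaled to be exactly [PI] at [N]. Its speed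
    then differs from [c] by [O(ln m / m)], and through this mismatch the phase [sigma_k] enters the
    limit. The terms in [ln m] contributed by the base logarithm, by [ln (sin theta)] and by this
    mismatch cancel exactly when [beta0 = (b03 - a) (alpha0 - 1)], which explains the logarithm in
    the notion of admissible sequence. *)

Lemma Cmod_minus_sym (x y : C) : Cmod (x - y) = Cmod (y - x).
Proof. rewrite <- (Cmod_opp (x - y)). f_equal. ring. Qed.

Lemma Cmod_minus_le (x y : C) : Cmod (x - y) <= Cmod x + Cmod y.
Proof. unfold Cminus. rewrite <- (Cmod_opp y). apply Cmod_triangle. Qed.

Lemma Cmod_rev (x y : C) : Cmod x <= Cmod y + Cmod (x - y).
Proof. replace x with (y + (x - y))%C at 1 by ring. apply Cmod_triangle. Qed.

Lemma Re_le_Cmod (z : C) : Rabs (Re z) <= Cmod z.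
Proof. eapply Rle_trans; [apply Rmax_l | apply Rmax_Cmod]. Qed.

Lemma Im_le_Cmod (z : C) : Rabs (Im z) <= Cmod z.
Proof. eapply Rle_trans; [apply Rmax_r | apply Rmax_Cmod]. Qed.

Lemma Cmod_le_Re_Im (z : C) : Cmod z <= Rabs (Re z) + Rabs (Im z).
Proof.
  unfold Cmod. apply Rsqr_incr_0_var.
  - rewrite Rsqr_sqrt by nra.
    unfold Rsqr, Re, Im.
    rewrite <- (pow2_abs (fst z)), <- (pow2_abs (snd z)).
    pose proof (Rabs_pos (fst z)). pose proof (Rabs_pos (snd z)). nra.
  - pose proof (Rabs_pos (Re z)). pose proof (Rabs_pos (Im z)). lra.
Qed.

Lemma Cmod_sqr (z : C) : Cmod z ^ 2 = Re z ^ 2 + Im z ^ 2.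
Proof. unfold Cmod, Re, Im. rewrite pow2_sqrt; [reflexivity | nra]. Qed.

Lemma Re_plus (x y : C) : Re (x + y) = Re x + Re y.
Proof. reflexivity. Qed.
Lemma Re_minus (x y : C) : Re (x - y) = Re x - Re y.
Proof. reflexivity. Qed.
Lemma Im_minus (x y : C) : Im (x - y) = Im x - Im y.
Proof. reflexivity. Qed.

Lemma Re_close (z : C) (x : R) : x - Cmod (z - x) <= Re z.
Proof.
  pose proof (Re_le_Cmod (z - x)) as H. rewrite Re_minus in H. simpl in H.
  apply Rabs_le_between in H. lra.
Qed.

(** The definition by [acos] splits along the real axis, exactly where the orbits run; on the right
    half-plane the formula with [atan] is smooth across it and can be differentiated. *)
Lemma Carg_right (z : C) : 0 < Re z -> Carg z = atan (Im z / Re z).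
Proof.
  intros H. unfold Carg.
  assert (Hm : 0 < Cmod z).
  { apply Rlt_le_trans with (1 := H).
    eapply Rle_trans; [apply Rle_abs | apply Re_le_Cmod]. }
  assert (Hc : Re z / Cmod z = cos (atan (Im z / Re z))).
  { rewrite cos_atan.
    assert (E : 1 + (Im z / Re z)² = (Cmod z / Re z) ^ 2).
    { unfold Rdiv. rewrite Rpow_mult_distr, Cmod_sqr. unfold Rsqr. field. lra. }
    rewrite E, sqrt_pow2.
    - field. lra.
    - apply Rlt_le, Rdiv_lt_0_compat; lra. }
  pose proof (atan_bound (Im z / Re z)) as Hb.
  destruct (Rle_dec 0 (Im z)) as [Hi|Hi].
  - rewrite Hc. apply acos_cos.
    split; [|lra].
    assert (Hq : 0 <= Im z / Re z) by (apply Rdiv_le_0_compat; lra).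
    destruct (Rle_lt_or_eq_dec _ _ Hq) as [Hq'|Hq'].
    + rewrite <- atan_0. apply Rlt_le, atan_increasing; exact Hq'.
    + rewrite <- Hq', atan_0; lra.
  - rewrite Hc, <- cos_neg, acos_cos. ring.
    assert (Hq : Im z / Re z < 0).
    { unfold Rdiv. apply Ropp_lt_cancel. rewrite Ropp_0, Ropp_mult_distr_l.
      apply Rmult_lt_0_compat; [lra|]. apply Rinv_0_lt_compat; lra. }
    split; [|lra].
    apply atan_increasing in Hq. rewrite atan_0 in Hq. lra.
Qed.

Lemma Clog_bound (z : C) : Cmod (Clog z) <= Rabs (ln (Cmod z)) + PI.
Proof.
  eapply Rle_trans; [apply Cmod_le_Re_Im|]. unfold Clog, Re, Im; simpl.
  apply Rplus_le_compat_l. unfold Carg.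
  pose proof (acos_bound (Re z / Cmod z)).
  destruct (Rle_dec 0 (Im z)); [|rewrite Rabs_Ropp]; rewrite Rabs_pos_eq; lra.
Qed.

Lemma ln_Cmod (z : C) : 0 < Cmod z -> ln (Cmod z) = / 2 * ln (Re z ^ 2 + Im z ^ 2).
Proof.
  intros H. rewrite <- Cmod_sqr. rewrite ln_pow by exact H. simpl. field.
Qed.

Lemma Clog_RtoC (x : R) : 0 < x -> Clog (RtoC x) = RtoC (ln x).
Proof.
  intros H. unfold Clog. rewrite Carg_right by exact H. simpl.
  replace (0 / x) with 0 by (field; lra). rewrite atan_0, Cmod_R, Rabs_pos_eq by lra.
  reflexivity.
Qed.

Lemma Cdiv_parts (h z : C) : z <> 0 ->
  Re (h / z) = (Re h * Re z + Im h * Im z) / (Re z ^ 2 + Im z ^ 2) /\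
  Im (h / z) = (Im h * Re z - Re h * Im z) / (Re z ^ 2 + Im z ^ 2).
Proof.
  intros Hz. destruct h as [p q], z as [x y].
  assert (x ^ 2 + y ^ 2 <> 0).
  { intros H. apply Hz. assert (x = 0) by nra. assert (y = 0) by nra. subst.
    reflexivity. }
  unfold Cdiv, Cinv, Cmult, Re, Im; simpl. split; field; simpl in H; lra.
Qed.

Lemma Cdiv_shift (z h : C) (t : R) :
  0 <= t <= 1 -> 0 < Cmod z -> Cmod h <= Cmod z / 2 ->
  (z + t * h)%C <> 0 /\
  Cmod (h / (z + t * h) - h / z) <= 2 * (Cmod h ^ 2 / Cmod z ^ 2).
Proof.
  intros Ht Hz Hh.
  assert (Hth : Cmod (t * h) <= Cmod z / 2).
  { rewrite Cmod_mult, Cmod_R, Rabs_pos_eq by lra.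
    pose proof (Cmod_ge_0 h). nra. }
  assert (H1 : Cmod z / 2 <= Cmod (z + t * h)).
  { pose proof (Cmod_rev z (z + t * h)) as H.
    replace (z - (z + t * h))%C with (- (t * h))%C in H by ring.
    rewrite Cmod_opp in H. lra. }
  assert (Hn : (z + t * h)%C <> 0) by (apply Cmod_gt_0; lra).
  assert (Hzn : z <> 0) by (apply Cmod_gt_0; lra).
  split; [exact Hn|].
  replace (h / (z + t * h) - h / z)%C with (- (t * (h * h)) / (z * (z + t * h)))%C
    by (field; auto).
  rewrite Cmod_div, Cmod_opp, !Cmod_mult, Cmod_R, Rabs_pos_eq by
    (try apply Cmult_neq_0; auto; lra).
  pose proof (Cmod_ge_0 h).
  apply Rle_trans with ((Cmod h * Cmod h) / (Cmod z * (Cmod z / 2))).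
  - unfold Rdiv. apply Rmult_le_compat; try nra.
    + apply Rlt_le, Rinv_0_lt_compat. nra.
    + apply Rinv_le_contravar; nra.
  - right. field. lra.
Qed.

Lemma Clog_path (z h : C) (t : R) :
  0 < Re (z + t * h) ->
  is_derive (fun t : R => Re (Clog (z + t * h))) t (Re (h / (z + t * h))) /\
  is_derive (fun t : R => Im (Clog (z + t * h))) t (Im (h / (z + t * h))).
Proof.
  set (x := Re z). set (y := Im z). set (p := Re h). set (q := Im h).
  assert (Hp : forall t : R, Re (z + t * h) = x + t * p /\ Im (z + t * h) = y + t * q).
  { intros u. unfold Re, Im, Cplus, Cmult, RtoC, x, y, p, q; simpl.
    unfold Re, Im. split; ring. }
  intros Ht. destruct (Hp t) as [Hre Him].
  assert (Hn : (z + t * h)%C <> 0) by (intros E; rewrite E in Ht; simpl in Ht; lra).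
  destruct (Cdiv_parts h _ Hn) as [-> ->]. rewrite Hre, Him in *. fold p q.
  assert (Hd : 0 < (x + t * p) ^ 2 + (y + t * q) ^ 2).
  { pose proof (pow2_ge_0 (y + t * q)). pose proof (pow_lt _ 2 Ht). lra. }
  assert (Hloc : locally t (fun u => 0 < x + u * p)).
  { assert (Hc : continuous (fun u => x + u * p) t).
    { apply (ex_derive_continuous (fun u => x + u * p)). auto_derive. exact I. }
    apply (Hc (fun v => 0 < v)). apply (open_gt 0). exact Ht. }
  split.
  - apply is_derive_ext_loc with (fun u => / 2 * ln ((x + u * p) ^ 2 + (y + u * q) ^ 2)).
    + revert Hloc. apply filter_imp. intros u Hu. destruct (Hp u) as [E1 E2].
      unfold Clog, Re at 1; simpl fst. rewrite ln_Cmod.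
      * rewrite E1, E2. reflexivity.
      * apply Rlt_le_trans with (2 := Re_le_Cmod _). rewrite E1, Rabs_pos_eq; lra.
    + auto_derive. simpl in Hd; lra. field. simpl in Hd; lra.
  - apply is_derive_ext_loc with (fun u => atan ((y + u * q) / (x + u * p))).
    + revert Hloc. apply filter_imp. intros u Hu. destruct (Hp u) as [E1 E2].
      unfold Clog, Im at 1; simpl snd. rewrite Carg_right; rewrite E1; [|exact Hu].
      rewrite E2. reflexivity.
    + auto_derive. lra. field. simpl in Hd. repeat split; lra.
Qed.

(** [w1 + t w2] stands for a Taylor polynomial in [t] of the derivative [h / (z + t h)] of
    [Clog (z + t h)]. Its primitive is subtracted and the real mean value theorem is applied to the
    real and imaginary parts separately; the two intermediate points differ, hence the factor
    [2]. *)
Lemma Clog_mean_value (z h w1 w2 : C) (M : R) :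
  0 < Re z -> 0 < Re (z + h) ->
  (forall t : R, 0 <= t <= 1 -> Cmod (h / (z + t * h) - w1 - t * w2) <= M) ->
  Cmod (Clog (z + h) - Clog z - w1 - w2 / 2) <= 2 * M.
Proof.
  intros Hz Hzh HM.
  assert (Hpos : forall t : R, 0 <= t <= 1 -> 0 < Re (z + t * h)).
  { intros t Ht. rewrite Re_plus in *.
    replace (Re (t * h)) with (t * Re h) by (unfold Re, Cmult, RtoC; simpl; ring).
    destruct (Rle_dec 0 (Re h)); nra. }
  assert (E0 : (z + 0 * h)%C = z) by ring.
  assert (E1 : (z + 1 * h)%C = (z + h)%C) by ring.
  assert (Hct : forall (g : R -> R) dg t, is_derive g t dg -> continuity_pt g t).
  { intros g dg t Hd. apply derivable_continuous_pt, ex_derive_Reals_0. exists dg. exact Hd. }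
  assert (Hre2 : Re (w2 / 2) = Re w2 / 2).
  { destruct (Cdiv_parts w2 2) as [-> _]; [intros E; apply RtoC_inj in E; lra|]. simpl. field. }
  assert (Him2 : Im (w2 / 2) = Im w2 / 2).
  { destruct (Cdiv_parts w2 2) as [_ ->]; [intros E; apply RtoC_inj in E; lra|]. simpl. field. }
  assert (Hscal : forall t : R, Re (t * w2) = t * Re w2 /\ Im (t * w2) = t * Im w2).
  { intros t. unfold Re, Im, Cmult, RtoC; simpl. split; ring. }
  assert (Hd1 : forall t : R, 0 <= t <= 1 -> is_derive
    (fun t : R => Re (Clog (z + t * h)) - t * Re w1 - t ^ 2 / 2 * Re w2) t
    (Re (h / (z + t * h)) - Re w1 - t * Re w2)).
  { intros t Ht. destruct (Clog_path z h t (Hpos t Ht)) as [Hd _].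
    apply (is_derive_minus (V := R_NormedModule)); [apply (is_derive_minus (V := R_NormedModule))|];
      [exact Hd | auto_derive; [exact I | ring] | auto_derive; [exact I | field]]. }
  assert (Hd2 : forall t : R, 0 <= t <= 1 -> is_derive
    (fun t : R => Im (Clog (z + t * h)) - t * Im w1 - t ^ 2 / 2 * Im w2) t
    (Im (h / (z + t * h)) - Im w1 - t * Im w2)).
  { intros t Ht. destruct (Clog_path z h t (Hpos t Ht)) as [_ Hd].
    apply (is_derive_minus (V := R_NormedModule)); [apply (is_derive_minus (V := R_NormedModule))|];
      [exact Hd | auto_derive; [exact I | ring] | auto_derive; [exact I | field]]. }
  assert (Hre : Rabs (Re (Clog (z + h) - Clog z - w1 - w2 / 2)) <= M).
  { destruct (MVT_gen _ 0 1 _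
      ltac:(intros t Ht; rewrite Rmin_left, Rmax_right in Ht by lra; apply Hd1; lra)
      ltac:(intros t Ht; rewrite Rmin_left, Rmax_right in Ht by lra; eapply Hct, Hd1; lra))
      as (t & Ht & Et).
    rewrite Rmin_left, Rmax_right in Ht by lra. rewrite E0, E1 in Et.
    eapply Rle_trans; [|apply (HM t Ht)]. eapply Rle_trans; [|apply Re_le_Cmod].
    right. f_equal. rewrite !Re_minus, Hre2. destruct (Hscal t) as [-> _]. lra. }
  assert (Him : Rabs (Im (Clog (z + h) - Clog z - w1 - w2 / 2)) <= M).
  { destruct (MVT_gen _ 0 1 _
      ltac:(intros t Ht; rewrite Rmin_left, Rmax_right in Ht by lra; apply Hd2; lra)
      ltac:(intros t Ht; rewrite Rmin_left, Rmax_right in Ht by lra; eapply Hct, Hd2; lra))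
      as (t & Ht & Et).
    rewrite Rmin_left, Rmax_right in Ht by lra. rewrite E0, E1 in Et.
    eapply Rle_trans; [|apply (HM t Ht)]. eapply Rle_trans; [|apply Im_le_Cmod].
    right. f_equal. rewrite !Im_minus, Him2. destruct (Hscal t) as [_ ->]. lra. }
  eapply Rle_trans; [apply Cmod_le_Re_Im|]. lra.
Qed.

Lemma Clog_diff (z h : C) :
  0 < Re z -> 0 < Re (z + h) -> Cmod h <= Cmod z / 2 ->
  Cmod (Clog (z + h) - Clog z - h / z) <= 4 * (Cmod h ^ 2 / Cmod z ^ 2).
Proof.
  intros Hz Hzh Hh.
  assert (Hm : 0 < Cmod z).
  { apply Rlt_le_trans with (1 := Hz).
    eapply Rle_trans; [apply Rle_abs | apply Re_le_Cmod]. }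
  assert (H : Cmod (Clog (z + h) - Clog z - h / z - 0 / 2) <= 2 * (2 * (Cmod h ^ 2 / Cmod z ^ 2))).
  { apply Clog_mean_value; [exact Hz | exact Hzh |]. intros t Ht.
    replace (h / (z + t * h) - h / z - t * 0)%C with (h / (z + t * h) - h / z)%C by ring.
    apply Cdiv_shift; assumption. }
  replace (Clog (z + h) - Clog z - h / z)%C with
    (Clog (z + h) - Clog z - h / z - 0 / 2)%C.
  - lra.
  - unfold Cdiv. ring.
Qed.

(** The logarithm of the base coordinate is followed over about [m] steps, so a quadratic error, of
    order [m ^ -2] per step, would leave a trace of order [1 / m]. One more order makes it
    negligible. *)
Lemma Clog_diff2 (z h : C) :
  0 < Re z -> 0 < Re (z + h) -> Cmod h <= Cmod z / 2 ->
  Cmod (Clog (z + h) - Clog z - h / z + (h / z) ^ 2 / 2) <= 4 * (Cmod h ^ 3 / Cmod z ^ 3).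
Proof.
  intros Hz Hzh Hh.
  assert (Hm : 0 < Cmod z).
  { apply Rlt_le_trans with (1 := Hz).
    eapply Rle_trans; [apply Rle_abs | apply Re_le_Cmod]. }
  assert (Hzn : z <> 0) by (apply Cmod_gt_0; exact Hm).
  replace (Clog (z + h) - Clog z - h / z + (h / z) ^ 2 / 2)%C with
    (Clog (z + h) - Clog z - h / z - (- (h / z) ^ 2) / 2)%C by (unfold Cdiv; ring).
  replace (4 * (Cmod h ^ 3 / Cmod z ^ 3)) with (2 * (2 * (Cmod h ^ 3 / Cmod z ^ 3))) by ring.
  apply Clog_mean_value; [exact Hz | exact Hzh |].
  intros t Ht. destruct (Cdiv_shift z h t Ht Hm Hh) as [Hn Hb].
  replace (h / (z + t * h) - h / z - t * - (h / z) ^ 2)%C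
    with (- (t * (h / z)) * (h / (z + t * h) - h / z))%C by (field; auto).
  rewrite Cmod_mult, Cmod_opp, Cmod_mult, Cmod_div, Cmod_R, Rabs_pos_eq by (exact Hzn || lra).
  pose proof (Cmod_ge_0 h).
  assert (Hq : 0 <= Cmod h / Cmod z) by (apply Rdiv_le_0_compat; lra).
  apply Rle_trans with (Cmod h / Cmod z * (2 * (Cmod h ^ 2 / Cmod z ^ 2))).
  - apply Rmult_le_compat; [nra | apply Cmod_ge_0 | nra | exact Hb].
  - right. field. lra.
Qed.

Lemma Clog_near_R (z : C) (x : R) :
  0 < x -> Cmod (z - x) <= x / 2 ->
  Cmod (Clog z - ln x) <= 3 * (Cmod (z - x) / x).
Proof.
  intros Hx Hz.
  assert (Hc : Cmod x = x) by (rewrite Cmod_R, Rabs_pos_eq; lra).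
  assert (Hr : 0 < Re z) by (pose proof (Re_close z x); lra).
  pose proof (Clog_diff x (z - x)) as H.
  replace (x + (z - x))%C with z in H by ring. rewrite Hc in H.
  specialize (H Hx Hr Hz). rewrite Clog_RtoC in H by exact Hx.
  set (d := Cmod (z - x)) in *. assert (0 <= d) by apply Cmod_ge_0.
  pose proof (Cmod_rev (Clog z - ln x) ((z - x) / x)) as H2.
  rewrite Cmod_div, Hc in H2 by (intros E; apply RtoC_inj in E; lra). fold d in H2.
  assert (d ^ 2 / x ^ 2 <= d / x / 2).
  { apply Rmult_le_reg_r with (x ^ 2); [nra|]. field_simplify; try lra. nra. }
  lra.
Qed.

(** * Mechanical bounds on the modulus of an expression *)

Lemma Cadd_le (x y : C) (a b : R) : Cmod x <= a -> Cmod y <= b -> Cmod (x + y) <= a + b.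
Proof. intros Hx Hy. eapply Rle_trans; [apply Cmod_triangle|]. lra. Qed.

Lemma Csub_le (x y : C) (a b : R) : Cmod x <= a -> Cmod y <= b -> Cmod (x - y) <= a + b.
Proof. intros Hx Hy. eapply Rle_trans; [apply Cmod_minus_le|]. lra. Qed.

Lemma Copp_le (x : C) (a : R) : Cmod x <= a -> Cmod (- x) <= a.
Proof. intros Hx. rewrite Cmod_opp. exact Hx. Qed.

Lemma Cmul_le (x y : C) (a b : R) : Cmod x <= a -> Cmod y <= b -> Cmod (x * y) <= a * b.
Proof.
  intros Hx Hy. rewrite Cmod_mult.
  apply Rmult_le_compat; auto using Cmod_ge_0.
Qed.

Lemma Cpow_le (x : C) (a : R) (n : nat) : Cmod x <= a -> Cmod (x ^ n) <= a ^ n.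
Proof. intros Hx. rewrite Cmod_pow. apply pow_incr. split; [apply Cmod_ge_0 | exact Hx]. Qed.

Lemma Cinv_le (x : C) (a : R) : 0 < a -> a <= Cmod x -> Cmod (/ x) <= / a.
Proof.
  intros Ha Hx. rewrite Cmod_inv by (apply Cmod_gt_0; lra).
  apply Rinv_le_contravar; assumption.
Qed.

Lemma Cdiv_le (x y : C) (a b : R) :
  0 < b -> Cmod x <= a -> b <= Cmod y -> Cmod (x / y) <= a / b.
Proof. intros Hb Hx Hy. apply Cmul_le; [exact Hx | apply Cinv_le; assumption]. Qed.

(** Bounds the modulus of an expression by the same expression in the bounds
    found in the context. *)
Ltac cbd :=
  first
  [ eassumption
  | lazymatch goal with
    | |- Cmod (Cplus _ _) <= _ => eapply Cadd_le; cbd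
    | |- Cmod (Cminus _ _) <= _ => eapply Csub_le; cbd
    | |- Cmod (Copp _) <= _ => eapply Copp_le; cbd
    | |- Cmod (Cmult _ _) <= _ => eapply Cmul_le; cbd
    | |- Cmod (Cpow _ _) <= _ => eapply Cpow_le; cbd
    | |- Cmod (RtoC _) <= _ => rewrite Cmod_R; first [eassumption | apply Rle_refl]
    | |- Cmod _ <= _ => apply Rle_refl
    end ].

Ltac cbound := eapply Rle_trans; [cbd|].

Lemma Cone_plus_ge (q : C) (a : R) : Cmod q <= a -> 1 - a <= Cmod (1 + q).
Proof.
  intros H. pose proof (Cmod_rev 1 (1 + q)) as H1.
  replace (1 - (1 + q))%C with (- q)%C in H1 by ring.
  rewrite Cmod_1, Cmod_opp in H1. lra.
Qed.

Lemma Cone_minus_ge (q : C) (a : R) : Cmod q <= a -> 1 - a <= Cmod (1 - q).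
Proof.
  intros H. unfold Cminus. apply Cone_plus_ge. rewrite Cmod_opp. exact H.
Qed.

Lemma Cneq_0 (z : C) (a : R) : 0 < a -> a <= Cmod z -> z <> 0.
Proof. intros Ha H. apply Cmod_gt_0. lra. Qed.

Lemma inv_step (a2 a3 : C) :
  exists M d : R, 0 < M /\ 0 < d /\
  forall z r : C, 0 < Cmod z <= d -> Cmod r * Cmod z ^ 3 <= / 8 ->
    let f := (z + a2 * z ^ 2 + a3 * z ^ 3 + r * z ^ 4)%C in
    f <> 0 /\
    Cmod (/ f - / z * (1 - a2 * z + (a2 ^ 2 - a3) * z ^ 2)) <= M * (1 + Cmod r) * Cmod z ^ 2.
Proof.
  set (L := Cmod a2 + Cmod a3 + 1).
  assert (HL : 1 <= L) by (pose proof (Cmod_ge_0 a2); pose proof (Cmod_ge_0 a3); unfold L; lra).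
  exists (70 * L ^ 3), (/ (8 * L)).
  assert (HLi : 0 < / (8 * L) <= / 8).
  { split; [apply Rinv_0_lt_compat; lra | apply Rinv_le_contravar; lra]. }
  assert (HL3 : L <= L ^ 2 <= L ^ 3) by (simpl; nra).
  split; [nra|]. split; [lra|].
  intros z r [Hz Hzd] Hr f.
  set (t := Cmod z) in *.
  assert (HLt : L * t <= / 8).
  { apply Rmult_le_compat_l with (r := L) in Hzd; [|lra].
    replace (L * / (8 * L)) with (/ 8) in Hzd by (field; lra). exact Hzd. }
  set (R := Cmod r) in *. assert (HR : 0 <= R) by apply Cmod_ge_0.
  set (s := R * t ^ 3) in *. assert (Hs : 0 <= s) by (unfold s; apply Rmult_le_pos; [lra|apply pow_le; lra]).
  set (e := (a3 * z ^ 2 + r * z ^ 3)%C).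
  set (q := (a2 * z + e)%C).
  assert (Ha2 : Cmod (a2 * z) <= L * t).
  { rewrite Cmod_mult. apply Rmult_le_compat_r; [lra|]. unfold L. pose proof (Cmod_ge_0 a3). lra. }
  assert (He : Cmod e <= L * t ^ 2 + s).
  { unfold e. apply Cadd_le; rewrite Cmod_mult, Cmod_pow; fold t R; [|apply Rle_refl].
    apply Rmult_le_compat_r; [nra|]. unfold L. pose proof (Cmod_ge_0 a2). lra. }
  assert (He2 : Cmod e <= L * t + s).
  { eapply Rle_trans; [exact He|]. assert (t <= 1) by lra. nra. }
  assert (Hq : Cmod q <= 2 * (L * t) + s) by (unfold q; cbound; lra).
  assert (H1q : / 2 <= Cmod (1 + q)) by (pose proof (Cone_plus_ge q (/ 2) ltac:(lra)); lra).
  assert (Hzn : z <> 0) by (apply Cmod_gt_0; exact Hz).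
  assert (Hqn : (1 + q)%C <> 0) by (apply (Cneq_0 _ (/ 2)); lra).
  assert (Ef : f = (z * (1 + q))%C) by (unfold f, q, e; ring).
  split. { rewrite Ef. apply Cmult_neq_0; assumption. }
  (* With [f = z (1 + q)] this is the exact formula [1 / (1 + q) = 1 - q + q ^ 2 - q ^ 3 / (1 + q)];
     writing [q = a2 z + e], the terms of degree at most two cancel. *)
  replace (/ f - / z * (1 - a2 * z + (a2 ^ 2 - a3) * z ^ 2))%C
    with (/ z * (e * (q + a2 * z) - r * z ^ 3 - q ^ 3 * / (1 + q)))%C
    by (rewrite Ef; unfold q, e in *; field; auto).
  rewrite Cmod_mult, Cmod_inv by exact Hzn. fold t.
  assert (Hi : Cmod (/ (1 + q)) <= 2).
  { replace 2 with (/ / 2) by field. apply Cinv_le; lra. }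
  assert (Hb : Cmod (e * (q + a2 * z) - r * z ^ 3 - q ^ 3 * / (1 + q)) <= 70 * L ^ 3 * (t ^ 3 + s)).
  { assert (Hrz : Cmod (r * z ^ 3) <= s) by (rewrite Cmod_mult, Cmod_pow; apply Rle_refl).
    eapply Rle_trans.
    { eapply Csub_le; [eapply Csub_le; [eapply Cmul_le; [exact He|cbd]|exact Hrz]|cbd]. }
    assert (Ht3 : 0 < t ^ 3) by (apply pow_lt; lra).
    assert (Hc : (2 * (L * t) + s) ^ 3 <= 4 * (8 * (L ^ 3 * t ^ 3) + s ^ 3)).
    { replace (8 * (L ^ 3 * t ^ 3)) with ((2 * (L * t)) ^ 3) by ring.
      assert (0 <= 2 * (L * t)) by nra. set (u := 2 * (L * t)) in *.
      pose proof (pow2_ge_0 (u - s)). nra. }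
    assert (Hs3 : s ^ 3 <= s / 64) by (simpl; nra).
    assert (Hc' : (2 * (L * t) + s) ^ 3 * 2 <= 64 * (L ^ 3 * t ^ 3) + s).
    { lra. }
    assert ((L * t ^ 2 + s) * (2 * (L * t) + s + L * t) <= 3 * (L ^ 2 * t ^ 3) + s).
    { replace ((L * t ^ 2 + s) * (2 * (L * t) + s + L * t))
        with (3 * (L ^ 2 * t ^ 3) + s * (t * (L * t) + 3 * (L * t) + s)) by ring.
      assert (t <= 1) by lra.
      assert (Hk : t * (L * t) + 3 * (L * t) + s <= 1) by nra.
      apply (Rmult_le_compat_l s) in Hk; lra. }
    assert (L ^ 2 * t ^ 3 <= L ^ 3 * t ^ 3) by (apply Rmult_le_compat_r; lra).
    assert (s <= L ^ 3 * s) by (rewrite <- (Rmult_1_l s) at 1; apply Rmult_le_compat_r; lra).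
    assert (0 <= L ^ 3 * t ^ 3) by (apply Rmult_le_pos; lra).
    lra. }
  apply Rle_trans with (/ t * (70 * L ^ 3 * (t ^ 3 + s))).
  { apply Rmult_le_compat_l; [|exact Hb]. apply Rlt_le, Rinv_0_lt_compat; lra. }
  right. unfold s. field. lra.
Qed.

(** * Compactness *)

Lemma locally_open {U : UniformSpace} (P : U -> Prop) : open (fun x => locally x P).
Proof. intros x H. apply locally_locally. exact H. Qed.

(** For properties that weaken as the index grows, the largest index of a finite subcover serves the
    whole of [K]. Entrance times into a petal and bounds on Fatou coordinates, known near each
    point, become uniform in this way. *)
Lemma compact_nat {U : UniformSpace} (K : U -> Prop) (P : nat -> U -> Prop) :
  compact_set K ->
  (forall i j x, (i <= j)%nat -> P i x -> P j x) ->
  (forall x, K x -> exists i, locally x (P i)) ->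
  exists i, forall x, K x -> P i x.
Proof.
  intros HK Hmon Hloc.
  destruct (HK nat (fun i x => locally x (P i)) (fun i => locally_open _) Hloc) as (l & Hl).
  exists (fold_right Nat.max 0%nat l). intros x Hx.
  destruct (Hl x Hx) as (i & Hi & Hxi).
  apply Hmon with i; [|apply locally_singleton; exact Hxi].
  clear -Hi. induction l as [|j l IH]; simpl in *; [tauto|].
  destruct Hi as [->|Hi]; [lia|]. specialize (IH Hi). lia.
Qed.

Lemma compact_image {U V : UniformSpace} (F : U -> V) (K : U -> Prop) :
  (forall x, continuous F x) -> compact_set K ->
  compact_set (fun y => exists x, K x /\ F x = y).
Proof.
  intros HF HK I O HO Hcov.
  destruct (HK I (fun i x => O i (F x))) as (l & Hl).
  - intros i x Hx. apply HF. apply HO. exact Hx.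
  - intros x Hx. apply Hcov. eauto.
  - exists l. intros y (x & Hx & <-). apply Hl. exact Hx.
Qed.

Lemma list_posreal_min {T : Type} (l : list (T * posreal)) :
  exists d : posreal, forall x, In x l -> d <= snd x.
Proof.
  induction l as [|[x d] l (d' & IH)].
  - exists (mkposreal 1 Rlt_0_1). intros x [].
  - assert (H : 0 < Rmin d d') by (apply Rmin_pos; apply cond_pos).
    exists (mkposreal _ H). intros y [<-|Hy]; simpl.
    + apply Rmin_l.
    + eapply Rle_trans; [apply Rmin_r | apply IH; exact Hy].
Qed.

(** Only the first point has to lie in [K], since perturbed orbits, which may leave [K], are
    compared with orbits starting in it. Balls of half the radius given by continuity are used for
    the cover, and the smallest of finitely many such radii works everywhere. *)
Lemma compact_unif_cont {U V : UniformSpace} (F : U -> V) (K : U -> Prop) :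
  (forall x, continuous F x) -> compact_set K ->
  forall eps : posreal, exists d : posreal, forall x y, K x -> ball x d y ->
    ball (F x) eps (F y).
Proof.
  intros HF HK eps.
  set (Q := fun (xd : U * posreal) =>
    forall y, ball (fst xd) (snd xd + snd xd) y -> ball (F (fst xd)) (eps / 2) (F y)).
  destruct (HK (U * posreal)%type
    (fun xd y => Q xd /\ locally y (ball (fst xd) (snd xd)))) as (l & Hl).
  - intros xd y [HQ Hy]. apply locally_open in Hy. revert Hy.
    apply filter_imp. intros y' Hy'. split; assumption.
  - intros x Hx.
    assert (He : 0 < eps / 2) by (apply is_pos_div_2).
    destruct (HF x (fun y => ball (F x) (eps / 2) y)
      (locally_ball (F x) (mkposreal _ He))) as (d & Hd).
    assert (Hd2 : 0 < d / 2) by (apply is_pos_div_2).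
    exists (x, mkposreal _ Hd2). split.
    + intros y Hy. simpl in Hy. apply Hd.
      replace (pos d) with (d / 2 + d / 2) by field. exact Hy.
    + apply (locally_ball x (mkposreal _ Hd2)).
  - destruct (list_posreal_min l) as (d & Hd). exists d.
    intros x y Hx Hxy. destruct (Hl x Hx) as ((x0 & d0) & Hin & HQ & Hb).
    apply locally_singleton in Hb. specialize (Hd _ Hin). simpl in *.
    assert (Hy : ball x0 (d0 + d0) y).
    { apply ball_triangle with x; [exact Hb|]. apply ball_le with d; assumption. }
    assert (Hx' : ball x0 (d0 + d0) x).
    { apply ball_le with d0; [|exact Hb]. pose proof (cond_pos d0). simpl. lra. }
    apply HQ in Hy. apply HQ in Hx'. simpl in *.
    replace (pos eps) with (eps / 2 + eps / 2) by field.
    apply ball_triangle with (F x0); [apply ball_sym|]; assumption.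
Qed.

Lemma ball_C (x y : C) (d : R) : Cmod (y - x) < d -> @ball C_UniformSpace x d y.
Proof.
  intros H. split.
  - apply Rle_lt_trans with (2 := H). apply (Re_le_Cmod (y - x)).
  - apply Rle_lt_trans with (2 := H). apply (Im_le_Cmod (y - x)).
Qed.

Lemma ball_C_inv (x y : C) (d : R) : @ball C_UniformSpace x d y -> Cmod (y - x) < 2 * d.
Proof.
  intros [H1 H2]. eapply Rle_lt_trans; [apply Cmod_le_Re_Im|].
  change (Rabs (Re y - Re x) < d) in H1. change (Rabs (Im y - Im x) < d) in H2.
  rewrite Re_minus, Im_minus. lra.
Qed.

Lemma locally_Cmod (x : C) (P : C -> Prop) :
  @locally C_UniformSpace x P <->
  exists d, 0 < d /\ forall y, Cmod (y - x) < d -> P y.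
Proof.
  split.
  - intros (d & Hd). exists d. split; [apply cond_pos|]. intros y Hy. apply Hd, ball_C, Hy.
  - intros (d & Hd0 & Hd). assert (H : 0 < d / 2) by lra.
    exists (mkposreal _ H). intros y Hy. apply Hd. apply ball_C_inv in Hy. simpl in Hy. lra.
Qed.

Lemma locally_C2 (x : C2) (P : C2 -> Prop) :
  locally x P <->
  exists d, 0 < d /\ forall y : C2, Cmod (fst y - fst x) < d -> Cmod (snd y - snd x) < d -> P y.
Proof.
  split.
  - intros (d & Hd). exists d. split; [apply cond_pos|]. intros y Hy1 Hy2. apply Hd.
    split; apply ball_C; assumption.
  - intros (d & Hd0 & Hd). assert (H : 0 < d / 2) by lra.
    exists (mkposreal _ H). intros y [Hy1 Hy2].
    apply ball_C_inv in Hy1. apply ball_C_inv in Hy2. simpl in *. apply Hd; lra.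
Qed.

Lemma continuous_Cmod (f : C -> C) (x : C) :
  @continuous C_UniformSpace C_UniformSpace f x <->
  forall eps, 0 < eps -> exists d, 0 < d /\ forall y, Cmod (y - x) < d -> Cmod (f y - f x) < eps.
Proof.
  split.
  - intros H eps He. apply (locally_Cmod x (fun y => Cmod (f y - f x) < eps)).
    apply (H (fun y => Cmod (y - f x) < eps)). apply locally_Cmod.
    exists eps. auto.
  - intros H P HP. apply locally_Cmod in HP. destruct HP as (e & He & HP).
    destruct (H e He) as (d & Hd & Hd'). apply locally_Cmod. exists d. auto.
Qed.

Lemma holomorphic_continuous (f : C -> C) (x : C) :
  holomorphic_at f x -> @continuous C_UniformSpace C_UniformSpace f x.
Proof.
  intros H. apply ex_derive_continuous in H.
  intros P HP. specialize (H P HP). destruct H as (d & Hd).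
  apply locally_Cmod. exists d. split; [apply cond_pos|]. intros y Hy. apply Hd. exact Hy.
Qed.

Lemma filterlim_Cmod (f : C -> C) (D : C -> Prop) :
  filterlim f (within D (locally (RtoC 0))) (locally (RtoC 0)) ->
  forall eps, 0 < eps -> exists d, 0 < d /\
    forall z, Cmod z < d -> D z -> Cmod (f z) < eps.
Proof.
  intros H eps He.
  assert (HP : @locally C_UniformSpace (RtoC 0) (fun y => Cmod y < eps)).
  { apply locally_Cmod. exists eps. split; [exact He|]. intros y Hy.
    replace (y - 0)%C with y in Hy by ring. exact Hy. }
  specialize (H _ HP). unfold filtermap, within in H. apply locally_Cmod in H.
  destruct H as (d & Hd & H). exists d. split; [exact Hd|].
  intros z Hz. apply H. replace (z - 0)%C with z by ring. exact Hz.
Qed.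

Lemma compact_box (M : R) :
  @compact_set C_UniformSpace (fun z => Cmod z <= M).
Proof.
  intros I O HO Hcov. apply NNPP. intros Hno.
  assert (Hr : forall z : C, exists d : posreal, Cmod z <= M ->
    exists i, forall y, Cmod (y - z) < 2 * d -> O i y).
  { intros z. destruct (Rle_dec (Cmod z) M) as [Hz|Hz].
    - destruct (Hcov z Hz) as (i & Hi). apply HO in Hi. apply locally_Cmod in Hi.
      destruct Hi as (d & Hd & Hi). assert (H : 0 < d / 2) by lra.
      exists (mkposreal _ H). intros _. exists i. intros y Hy. apply Hi. simpl in Hy. lra.
    - exists (mkposreal 1 Rlt_0_1). intros; contradiction. }
  (* The cover to be extracted is one of a square. A point of the square outside the disc receives a
     radius so small that its ball misses the disc, and can be discarded afterwards. *)
  assert (Hr' : forall z : C, exists d : posreal,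
    (Cmod z <= M -> exists i, forall y, Cmod (y - z) < 2 * d -> O i y) /\
    (M < Cmod z -> forall y, Cmod (y - z) < 2 * d -> M < Cmod y)).
  { intros z. destruct (Rle_dec (Cmod z) M) as [Hz|Hz].
    - destruct (Hr z) as (d & Hd). exists d. split; [exact Hd|]. lra.
    - assert (H : 0 < (Cmod z - M) / 2) by lra.
      exists (mkposreal _ H). split; [lra|]. intros _ y Hy. simpl in Hy.
      pose proof (Cmod_rev z y). rewrite Cmod_minus_sym in Hy. lra. }
  apply (choice (fun z d => (Cmod z <= M -> exists i, forall y, Cmod (y - z) < 2 * pos d -> O i y) /\
    (M < Cmod z -> forall y, Cmod (y - z) < 2 * pos d -> M < Cmod y))) in Hr'.
  destruct Hr' as (de & Hde).
  (* The finite list is delivered under a double negation, which is why the goal was first turned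
     into [False]. *)
  apply (compactness_list 2 (- M, (- M, tt)) (M, (M, tt))
    (fun t => de (fst t, fst (snd t)))).
  intros (l & Hl). apply Hno.
  assert (HI : exists li : list I, forall t, In t l ->
    forall y, Cmod (y - (fst t, fst (snd t))) < 2 * de (fst t, fst (snd t)) -> Cmod y <= M ->
    exists i, In i li /\ O i y).
  { clear Hl. induction l as [|t l (li & IH)]; [exists nil; intros t []|].
    destruct (Hde (fst t, fst (snd t))) as [H1 H2].
    destruct (Rle_dec (Cmod (fst t, fst (snd t))) M) as [Ht|Ht].
    - destruct (H1 Ht) as (i & Hi). exists (i :: li).
      intros t' [<-|Ht'] y Hy Hy'.
      + exists i. split; [left; reflexivity | apply Hi; exact Hy].
      + destruct (IH t' Ht' y Hy Hy') as (j & Hj & Hj'). exists j. split; [right|]; assumption.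
    - exists li. intros t' [<-|Ht'] y Hy Hy'.
      + apply Rnot_le_lt in Ht. specialize (H2 Ht y Hy). lra.
      + apply (IH t'); assumption. }
  destruct HI as (li & Hli). exists li. intros z Hz.
  destruct (Hl (Re z, (Im z, tt))) as ((t1 & t2 & t3) & Hin & _ & Hc).
  - pose proof (Re_le_Cmod z) as H1. pose proof (Im_le_Cmod z) as H2.
    apply Rabs_le_between in H1. apply Rabs_le_between in H2. simpl. repeat split; lra.
  - apply (Hli _ Hin); [|exact Hz]. simpl in *.
    eapply Rle_lt_trans; [apply Cmod_le_Re_Im|]. rewrite Re_minus, Im_minus. simpl.
    destruct Hc as (Hc1 & Hc2 & _). lra.
Qed.

(** * Petals and Fatou coordinates *)

(** With this normalization the map becomes a perturbation of [X -> X + 1] for every [a2]: it is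
    [1 / z] in the base, where [a2 = -1], and [- 1 / w] in the fiber, where [a2 = 1]. *)
Definition Xc (a2 z : C) : C := (- (1 / (a2 * z)))%C.

Lemma Xc_mod (a2 z : C) : a2 <> 0 -> z <> 0 -> Cmod (Xc a2 z) = / (Cmod a2 * Cmod z).
Proof.
  intros Ha Hz. unfold Xc. rewrite Cmod_opp, Cmod_div, Cmod_1, Cmod_mult.
  - field. split; apply Rgt_not_eq, Cmod_gt_0; assumption.
  - apply Cmult_neq_0; assumption.
Qed.

(** Inversion sends a disc whose boundary passes through the origin to a half-plane: expanding the
    square of the modulus turns the first condition into [|u| ^ 2 < 2 r Re u]. Petals thus become
    half-planes, on which a near translation is easy to follow. *)
Lemma disc_iff (u : C) (r : R) : 0 < r ->
  Cmod (u - r) < r <-> u <> 0 /\ / (2 * r) < Re (/ u).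
Proof.
  intros Hr.
  assert (E : forall v : C, v <> 0 -> Re (/ v) = Re v / Cmod v ^ 2).
  { intros v Hv. replace (/ v)%C with (1 / v)%C by (field; exact Hv).
    destruct (Cdiv_parts 1 v Hv) as [-> _]. rewrite Cmod_sqr. simpl. f_equal. ring. }
  assert (E2 : Cmod (u - r) ^ 2 = Cmod u ^ 2 - 2 * r * Re u + r ^ 2).
  { rewrite !Cmod_sqr, Re_minus, Im_minus. simpl. ring. }
  pose proof (Cmod_ge_0 (u - r)) as H0.
  split.
  - intros H. assert (Hu : u <> 0).
    { intros ->. replace (0 - r)%C with (- r)%C in H by ring.
      rewrite Cmod_opp, Cmod_R, Rabs_pos_eq in H; lra. }
    split; [exact Hu|]. rewrite E by exact Hu.
    assert (Hm : 0 < Cmod u) by (apply Cmod_gt_0; exact Hu).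
    assert (Hm2 : 0 < Cmod u ^ 2) by (apply pow_lt; exact Hm).
    assert (Hm3 : 0 < 2 * r * Cmod u ^ 2) by (apply Rmult_lt_0_compat; lra).
    apply Rmult_lt_reg_r with (2 * r * Cmod u ^ 2); [exact Hm3|].
    field_simplify; [nra|lra|lra].
  - intros [Hu H]. rewrite E in H by exact Hu.
    assert (Hm : 0 < Cmod u) by (apply Cmod_gt_0; exact Hu).
    assert (Hm2 : 0 < Cmod u ^ 2) by (apply pow_lt; exact Hm).
    assert (Hm3 : 0 < 2 * r * Cmod u ^ 2) by (apply Rmult_lt_0_compat; lra).
    apply Rmult_lt_compat_r with (r := 2 * r * Cmod u ^ 2) in H; [|exact Hm3].
    field_simplify in H; [|lra|lra]. nra.
Qed.

Lemma incoming_petal_Xc (a2 z : C) (r : R) : 0 < r ->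
  incoming_petal a2 r z <-> (a2 * z)%C <> 0 /\ / (2 * r) < Re (Xc a2 z).
Proof.
  intros Hr. unfold incoming_petal, Xc.
  replace (a2 * z + r)%C with (- (- (a2 * z) - r))%C by ring.
  rewrite Cmod_opp, disc_iff by exact Hr.
  assert (H : (- (a2 * z))%C <> 0 <-> (a2 * z)%C <> 0).
  { split; intros H E; apply H.
    - rewrite E. ring.
    - replace (a2 * z)%C with (- - (a2 * z))%C by ring. rewrite E. ring. }
  assert (E : (a2 * z)%C <> 0 -> (/ (- (a2 * z)))%C = (- (1 / (a2 * z)))%C).
  { intros Hn. assert (Hn' : (- (a2 * z))%C <> 0) by tauto.
    set (u := (a2 * z)%C) in *.
    replace (- (1 / u))%C with (- (1 / u) * (- u) * / (- u))%C; field; auto. }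
  split; intros [H1 H2]; (split; [tauto|]); [rewrite <- E by tauto | rewrite E by tauto]; exact H2.
Qed.

Lemma Xc_step (a2 a3 : C) : a2 <> 0 ->
  exists M d : R, 0 < M /\ 0 < d /\
  forall z r : C, 0 < Cmod z <= d -> Cmod r * Cmod z ^ 3 <= / 8 ->
    let f := (z + a2 * z ^ 2 + a3 * z ^ 3 + r * z ^ 4)%C in
    f <> 0 /\
    Cmod (Xc a2 f - Xc a2 z - 1 - resit a2 a3 / Xc a2 z) <= M * (1 + Cmod r) * Cmod z ^ 2.
Proof.
  intros Ha. destruct (inv_step a2 a3) as (M & d & HM & Hd & H).
  assert (Ham : 0 < Cmod a2) by (apply Cmod_gt_0; exact Ha).
  exists (M / Cmod a2), d. split; [apply Rdiv_lt_0_compat; assumption|]. split; [exact Hd|].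
  intros z r Hz Hr f. destruct (H z r Hz Hr) as [Hf Hb]. fold f in Hf, Hb.
  split; [exact Hf|].
  assert (Hzn : z <> 0) by (apply Cmod_gt_0; apply Hz).
  replace (Xc a2 f - Xc a2 z - 1 - resit a2 a3 / Xc a2 z)%C
    with (- / a2 * (/ f - / z * (1 - a2 * z + (a2 ^ 2 - a3) * z ^ 2)))%C.
  - rewrite Cmod_mult, Cmod_opp, Cmod_inv by exact Ha.
    replace (M / Cmod a2 * (1 + Cmod r) * Cmod z ^ 2)
      with (/ Cmod a2 * (M * (1 + Cmod r) * Cmod z ^ 2)) by (field; lra).
    apply Rmult_le_compat_l; [apply Rlt_le, Rinv_0_lt_compat; exact Ham | exact Hb].
  - unfold Xc, resit. field. repeat split; auto.
Qed.

Lemma bigO_expansion (f : C -> C) (a2 a3 : C) :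
  @bigO_pow C_NormedModule (fun z : C => f z - (z + a2 * z ^ 2 + a3 * z ^ 3))%C 4 ->
  exists M d : R, 0 <= M /\ 0 < d /\ forall z : C, z <> 0 -> Cmod z < d ->
    exists r, Cmod r <= M /\ f z = (z + a2 * z ^ 2 + a3 * z ^ 3 + r * z ^ 4)%C.
Proof.
  intros (M & d & Hd & H). exists (Rmax 0 M), d. split; [apply Rmax_l|]. split; [exact Hd|].
  intros z Hz Hzd. exists ((f z - (z + a2 * z ^ 2 + a3 * z ^ 3)) / z ^ 4)%C.
  assert (Hz4 : (z ^ 4)%C <> 0) by (apply Cpow_nz; exact Hz).
  split.
  - rewrite Cmod_div by exact Hz4. rewrite Cmod_pow. specialize (H z Hzd).
    change (norm (z : C_NormedModule)) with (Cmod z) in H.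
    assert (0 < Cmod z ^ 4) by (apply pow_lt, Cmod_gt_0; exact Hz).
    apply Rle_trans with (M * Cmod z ^ 4 / Cmod z ^ 4).
    + apply Rmult_le_compat_r; [apply Rlt_le, Rinv_0_lt_compat; assumption | exact H].
    + replace (M * Cmod z ^ 4 / Cmod z ^ 4) with M by (field; apply Rgt_not_eq, Cmod_gt_0, Hz).
      apply Rmax_r.
  - field. exact Hz.
Qed.

Lemma Xc_dyn (f : C -> C) (a2 a3 : C) : a2 <> 0 ->
  @bigO_pow C_NormedModule (fun z : C => f z - (z + a2 * z ^ 2 + a3 * z ^ 3))%C 4 ->
  exists R0 M : R, 0 < R0 /\ 0 < M /\
  forall z : C, z <> 0 -> R0 <= Cmod (Xc a2 z) ->
    f z <> 0 /\
    Cmod (Xc a2 (f z) - Xc a2 z - 1 - resit a2 a3 / Xc a2 z) <= M / Cmod (Xc a2 z) ^ 2 /\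
    Cmod (Xc a2 (f z) - Xc a2 z - 1) <= / 4.
Proof.
  intros Ha Hf. destruct (Xc_step a2 a3 Ha) as (M & d & HM & Hd & Hs).
  destruct (bigO_expansion f a2 a3 Hf) as (Mr & dr & HMr & Hdr & Hr).
  assert (Ham : 0 < Cmod a2) by (apply Cmod_gt_0; exact Ha).
  set (M1 := M * (1 + Mr) / Cmod a2 ^ 2).
  assert (HM1 : 0 < M1).
  { unfold M1. apply Rdiv_lt_0_compat; [|apply pow_lt; exact Ham].
    apply Rmult_lt_0_compat; lra. }
  set (Bm := Cmod (resit a2 a3)). assert (HB : 0 <= Bm) by apply Cmod_ge_0.
  set (e := Rmin (Rmin d (dr / 2)) (Rmin 1 (/ (8 * (1 + Mr))))).
  assert (H8 : 0 < / (8 * (1 + Mr))) by (apply Rinv_0_lt_compat; lra).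
  assert (He : 0 < e) by (unfold e; repeat apply Rmin_pos; lra).
  assert (He1 : e <= d /\ e <= dr / 2 /\ e <= 1 /\ e <= / (8 * (1 + Mr))).
  { unfold e. pose proof (Rmin_l (Rmin d (dr / 2)) (Rmin 1 (/ (8 * (1 + Mr))))).
    pose proof (Rmin_r (Rmin d (dr / 2)) (Rmin 1 (/ (8 * (1 + Mr))))).
    pose proof (Rmin_l d (dr / 2)). pose proof (Rmin_r d (dr / 2)).
    pose proof (Rmin_l 1 (/ (8 * (1 + Mr)))). pose proof (Rmin_r 1 (/ (8 * (1 + Mr)))). lra. }
  destruct He1 as (He1 & He2 & He3 & He4).
  assert (Hae : 0 < / (Cmod a2 * e)) by (apply Rinv_0_lt_compat, Rmult_lt_0_compat; lra).
  exists (/ (Cmod a2 * e) + 8 * (M1 + Bm) + 1), M1. split; [lra|]. split; [exact HM1|].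
  intros z Hz HX. set (X := Cmod (Xc a2 z)) in *.
  assert (Hzm : 0 < Cmod z) by (apply Cmod_gt_0; exact Hz).
  assert (HXz : X = / (Cmod a2 * Cmod z)) by (apply Xc_mod; assumption).
  assert (Hze : Cmod z <= e).
  { apply Rmult_le_reg_l with (Cmod a2); [exact Ham|].
    rewrite <- (Rinv_inv (Cmod a2 * Cmod z)), <- (Rinv_inv (Cmod a2 * e)), <- HXz.
    apply Rinv_le_contravar; lra. }
  destruct (Hr z Hz ltac:(lra)) as (r & Hrm & Ef).
  assert (Hr8 : Cmod r * Cmod z ^ 3 <= / 8).
  { apply Rle_trans with ((1 + Mr) * e).
    - apply Rmult_le_compat; [apply Cmod_ge_0 | apply pow_le; lra | lra |].
      simpl. assert (Cmod z * Cmod z <= 1) by nra. nra.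
    - apply Rmult_le_compat_l with (r := 1 + Mr) in He4; [|lra].
      replace ((1 + Mr) * / (8 * (1 + Mr))) with (/ 8) in He4 by (field; lra). exact He4. }
  destruct (Hs z r ltac:(lra) Hr8) as (Hn & Hb). rewrite <- Ef in Hn, Hb.
  assert (HXp : 0 < X) by lra.
  assert (Hb1 : Cmod (Xc a2 (f z) - Xc a2 z - 1 - resit a2 a3 / Xc a2 z) <= M1 / X ^ 2).
  { eapply Rle_trans; [exact Hb|].
    replace (M1 / X ^ 2) with (M * (1 + Mr) * Cmod z ^ 2)
      by (unfold M1; rewrite HXz; field; lra).
    apply Rmult_le_compat_r; [nra|]. apply Rmult_le_compat_l; lra. }
  split; [exact Hn|]. split; [exact Hb1|].
  replace (Xc a2 (f z) - Xc a2 z - 1)%C with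
    ((Xc a2 (f z) - Xc a2 z - 1 - resit a2 a3 / Xc a2 z) + resit a2 a3 / Xc a2 z)%C by ring.
  eapply Rle_trans; [apply Cadd_le; [exact Hb1|]|].
  { rewrite Cmod_div; [apply Rle_refl|]. apply Cmod_gt_0. exact HXp. }
  fold X Bm.
  assert (Hx1 : 1 <= X) by lra.
  assert (M1 / X ^ 2 <= M1 / X).
  { apply Rmult_le_compat_l; [lra|]. apply Rinv_le_contravar; simpl; nra. }
  assert ((M1 + Bm) / X <= / 8).
  { apply Rmult_le_reg_r with X; [lra|]. replace ((M1 + Bm) / X * X) with (M1 + Bm) by (field; lra). lra. }
  replace ((M1 + Bm) / X) with (M1 / X + Bm / X) in H0 by (field; lra). lra.
Qed.

Lemma ln_small (eps : R) : 0 < eps -> exists x0, 1 <= x0 /\ forall x, x0 <= x -> ln x <= eps * x.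
Proof.
  intros He. pose proof is_lim_div_ln_p as H. apply is_lim_spec in H.
  destruct (H (mkposreal _ He)) as (M & HM). simpl in HM.
  exists (Rmax 1 (M + 1)). split; [apply Rmax_l|]. intros x Hx.
  pose proof (Rmax_l 1 (M + 1)). pose proof (Rmax_r 1 (M + 1)).
  specialize (HM x ltac:(lra)). rewrite Rminus_0_r in HM. apply Rabs_lt_between in HM.
  apply Rmult_le_reg_r with (/ x); [apply Rinv_0_lt_compat; lra|].
  replace (eps * x * / x) with eps by (field; lra). unfold Rdiv in HM. lra.
Qed.

Lemma log_affine_small (a b eps : R) : 0 <= b -> 0 < eps ->
  exists x0, 1 <= x0 /\ forall x, x0 <= x -> a + b * ln (2 * x) <= eps * x.
Proof.
  intros Hb He.
  assert (He' : 0 < eps / (4 * (b + 1))) by (apply Rdiv_lt_0_compat; lra).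
  destruct (ln_small _ He') as (x1 & Hx1 & H).
  exists (Rmax x1 (2 * Rabs a / eps)). split; [eapply Rle_trans; [exact Hx1 | apply Rmax_l]|].
  intros x Hx. pose proof (Rmax_l x1 (2 * Rabs a / eps)). pose proof (Rmax_r x1 (2 * Rabs a / eps)).
  specialize (H (2 * x) ltac:(lra)).
  assert (Ha : Rabs a <= eps * x / 2).
  { apply Rmult_le_reg_l with (2 / eps); [apply Rdiv_lt_0_compat; lra|].
    replace (2 / eps * (eps * x / 2)) with x by (field; lra).
    replace (2 / eps * Rabs a) with (2 * Rabs a / eps) by (field; lra). lra. }
  pose proof (Rle_abs a).
  apply (Rmult_le_compat_l b) in H; [|exact Hb].
  assert (Hx0 : 0 <= eps * x / 2).
  { apply Rle_trans with (2 := Ha). apply Rabs_pos. }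
  assert (b * (eps / (4 * (b + 1)) * (2 * x)) <= eps * x / 2).
  { replace (b * (eps / (4 * (b + 1)) * (2 * x))) with ((b / (b + 1)) * (eps * x / 2)) by (field; lra).
    rewrite <- (Rmult_1_l (eps * x / 2)) at 2. apply Rmult_le_compat_r; [exact Hx0|].
    apply Rmult_le_reg_r with (b + 1); [lra|]. field_simplify; lra. }
  lra.
Qed.

(** Outside a large disc one step moves [X] by [1] up to [1 / 4], so [Re X] increases and
    half-planes far to the right are stable. The radius [r0] places the half-plane of the petal
    outside that disc. *)
Lemma petal_orbit (f : C -> C) (a2 a3 : C) : a2 <> 0 ->
  @bigO_pow C_NormedModule (fun z : C => f z - (z + a2 * z ^ 2 + a3 * z ^ 3))%C 4 ->
  exists r0, 0 < r0 /\ forall r, 0 < r < r0 -> forall z, incoming_petal a2 r z ->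
  forall j, incoming_petal a2 r (Nat.iter j f z) /\
    Cmod (Xc a2 (Nat.iter j f z) - Xc a2 z - INR j) <= INR j / 4.
Proof.
  intros Ha Hf. destruct (Xc_dyn f a2 a3 Ha Hf) as (R0 & M & HR0 & HM & Hd).
  exists (/ (2 * R0)). split; [apply Rinv_0_lt_compat; lra|].
  intros r [Hr Hr0] z Hz.
  assert (HR : R0 < / (2 * r)).
  { rewrite <- (Rinv_inv R0). apply Rinv_lt_contravar.
    - apply Rmult_lt_0_compat; [lra | apply Rinv_0_lt_compat; lra].
    - replace (/ R0) with (2 * / (2 * R0)) by (field; lra). lra. }
  induction j as [|j [IH1 IH2]]; simpl Nat.iter.
  - split; [exact Hz|]. replace (Xc a2 z - Xc a2 z - INR 0)%C with (RtoC 0) by (simpl; ring).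
    rewrite Cmod_0. simpl. lra.
  - set (zj := Nat.iter j f z) in *.
    apply incoming_petal_Xc in IH1; [|exact Hr]. destruct IH1 as [Hn HRe].
    assert (Hzn : zj <> 0) by (intros E; apply Hn; rewrite E; ring).
    assert (HX : R0 <= Cmod (Xc a2 zj)).
    { pose proof (Re_le_Cmod (Xc a2 zj)). pose proof (Rle_abs (Re (Xc a2 zj))). lra. }
    destruct (Hd zj Hzn HX) as (Hfn & _ & Hs).
    split.
    + apply incoming_petal_Xc; [exact Hr|]. split; [apply Cmult_neq_0; assumption|].
      pose proof (Re_le_Cmod (Xc a2 (f zj) - Xc a2 zj - 1)) as H.
      rewrite !Re_minus in H. change (Re (RtoC 1)) with 1 in H. apply Rabs_le_between in H. lra.
    + rewrite S_INR, RtoC_plus.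
      replace (Xc a2 (f zj) - Xc a2 z - (INR j + 1))%C with
        ((Xc a2 zj - Xc a2 z - INR j) + (Xc a2 (f zj) - Xc a2 zj - 1))%C by ring.
      cbound. lra.
Qed.

Lemma iter_continuous (f : C -> C) (n : nat) (z : C) :
  (forall z, @continuous C_UniformSpace C_UniformSpace f z) ->
  @continuous C_UniformSpace C_UniformSpace (Nat.iter n f) z.
Proof.
  intros Hf. induction n as [|n IH].
  - apply continuous_id.
  - simpl. apply (continuous_comp (Nat.iter n f) f); [exact IH | apply Hf].
Qed.

Lemma incoming_petal_open (a2 z : C) (r : R) :
  incoming_petal a2 r z -> @locally C_UniformSpace z (incoming_petal a2 r).
Proof.
  unfold incoming_petal. intros H. apply (proj2 (locally_Cmod _ _)).
  set (d := r - Cmod (a2 * z + r)). assert (Hd : 0 < d) by (unfold d; lra).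
  exists (d / (Cmod a2 + 1)). pose proof (Cmod_ge_0 a2).
  split; [apply Rdiv_lt_0_compat; lra|].
  intros y Hy. pose proof (Cmod_rev (a2 * y + r) (a2 * z + r)) as H1.
  replace (a2 * y + r - (a2 * z + r))%C with (a2 * (y - z))%C in H1 by ring.
  rewrite Cmod_mult in H1.
  assert (Cmod a2 * Cmod (y - z) < d).
  { apply Rle_lt_trans with ((Cmod a2) * (d / (Cmod a2 + 1))).
    - apply Rmult_le_compat_l; lra.
    - apply Rmult_lt_reg_r with (Cmod a2 + 1); [lra|]. field_simplify; lra. }
  unfold d in *. lra.
Qed.

Lemma basin_iter (f : C -> C) (a2 : C) (r : R) (z : C) (j : nat) :
  (forall z j, incoming_petal a2 r z -> incoming_petal a2 r (Nat.iter j f z)) ->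
  basin f a2 r z -> basin f a2 r (Nat.iter j f z).
Proof.
  intros Hp (n & Hn). exists n. rewrite <- Nat.iter_add, Nat.add_comm, Nat.iter_add.
  apply Hp. exact Hn.
Qed.

Lemma fatou_iter (f phi : C -> C) (a2 a3 : C) (r : R) (z : C) (j : nat) :
  (forall z j, incoming_petal a2 r z -> incoming_petal a2 r (Nat.iter j f z)) ->
  incoming_fatou f a2 a3 r phi -> basin f a2 r z ->
  phi (Nat.iter j f z) = (phi z + INR j)%C.
Proof.
  intros Hp Hphi Hz. induction j as [|j IH]; simpl Nat.iter.
  - simpl. ring.
  - rewrite (incoming_equation _ _ _ _ _ Hphi) by (apply basin_iter; assumption).
    rewrite IH, S_INR, RtoC_plus. ring.
Qed.

(** The functional equation gives [phi (f^n z) = phi z + n], and the normalization rewrites the left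
    side as [X - resit Clog X + o(1)]. There remains to replace [Clog X] by [ln n], which follows
    from a first crude bound on [X - n]. Everything is uniform on [K] because the entrance time into
    the petal is. *)
Lemma incoming_asymptotics (f : C -> C) (a2 a3 : C) : a2 <> 0 ->
  (forall z, @continuous C_UniformSpace C_UniformSpace f z) ->
  @bigO_pow C_NormedModule (fun z : C => f z - (z + a2 * z ^ 2 + a3 * z ^ 3))%C 4 ->
  exists r0, 0 < r0 /\ forall r, 0 < r < r0 -> forall phi,
  incoming_fatou f a2 a3 r phi -> forall K : C -> Prop,
  @compact_set C_UniformSpace K -> (forall z, K z -> basin f a2 r z) ->
  (exists M, forall z, K z -> Cmod (phi z) <= M) /\
  forall eps, 0 < eps -> exists n0, forall n z, (n0 <= n)%nat -> K z ->
    Nat.iter n f z <> 0 /\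
    Cmod (Xc a2 (Nat.iter n f z) - (INR n + resit a2 a3 * ln (INR n) + phi z)) < eps.
Proof.
  intros Ha Hc Hf. destruct (petal_orbit f a2 a3 Ha Hf) as (r0 & Hr0 & Hpet).
  exists r0. split; [exact Hr0|]. intros r Hr phi Hphi K HK HKb.
  assert (Hinv : forall z j, incoming_petal a2 r z -> incoming_petal a2 r (Nat.iter j f z)).
  { intros z j Hz. apply (Hpet r Hr z Hz j). }
  assert (Hbd : exists M, forall z, K z -> Cmod (phi z) <= M).
  { destruct (compact_nat K (fun i z => basin f a2 r z -> Cmod (phi z) <= INR i) HK) as (i & Hi).
    - intros i j x Hij Hx Hb. apply le_INR in Hij. specialize (Hx Hb). lra.
    - intros x Hx. destruct (HKb x Hx) as (n & Hn).
      assert (Hcp : @continuous C_UniformSpace C_UniformSpace (fun y => phi (Nat.iter n f y)) x).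
      { apply (continuous_comp (Nat.iter n f) phi); [apply iter_continuous; exact Hc|].
        apply holomorphic_continuous. apply (incoming_holomorphic _ _ _ _ _ Hphi). exact Hn. }
      rewrite continuous_Cmod in Hcp. destruct (Hcp 1 Rlt_0_1) as (d & Hd & Hd').
      destruct (nfloor_ex (Cmod (phi (Nat.iter n f x)) + 1 + INR n)) as (N & _ & HN).
      { pose proof (Cmod_ge_0 (phi (Nat.iter n f x))). pose proof (pos_INR n). lra. }
      exists (S N). apply (proj2 (locally_Cmod _ _)). exists d. split; [exact Hd|]. intros y Hy Hb.
      specialize (Hd' y Hy). rewrite S_INR.
      rewrite (fatou_iter f phi a2 a3 r y n Hinv Hphi Hb) in Hd'.
      pose proof (Cmod_rev (phi y) (phi (Nat.iter n f x) - INR n)) as H1.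
      replace (phi y - (phi (Nat.iter n f x) - INR n))%C with
        (phi y + INR n - phi (Nat.iter n f x))%C in H1 by ring.
      pose proof (Cmod_minus_le (phi (Nat.iter n f x)) (INR n)) as H2.
      rewrite Cmod_R, (Rabs_pos_eq (INR n)) in H2 by apply pos_INR. lra.
    - exists (INR i). intros z Hz. apply Hi; auto. }
  split; [exact Hbd|]. destruct Hbd as (Mphi & HMphi).
  (* A single integer bounds both the entrance time into the petal and the coordinate [Xc] at that
     time. *)
  assert (HN : exists N, forall z, K z -> exists j, (j <= N)%nat /\
    incoming_petal a2 r (Nat.iter j f z) /\ Cmod (Xc a2 (Nat.iter j f z)) <= INR N).
  { apply (compact_nat K (fun N z => exists j, (j <= N)%nat /\
      incoming_petal a2 r (Nat.iter j f z) /\ Cmod (Xc a2 (Nat.iter j f z)) <= INR N) HK).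
    - intros i j x Hij (n & Hn & H1 & H2). exists n. split; [lia|]. split; [exact H1|].
      apply le_INR in Hij. lra.
    - intros x Hx. destruct (HKb x Hx) as (n & Hn).
      assert (Hx0 : Nat.iter n f x <> 0).
      { pose proof Hn as Hn0. apply incoming_petal_Xc in Hn0; [|apply Hr].
        intros E. apply (proj1 Hn0). rewrite E. ring. }
      set (t := Cmod (Nat.iter n f x)). assert (Ht : 0 < t) by (apply Cmod_gt_0; exact Hx0).
      assert (Ham : 0 < Cmod a2) by (apply Cmod_gt_0; exact Ha).
      pose proof (iter_continuous f n x Hc) as Hcn.
      pose proof (Hcn _ (incoming_petal_open _ _ _ Hn)) as Hop.
      unfold filtermap in Hop. apply locally_Cmod in Hop. destruct Hop as (d1 & Hd1 & Hop).
      rewrite continuous_Cmod in Hcn. destruct (Hcn (t / 2) ltac:(lra)) as (d2 & Hd2 & Hcn').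
      destruct (nfloor_ex (/ (Cmod a2 * (t / 2)) + INR n)) as (N & _ & HN).
      { pose proof (pos_INR n). assert (0 < / (Cmod a2 * (t / 2))); [|lra].
        apply Rinv_0_lt_compat, Rmult_lt_0_compat; lra. }
      exists (S N). apply (proj2 (locally_Cmod _ _)). exists (Rmin d1 d2). split; [apply Rmin_pos; assumption|].
      intros y Hy. exists n.
      assert (Hi : 0 < / (Cmod a2 * (t / 2))) by (apply Rinv_0_lt_compat, Rmult_lt_0_compat; lra).
      split; [|split].
      + apply INR_le. rewrite S_INR. lra.
      + apply Hop. eapply Rlt_le_trans; [exact Hy | apply Rmin_l].
      + assert (Hy2 : t / 2 <= Cmod (Nat.iter n f y)).
        { specialize (Hcn' y (Rlt_le_trans _ _ _ Hy (Rmin_r _ _))).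
          pose proof (Cmod_rev (Nat.iter n f x) (Nat.iter n f y)) as H.
          rewrite Cmod_minus_sym in H. fold t in H. lra. }
        rewrite Xc_mod; [|exact Ha|apply (Cneq_0 _ (t / 2)); lra].
        rewrite S_INR. pose proof (pos_INR n).
        apply Rle_trans with (/ (Cmod a2 * (t / 2))); [|lra].
        apply Rinv_le_contravar; [apply Rmult_lt_0_compat; lra|].
        apply Rmult_le_compat_l; lra. }
  destruct HN as (N & HN).
  set (B := resit a2 a3). assert (HB : 0 <= Cmod B) by apply Cmod_ge_0.
  assert (Hfar : forall n z, (N <= n)%nat -> K z ->
    incoming_petal a2 r (Nat.iter n f z) /\
    Cmod (Xc a2 (Nat.iter n f z) - INR n) <= INR n / 4 + 2 * INR N).
  { intros n z Hn Hz. destruct (HN z Hz) as (j & Hj & H1 & H2).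
    destruct (Hpet r Hr _ H1 (n - j)%nat) as [H3 H4].
    rewrite <- Nat.iter_add in H3, H4. replace (n - j + j)%nat with n in H3, H4 by lia.
    split; [exact H3|]. rewrite minus_INR in H4 by lia.
    replace (Xc a2 (Nat.iter n f z) - INR n)%C with
      ((Xc a2 (Nat.iter n f z) - Xc a2 (Nat.iter j f z) - (INR n - INR j)%R)
        + Xc a2 (Nat.iter j f z) - INR j)%C by (rewrite RtoC_minus; ring).
    cbound. apply le_INR in Hj. pose proof (pos_INR j). rewrite (Rabs_pos_eq (INR j)) by lra. lra. }
  intros eps He.
  (* The normalization of [phi] may use [eps / 2], and the replacement of [Clog X] by [ln n], which
     costs [3 e1] times [Cmod B], uses at most [eps / 4]. *)
  set (e1 := Rmin (eps / 2) (eps / (12 * (Cmod B + 1)))).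
  assert (He1 : 0 < e1) by (unfold e1; apply Rmin_pos; apply Rdiv_lt_0_compat; lra).
  assert (Hee : e1 <= eps / 2 /\ Cmod B * (3 * e1) <= eps / 4).
  { unfold e1. split; [apply Rmin_l|]. pose proof (Rmin_r (eps / 2) (eps / (12 * (Cmod B + 1)))) as H.
    set (e2 := Rmin _ _) in *.
    apply Rle_trans with (Cmod B * (3 * (eps / (12 * (Cmod B + 1))))); [apply Rmult_le_compat_l; lra|].
    apply Rmult_le_reg_r with (4 * (Cmod B + 1)); [lra|]. field_simplify; [|lra]. nra. }
  destruct Hee as [Hee1 Hee2].
  destruct (filterlim_Cmod _ _ (incoming_normalized _ _ _ _ _ Hphi) e1 He1) as (d & Hd & Hnorm).
  assert (Ham : 0 < Cmod a2) by (apply Cmod_gt_0; exact Ha).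
  assert (Hin : exists n1, forall n, (n1 <= n)%nat ->
    2 * INR N <= INR n / 4 /\ / (Cmod a2 * d) < INR n / 2 /\ 2 <= INR n /\
    (Mphi + e1 + Cmod B * PI) + Cmod B * ln (2 * INR n) <= Rmin (/ 2) e1 * INR n).
  { destruct (log_affine_small (Mphi + e1 + Cmod B * PI) (Cmod B) (Rmin (/ 2) e1) HB
      ltac:(apply Rmin_pos; lra)) as (x0 & Hx0 & Hx).
    destruct (nfloor_ex (Rmax x0 (8 * INR N + 2 * / (Cmod a2 * d) + 2))) as (n1 & _ & Hn1).
    { eapply Rle_trans; [|apply Rmax_l]. lra. }
    exists (S n1). intros n Hn. apply le_INR in Hn. rewrite S_INR in Hn.
    pose proof (Rmax_l x0 (8 * INR N + 2 * / (Cmod a2 * d) + 2)).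
    pose proof (Rmax_r x0 (8 * INR N + 2 * / (Cmod a2 * d) + 2)).
    pose proof (pos_INR N).
    assert (0 < / (Cmod a2 * d)) by (apply Rinv_0_lt_compat, Rmult_lt_0_compat; lra).
    repeat split; try lra. apply Hx. lra. }
  destruct Hin as (n1 & Hn1). exists (Nat.max N n1). intros n z Hn Hz.
  destruct (Hn1 n ltac:(lia)) as (Ha1 & Ha2 & Ha3 & Ha4).
  destruct (Hfar n z ltac:(lia) Hz) as [Hpn HXn].
  set (zn := Nat.iter n f z) in *. set (X := Xc a2 zn) in *.
  assert (Hzn : zn <> 0).
  { apply incoming_petal_Xc in Hpn; [|apply Hr]. intros E. apply (proj1 Hpn). rewrite E. ring. }
  split; [exact Hzn|].
  assert (HXlo : INR n / 2 <= Cmod X).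
  { pose proof (Cmod_rev (INR n) X) as H. rewrite Cmod_minus_sym, Cmod_R, Rabs_pos_eq in H; lra. }
  assert (HXhi : Cmod X <= 2 * INR n).
  { pose proof (Cmod_rev X (INR n)) as H. rewrite Cmod_R, Rabs_pos_eq in H; lra. }
  assert (Hzd : Cmod zn < d).
  { assert (HX : Cmod X = / (Cmod a2 * Cmod zn)) by (apply Xc_mod; assumption).
    assert (Hzm : 0 < Cmod zn) by (apply Cmod_gt_0; exact Hzn).
    apply Rmult_lt_reg_l with (Cmod a2); [exact Ham|].
    rewrite <- (Rinv_inv (Cmod a2 * Cmod zn)), <- HX, <- (Rinv_inv (Cmod a2 * d)).
    apply Rinv_lt_contravar; [|lra].
    apply Rmult_lt_0_compat; [apply Rinv_0_lt_compat, Rmult_lt_0_compat|]; lra. }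
  specialize (Hnorm zn Hzd Hpn). change (- (1 / (a2 * zn)))%C with X in Hnorm. fold B in Hnorm.
  unfold zn in Hnorm at 1. rewrite (fatou_iter f phi a2 a3 r z n Hinv Hphi (HKb z Hz)) in Hnorm.
  assert (Hln : Rabs (ln (Cmod X)) <= ln (2 * INR n)).
  { rewrite Rabs_pos_eq.
    - apply ln_le; lra.
    - rewrite <- ln_1. apply ln_le; lra. }
  (* Bootstrap: knowing only that [X] is comparable with [n], its logarithm is [O(ln n)], so [X - n]
     is [O(ln n)], which is a small multiple of [n]. *)
  assert (HXclose : Cmod (X - INR n) <= Rmin (/ 2) e1 * INR n).
  { eapply Rle_trans; [|exact Ha4].
    replace (X - INR n)%C with
      (phi z + B * Clog X - (phi z + INR n - (X - B * Clog X)))%C by ring.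
    pose proof (Clog_bound X) as HC. specialize (HMphi z Hz).
    eapply Rle_trans; [apply Csub_le; [apply Cadd_le; [exact HMphi|apply Cmul_le;[apply Rle_refl|]]|]|].
    - eapply Rle_trans; [exact HC|]. apply Rplus_le_compat_r. exact Hln.
    - apply Rlt_le. exact Hnorm.
    - lra. }
  assert (Hc1 : Cmod (X - INR n) <= INR n / 2).
  { eapply Rle_trans; [exact HXclose|]. pose proof (Rmin_l (/ 2) e1). nra. }
  pose proof (Clog_near_R X (INR n) ltac:(lra) Hc1) as Hlog.
  assert (Hc2 : Cmod (Clog X - ln (INR n)) <= 3 * e1).
  { eapply Rle_trans; [exact Hlog|]. apply Rmult_le_compat_l; [lra|].
    apply Rmult_le_reg_r with (INR n); [lra|].
    replace (Cmod (X - INR n) / INR n * INR n) with (Cmod (X - INR n)) by (field; lra).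
    eapply Rle_trans; [exact HXclose|]. apply Rmult_le_compat_r; [lra | apply Rmin_r]. }
  replace (X - (INR n + B * ln (INR n) + phi z))%C with
    (- (phi z + INR n - (X - B * Clog X)) + B * (Clog X - ln (INR n)))%C by ring.
  eapply Rle_lt_trans; [apply Cadd_le; [rewrite Cmod_opp; apply Rlt_le; exact Hnorm|
    eapply Cmul_le; [apply Rle_refl|exact Hc2]]|]. lra.
Qed.

(** [s = 1] in the incoming petal and [s = -1] in the outgoing one; [e] measures the
    forcing by the base coordinate. *)
Lemma fatou_approx_step (B : C) (M s x e : R) (X X' : C) :
  0 <= M -> Rabs s = 1 -> 8 <= s * x -> 0 <= e ->
  16 * Cmod B <= s * x -> 32 * M <= (s * x) ^ 2 -> 32 * M * e <= 1 ->
  Cmod (X - x) <= Rabs x / 4 ->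
  Cmod (X' - X - 1 - B / X) <= 2 * M * (/ x ^ 2 + e) ->
  0 < Re (s * X) /\ 0 < Re (s * X') /\ Cmod (X' - X - 1) <= / 4 /\
  Cmod (X' - B * Clog (s * X') - (X - B * Clog (s * X)) - 1)
    <= (2 * M * (1 + 2 * Cmod B) + 2 * Cmod B ^ 2 + 12 * Cmod B) * (/ x ^ 2 + e).
Proof.
  intros HM Hs Hx He HB HM2 HMe HX HX'.
  set (b := Cmod B) in *. assert (Hb : 0 <= b) by apply Cmod_ge_0.
  assert (Hax : Rabs x = s * x).
  { rewrite <- (Rabs_pos_eq (s * x)) by lra. rewrite Rabs_mult, Hs. ring. }
  set (u := s * x) in *. rewrite Hax in HX.
  assert (Hx2 : x ^ 2 = u ^ 2) by (rewrite <- pow2_abs, Hax; reflexivity).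
  rewrite Hx2 in *.
  assert (Hss : s * s = 1).
  { pose proof (pow2_abs s) as H. rewrite Hs in H. simpl in H. lra. }
  assert (Hcx : Cmod x = u) by (rewrite Cmod_R; exact Hax).
  assert (HXlo : 3 / 4 * u <= Cmod X).
  { pose proof (Cmod_rev x X) as H. rewrite Cmod_minus_sym, Hcx in H. lra. }
  assert (Hxn : X <> 0) by (apply (Cneq_0 _ (3 / 4 * u)); lra).
  assert (Hi2 : 0 < / u ^ 2 <= / 64).
  { split; [apply Rinv_0_lt_compat; nra | apply Rinv_le_contravar; [lra|nra]]. }
  set (E := (X' - X - 1 - B / X)%C) in *.
  assert (HBX : Cmod (B / X) <= b * (4 / 3 * / u)).
  { replace (b * (4 / 3 * / u)) with (b / (3 / 4 * u)) by (field; lra).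
    apply Cdiv_le; [lra | apply Rle_refl | exact HXlo]. }
  assert (Hbu : b * / u <= / 16).
  { apply Rmult_le_reg_r with u; [lra|]. replace (b * / u * u) with b by (field; lra). lra. }
  assert (HMu : M * / u ^ 2 <= / 32).
  { apply Rmult_le_reg_r with (u ^ 2); [nra|]. replace (M * / u ^ 2 * u ^ 2) with M by (field; lra). lra. }
  assert (HE : Cmod E <= / 8) by lra.
  assert (Hh1 : Cmod (X' - X - 1) <= / 4).
  { replace (X' - X - 1)%C with (E + B / X)%C by (unfold E; ring). cbound. lra. }
  set (h := (X' - X)%C) in *.
  assert (Hh : Cmod h <= 5 / 4).
  { pose proof (Cmod_rev h 1) as H. rewrite Cmod_1 in H. lra. }
  assert (HRe : forall Y : C, s * x - Cmod (Y - x) <= Re (s * Y)).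
  { intros Y. pose proof (Re_close (s * Y) (s * x)) as H.
    replace (s * Y - (s * x)%R)%C with (s * (Y - x))%C in H by (rewrite RtoC_mult; ring).
    rewrite Cmod_mult, Cmod_R, Hs, Rmult_1_l in H. exact H. }
  assert (H1 : 0 < Re (s * X)) by (pose proof (HRe X); fold u in H; lra).
  assert (H2 : 0 < Re (s * X')).
  { pose proof (HRe X') as H. fold u in H.
    assert (Cmod (X' - x) <= u / 4 + 5 / 4).
    { replace (X' - x)%C with ((X - x) + h)%C by (unfold h; ring). cbound. lra. }
    lra. }
  split; [exact H1|]. split; [exact H2|]. split; [exact Hh1|].
  assert (Hsn : RtoC s <> 0) by (apply (Cneq_0 _ 1); [lra | rewrite Cmod_R; lra]).
  pose proof (Clog_diff (s * X) (s * h)) as HL.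
  replace (s * X + s * h)%C with (s * X')%C in HL by (unfold h; ring).
  replace (s * h / (s * X))%C with (h / X)%C in HL by (field; auto).
  rewrite !Cmod_mult, Cmod_R, Hs, !Rmult_1_l in HL.
  specialize (HL H1 H2 ltac:(lra)).
  set (l := (Clog (s * X') - Clog (s * X) - h / X)%C) in *.
  assert (Hl : Cmod l <= 12 * / u ^ 2).
  { eapply Rle_trans; [exact HL|].
    assert (Cmod h ^ 2 <= 25 / 16) by (pose proof (Cmod_ge_0 h); nra).
    assert (Cmod h ^ 2 / Cmod X ^ 2 <= 25 / 16 / (9 / 16 * u ^ 2)).
    { unfold Rdiv at 1 3. apply Rmult_le_compat; [apply pow2_ge_0 | | lra |].
      - apply Rlt_le, Rinv_0_lt_compat. nra.
      - apply Rinv_le_contravar; nra. }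
    replace (25 / 16 / (9 / 16 * u ^ 2)) with (25 / 9 * / u ^ 2) in H0 by (field; lra). lra. }
  (* Since [h = 1 + B / X + E], the first-order term [B h / X] of the logarithm cancels the drift
     [B / X] and leaves products of two small quantities. *)
  replace (X' - B * Clog (s * X') - (X - B * Clog (s * X)) - 1)%C
    with (E - B * ((B / X + E) / X) - B * l)%C.
  2: { unfold l, E, h. field. exact Hxn. }
  assert (HEu : Cmod ((B / X + E) / X) <= 2 * b * / u ^ 2 + Cmod E).
  { replace ((B / X + E) / X)%C with (B / X * (/ X) + E * / X)%C by (field; exact Hxn).
    assert (HiX : Cmod (/ X) <= 4 / 3 * / u).
    { replace (4 / 3 * / u) with (/ (3 / 4 * u)) by (field; lra). apply Cinv_le; lra. }
    assert (Hiu : 0 < / u <= / 8).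
    { split; [apply Rinv_0_lt_compat; lra | apply Rinv_le_contravar; lra]. }
    clear HE HX'. cbound. replace (/ u ^ 2) with (/ u * / u) by (field; lra). pose proof (Cmod_ge_0 E).
    set (i := / u) in *. assert (0 <= b * (i * i)) by (apply Rmult_le_pos; [lra | apply Rmult_le_pos; lra]).
    assert (Cmod E * (4 / 3 * i) <= Cmod E * 1) by (apply Rmult_le_compat_l; lra). lra. }
  eapply Rle_trans.
  { apply Csub_le; [apply Csub_le; [apply Rle_refl | eapply Cmul_le; [apply Rle_refl | exact HEu]]
    | eapply Cmul_le; [apply Rle_refl | exact Hl]]. }
  fold b. pose proof (Cmod_ge_0 E).
  assert (b * Cmod E <= b * (2 * M * (/ u ^ 2 + e))) by (apply Rmult_le_compat_l; lra).
  assert (0 <= b * b * e) by (repeat apply Rmult_le_pos; lra).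
  assert (0 <= b * e) by (apply Rmult_le_pos; lra).
  assert (0 <= M * b * (/ u ^ 2 + e)) by (repeat apply Rmult_le_pos; lra).
  lra.
Qed.

(** Continuous induction in discrete time. As long as [X] stays within a quarter of the reference
    point [x0 + t], each step changes [X - B log (s X)] by [1] up to [1 / x ^ 2 + e]; these errors
    have a bounded sum, so [X] deviates from the reference only logarithmically, which
    re-establishes the quarter. The case [s = -1] is the outgoing petal, traversed towards the
    origin of the [x] axis but never closer than [J]. *)
Lemma fatou_approx_orbit (B : C) (M C1 : R) : 0 < M -> 0 <= C1 ->
  exists J0 M1 kappa, 8 <= J0 /\ 0 < M1 /\ 0 < kappa /\
  forall (s x0 J e : R) (L : nat) (X : nat -> C),
  Rabs s = 1 -> J0 <= J -> 0 <= e -> INR L * e <= kappa ->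
  (forall t, (t <= L)%nat -> J <= s * (x0 + INR t)) ->
  Cmod (X 0%nat - x0) <= Rabs x0 / 4 ->
  Cmod (X 0%nat - B * Clog (s * X 0%nat) - x0) <= C1 ->
  (forall t, (t < L)%nat -> Cmod (X t - (x0 + INR t)%R) <= Rabs (x0 + INR t) / 4 ->
    Cmod (X (S t) - X t - 1 - B / X t) <= 2 * M * (/ (x0 + INR t) ^ 2 + e)) ->
  forall t, (t <= L)%nat ->
    Cmod (X t - (x0 + INR t)%R) <= Rabs (x0 + INR t) / 4 /\
    Cmod (X t - B * Clog (s * X t) - (X 0%nat - B * Clog (s * X 0%nat)) - INR t)
      <= M1 * (2 / J + INR L * e) /\
    Cmod (X t - (x0 + INR t)%R) <= C1 + 1 + Cmod B * (ln (2 * Rabs (x0 + INR t)) + PI).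
Proof.
  intros HM HC1.
  set (b := Cmod B). assert (Hb : 0 <= b) by apply Cmod_ge_0.
  set (M1 := 2 * M * (1 + 2 * b) + 2 * b ^ 2 + 12 * b).
  assert (HM1 : 0 < M1).
  { unfold M1. assert (0 <= M * b) by (apply Rmult_le_pos; lra).
    pose proof (pow2_ge_0 b). lra. }
  destruct (log_affine_small (C1 + 1 + b * PI) b (/ 4) Hb ltac:(lra)) as (x1 & Hx1 & Hlog).
  set (kappa := Rmin (/ (32 * M)) (/ (2 * M1))).
  assert (Hk1 : 0 < / (32 * M)) by (apply Rinv_0_lt_compat; lra).
  assert (Hk2 : 0 < / (2 * M1)) by (apply Rinv_0_lt_compat; lra).
  exists (8 + 16 * b + 32 * M + 4 * M1 + x1), M1, kappa.
  split; [lra|]. split; [exact HM1|].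
  split; [unfold kappa; apply Rmin_pos; assumption|].
  intros s x0 J e L X Hs HJ He HLe Hpos H0 HPsi Hdyn.
  assert (Habs : forall t, (t <= L)%nat -> Rabs (x0 + INR t) = s * (x0 + INR t)).
  { intros t Ht. rewrite <- (Rabs_pos_eq (s * (x0 + INR t))) by (pose proof (Hpos t Ht); lra).
    rewrite Rabs_mult, Hs. ring. }
  assert (Hss : s = 1 \/ s = -1).
  { unfold Rabs in Hs. destruct (Rcase_abs s); lra. }
  assert (HJp : 0 < / J) by (apply Rinv_0_lt_compat; lra).
  assert (HtL : forall t, (t <= L)%nat -> 0 <= INR t * e <= INR L * e).
  { intros t Ht. apply le_INR in Ht. pose proof (pos_INR t).
    split; [apply Rmult_le_pos; lra | apply Rmult_le_compat_r; lra]. }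
  (* The telescoping majorant of the sum of [1 / x ^ 2]. Its total is at most [2 / J] for either
     sign, since the reference point never crosses [0]. *)
  assert (Hinv : forall t, (t <= L)%nat -> 0 <= 2 * (/ x0 - / (x0 + INR t)) <= 2 / J).
  { intros t Ht. pose proof (Hpos t Ht) as Hp. pose proof (Hpos 0%nat ltac:(lia)) as Hp0.
    simpl INR in Hp0. rewrite Rplus_0_r in Hp0. pose proof (pos_INR t).
    destruct Hss as [-> | ->].
    - assert (0 < / (x0 + INR t)) by (apply Rinv_0_lt_compat; lra).
      assert (/ x0 <= / J) by (apply Rinv_le_contravar; lra).
      assert (/ (x0 + INR t) <= / x0) by (apply Rinv_le_contravar; lra).
      unfold Rdiv. lra.
    - assert (0 < / - x0) by (apply Rinv_0_lt_compat; lra).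
      assert (/ - (x0 + INR t) <= / J) by (apply Rinv_le_contravar; lra).
      assert (/ - x0 <= / - (x0 + INR t)) by (apply Rinv_le_contravar; lra).
      rewrite Rinv_opp in *. rewrite Rinv_opp in *. unfold Rdiv. lra. }
  set (Psi := fun t => (X t - B * Clog (s * X t))%C).
  assert (HP0 : Cmod (Psi 0%nat - x0) <= C1) by exact HPsi.
  assert (Hmain : forall t, (t <= L)%nat ->
    Cmod (X t - (x0 + INR t)%R) <= Rabs (x0 + INR t) / 4 /\
    Cmod (Psi t - Psi 0%nat - INR t) <= M1 * (2 * (/ x0 - / (x0 + INR t)) + INR t * e) /\
    Cmod (X t - (x0 + INR t)%R) <= C1 + 1 + b * (ln (2 * Rabs (x0 + INR t)) + PI)).
  2: { intros t Ht. destruct (Hmain t Ht) as (G1 & G2 & G3).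
       split; [exact G1|]. split; [|exact G3].
       eapply Rle_trans; [exact G2|]. apply Rmult_le_compat_l; [lra|].
       pose proof (Hinv t Ht). pose proof (HtL t Ht). lra. }
  (* The self-improving part: a deviation of at most one half of the reference, together with the
     accumulated estimate, gives back a deviation of at most one quarter. *)
  assert (Hfin : forall t, (t <= L)%nat ->
    Cmod (X t - (x0 + INR t)%R) <= Rabs (x0 + INR t) / 2 ->
    Cmod (Psi t - Psi 0%nat - INR t) <= M1 * (2 * (/ x0 - / (x0 + INR t)) + INR t * e) ->
    Cmod (X t - (x0 + INR t)%R) <= C1 + 1 + b * (ln (2 * Rabs (x0 + INR t)) + PI) /\
    Cmod (X t - (x0 + INR t)%R) <= Rabs (x0 + INR t) / 4).
  { intros t Ht HXt HPt.
    pose proof (Hpos t Ht) as Hp. pose proof (Habs t Ht) as Ha.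
    set (x := x0 + INR t) in *.
    assert (HPt1 : Cmod (Psi t - Psi 0%nat - INR t) <= 1).
    { eapply Rle_trans; [exact HPt|].
      apply Rle_trans with (M1 * (2 * / J + / (2 * M1))).
      - apply Rmult_le_compat_l; [lra|]. pose proof (Hinv t Ht) as Hi. fold x in Hi.
        pose proof (HtL t Ht). unfold kappa in HLe. pose proof (Rmin_r (/ (32 * M)) (/ (2 * M1))).
        unfold Rdiv in Hi. lra.
      - assert (M1 * / J <= / 4).
        { apply Rmult_le_reg_r with J; [lra|]. rewrite Rmult_assoc, Rinv_l by lra. lra. }
        replace (M1 * (2 * / J + / (2 * M1))) with (2 * (M1 * / J) + / 2) by (field; lra). lra. }
    assert (Hm : Cmod (X t) <= 2 * Rabs x /\ 1 <= Cmod (X t)).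
    { assert (Hcx : Cmod x = Rabs x) by apply Cmod_R.
      pose proof (Cmod_rev (X t) x) as G1. pose proof (Cmod_rev x (X t)) as G2.
      rewrite Cmod_minus_sym in G2. lra. }
    assert (HC : Cmod (Clog (s * X t)) <= ln (2 * Rabs x) + PI).
    { eapply Rle_trans; [apply Clog_bound|]. apply Rplus_le_compat_r.
      rewrite Cmod_mult, Cmod_R, Hs, Rmult_1_l. rewrite Rabs_pos_eq.
      - apply ln_le; lra.
      - rewrite <- ln_1. apply ln_le; lra. }
    assert (G : Cmod (X t - x) <= C1 + 1 + b * (ln (2 * Rabs x) + PI)).
    { replace (X t - x)%C with ((Psi t - Psi 0%nat - INR t) + (Psi 0%nat - x0) + B * Clog (s * X t))%C
        by (unfold Psi, x; rewrite RtoC_plus; ring).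
      cbound. fold b. lra. }
    split; [exact G|]. eapply Rle_trans; [exact G|].
    specialize (Hlog (Rabs x) ltac:(lra)). lra. }
  induction t as [|t IH]; intros Ht.
  - assert (HP : Cmod (Psi 0%nat - Psi 0%nat - INR 0) <=
      M1 * (2 * (/ x0 - / (x0 + INR 0)) + INR 0 * e)).
    { replace (Psi 0%nat - Psi 0%nat - INR 0)%C with (RtoC 0) by (simpl; ring).
      rewrite Cmod_0. simpl. rewrite Rplus_0_r. lra. }
    assert (H0' : Cmod (X 0%nat - (x0 + INR 0)%R) <= Rabs (x0 + INR 0) / 4)
      by (simpl INR; rewrite Rplus_0_r; exact H0).
    destruct (Hfin 0%nat Ht) as [G1 G2]; auto.
    pose proof (Rabs_pos (x0 + INR 0)). lra.
  - destruct (IH ltac:(lia)) as (G1 & G2 & _).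
    pose proof (Hpos t ltac:(lia)) as Hp. pose proof (Habs t ltac:(lia)) as Ha.
    pose proof (Hpos (S t) Ht) as Hp'. pose proof (Habs (S t) Ht) as Ha'.
    pose proof (Hdyn t ltac:(lia) G1) as Hd.
    rewrite S_INR in *. set (x := x0 + INR t) in *.
    replace (x0 + (INR t + 1)) with (x + 1) in * by (unfold x; ring).
    assert (HMe : 32 * M * e <= 1).
    { assert (e <= / (32 * M)).
      { assert (1 * e <= INR L * e).
        { apply Rmult_le_compat_r; [exact He|]. change 1 with (INR 1). apply le_INR. lia. }
        unfold kappa in HLe. pose proof (Rmin_l (/ (32 * M)) (/ (2 * M1))). lra. }
      apply (Rmult_le_compat_l (32 * M)) in H; [|lra]. rewrite Rinv_r in H by lra. lra. }
    destruct (fatou_approx_step B M s x e (X t) (X (S t))) as (_ & _ & S3 & S4); try lra.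
    { fold b. lra. }
    { simpl. nra. }
    fold b in S4. fold M1 in S4.
    assert (Hx2 : / x ^ 2 <= 2 * (/ x - / (x + 1))).
    { assert (Hxx : 0 < x * (x + 1) <= 2 * x ^ 2).
      { destruct Hss as [-> | ->]; nra. }
      assert (x <> 0) by (intros E; rewrite E in Hxx; lra).
      assert (x + 1 <> 0) by (intros E; rewrite E in Hxx; lra).
      replace (2 * (/ x - / (x + 1))) with (2 * / (x * (x + 1))) by (field; auto).
      apply Rmult_le_reg_r with (x ^ 2 * (x * (x + 1))).
      - apply Rmult_lt_0_compat; [nra|lra].
      - field_simplify; try (repeat split; auto). nra. }
    assert (HP : Cmod (Psi (S t) - Psi 0%nat - (INR t + 1)%R) <=
      M1 * (2 * (/ x0 - / (x + 1)) + (INR t + 1) * e)).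
    { replace (Psi (S t) - Psi 0%nat - (INR t + 1)%R)%C with
        ((Psi t - Psi 0%nat - INR t) + (Psi (S t) - Psi t - 1))%C by (rewrite RtoC_plus; ring).
      eapply Rle_trans; [apply Cadd_le; [exact G2 | exact S4]|].
      rewrite <- Rmult_plus_distr_l. apply Rmult_le_compat_l; lra. }
    assert (HX' : Cmod (X (S t) - (x + 1)%R) <= Rabs (x + 1) / 2).
    { replace (X (S t) - (x + 1)%R)%C with ((X t - x) + (X (S t) - X t - 1))%C
        by (rewrite RtoC_plus; ring).
      eapply Rle_trans; [apply Cadd_le; [exact G1 | exact S3]|]. rewrite Ha, Ha' in *.
      destruct Hss as [-> | ->]; lra. }
    pose proof (Hfin (S t) Ht) as HF. rewrite S_INR in HF.
    replace (x0 + (INR t + 1)) with (x + 1) in HF by (unfold x; ring).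
    destruct (HF HX' HP) as [F1 F2]. auto.
Qed.

(** * The transit between the petals *)

Section Transit_step.

Local Open Scope C_scope.
Variables (a b03 b30 : C) (b c : R).

(** Near both ends [w / z] blows up like [1 / S], so the computation is done with [z = Z S],
    [w = Z U] and [eps = x S], in which [U] stays bounded. In the expansion of [S w' / z' - U] in
    powers of [Z], the coefficient of [Z] is the Riccati field [U ^ 2 + S U + b S ^ 2], that of
    [Z ^ 2] is [quad_coef], and [cubic_rest] gathers all the rest. *)
Definition quad_coef (S U : C) : C :=
  b03 * U ^ 3 + b30 * S ^ 3 + S * (U ^ 2 + b * S ^ 2) + (1 - a) * S ^ 2 * U.

Definition cubic_rest (Z S U r1 r2 : C) : C :=
  (S * (b03 * U ^ 3 + b30 * S ^ 3) + (1 - a) * S ^ 2 * (U ^ 2 + b * S ^ 2)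
    + r1 * S ^ 3 * U + r2)
  + Z * (S * r2 + (1 - a) * S ^ 2 * (b03 * U ^ 3 + b30 * S ^ 3)
    + r1 * S ^ 3 * (U ^ 2 + b * S ^ 2))
  + Z ^ 2 * ((1 - a) * S ^ 2 * r2 + r1 * S ^ 3 * (b03 * U ^ 3 + b30 * S ^ 3))
  + Z ^ 3 * (r1 * S ^ 3 * r2).

(** The part of the step beyond the Riccati field, pulled back to the tangent coordinate:
    [h = 1 + x Co] is the denominator of the change of variable, whose derivative is [c / h ^ 2]. *)
Definition step_K (Z S U h r1 r2 : C) : C :=
  (quad_coef S U + Z * cubic_rest Z S U r1 r2) * h ^ 2 * / c.

(** The quotient by [x] of the change of [quad_coef S U * h ^ 2] when [U] moves away from its value
    [U0] at [x = 0]. *)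
Definition step_q (x S Co U U0 h hi : C) : C :=
  c * hi * (b03 * (U ^ 2 + U * U0 + U0 ^ 2) + S * (U + U0) + (1 - a) * S ^ 2)
  + quad_coef S U * (2 * Co + x * Co ^ 2).

(** [step_e1] and [step_e2] are the exact cofactors of the error terms [Z ^ 3] and [Z ^ 2 x] in the
    increment of [x]. Written as polynomials in bounded quantities, they can be estimated without
    further expansion. *)
Definition step_e1 (Z x S Co U h hi r1 r2 gi : C) : C :=
  cubic_rest Z S U r1 r2 * h ^ 2 * / c
  + Co * step_K Z S U h r1 r2 * (2 * c + c * (x * S) ^ 2 + Z * step_K Z S U h r1 r2) * hi
  + (c * (1 + (x * S) ^ 2) + Z * step_K Z S U h r1 r2) ^ 3 * (Co * hi) ^ 2 * gi.

Definition step_e2 (Z x S Co U U0 h hi r1 r2 : C) : C :=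
  step_q x S Co U U0 h hi * / c - c ^ 2 * Co ^ 2 * hi
  + Co * c * x * S ^ 2 * (2 * c + c * (x * S) ^ 2 + Z * step_K Z S U h r1 r2) * hi.

(** The three constants are existential variables introduced before the parameters, so they are
    uniform; [cbd] fills them in by replacing each factor by its bound. *)
Lemma step_bounds (UB r1B r2B : R) :
  exists KB E1 E2 : R, forall Z x S Co U U0 h hi r1 r2 gi : C,
  (Cmod Z <= 1)%R -> (Cmod x <= 1)%R -> (Cmod S <= 1)%R -> (Cmod Co <= 1)%R ->
  (Cmod U <= UB)%R -> (Cmod U0 <= UB)%R -> (Cmod h <= 2)%R -> (Cmod hi <= 2)%R ->
  (Cmod r1 <= r1B)%R -> (Cmod r2 <= r2B)%R -> (Cmod gi <= 2)%R ->
  (Cmod (step_K Z S U h r1 r2) <= KB)%R /\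
  (Cmod (step_e1 Z x S Co U h hi r1 r2 gi) <= E1)%R /\
  (Cmod (step_e2 Z x S Co U U0 h hi r1 r2) <= E2)%R.
Proof.
  do 3 eexists. intros Z x S Co U U0 h hi r1 r2 gi HZ Hx HS HCo HU HU0 Hh Hhi Hr1 Hr2 Hgi.
  unfold step_e1, step_e2, step_q, step_K, quad_coef, cubic_rest.
  split; [|split]; cbd.
Qed.

(** As [b = c ^ 2 + 1 / 4], the Riccati field is the sum of squares [(U + S / 2) ^ 2 + c ^ 2 S ^ 2].
    In the tangent coordinate the first square is explicit and the sum becomes
    [c ^ 2 (1 + (x S) ^ 2) / h ^ 2], the usual [1 + tan ^ 2]: the leading motion is a rotation of
    the angle at speed [c]. *)
Lemma step_kappa (Z x S Co h hi U r1 r2 V : C) :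
  RtoC c <> 0 -> h * hi = 1 -> h = 1 + x * Co -> U = c * (x * S ^ 2 - Co) * hi - S / 2 ->
  S ^ 2 + Co ^ 2 = 1 -> RtoC b = c ^ 2 + 1 / 4 ->
  V = (1 + Z * S + (1 - a) * (Z * S) ^ 2 + r1 * (Z * S) ^ 3)
      * (U + Z * U ^ 2 + b * Z * S ^ 2 + b03 * Z ^ 2 * U ^ 3 + b30 * Z ^ 2 * S ^ 3 + r2 * Z ^ 3) ->
  h ^ 2 * (V - U) / c = Z * (c * (1 + (x * S) ^ 2) + Z * step_K Z S U h r1 r2).
Proof.
  intros Hc Hh Hh0 HU HS Hb HV.
  assert (HD : (U ^ 2 + S * U + b * S ^ 2) * h ^ 2 = c ^ 2 * (1 + (x * S) ^ 2)).
  { replace (U ^ 2 + S * U + b * S ^ 2) with ((U + S / 2) ^ 2 + c ^ 2 * S ^ 2)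
      by (rewrite Hb; field).
    replace (U + S / 2) with (c * (x * S ^ 2 - Co) * hi) by (rewrite HU; ring).
    replace (((c * (x * S ^ 2 - Co) * hi) ^ 2 + c ^ 2 * S ^ 2) * h ^ 2)
      with (c ^ 2 * ((x * S ^ 2 - Co) ^ 2 * (h * hi) ^ 2 + S ^ 2 * h ^ 2)) by ring.
    rewrite Hh, Hh0.
    replace (c ^ 2 * ((x * S ^ 2 - Co) ^ 2 * 1 ^ 2 + S ^ 2 * (1 + x * Co) ^ 2))
      with (c ^ 2 * (x ^ 2 * S ^ 2 * (S ^ 2 + Co ^ 2) + (S ^ 2 + Co ^ 2))) by ring.
    rewrite HS. ring. }
  assert (HVU : V - U = Z * (U ^ 2 + S * U + b * S ^ 2)
    + Z ^ 2 * (quad_coef S U + Z * cubic_rest Z S U r1 r2)).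
  { rewrite HV. unfold quad_coef, cubic_rest. ring. }
  rewrite HVU. unfold step_K.
    replace (h ^ 2 * (Z * (U ^ 2 + S * U + b * S ^ 2)
      + Z ^ 2 * (quad_coef S U + Z * cubic_rest Z S U r1 r2)) / c)
      with ((Z * ((U ^ 2 + S * U + b * S ^ 2) * h ^ 2)
      + Z ^ 2 * (quad_coef S U + Z * cubic_rest Z S U r1 r2) * h ^ 2) / c) by (field; exact Hc).
    rewrite HD. field. exact Hc.
Qed.

(** The increment [kappa gi] of [x] is expanded through the exact formula [gi = 1 + g + g ^ 2 gi],
    and the quadratic coefficient is evaluated at [U0], its value at [x = 0]. No remainder is
    dropped, so estimates come only from [step_bounds]. *)
Lemma step_identity (Z x S Co h hi U U0 r1 r2 kappa gi : C) :
  RtoC c <> 0 -> h * hi = 1 -> h = 1 + x * Co ->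
  U0 = - (c * Co) - S / 2 -> U = c * (x * S ^ 2 - Co) * hi - S / 2 ->
  S ^ 2 + Co ^ 2 = 1 ->
  kappa = Z * (c * (1 + (x * S) ^ 2) + Z * step_K Z S U h r1 r2) ->
  (1 - Co * kappa * hi) * gi = 1 ->
  kappa * gi - (c * Z + Z ^ 2 * (quad_coef S U0 / c + c ^ 2 * Co))
  = Z ^ 3 * step_e1 Z x S Co U h hi r1 r2 gi + Z ^ 2 * x * step_e2 Z x S Co U U0 h hi r1 r2
    + Z * (x * S) ^ 2 * c.
Proof.
  intros Hc Hh Hh0 HU0 HU HS HK Hg.
  set (g := Co * kappa * hi) in *.
  assert (Hgi : gi = 1 + g + g ^ 2 * gi).
  { replace (1 + g + g ^ 2 * gi) with (1 + g + g * (gi - (1 - g) * gi)) by ring.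
    rewrite Hg. replace gi with (g * gi + (1 - g) * gi) at 1 by ring. rewrite Hg. ring. }
  assert (HUd : U = U0 + x * (c * hi)).
  { rewrite HU, HU0.
    replace (- (c * Co) - S / 2 + x * (c * hi)) with (c * (x * hi - Co * (h * hi)) - S / 2)
      by (rewrite Hh; ring).
    rewrite Hh0.
    replace (x * hi - Co * ((1 + x * Co) * hi)) with ((x * (1 - Co ^ 2) - Co) * hi) by ring.
    rewrite <- HS. ring. }
  assert (Hq : quad_coef S U * h ^ 2 - quad_coef S U0 = x * step_q x S Co U U0 h hi).
  { unfold step_q.
    replace (quad_coef S U * h ^ 2 - quad_coef S U0)
      with ((quad_coef S U - quad_coef S U0) + quad_coef S U * (x * (2 * Co + x * Co ^ 2)))
      by (rewrite Hh0; ring).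
    replace (quad_coef S U - quad_coef S U0) with
      ((U - U0) * (b03 * (U ^ 2 + U * U0 + U0 ^ 2) + S * (U + U0) + (1 - a) * S ^ 2))
      by (unfold quad_coef; ring).
    replace (U - U0) with (x * (c * hi)) by (rewrite HUd; ring). ring. }
  assert (HKq : step_K Z S U h r1 r2 = quad_coef S U0 / c
    + x * step_q x S Co U U0 h hi / c + Z * cubic_rest Z S U r1 r2 * h ^ 2 / c).
  { rewrite <- Hq. unfold step_K. field. exact Hc. }
  assert (Hhi : hi = 1 - x * Co * hi).
  { replace hi with (h * hi - x * Co * hi) at 1 by (rewrite Hh0; ring). rewrite Hh. reflexivity. }
  unfold step_e1, step_e2. rewrite Hgi at 1.
  replace (kappa * (1 + g + g ^ 2 * gi)) with (kappa + Co * kappa ^ 2 * hi + kappa * g ^ 2 * gi)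
    by (unfold g; ring).
  unfold step_e1, step_e2.
  set (K := step_K Z S U h r1 r2) in *. set (T := cubic_rest Z S U r1 r2) in *.
  set (q := step_q x S Co U U0 h hi) in *. set (Q := quad_coef S U0) in *.
  assert (H1 : kappa - c * Z - Z ^ 2 * (Q / c) =
    Z ^ 3 * (T * h ^ 2 * / c) + Z ^ 2 * x * (q * / c) + Z * (x * S) ^ 2 * c).
  { rewrite HK, HKq. field. exact Hc. }
  assert (H2 : Co * kappa ^ 2 * hi - Z ^ 2 * (c ^ 2 * Co) =
    Z ^ 3 * (Co * K * (2 * c + c * (x * S) ^ 2 + Z * K) * hi)
    + Z ^ 2 * x * (- (c ^ 2 * Co ^ 2 * hi)
        + Co * c * x * S ^ 2 * (2 * c + c * (x * S) ^ 2 + Z * K) * hi)).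
  { rewrite HK.
    replace (Z ^ 2 * (c ^ 2 * Co)) with (Z ^ 2 * (c ^ 2 * Co) * (hi + x * Co * hi))
      by (rewrite Hhi at 1; ring). ring. }
  assert (H3 : kappa * g ^ 2 * gi =
    Z ^ 3 * ((c * (1 + (x * S) ^ 2) + Z * K) ^ 3 * (Co * hi) ^ 2 * gi)).
  { unfold g. rewrite HK. ring. }
  rewrite H3.
  replace (kappa + Co * kappa ^ 2 * hi
    + Z ^ 3 * ((c * (1 + (x * S) ^ 2) + Z * K) ^ 3 * (Co * hi) ^ 2 * gi)
    - (c * Z + Z ^ 2 * (Q / c + c ^ 2 * Co)))
    with ((kappa - c * Z - Z ^ 2 * (Q / c)) + (Co * kappa ^ 2 * hi - Z ^ 2 * (c ^ 2 * Co))
    + Z ^ 3 * ((c * (1 + (x * S) ^ 2) + Z * K) ^ 3 * (Co * hi) ^ 2 * gi)) by (field; exact Hc).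
  rewrite H1, H2. ring.
Qed.

(** The map [x -> (x S ^ 2 - Co) / (1 + x Co)] is a Möbius transformation with derivative
    [1 / h ^ 2]. Moving its value by [kappa / h ^ 2] amounts exactly to moving [x] by [kappa gi],
    where [gi] accounts for the curvature. *)
Lemma step_rel (x S Co h hi kappa gi P : C) :
  h * hi = 1 -> h = 1 + x * Co -> S ^ 2 + Co ^ 2 = 1 -> (1 - Co * kappa * hi) * gi = 1 ->
  P = c * ((x * S ^ 2 - Co) * hi + kappa * hi ^ 2) ->
  P * (1 + (x + kappa * gi) * Co) = c * ((x + kappa * gi) * S ^ 2 - Co).
Proof.
  intros Hh Hh0 HS Hg HP.
  assert (Hgi : gi - Co * kappa * hi * gi = 1) by (rewrite <- Hg; ring).
  assert (H1 : (x * S ^ 2 - Co) * Co + 1 = S ^ 2 * h).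
  { assert (E : 1 - Co ^ 2 = S ^ 2) by (rewrite <- HS; ring).
    replace ((x * S ^ 2 - Co) * Co + 1) with (x * S ^ 2 * Co + (1 - Co ^ 2)) by ring.
    rewrite E, Hh0. ring. }
  apply Ceq_minus. rewrite HP.
  replace (1 + (x + kappa * gi) * Co) with (h + kappa * gi * Co) by (rewrite Hh0; ring).
  replace (c * ((x * S ^ 2 - Co) * hi + kappa * hi ^ 2) * (h + kappa * gi * Co)
    - c * ((x + kappa * gi) * S ^ 2 - Co))
    with (c * ((x * S ^ 2 - Co) * (h * hi - 1) + kappa * hi * (h * hi - 1)
      - kappa * hi * (gi - Co * kappa * hi * gi - 1)
      + kappa * gi * (hi * ((x * S ^ 2 - Co) * Co + 1) - S ^ 2))) by ring.
  rewrite H1, Hgi.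
  replace (hi * (S ^ 2 * h) - S ^ 2) with (S ^ 2 * (h * hi - 1)) by ring.
  rewrite Hh. ring.
Qed.

End Transit_step.

(** [eps] is the tangent of the difference between [atan ((w / z + 1 / 2) / c)]
    and the angle [theta - PI / 2], where [S = sin theta] and [Co = cos theta]. *)
Definition transit_rel (c S Co : R) (z w eps : C) : Prop :=
  ((w + z / 2) * (S + eps * Co) = c * z * (eps * S - Co))%C.

(** The coefficient of [z ^ 2] in the increment of [eps] on the unperturbed Riccati solution. The
    term [c ^ 2 Co] comes from the second-order effect of the rotation itself, and the division by
    [S] from undoing the scaling: [S Z ^ 2 = z ^ 2 / S]. *)
Definition step_G (a b03 b30 : C) (b c S Co : R) : C :=
  ((quad_coef a b03 b30 b S (- (c * Co) - S / 2) / c + c ^ 2 * Co) / S)%C.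

(** One step of the map seen from a fixed angle; the angle is advanced separately afterwards. The
    smallness of [z] and [eps] is required relative to [S], so that [Z] and [x] are small, and the
    errors accordingly contain [1 / S ^ 2]. *)
Lemma transit_step (a b03 b30 : C) (b c C0 : R) :
  0 < c -> b = c ^ 2 + 1 / 4 -> 0 <= C0 ->
  exists M eta, 0 < M /\ 0 < eta /\
  forall (S Co : R) (z w z' w' eps : C),
  0 < S -> S ^ 2 + Co ^ 2 = 1 -> 0 < Cmod z <= eta * S -> Cmod eps <= eta * S ->
  transit_rel c S Co z w eps ->
  Cmod (z' - (z - z ^ 2 + a * z ^ 3)) <= C0 * Cmod z ^ 4 ->
  Cmod (w' - (w + w ^ 2 + b * z ^ 2 + b03 * w ^ 3 + b30 * z ^ 3))
    <= C0 * (Cmod z + Cmod w) ^ 4 ->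
  exists eps1, transit_rel c S Co z' w' eps1 /\
    Cmod (eps1 - eps - (c * z + z ^ 2 * step_G a b03 b30 b c S Co))
      <= M * (Cmod z ^ 3 / S ^ 2 + Cmod z ^ 2 * Cmod eps / S ^ 2 + Cmod eps ^ 2 * Cmod z).
Proof.
  intros Hc Hb HC0.
  destruct (inv_step (-1) a) as (M0 & d0 & HM0 & Hd0 & Hinv).
  set (UB := 5 * c + 1). set (r1B := M0 * (1 + C0)). set (r2B := C0 * (1 + UB) ^ 4).
  destruct (step_bounds a b03 b30 b c UB r1B r2B) as (KB & E1 & E2 & Hbd).
  set (KB' := Rabs KB + 2 * c + 1). pose proof (Rabs_pos KB). pose proof (Rle_abs KB).
  assert (HKB' : 0 < KB') by (unfold KB'; lra).
  set (eta := Rmin (Rmin (/ 2) d0) (Rmin (/ (4 * KB')) (/ (8 * (1 + C0))))).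
  assert (Heta : 0 < eta /\ eta <= / 2 /\ eta <= d0 /\ eta <= / (4 * KB') /\ eta <= / (8 * (1 + C0))).
  { assert (0 < / (4 * KB')) by (apply Rinv_0_lt_compat; lra).
    assert (0 < / (8 * (1 + C0))) by (apply Rinv_0_lt_compat; lra).
    unfold eta. split; [repeat apply Rmin_pos; lra|].
    set (u := / (4 * KB')) in *. set (v := / (8 * (1 + C0))) in *.
    pose proof (Rmin_l (Rmin (/ 2) d0) (Rmin u v)). pose proof (Rmin_r (Rmin (/ 2) d0) (Rmin u v)).
    pose proof (Rmin_l (/ 2) d0). pose proof (Rmin_r (/ 2) d0).
    pose proof (Rmin_l u v). pose proof (Rmin_r u v). lra. }
  destruct Heta as (He0 & He1 & He2 & He3 & He4).
  exists (Rabs E1 + Rabs E2 + c), eta.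
  pose proof (Rabs_pos E1). pose proof (Rabs_pos E2). pose proof (Rle_abs E1). pose proof (Rle_abs E2).
  split; [lra|]. split; [exact He0|].
  intros S Co z w z' w' eps HS HSC [Hz0 Hz] Heps Hrel Hz' Hw'.
  assert (HS1 : S <= 1) by nra.
  assert (HCo1 : Rabs Co <= 1) by (apply Rabs_le; nra).
  assert (Hcn : RtoC c <> 0) by (intros E; apply RtoC_inj in E; lra).
  assert (HSn : RtoC S <> 0) by (intros E; apply RtoC_inj in E; lra).
  assert (Hzn : z <> 0) by (apply Cmod_gt_0; exact Hz0).
  assert (HmS : Cmod S = S) by (rewrite Cmod_R; apply Rabs_pos_eq; lra).
  set (Z := (z / S)%C). set (x := (eps / S)%C).
  assert (Ez : z = (Z * S)%C) by (unfold Z; field; exact HSn).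
  assert (Ee : eps = (x * S)%C) by (unfold x; field; exact HSn).
  assert (HZm : Cmod Z = Cmod z / S) by (unfold Z; rewrite Cmod_div, HmS by exact HSn; reflexivity).
  assert (Hxm : Cmod x = Cmod eps / S) by (unfold x; rewrite Cmod_div, HmS by exact HSn; reflexivity).
  assert (HZ : Cmod Z <= eta).
  { rewrite HZm. apply Rmult_le_reg_r with S; [lra|]. replace (Cmod z / S * S) with (Cmod z) by (field; lra). lra. }
  assert (Hx : Cmod x <= eta).
  { rewrite Hxm. apply Rmult_le_reg_r with S; [lra|]. replace (Cmod eps / S * S) with (Cmod eps) by (field; lra). lra. }
  assert (HZn : Z <> 0) by (intros E; apply Hzn; rewrite Ez, E; ring).
  assert (HCo : Cmod Co <= 1) by (rewrite Cmod_R; exact HCo1).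
  assert (HxCo : Cmod (x * Co) <= / 2).
  { apply Rle_trans with (eta * 1); [cbd | lra]. }
  set (h := (1 + x * Co)%C).
  assert (Hhlo : / 2 <= Cmod h) by (pose proof (Cone_plus_ge (x * Co) _ HxCo); unfold h; lra).
  assert (Hhn : h <> 0) by (apply (Cneq_0 _ (/ 2)); lra).
  assert (Hh2 : Cmod h <= 2).
  { unfold h. eapply Rle_trans; [apply Cadd_le; [apply Req_le, Cmod_1 | exact HxCo]|]. lra. }
  assert (Hhi2 : Cmod (/ h) <= 2).
  { replace 2 with (/ / 2) by field. apply Cinv_le; lra. }
  set (U0 := (- (c * Co) - S / 2)%C).
  set (U := (c * (x * S ^ 2 - Co) * / h - S / 2)%C).
  assert (HmS1 : Cmod S <= 1) by lra.
  assert (Hmc : Cmod c <= c) by (rewrite Cmod_R, Rabs_pos_eq; lra).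
  assert (HS2 : Cmod (S / 2) <= 1).
  { rewrite Cmod_div, HmS by (intros E; apply RtoC_inj in E; lra). rewrite Cmod_R, Rabs_pos_eq by lra. lra. }
  assert (HU0 : Cmod U0 <= UB) by (unfold U0, UB; cbound; lra).
  assert (HU : Cmod U <= UB).
  { unfold U, UB. cbound. nra. }
  assert (Ew : w = (Z * U)%C).
  { unfold transit_rel in Hrel.
    assert (E : (S + eps * Co)%C = (S * h)%C) by (rewrite Ee; unfold h; ring).
    rewrite E in Hrel.
    replace w with ((w + z / 2) * (S * h) / (S * h) - z / 2)%C by (field; auto).
    rewrite Hrel, Ee, Ez. unfold U. field; auto. }
  assert (HSZ : Cmod z <= Cmod Z).
  { rewrite HZm. apply Rmult_le_reg_r with S; [lra|]. replace (Cmod z / S * S) with (Cmod z) by (field; lra). nra. }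
  assert (Hz4 : (z ^ 4)%C <> 0) by (apply Cpow_nz; exact Hzn).
  assert (HZ4 : (Z ^ 4)%C <> 0) by (apply Cpow_nz; exact HZn).
  set (rz := ((z' - (z - z ^ 2 + a * z ^ 3)) / z ^ 4)%C).
  assert (Hrz : Cmod rz <= C0).
  { unfold rz. rewrite Cmod_div, Cmod_pow by exact Hz4.
    assert (0 < Cmod z ^ 4) by (apply pow_lt; exact Hz0).
    apply Rmult_le_reg_r with (Cmod z ^ 4); [assumption|]. unfold Rdiv.
    rewrite Rmult_assoc, Rinv_l by lra. lra. }
  assert (Ez' : z' = (z + (-1) * z ^ 2 + a * z ^ 3 + rz * z ^ 4)%C) by (unfold rz; field; exact Hzn).
  assert (Hrz8 : Cmod rz * Cmod z ^ 3 <= / 8).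
  { apply Rle_trans with ((1 + C0) * eta).
    - apply Rmult_le_compat; [apply Cmod_ge_0 | apply pow_le; lra | lra |].
      assert (Cmod z <= eta) by nra. assert (Cmod z * Cmod z <= 1) by nra. simpl. nra.
    - apply Rmult_le_compat_l with (r := 1 + C0) in He4; [|lra].
      replace ((1 + C0) * / (8 * (1 + C0))) with (/ 8) in He4 by (field; lra). exact He4. }
  destruct (Hinv z rz ltac:(lra) Hrz8) as [Hz'n Hr1]. rewrite <- Ez' in Hz'n, Hr1.
  set (r1 := ((/ z' - / z * (1 - -1 * z + ((-1) ^ 2 - a) * z ^ 2)) / z ^ 2)%C).
  assert (Hr1B : Cmod r1 <= r1B).
  { unfold r1. rewrite Cmod_div, Cmod_pow by (apply Cpow_nz; exact Hzn).
    assert (0 < Cmod z ^ 2) by (apply pow_lt; exact Hz0).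
    apply Rmult_le_reg_r with (Cmod z ^ 2); [assumption|]. unfold Rdiv.
    rewrite Rmult_assoc, Rinv_l, Rmult_1_r by lra. eapply Rle_trans; [exact Hr1|].
    apply Rmult_le_compat_r; [lra|]. unfold r1B. apply Rmult_le_compat_l; lra. }
  (* The remainder is measured against [Z ^ 4] and not [z ^ 4], since [w = Z U] has the size of [Z],
     which exceeds that of [z] near the ends. *)
  set (r2 := ((w' - (w + w ^ 2 + b * z ^ 2 + b03 * w ^ 3 + b30 * z ^ 3)) / Z ^ 4)%C).
  assert (Hr2B : Cmod r2 <= r2B).
  { unfold r2. rewrite Cmod_div, Cmod_pow by exact HZ4.
    assert (HZ0 : 0 < Cmod Z) by (apply Cmod_gt_0; exact HZn).
    assert (0 < Cmod Z ^ 4) by (apply pow_lt; exact HZ0).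
    apply Rmult_le_reg_r with (Cmod Z ^ 4); [assumption|]. unfold Rdiv.
    rewrite Rmult_assoc, Rinv_l, Rmult_1_r by lra. eapply Rle_trans; [exact Hw'|].
    unfold r2B. rewrite Rmult_assoc, <- Rpow_mult_distr. apply Rmult_le_compat_l; [exact HC0|].
    apply pow_incr. pose proof (Cmod_ge_0 w). split; [lra|].
    assert (Cmod w <= Cmod Z * UB) by (rewrite Ew; cbd). lra. }
  set (V := (S * w' / z')%C).
  set (kappa := (h ^ 2 * (V - U) / c)%C).
  assert (HV : V = ((1 + Z * S + (1 - a) * (Z * S) ^ 2 + r1 * (Z * S) ^ 3)
      * (U + Z * U ^ 2 + b * Z * S ^ 2 + b03 * Z ^ 2 * U ^ 3 + b30 * Z ^ 2 * S ^ 3 + r2 * Z ^ 3))%C).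
  { rewrite <- Ez.
    replace (1 + z + (1 - a) * z ^ 2 + r1 * z ^ 3)%C with (z / z')%C
      by (unfold r1; field; auto).
    replace (U + Z * U ^ 2 + b * Z * S ^ 2 + b03 * Z ^ 2 * U ^ 3 + b30 * Z ^ 2 * S ^ 3 + r2 * Z ^ 3)%C
      with (w' / Z)%C.
    - unfold V. rewrite Ez. field; auto.
    - unfold r2. rewrite Ew, Ez. field; auto. }
  destruct (Hbd Z x S Co U U0 h (/ h)%C r1 r2 0%C) as (HK & _ & _); try lra; try assumption.
  { rewrite Cmod_0; lra. }
  set (K := step_K a b03 b30 b c Z S U h r1 r2) in *.
  assert (HbC : RtoC b = (c ^ 2 + 1 / 4)%C).
  { rewrite Hb, RtoC_plus, RtoC_div by lra. f_equal. simpl. rewrite !RtoC_mult. ring. }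
  assert (HSCC : (S ^ 2 + Co ^ 2)%C = 1).
  { rewrite <- HSC. rewrite RtoC_plus. simpl. rewrite !RtoC_mult. ring. }
  assert (Hhh : (h * / h)%C = 1) by (apply Cinv_r; exact Hhn).
  assert (HkK : kappa = (Z * (c * (1 + (x * S) ^ 2) + Z * K))%C).
  { apply (step_kappa a b03 b30 b c Z x S Co h (/ h) U r1 r2 V); auto. }
  assert (Hkap : Cmod kappa <= / 4).
  { rewrite HkK. apply Rle_trans with (eta * KB').
    - apply Cmul_le; [exact HZ|].
      assert (Hx1 : Cmod (x * S) <= 1) by (apply Rle_trans with (eta * 1); [cbd | lra]).
      assert (HZ1 : Cmod Z <= 1) by lra. clear HZ Hx.
      assert (Hone : Cmod 1 <= 1) by (rewrite Cmod_1; lra).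
      cbound. unfold KB'. lra.
    - apply Rmult_le_compat_r with (r := KB') in He3; [|lra].
      replace (/ (4 * KB') * KB') with (/ 4) in He3 by (field; lra). exact He3. }
  set (gi := (/ (1 - Co * kappa * / h))%C).
  assert (Hgl : / 2 <= Cmod (1 - Co * kappa * / h)).
  { assert (Hg : Cmod (Co * kappa * / h) <= 1 * / 4 * 2) by cbd.
    pose proof (Cone_minus_ge _ _ Hg). lra. }
  assert (Hgn : (1 - Co * kappa * / h)%C <> 0) by (apply (Cneq_0 _ (/ 2)); lra).
  assert (Hgi : Cmod gi <= 2).
  { unfold gi. replace 2 with (/ / 2) by field. apply Cinv_le; lra. }
  assert (Hgg : ((1 - Co * kappa * / h) * gi)%C = 1) by (apply Cinv_r; exact Hgn).
  assert (Hid := step_identity a b03 b30 b c Z x S Co h (/ h) U U0 r1 r2 kappa gi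
    Hcn Hhh eq_refl eq_refl eq_refl HSCC HkK Hgg).
  destruct (Hbd Z x S Co U U0 h (/ h)%C r1 r2 gi) as (_ & HE1 & HE2); try lra; try assumption.
  exists (S * (x + kappa * gi))%C. split.
  - unfold transit_rel.
    assert (HP : ((V + S / 2) * (1 + (x + kappa * gi) * Co) = c * ((x + kappa * gi) * S ^ 2 - Co))%C).
    { apply (step_rel c x S Co h (/ h) kappa gi); auto.
      unfold kappa, U. field; auto. }
    replace (w' + z' / 2)%C with ((V + S / 2) * z' / S)%C by (unfold V; field; auto).
    replace ((V + S / 2) * z' / S * (S + S * (x + kappa * gi) * Co))%C
      with (z' * ((V + S / 2) * (1 + (x + kappa * gi) * Co)))%C by (field; auto).
    rewrite HP. ring.
  - replace (S * (x + kappa * gi) - eps - (c * z + z ^ 2 * step_G a b03 b30 b c S Co))%C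
      with (S * (kappa * gi - (c * Z + Z ^ 2 * (quad_coef a b03 b30 b S U0 / c + c ^ 2 * Co))))%C.
    2: { unfold step_G. fold U0. rewrite Ee, Ez. field; auto. }
    rewrite Hid.
    assert (G3 : Cmod (Z * (x * S) ^ 2 * c) <= Cmod z / S * Cmod eps ^ 2 * c).
    { rewrite <- Ee, !Cmod_mult, Cmod_pow, HZm, (Cmod_R c), (Rabs_pos_eq c) by lra. lra. }
    assert (G4 : Cmod (Z ^ 2 * x) <= (Cmod z / S) ^ 2 * (Cmod eps / S)).
    { rewrite Cmod_mult, Cmod_pow, HZm, Hxm. lra. }
    assert (G5 : Cmod (Z ^ 3) <= (Cmod z / S) ^ 3) by (rewrite Cmod_pow, HZm; lra).
    eapply Rle_trans.
    { apply Cmul_le; [apply Req_le, HmS|]. apply Cadd_le; [apply Cadd_le|exact G3].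
      - apply Cmul_le; [exact G5 | exact HE1].
      - apply Cmul_le; [exact G4 | exact HE2]. }
    pose proof (Cmod_ge_0 eps).
    replace (S * ((Cmod z / S) ^ 3 * E1 + (Cmod z / S) ^ 2 * (Cmod eps / S) * E2
      + Cmod z / S * Cmod eps ^ 2 * c)) with
      (E1 * (Cmod z ^ 3 / S ^ 2) + E2 * (Cmod z ^ 2 * Cmod eps / S ^ 2) + c * (Cmod eps ^ 2 * Cmod z))
      by (field; lra).
    assert (P1 : 0 <= Cmod z ^ 3 / S ^ 2).
    { apply Rdiv_le_0_compat; [apply pow_le; lra | apply pow_lt; lra]. }
    assert (P2 : 0 <= Cmod z ^ 2 * Cmod eps / S ^ 2).
    { apply Rdiv_le_0_compat; [apply Rmult_le_pos; [apply pow_le; lra | lra] | apply pow_lt; lra]. }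
    assert (P3 : 0 <= Cmod eps ^ 2 * Cmod z) by (apply Rmult_le_pos; [apply pow_le; lra | lra]).
    nra.
Qed.

(** * Elementary real estimates on trigonometric functions, logarithm and exponential *)

Lemma taylor_order2 (g g1 g2 : R -> R) (x y M : R) :
  x <= y ->
  (forall t, x <= t <= y -> is_derive g t (g1 t)) ->
  (forall t, x <= t <= y -> is_derive g1 t (g2 t)) ->
  (forall t, x <= t <= y -> Rabs (g2 t) <= M) ->
  Rabs (g y - g x - g1 x * (y - x)) <= M * (y - x) ^ 2.
Proof.
  intros Hxy H1 H2 HM.
  assert (HM0 : 0 <= M) by (eapply Rle_trans; [apply Rabs_pos | apply (HM x); lra]).
  assert (Hct : forall h dh t, is_derive h t dh -> continuity_pt h t).
  { intros h dh t Hd. apply derivable_continuous_pt, ex_derive_Reals_0. exists dh. exact Hd. }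
  assert (Hg1 : forall t, x <= t <= y -> Rabs (g1 t - g1 x) <= M * (y - x)).
  { intros t Ht. destruct (MVT_gen g1 x t g2) as (u & Hu & Eu).
    - intros v Hv. rewrite Rmin_left, Rmax_right in Hv by lra. apply H2. lra.
    - intros v Hv. rewrite Rmin_left, Rmax_right in Hv by lra. eapply Hct, H2. lra.
    - rewrite Rmin_left, Rmax_right in Hu by lra. rewrite Eu, Rabs_mult.
      rewrite (Rabs_pos_eq (t - x)) by lra.
      apply Rmult_le_compat; [apply Rabs_pos | lra | apply HM; lra | lra]. }
  destruct (MVT_gen g x y g1) as (u & Hu & Eu).
  - intros v Hv. rewrite Rmin_left, Rmax_right in Hv by lra. apply H1. lra.
  - intros v Hv. rewrite Rmin_left, Rmax_right in Hv by lra. eapply Hct, H1. lra.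
  - rewrite Rmin_left, Rmax_right in Hu by lra. rewrite Eu.
    replace (g1 u * (y - x) - g1 x * (y - x)) with ((g1 u - g1 x) * (y - x)) by ring.
    rewrite Rabs_mult, (Rabs_pos_eq (y - x)) by lra.
    replace (M * (y - x) ^ 2) with (M * (y - x) * (y - x)) by ring.
    apply Rmult_le_compat_r; [lra | apply Hg1; lra].
Qed.

Lemma sin_lower (x : R) : 0 <= x <= 2 -> x / 4 <= sin x.
Proof.
  intros Hx. pose proof PI2_3_2 as HP.
  destruct (SIN x) as [H _]; try lra.
  eapply Rle_trans; [|exact H].
  unfold sin_lb, sin_approx. simpl. unfold sin_term. simpl. field_simplify.
  assert (H3 : x ^ 3 <= 4 * x) by (assert (x * x <= 4) by nra; simpl; nra).
  assert (0 <= x ^ 5) by (apply pow_le; lra).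
  assert (x ^ 7 <= x ^ 5 * 4).
  { replace (x ^ 7) with (x ^ 5 * (x * x)) by ring. apply Rmult_le_compat_l; nra. }
  lra.
Qed.

Lemma sin_lower_PI (x : R) : 0 <= x <= PI -> Rmin x (PI - x) / 4 <= sin x.
Proof.
  intros Hx. pose proof PI_4 as HP.
  destruct (Rle_dec x (PI / 2)).
  - rewrite Rmin_left by lra. apply sin_lower. lra.
  - rewrite Rmin_right by lra. rewrite <- sin_PI_x. apply sin_lower. lra.
Qed.

Lemma sin_near (x : R) : 0 <= x <= 1 -> x - x ^ 3 <= sin x <= x.
Proof.
  intros Hx. pose proof PI2_3_2 as HP. split.
  - destruct (SIN x) as [H _]; try lra.
    eapply Rle_trans; [|exact H].
    unfold sin_lb, sin_approx. simpl. unfold sin_term. simpl. field_simplify.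
    assert (0 <= x ^ 3) by (apply pow_le; lra). assert (0 <= x ^ 5) by (apply pow_le; lra).
    assert (x ^ 7 <= x ^ 5).
    { replace (x ^ 7) with (x ^ 5 * (x * x)) by ring. rewrite <- (Rmult_1_r (x ^ 5)) at 2.
      apply Rmult_le_compat_l; nra. }
    lra.
  - destruct (Rle_lt_or_eq_dec 0 x (proj1 Hx)) as [H | <-].
    + apply Rlt_le, sin_lt_x, H.
    + rewrite sin_0. lra.
Qed.

Lemma cos_near (x : R) : 1 - x ^ 2 <= cos x <= 1.
Proof.
  split; [|apply COS_bound].
  replace x with (2 * (x / 2)) at 2 by field. rewrite cos_2a_sin.
  assert (H : Rabs (sin (x / 2)) <= Rabs (x / 2)).
  { destruct (Rle_dec 0 (x / 2)) as [H|H].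
    - rewrite (Rabs_pos_eq (x / 2)) by exact H.
      destruct (Rle_lt_or_eq_dec _ _ H) as [H' | <-].
      + apply Rabs_le. split; [|apply Rlt_le, sin_lt_x, H'].
        destruct (Rle_dec (x / 2) 1).
        * destruct (sin_near (x / 2)) as [G _]; [lra|].
          assert (x / 2 * (x / 2) <= 1) by nra. simpl in G. nra.
        * pose proof (SIN_bound (x / 2)). lra.
      + rewrite sin_0, Rabs_R0. lra.
    - rewrite (Rabs_left1 (x / 2)) by lra. rewrite <- Rabs_Ropp, <- sin_neg.
      assert (H' : 0 < - (x / 2)) by lra.
      apply Rabs_le. split; [|apply Rlt_le, sin_lt_x, H'].
      destruct (Rle_dec (- (x / 2)) 1).
      + destruct (sin_near (- (x / 2))) as [G _]; [lra|].
        assert (x / 2 * (x / 2) <= 1) by nra. simpl in G. nra.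
      + pose proof (SIN_bound (- (x / 2))). lra. }
  apply Rsqr_le_abs_1 in H. unfold Rsqr in H. nra.
Qed.

Lemma tan_near (x : R) : 0 <= x <= / 2 -> Rabs (tan x - x) <= 2 * x ^ 3.
Proof.
  intros Hx. pose proof (sin_near x ltac:(lra)) as [S1 S2]. pose proof (cos_near x) as [C1 C2].
  assert (Hc : 3 / 4 <= cos x) by nra.
  unfold tan. apply Rabs_le. split.
  - apply Rle_trans with (sin x - x).
    + assert (0 <= x ^ 3) by (apply pow_le; lra). lra.
    + apply Rplus_le_compat_r. apply Rmult_le_reg_r with (cos x); [lra|].
      unfold Rdiv. rewrite Rmult_assoc, Rinv_l, Rmult_1_r by lra.
      assert (0 <= sin x) by (apply sin_ge_0; pose proof PI2_3_2; lra). nra.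
  - apply Rmult_le_reg_r with (cos x); [lra|].
    replace ((sin x / cos x - x) * cos x) with (sin x - x * cos x) by (field; lra).
    assert (x - x * cos x <= x ^ 3) by (simpl; nra).
    assert (0 <= x ^ 3) by (apply pow_le; lra). nra.
Qed.

Lemma ln_near (x : R) : Rabs x <= / 2 -> Rabs (ln (1 + x) - x) <= 2 * x ^ 2.
Proof.
  intros Hx. apply Rabs_le_between in Hx.
  assert (H1 : ln (1 + x) <= x).
  { pose proof (exp_ineq1_le (ln (1 + x))) as H. rewrite exp_ln in H by lra. lra. }
  assert (H2 : - ln (1 + x) <= / (1 + x) - 1).
  { rewrite <- ln_Rinv by lra.
    assert (0 < / (1 + x)) by (apply Rinv_0_lt_compat; lra).
    pose proof (exp_ineq1_le (ln (/ (1 + x)))) as G. rewrite exp_ln in G by lra. lra. }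
  assert (H3 : / (1 + x) - 1 <= - x + 2 * x ^ 2).
  { apply Rmult_le_reg_r with (1 + x); [lra|].
    replace ((/ (1 + x) - 1) * (1 + x)) with (- x) by (field; lra).
    assert (0 <= x ^ 2 * (1 + 2 * x)) by (apply Rmult_le_pos; [apply pow2_ge_0 | lra]). nra. }
  apply Rabs_le. pose proof (pow2_ge_0 x). lra.
Qed.

Lemma ln_near1 (x : R) : Rabs x <= / 2 -> Rabs (ln (1 + x)) <= 2 * Rabs x.
Proof.
  intros Hx. pose proof (ln_near x Hx) as H.
  assert (x ^ 2 <= Rabs x / 2).
  { rewrite <- pow2_abs. pose proof (Rabs_pos x). nra. }
  replace (ln (1 + x)) with ((ln (1 + x) - x) + x) by ring.
  eapply Rle_trans; [apply Rabs_triang|]. lra.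
Qed.

Lemma exp_near (x : R) : Rabs x <= / 2 -> Rabs (exp x - 1) <= 2 * Rabs x.
Proof.
  intros Hx. pose proof Hx as Hx'. apply Rabs_le_between in Hx'.
  pose proof (exp_ineq1_le x) as H1. pose proof (exp_ineq1_le (- x)) as H2.
  rewrite exp_Ropp in H2. pose proof (exp_pos x) as H3.
  assert (H4 : exp x <= / (1 - x)).
  { rewrite <- (Rinv_inv (exp x)). apply Rinv_le_contravar; lra. }
  assert (H5 : / (1 - x) - 1 <= 2 * Rabs x).
  { apply Rmult_le_reg_r with (1 - x); [lra|].
    replace ((/ (1 - x) - 1) * (1 - x)) with x by (field; lra).
    unfold Rabs. destruct (Rcase_abs x); nra. }
  apply Rabs_le. split; [|lra].
  pose proof (Rle_abs (- x)) as G. rewrite Rabs_Ropp in G. lra.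
Qed.

Lemma Rmult_le_1 (x t : R) : 0 <= x -> t <= 1 -> x * t <= x.
Proof. intros Hx Ht. rewrite <- (Rmult_1_r x) at 2. apply Rmult_le_compat_l; assumption. Qed.

(** [Clog (/ z)] is the approximate primitive of the term [c z] in the increments of [eps]. Since
    [/ z] increases by [1 + (1 - a) z + O(z ^ 2)], its logarithm increases by
    [z + (1 / 2 - a) z ^ 2]; the quadratic part is compensated elsewhere in the potential. *)
Lemma Clog_inv_step (a : C) (C0 : R) : 0 <= C0 ->
  exists M d, 0 < M /\ 0 < d /\ forall z z' : C,
  0 < Cmod z <= d -> Cmod (z' - (z - z ^ 2 + a * z ^ 3)) <= C0 * Cmod z ^ 4 ->
  0 < Re (/ z) -> 0 < Re (/ z') ->
  Cmod (Clog (/ z') - Clog (/ z) - z - (1 / 2 - a) * z ^ 2) <= M * Cmod z ^ 3 /\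
  Cmod (/ z' - / z - 1 - (1 - a) * z) <= M * Cmod z ^ 2.
Proof.
  intros HC0. destruct (inv_step (-1) a) as (M0 & d0 & HM0 & Hd0 & Hinv).
  set (M1 := M0 * (1 + C0)). assert (HM1 : 0 < M1) by (apply Rmult_lt_0_compat; lra).
  set (A1 := Cmod (1 - a)). assert (HA1 : 0 <= A1) by apply Cmod_ge_0.
  set (H1 := 1 + A1 + M1).
  exists (M1 + (A1 + M1) * (2 + A1 + M1) + 4 * H1 ^ 3), (Rmin d0 (Rmin (/ (2 * H1)) (/ (8 * (1 + C0))))).
  assert (HH1 : 1 < H1) by (unfold H1; lra).
  assert (Hi1 : 0 < / (2 * H1)) by (apply Rinv_0_lt_compat; lra).
  assert (Hi2 : 0 < / (8 * (1 + C0))) by (apply Rinv_0_lt_compat; lra).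
  assert (HM1' : M1 <= M1 + (A1 + M1) * (2 + A1 + M1) + 4 * H1 ^ 3).
  { assert (0 <= (A1 + M1) * (2 + A1 + M1)) by (apply Rmult_le_pos; lra).
    assert (0 <= H1 ^ 3) by (apply pow_le; lra). lra. }
  split; [lra|].
  split; [repeat apply Rmin_pos; assumption|].
  intros z z' [Hz0 Hz] Hz' HR HR'.
  set (u := / (2 * H1)) in *. set (v := / (8 * (1 + C0))) in *.
  assert (Hz1 : Cmod z <= d0) by (eapply Rle_trans; [exact Hz | apply Rmin_l]).
  assert (Hz2 : Cmod z <= u) by (eapply Rle_trans; [exact Hz |]; eapply Rle_trans; [apply Rmin_r | apply Rmin_l]).
  assert (Hz3 : Cmod z <= v) by (eapply Rle_trans; [exact Hz |]; eapply Rle_trans; [apply Rmin_r | apply Rmin_r]).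
  assert (Hu2 : u <= / 2) by (unfold u; apply Rinv_le_contravar; lra).
  assert (Hzn : z <> 0) by (apply Cmod_gt_0; exact Hz0).
  set (rz := ((z' - (z - z ^ 2 + a * z ^ 3)) / z ^ 4)%C).
  assert (Hz4 : (z ^ 4)%C <> 0) by (apply Cpow_nz; exact Hzn).
  assert (Hrz : Cmod rz <= C0).
  { unfold rz. rewrite Cmod_div, Cmod_pow by exact Hz4.
    assert (0 < Cmod z ^ 4) by (apply pow_lt; exact Hz0).
    apply Rmult_le_reg_r with (Cmod z ^ 4); [assumption|]. unfold Rdiv.
    rewrite Rmult_assoc, Rinv_l by lra. lra. }
  assert (Ez' : z' = (z + (-1) * z ^ 2 + a * z ^ 3 + rz * z ^ 4)%C) by (unfold rz; field; exact Hzn).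
  assert (Hrz8 : Cmod rz * Cmod z ^ 3 <= / 8).
  { apply Rle_trans with ((1 + C0) * v).
    - apply Rmult_le_compat; [apply Cmod_ge_0 | apply pow_le; lra | lra |].
      assert (Cmod z * Cmod z <= 1) by nra. simpl. nra.
    - unfold v. right. field. lra. }
  destruct (Hinv z rz ltac:(lra) Hrz8) as [Hz'n Hr1]. rewrite <- Ez' in Hz'n, Hr1.
  set (E := (/ z' - / z * (1 - -1 * z + ((-1) ^ 2 - a) * z ^ 2))%C) in *.
  assert (HE : Cmod E <= M1 * Cmod z ^ 2).
  { eapply Rle_trans; [exact Hr1|]. apply Rmult_le_compat_r; [apply pow_le; lra|].
    unfold M1. apply Rmult_le_compat_l; lra. }
  assert (HEe : (/ z' - / z - 1 - (1 - a) * z)%C = E) by (unfold E; field; auto).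
  split.
  2: { rewrite HEe. eapply Rle_trans; [exact HE|]. apply Rmult_le_compat_r; [apply pow_le; lra|]. lra. }
  set (h := (/ z' - / z)%C).
  assert (Hh : h = (1 + (1 - a) * z + E)%C) by (unfold h; rewrite <- HEe; ring).
  set (t := Cmod z) in *.
  assert (Ht1 : t <= 1) by lra.
  assert (Ht2 : t ^ 2 <= t) by (simpl; nra).
  assert (HhB : Cmod h <= H1).
  { rewrite Hh. assert (G1 : Cmod 1 <= 1) by (rewrite Cmod_1; lra).
    assert (G2 : Cmod (1 - a) <= A1) by (apply Rle_refl). clear Hz Hz1 Hz2 Hz3. cbound. fold t. unfold H1.
    pose proof (Rmult_le_1 A1 t HA1 Ht1). pose proof (Rmult_le_1 M1 (t ^ 2) ltac:(lra) ltac:(lra)). lra. }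
  assert (Hiz : Cmod (/ z) = / t) by (apply Cmod_inv; exact Hzn).
  assert (Hhz : Cmod h <= Cmod (/ z) / 2).
  { rewrite Hiz. eapply Rle_trans; [exact HhB|].
    apply Rmult_le_reg_r with t; [exact Hz0|].
    replace (/ t / 2 * t) with (H1 * u) by (unfold u; field; lra).
    apply Rmult_le_compat_l; lra. }
  pose proof (Clog_diff2 (/ z)%C h HR) as HC.
  replace (/ z + h)%C with (/ z')%C in HC by (unfold h; ring).
  specialize (HC HR' Hhz).
  set (D := (Clog (/ z') - Clog (/ z) - h / / z + (h / / z) ^ 2 / 2)%C) in *.
  assert (HD : Cmod D <= 4 * H1 ^ 3 * t ^ 3).
  { eapply Rle_trans; [exact HC|]. rewrite Hiz.
    replace (4 * (Cmod h ^ 3 / (/ t) ^ 3)) with (4 * Cmod h ^ 3 * t ^ 3) by (field; lra).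
    apply Rmult_le_compat_r; [apply pow_le; lra|]. apply Rmult_le_compat_l; [lra|].
    apply pow_incr. split; [apply Cmod_ge_0 | exact HhB]. }
  set (g := ((1 - a) * z + E)%C).
  assert (Hg : Cmod g <= (A1 + M1) * t).
  { unfold g. assert (G2 : Cmod (1 - a) <= A1) by (apply Rle_refl). clear Hz Hz1 Hz2 Hz3 Ht1. cbound. fold t. pose proof (Rmult_le_compat_l M1 _ _ ltac:(lra) Ht2). lra. }
  replace (Clog (/ z') - Clog (/ z) - z - (1 / 2 - a) * z ^ 2)%C
    with (D + E * z - z ^ 2 * g * (2 + g) / 2)%C.
  2: { unfold D. rewrite Hh. fold g. replace (1 + (1 - a) * z + E)%C with (1 + g)%C by (unfold g; ring).
       replace E with (g - (1 - a) * z)%C by (unfold g; ring). field. exact Hzn. }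
  assert (Hlast : Cmod (z ^ 2 * g * (2 + g) / 2) <= t ^ 2 * ((A1 + M1) * t) * (2 + (A1 + M1))).
  { unfold Cdiv.
    assert (G3 : Cmod (2 + g) <= 2 + (A1 + M1)).
    { eapply Rle_trans; [apply Cadd_le; [apply Rle_refl | exact Hg]|].
      rewrite Cmod_R, Rabs_pos_eq by lra. pose proof (Rmult_le_1 (A1 + M1) t ltac:(lra) ltac:(lra)). lra. }
    assert (G4 : Cmod (/ 2) <= 1).
    { replace 1 with (/ 1) by field. apply Cinv_le; [lra|]. rewrite Cmod_R, Rabs_pos_eq; lra. }
    eapply Rle_trans; [apply Cmul_le; [apply Cmul_le; [apply Cmul_le; [apply Cpow_le, Rle_refl|exact Hg]|exact G3]|exact G4]|].
    fold t. lra. }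
  eapply Rle_trans; [apply Csub_le; [apply Cadd_le; [exact HD | apply Cmul_le; [exact HE | apply Rle_refl]] | exact Hlast]|].
  fold t. lra.
Qed.

(** The subtraction formula for tangents: [eps1] is the tangent of the deviation from the old angle,
    and the deviation from an angle larger by [Delta] is smaller by [Delta]. *)
Lemma transit_rel_shift (c S Co Delta : R) (z w eps1 : C) :
  cos Delta <> 0 -> (1 + eps1 * tan Delta)%C <> 0 ->
  transit_rel c S Co z w eps1 ->
  transit_rel c (S * cos Delta + Co * sin Delta) (Co * cos Delta - S * sin Delta) z w
    ((eps1 - tan Delta) / (1 + eps1 * tan Delta))%C.
Proof.
  unfold transit_rel. intros Hc Ht H.
  set (t := tan Delta) in *. set (k := cos Delta) in *.
  replace (sin Delta) with (t * k) by (unfold t, tan, k; field; exact Hc).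
  rewrite RtoC_minus, RtoC_plus, !RtoC_mult.
  replace (S * k + Co * (t * k) + (eps1 - t) / (1 + eps1 * t) * (Co * k - S * (t * k)))%C
    with ((S + eps1 * Co) * (k * (1 + t * t) / (1 + eps1 * t)))%C by (field; exact Ht).
  rewrite Cmult_assoc, H. field. exact Ht.
Qed.

Section Transit_constants.

Local Open Scope C_scope.
Variables (a b03 b30 : C) (b c : R).

(** With [V = w / z], the quadratic coefficient at [S = 1] is the cubic
    [b03 V ^ 3 + V ^ 2 + (1 - a) V + b + b30]. Divided by [V ^ 2 + V + b], it has quotient
    [b03 V + 1 - b03] and remainder [rem1 V + rem0]. *)
Definition rem1 : C := (1 - a) - b03 * b - (1 - b03).
Definition rem0 : C := b30 + b * b03.
(** The corrector is [u = (lin0 + lin1 V) / (V ^ 2 + V + b)], the numerator being chosen so that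
    [c u' - u] along the Riccati flow equals [(rem1 V + rem0) / (V ^ 2 + V + b) - lin1]. As
    [V = - c cot theta - 1 / 2] gives [V ^ 2 + V + b = c ^ 2 / sin ^ 2], the corrector is
    [trig1 sin ^ 2 + trig2 sin cos]. *)
Definition lin0 : C := - rem1 / 2.
Definition lin1 : C := (rem0 - rem1) / (2 * b).
Definition trig1 : C := (lin0 - lin1 / 2) / c ^ 2.
Definition trig2 : C := - lin1 / c.
Definition cst1 : C := (a - b03 + b30) / (2 * b) + a + 1 / 2 * (1 - b03).

(** Each of the three summands has a discrete primitive: [u / n] increases by about
    [(c u' - u) / n ^ 2], a constant is absorbed by [1 / n], and the cotangent by
    [ln (sin theta) / n] completed with [Phi / m]. The constant is written [cst1 + 1 / 2 - a]
    because its part [1 / 2 - a] already comes from [Clog (/ z)]. *)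
Lemma step_G_eq (S Co : R) :
  (0 < c)%R -> b = (c ^ 2 + 1 / 4)%R -> S <> 0%R -> (S ^ 2 + Co ^ 2 = 1)%R ->
  step_G a b03 b30 b c S Co =
    c * ((1 - b03) * (c * Co / S)%R + (cst1 + 1 / 2 - a)
      + (c * (trig1 * (2 * S * Co)%R + trig2 * (Co ^ 2 - S ^ 2)%R)
         - (trig1 * (S ^ 2)%R + trig2 * (S * Co)%R))).
Proof.
  intros Hc Hb HS HSC.
  assert (Hcn : RtoC c <> 0) by (intros E; apply RtoC_inj in E; lra).
  assert (HSn : RtoC S <> 0) by (intros E; apply RtoC_inj in E; lra).
  assert (Hbn : RtoC b <> 0) by (intros E; apply RtoC_inj in E; nra).
  assert (HbC : RtoC b = c ^ 2 + 1 / 4).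
  { rewrite Hb, RtoC_plus, RtoC_div by lra. f_equal. simpl. rewrite !RtoC_mult. ring. }
  assert (HSCC : S ^ 2 + Co ^ 2 = 1).
  { rewrite <- HSC. rewrite RtoC_plus. simpl. rewrite !RtoC_mult. ring. }
  assert (E1 : step_G a b03 b30 b c S Co =
    (quad_coef a b03 b30 b S (- (c * Co) - S / 2) / c + c ^ 2 * Co * (S ^ 2 + Co ^ 2)) / S).
  { rewrite HSCC. unfold step_G. field; auto. }
  rewrite E1.
  assert (E2 : c * ((1 - b03) * (c * Co / S)%R + (cst1 + 1 / 2 - a)
      + (c * (trig1 * (2 * S * Co)%R + trig2 * (Co ^ 2 - S ^ 2)%R)
         - (trig1 * (S ^ 2)%R + trig2 * (S * Co)%R)))
    = c * ((1 - b03) * c * Co * (S ^ 2 + Co ^ 2) + (cst1 + 1 / 2 - a) * S * (S ^ 2 + Co ^ 2)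
      + S * (c * (trig1 * (2 * S * Co) + trig2 * (Co ^ 2 - S ^ 2))
         - (trig1 * S ^ 2 + trig2 * (S * Co)))) / S).
  { rewrite HSCC. rewrite RtoC_div by exact HS. simpl pow. rewrite RtoC_minus, !RtoC_mult.
    field; auto. }
  rewrite E2. unfold trig1, trig2, cst1, lin1, lin0, rem1, rem0, quad_coef.
  rewrite HbC in *. field.
  repeat split; auto.
  replace (c ^ 2 * 4 + 1) with (RtoC (4 * b)).
  - intros E. apply RtoC_inj in E. nra.
  - rewrite RtoC_mult, HbC. field.
Qed.

End Transit_constants.

Lemma is_derive_n_ln_sin (x : R) : 0 < sin x -> is_derive (fun t => ln (sin t)) x (cos x / sin x).
Proof. intros H. auto_derive; [exact H|]. field. lra. Qed.

(** The hypotheses describe the size of one step: [n] is the index, [m] the first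
    index, [rho] the distance of [n] to the ends of the transit, [lam = ln m]. *)
Section Telescoping.

Variables (c K m n lam rho th th' : R).
Hypotheses (Hc : 0 < c) (HK : 1 <= K) (Hm : 1 <= m) (Hmn : m <= n) (Hlam : 1 <= lam)
  (Hrho : 1 <= rho <= K * m) (Hth : th <= th') (HthK : th' - th <= K / m)
  (HthD : Rabs (th' - th - c / n) <= K * lam / m ^ 2).

(** In one step [theta] gains about [c / n] and [1 / n] loses about [1 / n ^ 2], so [u (theta) / n]
    changes by [(c u' - u) / n ^ 2]. The error [ln m / m ^ 3] remains negligible against [1 / m]
    after [O(m)] steps. *)
Lemma telescope_bounded (u u1 u2 : R -> R) :
  (forall t, is_derive u t (u1 t)) -> (forall t, is_derive u1 t (u2 t)) ->
  (forall t, Rabs (u t) <= 1 /\ Rabs (u1 t) <= 2 /\ Rabs (u2 t) <= 4) ->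
  Rabs (u th' / (n + 1) - u th / n - (c * u1 th - u th) / n ^ 2)
    <= (4 * K ^ 2 + 2 * (K + c) + 1) * (lam / m ^ 3).
Proof.
  intros H1 H2 Hb.
  set (D := th' - th) in *. assert (HD : 0 <= D) by (unfold D; lra).
  assert (Hn : 0 < / n <= / m).
  { split; [apply Rinv_0_lt_compat; lra | apply Rinv_le_contravar; lra]. }
  assert (Hn1 : 0 < / (n + 1) <= / m).
  { split; [apply Rinv_0_lt_compat; lra | apply Rinv_le_contravar; lra]. }
  assert (Hmi : 0 < / m <= 1).
  { split; [lra|]. rewrite <- Rinv_1. apply Rinv_le_contravar; lra. }
  pose proof (taylor_order2 u u1 u2 th th' 4 Hth (fun t _ => H1 t) (fun t _ => H2 t)
    (fun t _ => proj2 (proj2 (Hb t)))) as HT.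
  fold D in HT. destruct (Hb th) as (B0 & B1 & _).
  assert (HD2 : D ^ 2 <= K ^ 2 * (/ m) ^ 2).
  { rewrite <- Rpow_mult_distr. apply pow_incr. unfold Rdiv in HthK. lra. }
  set (i := / m) in *.
  assert (Hi2 : 0 < i ^ 2 <= 1) by (split; [apply pow_lt; lra | simpl; nra]).
  assert (Hi3 : 0 < i ^ 3) by (apply pow_lt; lra).
  assert (E : u th' / (n + 1) - u th / n - (c * u1 th - u th) / n ^ 2 =
    (u th' - u th - u1 th * D) * / (n + 1) + u1 th * ((D - c / n) * / (n + 1) - c * (/ n * / n * / (n + 1)))
    + u th * (/ n * / n * / (n + 1))).
  { field. lra. }
  rewrite E.
  replace (K * lam / m ^ 2) with (K * lam * i ^ 2) in HthD by (unfold i; field; lra).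
  replace (lam / m ^ 3) with (lam * i ^ 3) by (unfold i; field; lra).
  assert (Hnn : 0 <= / n * / n * / (n + 1) <= i ^ 3).
  { split; [repeat apply Rmult_le_pos; lra|]. replace (i ^ 3) with (i * i * i) by ring.
    apply Rmult_le_compat; [apply Rmult_le_pos; lra | lra | | lra]. apply Rmult_le_compat; lra. }
  assert (Hli : i ^ 3 <= lam * i ^ 3) by nra.
  assert (P1 : Rabs ((u th' - u th - u1 th * D) * / (n + 1)) <= 4 * K ^ 2 * (lam * i ^ 3)).
  { rewrite Rabs_mult, (Rabs_pos_eq (/ (n + 1))) by lra.
    apply Rle_trans with (4 * (K ^ 2 * i ^ 2) * i).
    - apply Rmult_le_compat; [apply Rabs_pos | lra | lra | lra].
    - replace (4 * (K ^ 2 * i ^ 2) * i) with (4 * K ^ 2 * i ^ 3) by ring.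
      apply Rmult_le_compat_l; [|exact Hli]. pose proof (pow2_ge_0 K). lra. }
  assert (P2 : Rabs (u1 th * ((D - c / n) * / (n + 1) - c * (/ n * / n * / (n + 1)))) <=
    2 * ((K + c) * (lam * i ^ 3))).
  { rewrite Rabs_mult. apply Rmult_le_compat; [apply Rabs_pos | apply Rabs_pos | lra |].
    unfold Rminus at 1. eapply Rle_trans; [apply Rabs_triang|]. rewrite Rabs_Ropp.
    rewrite Rabs_mult, (Rabs_pos_eq (/ (n + 1))) by lra.
    rewrite (Rabs_pos_eq (c * _)) by (apply Rmult_le_pos; lra).
    rewrite Rmult_plus_distr_r. apply Rplus_le_compat.
    - replace (K * (lam * i ^ 3)) with (K * lam * i ^ 2 * i) by ring.
      apply Rmult_le_compat; [apply Rabs_pos | lra | exact HthD | lra].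
    - apply Rmult_le_compat_l; lra. }
  assert (P3 : Rabs (u th * (/ n * / n * / (n + 1))) <= 1 * (lam * i ^ 3)).
  { rewrite Rabs_mult. apply Rmult_le_compat; [apply Rabs_pos | apply Rabs_pos | exact B0 |].
    rewrite Rabs_pos_eq; lra. }
  eapply Rle_trans; [apply Rabs_triang|].
  eapply Rle_trans; [apply Rplus_le_compat_r, Rabs_triang|]. lra.
Qed.

Hypotheses (Hsin : forall x, th <= x <= th' -> rho / (K * m) <= sin x)
  (Hlnsin : forall x, th <= x <= th' -> Rabs (ln (sin x)) <= K * lam).

(** The error allowed per step. Summed over the transit from distance [L] of the ends, it gives at
    most a multiple of [lam / (m L) + lam ^ 2 / m ^ 2], which is [o(1 / m)]. *)
Let err := lam / (m * rho ^ 2) + lam ^ 2 / m ^ 3.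

Lemma err_bounds :
  0 < / rho /\ 0 < / m <= 1 /\
  0 <= lam * (/ m * (/ rho) ^ 2) <= err /\ 0 <= lam ^ 2 * (/ m) ^ 3 <= err /\
  lam * ((/ m) ^ 2 * / rho) <= K * (lam * (/ m * (/ rho) ^ 2)) /\
  err = lam * (/ m * (/ rho) ^ 2) + lam ^ 2 * (/ m) ^ 3.
Proof.
  assert (Hr : 0 < / rho) by (apply Rinv_0_lt_compat; lra).
  assert (Hmi : 0 < / m <= 1).
  { split; [apply Rinv_0_lt_compat; lra|]. rewrite <- Rinv_1. apply Rinv_le_contravar; lra. }
  assert (E : err = lam * (/ m * (/ rho) ^ 2) + lam ^ 2 * (/ m) ^ 3) by (unfold err; field; lra).
  assert (P1 : 0 <= lam * (/ m * (/ rho) ^ 2)).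
  { apply Rmult_le_pos; [lra|]. apply Rmult_le_pos; [lra | apply pow2_ge_0]. }
  assert (P2 : 0 <= lam ^ 2 * (/ m) ^ 3).
  { apply Rmult_le_pos; [apply pow2_ge_0 | apply pow_le; lra]. }
  assert (P3 : / m <= K * / rho).
  { apply Rmult_le_reg_r with (m * rho); [nra|].
    replace (/ m * (m * rho)) with rho by (field; lra).
    replace (K * / rho * (m * rho)) with (K * m) by (field; lra). lra. }
  repeat split; try lra.
  replace (K * (lam * (/ m * (/ rho) ^ 2))) with (lam * (/ m * / rho) * (K * / rho)) by ring.
  replace (lam * ((/ m) ^ 2 * / rho)) with (lam * (/ m * / rho) * / m) by ring.
  apply Rmult_le_compat_l; [|exact P3]. repeat apply Rmult_le_pos; lra.
Qed.

Lemma inv_sin_bound x : th <= x <= th' -> 0 < sin x /\ 0 < / sin x <= K * m * / rho.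
Proof.
  intros Hx. pose proof (Hsin x Hx) as H.
  assert (H0 : 0 < rho / (K * m)) by (apply Rdiv_lt_0_compat; nra).
  assert (0 < sin x) by lra. split; [assumption|].
  split; [apply Rinv_0_lt_compat; assumption|].
  replace (K * m * / rho) with (/ (rho / (K * m))) by (field; lra).
  apply Rinv_le_contravar; assumption.
Qed.

(** The same computation for the unbounded [u = ln sin], of derivative [cot]: the second derivative
    [- 1 / sin ^ 2] is of order [(m / rho) ^ 2], which produces the singular part of [err]. Unlike
    for the bounded functions, the term [- ln (sin theta) / n ^ 2] is unwanted here. *)
Lemma telescope_ln_sin :
  Rabs (ln (sin th') / (n + 1) - ln (sin th) / n - (c * (cos th / sin th) - ln (sin th)) / n ^ 2)
    <= (K ^ 4 + K * (K + c) * K + K) * err.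
Proof.
  destruct err_bounds as (Hr & Hmi & E1 & E2 & E3 & Eerr).
  set (D := th' - th) in *. assert (HD : 0 <= D) by (unfold D; lra).
  assert (Hn : 0 < / n <= / m).
  { split; [apply Rinv_0_lt_compat; lra | apply Rinv_le_contravar; lra]. }
  assert (Hn1 : 0 < / (n + 1) <= / m).
  { split; [apply Rinv_0_lt_compat; lra | apply Rinv_le_contravar; lra]. }
  assert (HT : Rabs (ln (sin th') - ln (sin th) - cos th / sin th * D) <= (K * m * / rho) ^ 2 * D ^ 2).
  { apply (taylor_order2 (fun x => ln (sin x)) (fun x => cos x / sin x) (fun x => - (/ sin x) ^ 2)); [exact Hth | | |].
    - intros t Ht. apply is_derive_n_ln_sin, inv_sin_bound, Ht.
    - intros t Ht. destruct (inv_sin_bound t Ht) as [P _]. auto_derive; [lra|].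
      pose proof (sin2_cos2 t) as Q. unfold Rsqr in Q.
      replace ((/ sin t) ^ 2) with ((sin t * sin t + cos t * cos t) * (/ sin t) ^ 2)
        by (rewrite Q; ring). field. lra.
    - intros t Ht. destruct (inv_sin_bound t Ht) as [_ P]. rewrite Rabs_Ropp, Rabs_pos_eq by apply pow2_ge_0.
      apply pow_incr. lra. }
  destruct (inv_sin_bound th ltac:(lra)) as [Hs0 Hsi].
  assert (Hcot : Rabs (cos th / sin th) <= K * m * / rho).
  { unfold Rdiv. rewrite Rabs_mult, (Rabs_pos_eq (/ sin th)) by lra.
    pose proof (COS_bound th). rewrite <- (Rmult_1_l (K * m * / rho)).
    apply Rmult_le_compat; [apply Rabs_pos | lra | apply Rabs_le; lra | lra]. }
  assert (E : ln (sin th') / (n + 1) - ln (sin th) / n - (c * (cos th / sin th) - ln (sin th)) / n ^ 2 =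
    (ln (sin th') - ln (sin th) - cos th / sin th * D) * / (n + 1)
    + cos th / sin th * ((D - c / n) * / (n + 1) - c * (/ n * / n * / (n + 1)))
    + ln (sin th) * (/ n * / n * / (n + 1))).
  { field. lra. }
  rewrite E.
  assert (HD2 : D ^ 2 <= K ^ 2 * (/ m) ^ 2).
  { rewrite <- Rpow_mult_distr. apply pow_incr. unfold Rdiv in HthK. lra. }
  replace (K * lam / m ^ 2) with (K * lam * (/ m) ^ 2) in HthD by (field; lra).
  set (i := / m) in *. set (j := / rho) in *.
  assert (Hi2 : 0 < i ^ 2 <= 1) by (split; [apply pow_lt; lra | simpl; nra]).
  assert (Hi3 : 0 < i ^ 3) by (apply pow_lt; lra).
  assert (Hnn : 0 <= / n * / n * / (n + 1) <= i ^ 3).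
  { split; [repeat apply Rmult_le_pos; lra|]. replace (i ^ 3) with (i * i * i) by ring.
    apply Rmult_le_compat; [apply Rmult_le_pos; lra | lra | | lra]. apply Rmult_le_compat; lra. }
  assert (Hli : i ^ 3 <= lam * i ^ 3) by nra.
  assert (Hmi1 : m * i = 1) by (unfold i; field; lra).
  assert (P1 : Rabs ((ln (sin th') - ln (sin th) - cos th / sin th * D) * / (n + 1))
    <= K ^ 4 * (lam * (i * j ^ 2))).
  { rewrite Rabs_mult, (Rabs_pos_eq (/ (n + 1))) by lra.
    apply Rle_trans with ((K * m * j) ^ 2 * (K ^ 2 * i ^ 2) * i).
    - apply Rmult_le_compat; [apply Rabs_pos | lra | | lra].
      eapply Rle_trans; [exact HT|]. apply Rmult_le_compat_l; [apply pow2_ge_0 | exact HD2].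
    - replace ((K * m * j) ^ 2 * (K ^ 2 * i ^ 2) * i) with (K ^ 4 * ((m * i) ^ 2 * (i * j ^ 2))) by ring.
      rewrite Hmi1. apply Rmult_le_compat_l; [apply pow_le; lra|].
      assert (0 <= i * j ^ 2) by (apply Rmult_le_pos; [lra | apply pow2_ge_0]). nra. }
  assert (P2 : Rabs (cos th / sin th * ((D - c / n) * / (n + 1) - c * (/ n * / n * / (n + 1)))) <=
    K * (K + c) * K * (lam * (i * j ^ 2))).
  { apply Rle_trans with (K * m * j * ((K + c) * (lam * i ^ 3))).
    - rewrite Rabs_mult. apply Rmult_le_compat; [apply Rabs_pos | apply Rabs_pos | exact Hcot |].
      unfold Rminus at 1. eapply Rle_trans; [apply Rabs_triang|]. rewrite Rabs_Ropp.
      rewrite Rabs_mult, (Rabs_pos_eq (/ (n + 1))) by lra.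
      rewrite (Rabs_pos_eq (c * _)) by (apply Rmult_le_pos; lra).
      rewrite Rmult_plus_distr_r. apply Rplus_le_compat.
      + replace (K * (lam * i ^ 3)) with (K * lam * i ^ 2 * i) by ring.
        apply Rmult_le_compat; [apply Rabs_pos | lra | exact HthD | lra].
      + apply Rmult_le_compat_l; lra.
    - replace (K * m * j * ((K + c) * (lam * i ^ 3))) with
        (K * (K + c) * (lam * (i ^ 2 * j)) * (m * i)) by ring.
      rewrite Hmi1, Rmult_1_r, Rmult_assoc with (r2 := K).
      apply Rmult_le_compat_l; [apply Rmult_le_pos; lra | exact E3]. }
  assert (P3 : Rabs (ln (sin th) * (/ n * / n * / (n + 1))) <= K * (lam ^ 2 * i ^ 3)).
  { rewrite Rabs_mult. apply Rle_trans with (K * lam * i ^ 3).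
    - apply Rmult_le_compat; [apply Rabs_pos | apply Rabs_pos | apply Hlnsin; lra |].
      rewrite Rabs_pos_eq; lra.
    - rewrite Rmult_assoc. apply Rmult_le_compat_l; [lra|]. apply Rmult_le_compat_r; [lra|]. simpl; nra. }
  eapply Rle_trans; [apply Rabs_triang|].
  eapply Rle_trans; [apply Rplus_le_compat_r, Rabs_triang|].
  assert (G1 : K ^ 4 * (lam * (i * j ^ 2)) <= K ^ 4 * err) by (apply Rmult_le_compat_l; [apply pow_le; lra | lra]).
  assert (G2 : K * (K + c) * K * (lam * (i * j ^ 2)) <= K * (K + c) * K * err).
  { apply Rmult_le_compat_l; [|lra]. repeat apply Rmult_le_pos; lra. }
  assert (G3 : K * (lam ^ 2 * i ^ 3) <= K * err) by (apply Rmult_le_compat_l; lra).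
  lra.
Qed.

(** [Phi] is made to compensate the unwanted [ln (sin theta) / n ^ 2]: as [exp (- theta / c)] is
    close to [m / n] and the step in [theta] to [c / n], the increment of [Phi / m] is close to
    [(m / n) (ln (sin theta) / c) (c / n) / m]. *)
Lemma telescope_integral (Phi : R -> R) :
  (forall x, 0 < sin x -> th <= x <= th' -> is_derive Phi x (exp (- (x / c)) * ln (sin x) / c)) ->
  0 <= th ->
  Rabs (exp (- (th / c)) - m / n) <= K * lam / m ->
  Rabs ((Phi th' - Phi th) / m - ln (sin th) / n ^ 2)
    <= (K ^ 3 / c ^ 2 + K ^ 4 / c + 2 * K ^ 3 / c) * err.
Proof.
  intros HPhi Hth0 Hexp.
  destruct err_bounds as (Hr & Hmi & E1 & E2 & E3 & Eerr).
  set (D := th' - th) in *. assert (HD : 0 <= D) by (unfold D; lra).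
  assert (Hn : 0 < / n <= / m).
  { split; [apply Rinv_0_lt_compat; lra | apply Rinv_le_contravar; lra]. }
  assert (Hci : 0 < / c) by (apply Rinv_0_lt_compat; lra).
  assert (He1 : forall x, th <= x -> 0 < exp (- (x / c)) <= 1).
  { intros x Hx. split; [apply exp_pos|]. rewrite <- exp_0.
    destruct (Rle_lt_or_eq_dec (- (x / c)) 0) as [H|H].
    - assert (0 <= x / c) by (apply Rdiv_le_0_compat; lra). lra.
    - apply Rlt_le, exp_increasing, H.
    - rewrite H. lra. }
  assert (HT : Rabs (Phi th' - Phi th - exp (- (th / c)) * ln (sin th) / c * D)
    <= (K * m * / rho * / c + K * lam * (/ c) ^ 2) * D ^ 2).
  { apply (taylor_order2 Phi (fun x => exp (- (x / c)) * ln (sin x) / c)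
      (fun x => exp (- (x / c)) * (cos x / sin x * / c - ln (sin x) * (/ c) ^ 2))); [exact Hth | | |].
    - intros t Ht. apply HPhi; [apply inv_sin_bound|]; exact Ht.
    - intros t Ht. destruct (inv_sin_bound t Ht) as [P _]. auto_derive; [lra|].
      unfold Rdiv. field. lra.
    - intros t Ht. destruct (inv_sin_bound t Ht) as [_ P].
      rewrite Rabs_mult, (Rabs_pos_eq (exp _)) by (apply Rlt_le, exp_pos).
      rewrite <- (Rmult_1_l (_ + _)).
      destruct (He1 t ltac:(lra)) as [G1 G2].
      apply Rmult_le_compat; [lra | apply Rabs_pos | lra |].
      unfold Rminus. eapply Rle_trans; [apply Rabs_triang|]. rewrite Rabs_Ropp.
      apply Rplus_le_compat.
      + rewrite Rabs_mult, (Rabs_pos_eq (/ c)) by lra. apply Rmult_le_compat_r; [lra|].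
        unfold Rdiv. rewrite Rabs_mult, (Rabs_pos_eq (/ sin t)) by lra.
        pose proof (COS_bound t). rewrite <- (Rmult_1_l (K * m * / rho)).
        apply Rmult_le_compat; [apply Rabs_pos | lra | apply Rabs_le; lra | lra].
      + rewrite Rabs_mult, (Rabs_pos_eq ((/ c) ^ 2)) by apply pow2_ge_0.
        apply Rmult_le_compat_r; [apply pow2_ge_0 | apply Hlnsin, Ht]. }
  assert (E : (Phi th' - Phi th) / m - ln (sin th) / n ^ 2 =
    (Phi th' - Phi th - exp (- (th / c)) * ln (sin th) / c * D) * / m
    + ln (sin th) * ((exp (- (th / c)) - m / n) * D * / m * / c + (D - c / n) * / n * / c)).
  { field. lra. }
  rewrite E.
  assert (HD2 : D ^ 2 <= K ^ 2 * (/ m) ^ 2).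
  { rewrite <- Rpow_mult_distr. apply pow_incr. unfold Rdiv in HthK. lra. }
  replace (K * lam / m ^ 2) with (K * lam * (/ m) ^ 2) in HthD by (field; lra).
  unfold Rdiv in HthK, Hexp at 2. fold (m / n) in Hexp.
  set (e := exp (- (th / c)) - m / n) in *.
  set (i := / m) in *. set (j := / rho) in *.
  assert (Hi2 : 0 < i ^ 2 <= 1) by (split; [apply pow_lt; lra | simpl; nra]).
  assert (Hi3 : 0 < i ^ 3) by (apply pow_lt; lra).
  assert (Hmi1 : m * i = 1) by (unfold i; field; lra).
  assert (P1 : Rabs ((Phi th' - Phi th - exp (- (th / c)) * ln (sin th) / c * D) * i)
    <= K ^ 4 / c * (lam * (i * j ^ 2)) + K ^ 3 / c ^ 2 * (lam ^ 2 * i ^ 3)).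
  { rewrite Rabs_mult, (Rabs_pos_eq i) by lra.
    apply Rle_trans with ((K * m * j * / c + K * lam * (/ c) ^ 2) * (K ^ 2 * i ^ 2) * i).
    - apply Rmult_le_compat_r; [lra|]. eapply Rle_trans; [exact HT|].
      apply Rmult_le_compat_l; [|exact HD2].
      assert (0 <= K * m * j * / c) by (repeat apply Rmult_le_pos; lra).
      assert (0 <= K * lam * (/ c) ^ 2) by (repeat apply Rmult_le_pos; lra). lra.
    - replace ((K * m * j * / c + K * lam * (/ c) ^ 2) * (K ^ 2 * i ^ 2) * i) with
        (K ^ 3 / c * (i ^ 2 * j) * (m * i) + K ^ 3 / c ^ 2 * (lam * i ^ 3)) by (field; lra).
      rewrite Hmi1, Rmult_1_r. apply Rplus_le_compat.
      + replace (K ^ 4 / c * (lam * (i * j ^ 2))) with (K ^ 3 / c * (K * (lam * (i * j ^ 2))))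
          by (unfold Rdiv; ring).
        apply Rmult_le_compat_l; [apply Rdiv_le_0_compat; [apply pow_le; lra|lra]|].
        assert (0 <= i ^ 2 * j) by (apply Rmult_le_pos; lra). nra.
      + apply Rmult_le_compat_l; [apply Rdiv_le_0_compat; [apply pow_le; lra|apply pow_lt; lra]|].
        apply Rmult_le_compat_r; [lra|]. simpl; nra. }
  assert (P2 : Rabs (ln (sin th) * (e * D * i * / c + (D - c / n) * / n * / c))
    <= 2 * K ^ 3 / c * (lam ^ 2 * i ^ 3)).
  { apply Rle_trans with (K * lam * ((K * lam * i) * (K * i) * i * / c + (K * lam * i ^ 2) * i * / c)).
    - rewrite Rabs_mult. apply Rmult_le_compat; [apply Rabs_pos | apply Rabs_pos | apply Hlnsin; lra |].
      eapply Rle_trans; [apply Rabs_triang|]. apply Rplus_le_compat.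
      + rewrite !Rabs_mult, (Rabs_pos_eq D), (Rabs_pos_eq i), (Rabs_pos_eq (/ c)) by lra.
        apply Rmult_le_compat_r; [lra|]. apply Rmult_le_compat_r; [lra|].
        apply Rmult_le_compat; [apply Rabs_pos | lra | exact Hexp | exact HthK].
      + rewrite !Rabs_mult, (Rabs_pos_eq (/ n)), (Rabs_pos_eq (/ c)) by lra.
        apply Rmult_le_compat_r; [lra|]. apply Rmult_le_compat; [apply Rabs_pos | lra | exact HthD | lra].
    - replace (K * lam * ((K * lam * i) * (K * i) * i * / c + (K * lam * i ^ 2) * i * / c)) with
        ((K ^ 3 + K ^ 2) * / c * (lam ^ 2 * i ^ 3)) by ring.
      apply Rmult_le_compat_r; [lra|]. unfold Rdiv. apply Rmult_le_compat_r; [lra|]. simpl. nra. }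
  eapply Rle_trans; [apply Rabs_triang|].
  assert (G1 : K ^ 4 / c * (lam * (i * j ^ 2)) <= K ^ 4 / c * err).
  { apply Rmult_le_compat_l; [|lra]. apply Rdiv_le_0_compat; [apply pow_le; lra | lra]. }
  assert (G2 : K ^ 3 / c ^ 2 * (lam ^ 2 * i ^ 3) <= K ^ 3 / c ^ 2 * err).
  { apply Rmult_le_compat_l; [|lra]. apply Rdiv_le_0_compat; [apply pow_le; lra | apply pow_lt; lra]. }
  assert (G3 : 2 * K ^ 3 / c * (lam ^ 2 * i ^ 3) <= 2 * K ^ 3 / c * err).
  { apply Rmult_le_compat_l; [|lra]. apply Rdiv_le_0_compat; [|lra].
    assert (0 <= K ^ 3) by (apply pow_le; lra). lra. }
  lra.
Qed.

End Telescoping.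

(** * The improper integral of [Gamma] as a difference of boundary values *)

Lemma is_derive_continuity (g : R -> R) (dg t : R) : is_derive g t dg -> continuity_pt g t.
Proof. intros Hd. apply derivable_continuous_pt, ex_derive_Reals_0. exists dg. exact Hd. Qed.

Lemma monotone_of_derive (g g1 : R -> R) (x y : R) :
  x <= y -> (forall t, x <= t <= y -> is_derive g t (g1 t)) ->
  (forall t, x <= t <= y -> 0 <= g1 t) -> g x <= g y.
Proof.
  intros Hxy Hd Hp. destruct (MVT_gen g x y g1) as (u & Hu & Eu).
  - intros v Hv. rewrite Rmin_left, Rmax_right in Hv by lra. apply Hd. lra.
  - intros v Hv. rewrite Rmin_left, Rmax_right in Hv by lra. eapply is_derive_continuity, Hd. lra.
  - rewrite Rmin_left, Rmax_right in Hu by lra.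
    assert (0 <= g1 u * (y - x)) by (apply Rmult_le_pos; [apply Hp; lra | lra]). lra.
Qed.

(** The derivative is nonpositive, so [g] increases as [t] decreases to [0]; comparison with a
    primitive of the lower bound keeps it bounded above, and the limit is its supremum. *)
Lemma limit_log_singularity (g g1 : R -> R) (d C : R) :
  0 < d <= 4 -> 0 <= C ->
  (forall t, 0 < t <= d -> is_derive g t (g1 t)) ->
  (forall t, 0 < t <= d -> C * ln (t / 4) <= g1 t <= 0) ->
  exists l, (forall t, 0 < t <= d -> g t <= l) /\
    forall eps, 0 < eps -> exists d', 0 < d' /\ forall t, 0 < t < d' -> Rabs (g t - l) < eps.
Proof.
  intros Hd HC Hg Hb.
  assert (Hdec : forall x y, 0 < x <= y -> y <= d -> g y <= g x).
  { intros x y Hx Hy. apply Ropp_le_cancel.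
    apply (monotone_of_derive (fun t => - g t) (fun t => - g1 t)); [lra | |].
    - intros t Ht. apply (is_derive_opp (V := R_NormedModule)). apply Hg. lra.
    - intros t Ht. destruct (Hb t ltac:(lra)). lra. }
  (* A primitive of [ln (t / 4)], bounded near [0]; the factor [1 / 4] matches the lower bound
     [sin t >= t / 4]. *)
  set (h := fun t => t * ln (t / 4) - t).
  assert (Hup : forall t, 0 < t <= d -> g t <= g d - C * h d).
  { intros t Ht.
    assert (H : g t - C * h t <= g d - C * h d).
    { apply (monotone_of_derive (fun t => g t - C * h t) (fun t => g1 t - C * ln (t / 4))); [lra | |].
      - intros u Hu. apply (is_derive_minus (V := R_NormedModule)); [apply Hg; lra|].
        unfold h. auto_derive; [lra|]. unfold Rdiv. field. lra.
      - intros u Hu. destruct (Hb u ltac:(lra)). lra. }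
    assert (Hh : h t <= 0).
    { unfold h. assert (ln (t / 4) <= 0) by (rewrite <- ln_1; apply ln_le; lra). nra. }
    nra. }
  destruct (completeness (fun y => exists t, 0 < t <= d /\ y = g t)) as (l & Hl1 & Hl2).
  - exists (g d - C * h d). intros y (t & Ht & ->). apply Hup, Ht.
  - exists (g d), d. split; [lra|reflexivity].
  - exists l. split; [intros t Ht; apply Hl1; eauto|].
    intros eps He.
    assert (Hx : exists t, 0 < t <= d /\ l - eps < g t).
    { apply NNPP. intros Hn. assert (l <= l - eps); [|lra].
      apply Hl2. intros y (t & Ht & ->). apply Rnot_lt_le. intros Hlt. apply Hn. eauto. }
    destruct Hx as (t0 & Ht0 & Hgt). exists t0. split; [lra|].
    intros t Ht. pose proof (Hdec t t0 ltac:(lra) ltac:(lra)).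
    assert (g t <= l) by (apply Hl1; exists t; split; [lra | reflexivity]).
    rewrite Rabs_minus_sym. apply Rabs_lt_between. lra.
Qed.

Lemma cst_c_pos (b : R) : 1 / 4 < b -> 0 < cst_c b /\ b = cst_c b ^ 2 + 1 / 4.
Proof.
  intros Hb. unfold cst_c. assert (0 < sqrt (4 * b - 1)) by (apply sqrt_lt_R0; lra).
  split; [lra|]. replace ((sqrt (4 * b - 1) / 2) ^ 2) with (sqrt (4 * b - 1) ^ 2 / 4) by field.
  rewrite pow2_sqrt by lra. field.
Qed.

(** The variable [x = c u] turns the integrand of [Gamma] into the derivative of [Phi]. The limit at
    [PI] is that at [0] for the reflected function [- Phi (PI - t)], and the monotonicity of [Phi]
    places all its values between the two limits. *)
Lemma Gamma_integral_primitive (b : R) : 1 / 4 < b ->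
  exists (Phi : R -> R) (I0 I1 : R),
  (forall x, 0 < x < PI -> is_derive Phi x (exp (- (x / cst_c b)) * ln (sin x) / cst_c b)) /\
  (forall x, 0 < x < PI -> I1 <= Phi x <= I0) /\
  (forall eps, 0 < eps -> exists d, 0 < d /\ forall x, 0 < x < d -> Rabs (Phi x - I0) < eps) /\
  (forall eps, 0 < eps -> exists d, 0 < d /\ forall x, PI - d < x < PI -> Rabs (Phi x - I1) < eps) /\
  Gamma_integral b = I1 - I0.
Proof.
  intros Hb. destruct (cst_c_pos b Hb) as [Hc _]. unfold Gamma_integral. set (c := cst_c b) in *.
  set (f := fun u => exp (- u) * ln (sin (c * u))).
  pose proof PI2_3_2 as HP1. pose proof PI_4 as HP2.
  assert (Hrange : forall u, 0 < u < PI / c -> 0 < c * u < PI).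
  { intros u Hu. split; [nra|]. replace PI with (c * (PI / c)) by (field; lra). nra. }
  assert (Hfc : forall u, 0 < u < PI / c -> continuous f u).
  { intros u Hu. apply (ex_derive_continuous f). unfold f. auto_derive.
    destruct (Hrange u Hu). apply sin_gt_0; assumption. }
  set (u0 := PI / 2 / c).
  assert (Hci : 0 < / c) by (apply Rinv_0_lt_compat; lra).
  assert (Hu0 : 0 < u0 < PI / c).
  { unfold u0. split; [apply Rdiv_lt_0_compat; lra|]. unfold Rdiv. nra. }
  set (Q := fun u => RInt f u0 u).
  assert (HQ : forall u, 0 < u < PI / c -> is_derive Q u (f u)).
  { intros u Hu. apply (is_derive_RInt f Q u0 u); [|apply Hfc, Hu].
    assert (Hloc : locally u (fun v => 0 < v < PI / c)).
    { apply filter_and; [apply (open_gt 0) | apply (open_lt (PI / c))]; lra. }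
    revert Hloc. apply filter_imp. intros v Hv. apply (RInt_correct f), (ex_RInt_continuous f).
    intros w Hw. apply Hfc. unfold Rmin, Rmax in Hw. destruct (Rle_dec u0 v); lra. }
  set (Phi := fun x => Q (x / c)).
  assert (Hdr : forall x, 0 < x < PI -> 0 < x / c < PI / c).
  { intros x Hx. split; [apply Rdiv_lt_0_compat; lra|]. unfold Rdiv. nra. }
  assert (HPhi : forall x, 0 < x < PI -> is_derive Phi x (exp (- (x / c)) * ln (sin x) / c)).
  { intros x Hx.
    replace (exp (- (x / c)) * ln (sin x) / c) with (/ c * f (x / c)).
    - apply (is_derive_comp Q (fun x => x / c)); [apply HQ, Hdr, Hx|].
      auto_derive; [exact I|]. field. lra.
    - unfold f. replace (c * (x / c)) with x by (field; lra). field. lra. }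
  assert (Hlb : forall t, 0 < t <= 2 -> ln (t / 4) <= ln (sin t) <= 0).
  { intros t Ht. pose proof (sin_lower t ltac:(lra)). split; [apply ln_le; lra|].
    rewrite <- ln_1. apply ln_le; [lra | apply SIN_bound]. }
  assert (Hew : forall x t, 0 <= x -> t <= 0 -> / c * t <= exp (- (x / c)) * t / c <= 0).
  { intros x t Hx Ht. pose proof (exp_pos (- (x / c))).
    assert (exp (- (x / c)) <= 1).
    { rewrite <- exp_0. assert (0 <= x / c) by (apply Rdiv_le_0_compat; lra).
      destruct (Req_dec (x / c) 0) as [-> | Hne]; [rewrite Ropp_0; lra|].
      apply Rlt_le, exp_increasing. lra. }
    split.
    - replace (exp (- (x / c)) * t / c) with (/ c * (exp (- (x / c)) * t)) by (field; lra).
      apply Rmult_le_compat_l; [lra|]. nra.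
    - replace (exp (- (x / c)) * t / c) with (- (/ c * (exp (- (x / c)) * - t))) by (field; lra).
      assert (0 <= / c * (exp (- (x / c)) * - t)) by (repeat apply Rmult_le_pos; lra). lra. }
  destruct (limit_log_singularity Phi (fun x => exp (- (x / c)) * ln (sin x) / c) (PI / 2) (/ c))
    as (I0 & HI0a & HI0); try lra.
  { intros t Ht. apply HPhi. lra. }
  { intros t Ht. destruct (Hlb t ltac:(lra)) as [L1 L2]. destruct (Hew t (ln (sin t))) as [W1 W2]; try lra.
    split; [|exact W2]. eapply Rle_trans; [|exact W1]. apply Rmult_le_compat_l; lra. }
  destruct (limit_log_singularity (fun t => - Phi (PI - t))
    (fun t => exp (- ((PI - t) / c)) * ln (sin t) / c) (PI / 2) (/ c))
    as (I1 & HI1a & HI1); try lra.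
  { intros t Ht.
    replace (exp (- ((PI - t) / c)) * ln (sin t) / c) with
      (opp (-1 * (exp (- ((PI - t) / c)) * ln (sin (PI - t)) / c))).
    - apply (is_derive_opp (V := R_NormedModule)).
      apply (is_derive_comp Phi (fun t => PI - t)); [apply HPhi; lra|].
      auto_derive; [exact I | ring].
    - rewrite sin_PI_x. unfold opp; simpl. field. lra. }
  { intros t Ht. destruct (Hlb t ltac:(lra)) as [L1 L2].
    destruct (Hew (PI - t) (ln (sin t))) as [W1 W2]; try lra.
    split; [|exact W2]. eapply Rle_trans; [|exact W1]. apply Rmult_le_compat_l; lra. }
  assert (HI1' : forall eps, 0 < eps -> exists d, 0 < d /\
    forall x, PI - d < x < PI -> Rabs (Phi x - - I1) < eps).
  { intros eps He. destruct (HI1 eps He) as (d & Hd & H). exists d. split; [exact Hd|].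
    intros x Hx. specialize (H (PI - x) ltac:(lra)).
    replace (PI - (PI - x)) with x in H by ring.
    rewrite <- Rabs_Ropp. replace (- (Phi x - - I1)) with (- Phi x - I1) by ring. exact H. }
  assert (Hmon : forall x y, 0 < x <= y -> y < PI -> Phi y <= Phi x).
  { intros x y Hx Hy. apply Ropp_le_cancel.
    apply (monotone_of_derive (fun t => - Phi t) (fun t => - (exp (- (t / c)) * ln (sin t) / c))); [lra | |].
    - intros t Ht. apply (is_derive_opp (V := R_NormedModule)). apply HPhi. lra.
    - intros t Ht. destruct (Hew t (ln (sin t))) as [_ W]; [lra| |lra].
      rewrite <- ln_1. apply ln_le; [apply sin_gt_0; lra | apply SIN_bound]. }
  exists Phi, I0, (- I1). split; [exact HPhi|]. split; [|split; [exact HI0|split; [exact HI1'|]]].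
  { intros x Hx.
    assert (Hhi : forall x, 0 < x <= PI / 2 -> - I1 <= Phi x).
    { intros y Hy. pose proof (HI1a (PI / 2) ltac:(lra)) as G.
      replace (PI - PI / 2) with (PI / 2) in G by field.
      pose proof (Hmon y (PI / 2) ltac:(lra) ltac:(lra)). lra. }
    destruct (Rle_dec x (PI / 2)) as [Hx2|Hx2].
    - split; [apply Hhi; lra | apply HI0a; lra].
    - split.
      + pose proof (HI1a (PI - x) ltac:(lra)) as G. replace (PI - (PI - x)) with x in G by ring. lra.
      + pose proof (Hmon (PI / 2) x ltac:(lra) ltac:(lra)). pose proof (HI0a (PI / 2) ltac:(lra)). lra. }
  apply (is_RInt_gen_unique (V := R_CompleteNormedModule)).
  (* A neighborhood of [I1 - I0] contains a ball of radius [eps]; each endpoint of the integral may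
     use half of it, and the distances to the endpoints are divided by [c] to return to the variable
     [u]. *)
  intros P (eps & HP).
  destruct (HI0 (eps / 2)) as (d0 & Hd0 & G0); [apply is_pos_div_2|].
  destruct (HI1' (eps / 2)) as (d1 & Hd1 & G1); [apply is_pos_div_2|].
  assert (Hd0' : 0 < Rmin d0 1 / c) by (apply Rdiv_lt_0_compat; [apply Rmin_pos|]; lra).
  assert (Hd1' : 0 < Rmin d1 1 / c) by (apply Rdiv_lt_0_compat; [apply Rmin_pos|]; lra).
  exists (fun u => 0 < u < Rmin d0 1 / c) (fun u => PI / c - Rmin d1 1 / c < u < PI / c).
  - exists (mkposreal _ Hd0'). intros u Hu Hu'. unfold ball in Hu; simpl in Hu.
    unfold AbsRing_ball, abs, minus, plus, opp in Hu; simpl in Hu.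
    apply Rabs_lt_between in Hu. lra.
  - exists (mkposreal _ Hd1'). intros u Hu Hu'. unfold ball in Hu; simpl in Hu.
    unfold AbsRing_ball, abs, minus, plus, opp in Hu; simpl in Hu.
    apply Rabs_lt_between in Hu. lra.
  - intros u v Hu Hv. exists (Q v - Q u).
    pose proof (Rmin_l d0 1). pose proof (Rmin_r d0 1). pose proof (Rmin_l d1 1). pose proof (Rmin_r d1 1).
    assert (Hu1 : 0 < c * u < Rmin d0 1).
    { split; [nra|]. replace (Rmin d0 1) with (c * (Rmin d0 1 / c)) by (field; lra). nra. }
    assert (Hv1 : PI - Rmin d1 1 < c * v < PI).
    { split.
      - replace (PI - Rmin d1 1) with (c * (PI / c - Rmin d1 1 / c)) by (field; lra). nra.
      - replace PI with (c * (PI / c)) by (field; lra). nra. }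
    assert (Hur : 0 < u < PI / c).
    { split; [lra|]. apply Rmult_lt_reg_l with c; [lra|].
      replace (c * (PI / c)) with PI by (field; lra). lra. }
    assert (Hvr : 0 < v < PI / c).
    { split; [|lra]. apply Rmult_lt_reg_l with c; lra. }
    split.
    + simpl. apply (is_RInt_derive Q f).
      * intros x Hx. apply HQ. unfold Rmin, Rmax in Hx. destruct (Rle_dec u v); lra.
      * intros x Hx. apply Hfc. unfold Rmin, Rmax in Hx. destruct (Rle_dec u v); lra.
    + apply HP. unfold ball; simpl. unfold AbsRing_ball, abs, minus, plus, opp; simpl.
      specialize (G0 (c * u) ltac:(lra)). specialize (G1 (c * v) ltac:(lra)).
      unfold Phi in G0, G1. replace (c * u / c) with u in G0 by (field; lra).
      replace (c * v / c) with v in G1 by (field; lra).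
      apply Rabs_lt_between in G0. apply Rabs_lt_between in G1. apply Rabs_lt_between. lra.
Qed.

(** [transit_pot] is an approximate primitive: along the transit the coordinate
    [eps] of [transit_rel] varies like it, up to errors summing to [o(1 / m)]. *)
Definition transit_pot (a b03 b30 : C) (b c m : R) (Phi : R -> R) (n th : R) (z : C) : C :=
  (c * Clog (/ z) - th
   + c * (trig1 a b03 b30 b c * (sin th ^ 2 / n)%R
          + trig2 a b03 b30 b c * (sin th * cos th / n)%R - cst1 a b03 b30 b * (/ n)%R)
   + c * (1 - b03) * (ln (sin th) / n + Phi th / m)%R)%C.

Lemma sin_sqr_derive :
  (forall t, is_derive (fun t => sin t ^ 2) t (2 * sin t * cos t)) /\
  (forall t, is_derive (fun t => 2 * sin t * cos t) t (2 * (cos t ^ 2 - sin t ^ 2))) /\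
  (forall t, Rabs (sin t ^ 2) <= 1 /\ Rabs (2 * sin t * cos t) <= 2 /\
     Rabs (2 * (cos t ^ 2 - sin t ^ 2)) <= 4).
Proof.
  split; [|split].
  - intros t. auto_derive; [exact I | ring].
  - intros t. auto_derive; [exact I | ring].
  - intros t. pose proof (sin2_cos2 t) as H. unfold Rsqr in H.
    set (s := sin t) in *. set (k := cos t) in *.
    repeat split; apply Rabs_le; simpl; split; nra.
Qed.

Lemma sin_cos_derive :
  (forall t, is_derive (fun t => sin t * cos t) t (cos t ^ 2 - sin t ^ 2)) /\
  (forall t, is_derive (fun t => cos t ^ 2 - sin t ^ 2) t (- 4 * sin t * cos t)) /\
  (forall t, Rabs (sin t * cos t) <= 1 /\ Rabs (cos t ^ 2 - sin t ^ 2) <= 2 /\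
     Rabs (- 4 * sin t * cos t) <= 4).
Proof.
  split; [|split].
  - intros t. auto_derive; [exact I | ring].
  - intros t. auto_derive; [exact I | ring].
  - intros t. pose proof (sin2_cos2 t) as H. unfold Rsqr in H.
    set (s := sin t) in *. set (k := cos t) in *.
    repeat split; apply Rabs_le; simpl; split; nra.
Qed.

Lemma step_G_bound (a b03 b30 : C) (b c : R) : 0 < c ->
  exists GB, 0 <= GB /\ forall S Co : R, 0 < S -> S ^ 2 + Co ^ 2 = 1 ->
  Cmod (step_G a b03 b30 b c S Co) <= GB * / S.
Proof.
  intros Hc.
  assert (H : exists GB, forall S Co : R, Cmod S <= 1 -> Cmod Co <= 1 ->
    Cmod (quad_coef a b03 b30 b S (- (c * Co) - S / 2) / c + c ^ 2 * Co) <= GB).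
  { eexists. intros S Co HS HCo. unfold quad_coef, Cdiv. cbd. }
  destruct H as (GB & H). exists (Rabs GB). split; [apply Rabs_pos|].
  intros S Co HS HSC. unfold step_G.
  assert (HSm : Cmod S <= 1) by (rewrite Cmod_R; apply Rabs_le; nra).
  assert (HCm : Cmod Co <= 1) by (rewrite Cmod_R; apply Rabs_le; nra).
  apply Cdiv_le; [exact HS | | rewrite Cmod_R, Rabs_pos_eq; lra].
  eapply Rle_trans; [apply (H S Co HSm HCm) | apply Rle_abs].
Qed.

(** The step is first made at the fixed angle [th], then the angle is moved to [th'], which
    subtracts [tan (th' - th)]. What remains is [c z + z ^ 2 step_G - (th' - th)], and each of its
    pieces is the increment of the corresponding piece of [transit_pot] up to the error of its
    telescoping lemma. *)
Lemma bulk_step (a b03 b30 : C) (b c C0 K : R) :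
  0 < c -> b = c ^ 2 + 1 / 4 -> 0 <= C0 -> 1 <= K ->
  exists M m0, 0 < M /\ 1 <= m0 /\
  forall (m n lam rho th th' : R) (z w z' w' eps : C) (Phi : R -> R),
  m0 <= m -> m <= n -> 1 <= lam -> m0 * lam <= rho -> rho <= K * m ->
  0 <= th <= th' -> th' - th <= K / m -> Rabs (th' - th - c / n) <= K * lam / m ^ 2 ->
  (forall x, th <= x <= th' -> rho / (K * m) <= sin x) ->
  (forall x, th <= x <= th' -> Rabs (ln (sin x)) <= K * lam) ->
  (forall x, 0 < sin x -> th <= x <= th' -> is_derive Phi x (exp (- (x / c)) * ln (sin x) / c)) ->
  Rabs (exp (- (th / c)) - m / n) <= K * lam / m ->
  0 < Cmod z <= K / m -> Cmod (z - (/ n)%R) <= K * lam / m ^ 2 ->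
  0 < Re (/ z) -> 0 < Re (/ z') -> Cmod eps <= K * lam / m ->
  transit_rel c (sin th) (cos th) z w eps ->
  Cmod (z' - (z - z ^ 2 + a * z ^ 3)) <= C0 * Cmod z ^ 4 ->
  Cmod (w' - (w + w ^ 2 + b * z ^ 2 + b03 * w ^ 3 + b30 * z ^ 3))
    <= C0 * (Cmod z + Cmod w) ^ 4 ->
  exists eps', transit_rel c (sin th') (cos th') z' w' eps' /\
    Cmod (eps' - eps - (transit_pot a b03 b30 b c m Phi (n + 1) th' z'
                        - transit_pot a b03 b30 b c m Phi n th z))
      <= M * (lam / (m * rho ^ 2) + lam ^ 2 / m ^ 3).
Proof.
  intros Hc Hb HC0 HK.
  destruct (transit_step a b03 b30 b c C0 Hc Hb HC0) as (Ma & eta & HMa & Heta & Hstep).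
  destruct (Clog_inv_step a C0 HC0) as (Mz & dz & HMz & Hdz & Hclog).
  destruct (step_G_bound a b03 b30 b c Hc) as (GB & HGB & HG).
  set (t1 := Cmod (trig1 a b03 b30 b c)). set (t2 := Cmod (trig2 a b03 b30 b c)).
  set (t3 := Cmod (cst1 a b03 b30 b)). set (Bm := Cmod (1 - b03)). set (Am := Cmod (1 / 2 - a)).
  set (Ka := 6 * Ma * K ^ 5).
  set (K1 := K + c * K + GB * K ^ 3 + Ka).
  set (Ks := 8 * (K1 + 2 * K) * K1 * K).
  set (KT := 4 * K ^ 2 + 2 * (K + c) + 1).
  set (KL := K ^ 4 + K * (K + c) * K + K).
  set (KI := K ^ 3 / c ^ 2 + K ^ 4 / c + 2 * K ^ 3 / c).
  assert (HK5 : 1 <= K ^ 5) by (apply pow_R1_Rle; lra).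
  assert (HK3 : 1 <= K ^ 3) by (apply pow_R1_Rle; lra).
  assert (HK4 : 1 <= K ^ 4) by (apply pow_R1_Rle; lra).
  assert (HKa : 0 < Ka) by (unfold Ka; apply Rmult_lt_0_compat; lra).
  assert (HGK : 0 <= GB * K ^ 3) by (apply Rmult_le_pos; lra).
  assert (HcK : 0 < c * K) by (apply Rmult_lt_0_compat; lra).
  assert (HK1 : 1 <= K1) by (unfold K1; lra).
  assert (Hpos : 0 <= t1 /\ 0 <= t2 /\ 0 <= t3 /\ 0 <= Bm /\ 0 <= Am) by
    (repeat split; apply Cmod_ge_0).
  destruct Hpos as (Pt1 & Pt2 & Pt3 & PBm & PAm).
  exists (Ks + Ka + 2 * K ^ 4 * GB + 2 * K ^ 3 + c * (Mz * K ^ 3) + c * (Am * (2 * K ^ 2))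
    + c * (t1 * KT + t2 * KT + t3 * KT) + c * Bm * (KL + KI) + 1),
    (K ^ 2 / eta + K / dz + 8 * K1 * K ^ 2 + 2 * K).
  assert (Hm0a : 0 < K ^ 2 / eta) by (apply Rdiv_lt_0_compat; [apply pow_lt; lra | lra]).
  assert (Hm0b : 0 < K / dz) by (apply Rdiv_lt_0_compat; lra).
  assert (HK2 : 1 <= K ^ 2) by (apply pow_R1_Rle; lra).
  assert (HKK : 1 <= K1 * K ^ 2) by nra.
  set (m0 := K ^ 2 / eta + K / dz + 8 * K1 * K ^ 2 + 2 * K).
  assert (PKs : 0 <= Ks) by (unfold Ks; repeat apply Rmult_le_pos; lra).
  assert (PKT : 0 <= KT) by (unfold KT; lra).
  assert (PKL : 0 <= KL).
  { unfold KL. assert (0 <= K * (K + c) * K) by (repeat apply Rmult_le_pos; lra). lra. }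
  assert (PKI : 0 <= KI).
  { unfold KI. assert (0 <= K ^ 3 / c ^ 2) by (apply Rdiv_le_0_compat; [lra | apply pow_lt; lra]).
    assert (0 <= K ^ 4 / c) by (apply Rdiv_le_0_compat; lra).
    assert (0 <= 2 * K ^ 3 / c) by (apply Rdiv_le_0_compat; lra). lra. }
  split.
  { assert (0 <= 2 * K ^ 4 * GB) by (repeat apply Rmult_le_pos; lra).
    assert (0 <= c * (Mz * K ^ 3)) by (repeat apply Rmult_le_pos; lra).
    assert (0 <= c * (Am * (2 * K ^ 2))) by (repeat apply Rmult_le_pos; lra).
    assert (0 <= c * (t1 * KT + t2 * KT + t3 * KT)).
    { apply Rmult_le_pos; [lra|]. assert (0 <= t1 * KT) by (apply Rmult_le_pos; lra).
      assert (0 <= t2 * KT) by (apply Rmult_le_pos; lra).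
      assert (0 <= t3 * KT) by (apply Rmult_le_pos; lra). lra. }
    assert (0 <= c * Bm * (KL + KI)) by (repeat apply Rmult_le_pos; lra). lra. }
  split; [unfold m0; lra|].
  intros m n lam rho th th' z w z' w' eps Phi Hm Hmn Hlam Hrho HrhoK Hth HthK HthD Hsin Hlnsin
    HPhi Hexp Hz Hzn HRz HRz' Heps Hrel Hz' Hw'.
  assert (Hm0K : 2 * K <= m0 /\ K ^ 2 / eta <= m0 /\ K / dz <= m0 /\ 8 * K1 * K ^ 2 <= m0)
    by (unfold m0; lra).
  destruct Hm0K as (Hq1 & Hq2 & Hq3 & Hq4). clearbody m0.
  assert (Hm1 : 1 <= m) by lra.
  assert (Hrho1 : 1 <= rho).
  { assert (m0 * 1 <= m0 * lam) by (apply Rmult_le_compat_l; lra). lra. }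
  set (err := lam / (m * rho ^ 2) + lam ^ 2 / m ^ 3).
  destruct (err_bounds K m lam rho Hm1 Hlam ltac:(lra)) as (Hj & Hi & E1 & E2 & E3 & Eerr).
  fold err in E1, E2, Eerr.
  set (S := sin th) in *. set (Co := cos th) in *.
  assert (HS : rho / (K * m) <= S) by (apply Hsin; lra).
  assert (HKm : 0 < K * m) by (apply Rmult_lt_0_compat; lra).
  assert (HS0 : 0 < rho / (K * m)) by (apply Rdiv_lt_0_compat; lra).
  assert (HSC : S ^ 2 + Co ^ 2 = 1).
  { pose proof (sin2_cos2 th) as H0. unfold Rsqr in H0. unfold S, Co. simpl. lra. }
  assert (HSi : 0 < / S <= K * m * / rho).
  { split; [apply Rinv_0_lt_compat; lra|].
    replace (K * m * / rho) with (/ (rho / (K * m))) by (field; lra).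
    apply Rinv_le_contravar; lra. }
  set (i := / m) in *. set (j := / rho) in *.
  assert (Hmi : m * i = 1) by (unfold i; field; lra).
  (* The use of [m0 * lam <= rho]: at distance at least a large multiple of [ln m] from the ends,
     [z] and [eps] are small compared with [sin theta], as [transit_step] demands. *)
  assert (HKlam : K * (lam * K) <= eta * rho).
  { apply Rle_trans with (eta * (K ^ 2 / eta * lam)).
    - right. field. lra.
    - apply Rmult_le_compat_l; [lra|]. eapply Rle_trans; [|exact Hrho]. apply Rmult_le_compat_r; lra. }
  assert (HetaS : K * lam / m <= eta * S).
  { apply Rle_trans with (eta * (rho / (K * m))); [|apply Rmult_le_compat_l; lra].
    apply Rmult_le_reg_r with (K * m); [exact HKm|].
    replace (K * lam / m * (K * m)) with (K * (lam * K)) by (field; lra).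
    replace (eta * (rho / (K * m)) * (K * m)) with (eta * rho) by (field; lra). exact HKlam. }
  assert (HKi : K * i <= K * lam * i).
  { apply Rmult_le_compat_r; [lra|]. rewrite <- (Rmult_1_r K) at 1. apply Rmult_le_compat_l; lra. }
  unfold Rdiv in Hz, Heps, HetaS, HthK. fold i in Hz, Heps, HetaS, HthK.
  destruct (Hstep S Co z w z' w' eps ltac:(lra) HSC ltac:(lra) ltac:(lra) Hrel Hz' Hw')
    as (eps1 & Hrel1 & Hea).
  set (Gv := step_G a b03 b30 b c S Co) in *.
  assert (HGv : Cmod Gv <= GB * (K * m * j)).
  { eapply Rle_trans; [apply HG; [lra | exact HSC]|]. apply Rmult_le_compat_l; lra. }
  set (ea := (eps1 - eps - (c * z + z ^ 2 * Gv))%C) in *.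
  pose proof (Cmod_ge_0 z) as Hzp. pose proof (Cmod_ge_0 eps) as Hep.
  assert (Hi2 : 0 < i ^ 2 <= 1) by (split; [apply pow_lt; lra | simpl; nra]).
  assert (Hi3 : 0 < i ^ 3) by (apply pow_lt; lra).
  assert (Hl2 : i ^ 3 <= lam ^ 2 * i ^ 3).
  { rewrite <- (Rmult_1_l (i ^ 3)) at 1. apply Rmult_le_compat_r; [lra|]. simpl; nra. }
  assert (Hl1 : lam * i ^ 3 <= lam ^ 2 * i ^ 3).
  { apply Rmult_le_compat_r; [lra|]. simpl; nra. }
  assert (Hl0 : i * j ^ 2 <= lam * (i * j ^ 2)).
  { assert (0 <= i * j ^ 2) by (apply Rmult_le_pos; [lra | apply pow2_ge_0]). nra. }
  assert (HeaB : Cmod ea <= Ka / 2 * err).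
  { eapply Rle_trans; [exact Hea|].
    assert (HSi2 : / S ^ 2 <= (K * m * j) ^ 2).
    { rewrite <- pow_inv by lra. apply pow_incr. lra. }
    assert (HSi2p : 0 <= / S ^ 2) by (apply Rlt_le, Rinv_0_lt_compat, pow_lt; lra).
    assert (Q1 : Cmod z ^ 3 / S ^ 2 <= K ^ 5 * (i * j ^ 2)).
    { apply Rle_trans with ((K * i) ^ 3 * (K * m * j) ^ 2).
      - apply Rmult_le_compat; [apply pow_le; lra | exact HSi2p | apply pow_incr; lra | exact HSi2].
      - replace ((K * i) ^ 3 * (K * m * j) ^ 2) with (K ^ 5 * ((m * i) ^ 2 * (i * j ^ 2))) by ring.
        rewrite Hmi. right; ring. }
    assert (Q2 : Cmod z ^ 2 * Cmod eps / S ^ 2 <= K ^ 5 * (lam * (i * j ^ 2))).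
    { apply Rle_trans with ((K * i) ^ 2 * (K * lam * i) * (K * m * j) ^ 2).
      - apply Rmult_le_compat; [apply Rmult_le_pos; [apply pow_le; lra|lra] | exact HSi2p | | exact HSi2].
        apply Rmult_le_compat; [apply pow_le; lra | lra | apply pow_incr; lra | lra].
      - replace ((K * i) ^ 2 * (K * lam * i) * (K * m * j) ^ 2) with (K ^ 5 * (lam * ((m * i) ^ 2 * (i * j ^ 2)))) by ring.
        rewrite Hmi. right; ring. }
    assert (Q3 : Cmod eps ^ 2 * Cmod z <= K ^ 3 * (lam ^ 2 * i ^ 3)).
    { apply Rle_trans with ((K * lam * i) ^ 2 * (K * i)).
      - apply Rmult_le_compat; [apply pow_le; lra | lra | apply pow_incr; lra | lra].
      - right; ring. }
    assert (HK35 : K ^ 3 <= K ^ 5).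
    { replace (K ^ 5) with (K ^ 3 * K ^ 2) by ring. rewrite <- (Rmult_1_r (K ^ 3)) at 1.
      apply Rmult_le_compat_l; lra. }
    assert (Q4 : Cmod z ^ 3 / S ^ 2 + Cmod z ^ 2 * Cmod eps / S ^ 2 + Cmod eps ^ 2 * Cmod z
      <= 3 * K ^ 5 * err).
    { assert (K ^ 5 * (i * j ^ 2) <= K ^ 5 * err) by (apply Rmult_le_compat_l; lra).
      assert (K ^ 5 * (lam * (i * j ^ 2)) <= K ^ 5 * err) by (apply Rmult_le_compat_l; lra).
      assert (K ^ 3 * (lam ^ 2 * i ^ 3) <= K ^ 5 * err) by (apply Rmult_le_compat; lra).
      assert (0 <= K ^ 5 * err) by (apply Rmult_le_pos; lra). lra. }
    unfold Ka. replace (6 * Ma * K ^ 5 / 2 * err) with (Ma * (3 * K ^ 5 * err)) by field.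
    apply Rmult_le_compat_l; lra. }
  assert (Hj1 : j <= 1) by (unfold j; rewrite <- Rinv_1; apply Rinv_le_contravar; lra).
  assert (Hlm : lam * i <= K * / m0).
  { apply Rmult_le_reg_r with (m0 * m); [apply Rmult_lt_0_compat; lra|].
    replace (lam * i * (m0 * m)) with (m0 * lam * (m * i)) by ring.
    replace (K * / m0 * (m0 * m)) with (K * m) by (field; lra). rewrite Hmi. lra. }
  assert (Hlm1 : lam * i <= 1).
  { eapply Rle_trans; [exact Hlm|]. apply Rmult_le_reg_r with m0; [lra|].
    rewrite Rmult_assoc, Rinv_l by lra. lra. }
  assert (Herr1 : err <= 2 * (lam * i)).
  { rewrite Eerr.
    assert (lam * (i * j ^ 2) <= lam * i).
    { apply Rmult_le_compat_l; [lra|]. rewrite <- (Rmult_1_r i) at 2. apply Rmult_le_compat_l; [lra|].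
      simpl; nra. }
    assert (lam ^ 2 * i ^ 3 <= lam * i).
    { replace (lam ^ 2 * i ^ 3) with (lam * i * (lam * i * i)) by ring.
      rewrite <- (Rmult_1_r (lam * i)) at 3. apply Rmult_le_compat_l; nra. }
    lra. }
  assert (Hmj : m * (i * j) = j) by (rewrite <- Rmult_assoc, Hmi; ring).
  assert (HzG : Cmod (z ^ 2 * Gv) <= GB * K ^ 3 * (lam * i)).
  { apply Rle_trans with ((K * i) ^ 2 * (GB * (K * m * j))).
    - apply Cmul_le; [rewrite Cmod_pow; apply pow_incr; lra | exact HGv].
    - replace ((K * i) ^ 2 * (GB * (K * m * j))) with (GB * K ^ 3 * (m * i * (i * j))) by ring.
      rewrite Hmi, Rmult_1_l. apply Rmult_le_compat_l; [lra|].
      apply Rle_trans with (i * 1); [apply Rmult_le_compat_l; lra|]. rewrite Rmult_comm. apply Rmult_le_compat_r; lra. }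
  assert (He1 : Cmod eps1 <= K1 * (lam * i)).
  { replace eps1 with (eps + (c * z + z ^ 2 * Gv) + ea)%C by (unfold ea; ring).
    eapply Rle_trans; [apply Cadd_le; [apply Cadd_le; [exact Heps | apply Cadd_le; [|exact HzG]]|exact HeaB]|].
    { apply Cmul_le; [rewrite Cmod_R, Rabs_pos_eq by lra; apply Rle_refl | apply Hz]. }
    unfold K1. assert (Ka / 2 * err <= Ka * (lam * i)).
    { replace (Ka * (lam * i)) with (Ka / 2 * (2 * (lam * i))) by field. apply Rmult_le_compat_l; lra. }
    assert (c * (K * i) <= c * K * (lam * i)).
    { rewrite Rmult_assoc. apply Rmult_le_compat_l; [lra|]. rewrite <- Rmult_assoc. exact HKi. }
    lra. }
  set (D := th' - th) in *. assert (HD0 : 0 <= D) by (unfold D; lra).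
  assert (HKi2 : K * i <= / 2).
  { apply Rmult_le_reg_r with m; [lra|]. rewrite Rmult_assoc, (Rmult_comm i), Hmi. lra. }
  assert (HD : D <= / 2) by lra.
  set (t := tan D).
  assert (HtD : Rabs (t - D) <= 2 * D ^ 3) by (apply tan_near; lra).
  assert (HDD : D * D <= / 2 * / 2) by (apply Rmult_le_compat; lra).
  assert (HD3 : 2 * D ^ 3 <= D).
  { replace (2 * D ^ 3) with (D * (2 * (D * D))) by ring. apply Rmult_le_1; lra. }
  assert (Ht : Rabs t <= 2 * (K * i)).
  { apply Rabs_le_between in HtD. apply Rabs_le. lra. }
  assert (HtC : Cmod t <= 2 * (K * i)) by (rewrite Cmod_R; exact Ht).
  assert (Hcos : cos D <> 0).
  { pose proof (cos_near D). assert (D ^ 2 <= / 2) by (simpl; lra). lra. }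
  assert (Het : Cmod (eps1 * t) <= / 2).
  { apply Rle_trans with (K1 * (K * / m0) * (2 * (K * 1))).
    - apply Cmul_le; [eapply Rle_trans; [exact He1|]; apply Rmult_le_compat_l; lra|].
      eapply Rle_trans; [exact HtC|]. apply Rmult_le_compat_l; [lra|]. apply Rmult_le_compat_l; lra.
    - apply Rmult_le_reg_r with m0; [lra|].
      replace (K1 * (K * / m0) * (2 * (K * 1)) * m0) with (2 * K1 * K ^ 2) by (field; lra). lra. }
  assert (Hden : / 2 <= Cmod (1 + eps1 * t)) by (pose proof (Cone_plus_ge _ _ Het); lra).
  assert (Hdn : (1 + eps1 * t)%C <> 0) by (apply (Cneq_0 _ (/ 2)); lra).
  pose proof (transit_rel_shift c S Co D z' w' eps1 Hcos Hdn Hrel1) as Hrel'.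
  unfold S, Co in Hrel'. rewrite <- sin_plus, <- cos_plus in Hrel'.
  replace (th + D) with th' in Hrel' by (unfold D; ring). fold S Co t in Hrel'.
  set (eps' := ((eps1 - t) / (1 + eps1 * t))%C) in *.
  exists eps'. split; [exact Hrel'|].
  (* The defect of linearity in the subtraction of tangents is [(eps1 - t) eps1 t / (1 + eps1 t)], a
     product of three small factors of total order [lam ^ 2 / m ^ 3]. *)
  set (es := (eps' - (eps1 - t))%C).
  assert (Hes : Cmod es <= Ks * err).
  { replace es with (- ((eps1 - t) * eps1 * t * / (1 + eps1 * t)))%C by (unfold es, eps'; field; exact Hdn).
    assert (Hinv : Cmod (/ (1 + eps1 * t)) <= 2).
    { replace 2 with (/ / 2) by field. apply Cinv_le; lra. }
    apply Rle_trans with ((K1 * (lam * i) + 2 * (K * i)) * (K1 * (lam * i)) * (2 * (K * i)) * 2).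
    - rewrite Cmod_opp. apply Cmul_le; [apply Cmul_le; [apply Cmul_le; [apply Csub_le|]|]|]; assumption.
    - apply Rle_trans with ((K1 * (lam * i) + 2 * (K * lam * i)) * (K1 * (lam * i)) * (2 * (K * i)) * 2).
      + apply Rmult_le_compat_r; [lra|]. apply Rmult_le_compat_r; [lra|].
        apply Rmult_le_compat_r; [repeat apply Rmult_le_pos; lra|]. lra.
      + replace ((K1 * (lam * i) + 2 * (K * lam * i)) * (K1 * (lam * i)) * (2 * (K * i)) * 2) with
          (Ks / 2 * (lam ^ 2 * i ^ 3)) by (unfold Ks; field).
        apply Rle_trans with (Ks / 2 * err); [apply Rmult_le_compat_l; lra|].
        assert (0 <= Ks * err) by (apply Rmult_le_pos; lra). lra. }
  assert (Hin : 0 < / n <= i).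
  { split; [apply Rinv_0_lt_compat; lra | apply Rinv_le_contravar; lra]. }
  set (n2 := / n * / n).
  replace (K * lam / m ^ 2) with (K * lam * i ^ 2) in Hzn by (unfold i; field; lra).
  assert (Hz2 : Cmod (z ^ 2 - n2) <= 2 * K ^ 2 * (lam * i ^ 3)).
  { replace (z ^ 2 - n2)%C with ((z - (/ n)%R) * (z + (/ n)%R))%C
      by (unfold n2; rewrite RtoC_mult; ring).
    apply Rle_trans with (K * lam * i ^ 2 * (K * i + i)).
    - apply Cmul_le; [exact Hzn|]. apply Cadd_le; [apply Hz|]. rewrite Cmod_R, Rabs_pos_eq; lra.
    - replace (K * lam * i ^ 2 * (K * i + i)) with (K * (K + 1) * (lam * i ^ 3)) by ring.
      apply Rmult_le_compat_r; [apply Rmult_le_pos; lra|].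
      replace (2 * K ^ 2) with (K * (2 * K)) by ring. apply Rmult_le_compat_l; lra. }
  (* The potential is expressed with [1 / n ^ 2] in place of [z ^ 2]. The difference is
     [O(lam / m ^ 3)] against a coefficient [O(m / rho)], and [rho <= K m] lets [err] absorb it. *)
  set (eg := ((z ^ 2 - n2) * Gv)%C).
  assert (Heg : Cmod eg <= 2 * K ^ 4 * GB * err).
  { apply Rle_trans with (2 * K ^ 2 * (lam * i ^ 3) * (GB * (K * m * j))).
    - apply Cmul_le; assumption.
    - replace (2 * K ^ 2 * (lam * i ^ 3) * (GB * (K * m * j))) with
        (2 * K ^ 3 * GB * (lam * (i ^ 2 * j) * (m * i))) by ring.
      rewrite Hmi, Rmult_1_r.
      replace (2 * K ^ 4 * GB * err) with (2 * K ^ 3 * GB * (K * err)) by ring.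
      apply Rmult_le_compat_l; [repeat apply Rmult_le_pos; lra|].
      eapply Rle_trans; [exact E3|]. apply Rmult_le_compat_l; lra. }
  destruct (Hclog z z') as [Hf1 _]; try assumption.
  { split; [lra|]. eapply Rle_trans; [apply Hz|].
    apply Rmult_le_reg_r with (m * / dz); [apply Rmult_lt_0_compat; [lra | apply Rinv_0_lt_compat; lra]|].
    replace (K * i * (m * / dz)) with (K / dz * (m * i)) by (unfold Rdiv; ring).
    replace (dz * (m * / dz)) with m by (field; lra). rewrite Hmi. lra. }
  set (f1 := (Clog (/ z') - Clog (/ z) - z - (1 / 2 - a) * z ^ 2)%C) in *.
  assert (Hf1' : Cmod f1 <= Mz * K ^ 3 * err).
  { eapply Rle_trans; [exact Hf1|]. rewrite Rmult_assoc. apply Rmult_le_compat_l; [lra|].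
    apply Rle_trans with ((K * i) ^ 3); [apply pow_incr; lra|].
    rewrite Rpow_mult_distr. apply Rmult_le_compat_l; lra. }
  set (fz := ((1 / 2 - a) * (z ^ 2 - n2))%C).
  assert (Hfz : Cmod fz <= Am * (2 * K ^ 2) * err).
  { rewrite Rmult_assoc. apply Cmul_le; [apply Rle_refl|]. eapply Rle_trans; [exact Hz2|].
    apply Rmult_le_compat_l; lra. }
  destruct sin_sqr_derive as (Ds1 & Ds2 & Ds3). destruct sin_cos_derive as (Dc1 & Dc2 & Dc3).
  assert (HthK' : th' - th <= K / m) by (unfold Rdiv; exact HthK).
  pose proof (telescope_bounded c K m n lam th th' Hc Hm1 Hmn Hlam ltac:(lra) HthK' HthD _ _ _ Ds1 Ds2 Ds3) as T1.
  pose proof (telescope_bounded c K m n lam th th' Hc Hm1 Hmn Hlam ltac:(lra) HthK' HthD _ _ _ Dc1 Dc2 Dc3) as T2.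
  pose proof (telescope_bounded c K m n lam th th' Hc Hm1 Hmn Hlam ltac:(lra) HthK' HthD (fun _ => 1)
    (fun _ => 0) (fun _ => 0) (fun t => is_derive_const 1 t) (fun t => is_derive_const 0 t)) as T0.
  specialize (T0 ltac:(intros u; cbv beta; rewrite Rabs_R0, Rabs_R1; lra)).
  pose proof (telescope_ln_sin c K m n lam rho th th' Hc HK Hm1 Hmn Hlam ltac:(lra) ltac:(lra) HthK' HthD
    Hsin Hlnsin) as TL.
  pose proof (telescope_integral c K m n lam rho th th' Hc HK Hm1 Hmn Hlam ltac:(lra) ltac:(lra) HthK' HthD
    Hsin Hlnsin Phi HPhi ltac:(lra) Hexp) as TI.
  fold KL err in TL. fold KI err in TI. fold KT in T0, T1, T2. fold S Co in T1, T2, TL, TI.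
  assert (Hle3 : lam / m ^ 3 <= err).
  { replace (lam / m ^ 3) with (lam * i ^ 3) by (unfold i; field; lra). lra. }
  assert (HKTe : KT * (lam / m ^ 3) <= KT * err) by (apply Rmult_le_compat_l; lra).
  set (r1 := sin th' ^ 2 / (n + 1) - S ^ 2 / n - (c * (2 * S * Co) - S ^ 2) / n ^ 2) in *.
  set (r2 := sin th' * cos th' / (n + 1) - S * Co / n - (c * (Co ^ 2 - S ^ 2) - S * Co) / n ^ 2) in *.
  set (r0 := 1 / (n + 1) - 1 / n - (c * 0 - 1) / n ^ 2) in *.
  set (rL := ln (sin th') / (n + 1) - ln S / n - (c * (Co / S) - ln S) / n ^ 2) in *.
  set (rI := (Phi th' - Phi th) / m - ln S / n ^ 2) in *.
  assert (Er1 : (sin th' ^ 2 / (n + 1))%R = (r1 + S ^ 2 / n + (c * (2 * S * Co) - S ^ 2) * n2)%R :> R)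
    by (unfold r1, n2; field; lra).
  assert (Er2 : (sin th' * cos th' / (n + 1))%R = (r2 + S * Co / n + (c * (Co ^ 2 - S ^ 2) - S * Co) * n2)%R :> R)
    by (unfold r2, n2; field; lra).
  assert (Er0 : (/ (n + 1))%R = (r0 + / n - n2)%R :> R) by (unfold r0, n2; field; lra).
  assert (Er3 : (ln (sin th') / (n + 1) + Phi th' / m)%R =
    (rL + rI + ln S / n + Phi th / m + (c * Co / S) * n2)%R :> R)
    by (unfold rL, rI, n2; field; lra).
  assert (EG : Gv = (c * ((1 - b03) * (c * Co / S)%R + (cst1 a b03 b30 b + 1 / 2 - a)
      + (c * (trig1 a b03 b30 b c * (2 * S * Co)%R + trig2 a b03 b30 b c * (Co ^ 2 - S ^ 2)%R)
         - (trig1 a b03 b30 b c * (S ^ 2)%R + trig2 a b03 b30 b c * (S * Co)%R))))%C).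
  { apply step_G_eq; [exact Hc | exact Hb | lra | exact HSC]. }
  unfold transit_pot.
  set (k1 := trig1 a b03 b30 b c) in *. set (k2 := trig2 a b03 b30 b c) in *.
  set (k3 := cst1 a b03 b30 b) in *.
  (* An exact identity: once the formula for [step_G] is inserted, all main terms cancel and only
     the errors named above survive, each bounded by a constant times [err]. *)
  assert (Hid : (eps' - eps -
    (c * Clog (/ z') - th' + c * (k1 * (sin th' ^ 2 / (n + 1))%R + k2 * (sin th' * cos th' / (n + 1))%R
      - k3 * (/ (n + 1))%R) + c * (1 - b03) * (ln (sin th') / (n + 1) + Phi th' / m)%R -
    (c * Clog (/ z) - th + c * (k1 * (sin th ^ 2 / n)%R + k2 * (sin th * cos th / n)%R
      - k3 * (/ n)%R) + c * (1 - b03) * (ln (sin th) / n + Phi th / m)%R))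
    = es + ea + eg - (t - D)%R - c * f1 - c * fz - c * (k1 * r1 + k2 * r2 - k3 * r0)
      - c * (1 - b03) * (rL + rI)%R)%C).
  { fold S Co. rewrite Er1, Er2, Er0, Er3.
    replace (RtoC th') with (th + D)%C by (rewrite <- RtoC_plus; f_equal; unfold D; ring).
    unfold es, ea, eg, fz, f1. rewrite RtoC_minus.
    replace ((z ^ 2 - n2) * Gv)%C with (z ^ 2 * Gv - n2 * Gv)%C by ring.
    rewrite EG at 3.
    repeat (rewrite RtoC_plus || rewrite RtoC_minus || rewrite RtoC_mult). field. }
  rewrite Hid.
  assert (Hcc : Cmod c <= c) by (rewrite Cmod_R, Rabs_pos_eq; lra).
  assert (HtD3 : Cmod (t - D)%R <= 2 * K ^ 3 * err).
  { rewrite Cmod_R. eapply Rle_trans; [exact HtD|]. rewrite Rmult_assoc. apply Rmult_le_compat_l; [lra|].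
    apply Rle_trans with ((K * i) ^ 3); [apply pow_incr; lra|].
    rewrite Rpow_mult_distr. apply Rmult_le_compat_l; lra. }
  assert (HrC : forall r k, Rabs r <= k -> Cmod r <= k) by (intros r k Hr; rewrite Cmod_R; exact Hr).
  eapply Rle_trans.
  { apply Csub_le; [apply Csub_le; [apply Csub_le; [apply Csub_le; [apply Csub_le;
      [apply Cadd_le; [apply Cadd_le; [exact Hes | exact HeaB] | exact Heg] | exact HtD3]
      | apply Cmul_le; [exact Hcc | exact Hf1']] | apply Cmul_le; [exact Hcc | exact Hfz]]|]|].
    - apply Cmul_le; [exact Hcc|]. apply Csub_le; [apply Cadd_le|];
      (apply Cmul_le; [apply Rle_refl | apply HrC; eapply Rle_trans; [eassumption | exact HKTe]]).
    - apply Cmul_le; [apply Cmul_le; [exact Hcc | apply Rle_refl]|].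
      apply HrC. eapply Rle_trans; [apply Rabs_triang|]. apply Rplus_le_compat; [exact TL | exact TI]. }
  fold t1 t2 t3 Bm.
  assert (0 <= Ka * err) by (apply Rmult_le_pos; lra). lra.
Qed.

(** * The angle along a transit and its speed *)

Lemma ln_ge_1_minus_inv (y : R) : 0 < y -> 1 - / y <= ln y.
Proof.
  intros Hy. pose proof (exp_ineq1_le (ln (/ y))) as H.
  rewrite exp_ln in H by (apply Rinv_0_lt_compat; exact Hy). rewrite ln_Rinv in H by exact Hy. lra.
Qed.

Lemma ln_le_minus_1 (y : R) : 0 < y -> ln y <= y - 1.
Proof. intros Hy. pose proof (exp_ineq1_le (ln y)) as H. rewrite exp_ln in H; lra. Qed.

Lemma ln_div (x y : R) : 0 < x -> 0 < y -> ln (x / y) = ln x - ln y.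
Proof.
  intros Hx Hy. unfold Rdiv. rewrite ln_mult, ln_Rinv; auto. apply Rinv_0_lt_compat; exact Hy.
Qed.

(** This replaces the limit value [c], so that the angle is exactly [PI] at the actual integer [N]
    and the sine vanishes at both true ends. *)
Definition transit_speed (m N : R) : R := PI / ln (N / m).
Definition transit_angle (m N n : R) : R := transit_speed m N * ln (n / m).

Lemma log_ratio_small (M eps : R) : 0 <= M -> 0 < eps ->
  exists m1, 1 <= m1 /\ forall m, m1 <= m -> 1 <= ln m /\ M * (ln m / m) <= eps.
Proof.
  intros HM He. destruct (ln_small (eps / (M + 1))) as (x0 & Hx0 & H).
  { apply Rdiv_lt_0_compat; lra. }
  exists (Rmax x0 (exp 1)). split; [eapply Rle_trans; [exact Hx0|apply Rmax_l]|].
  intros m Hm. pose proof (Rmax_l x0 (exp 1)). pose proof (Rmax_r x0 (exp 1)).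
  split.
  - rewrite <- (ln_exp 1). apply ln_le; [apply exp_pos | lra].
  - specialize (H m ltac:(lra)).
    apply Rle_trans with ((M + 1) * (ln m / m)).
    + apply Rmult_le_compat_r; [|lra]. apply Rdiv_le_0_compat; [|lra].
      rewrite <- ln_1. apply ln_le; lra.
    + apply Rmult_le_reg_r with m; [lra|].
      replace ((M + 1) * (ln m / m) * m) with ((M + 1) * ln m) by (field; lra).
      replace (eps * m) with ((M + 1) * (eps / (M + 1) * m)) by (field; lra).
      apply Rmult_le_compat_l; lra.
Qed.

(** All estimates follow from [N = exp (PI / c) m (1 + mu)] with [mu = O(ln m / m)]: the speed is
    then [c + O(ln m / m)], and the angle at distance [rho] from an end is at least a multiple of
    [rho / m]. The range of [n] keeps [rho >= 1] for both [n] and [n + 1]. *)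
Lemma transit_env (c beta Ms : R) : 0 < c -> 0 <= Ms ->
  exists K m1, 1 <= K /\ 1 <= m1 /\
  forall m N sg, m1 <= m -> Rabs sg <= Ms -> N = exp (PI / c) * m + beta * ln m + sg ->
  let lam := ln m in let th := transit_angle m N in
  1 <= lam /\ K * (lam / m) <= / 2 /\ m + 4 < N /\ m * ((exp (PI / c) - 1) / 2) <= N - m /\ N <= K * m /\
  0 < transit_speed m N <= K /\ Rabs (transit_speed m N - c) <= K * lam / m /\
  forall n, m + 1 <= n <= N - 2 ->
  let rho := Rmin (n - m) (N - n) in
  rho <= K * m /\ 0 <= th n <= th (n + 1) /\ th (n + 1) - th n <= K / m /\
  Rabs (th (n + 1) - th n - c / n) <= K * lam / m ^ 2 /\
  (forall x, th n <= x <= th (n + 1) -> 0 < x < PI /\ rho / (K * m) <= sin x /\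
     Rabs (ln (sin x)) <= K * lam) /\
  Rabs (exp (- (th n / c)) - m / n) <= K * lam / m.
Proof.
  intros Hc HMs. set (al := exp (PI / c)).
  pose proof PI2_3_2 as HP1. pose proof PI_4 as HP2.
  assert (HPc : 0 < PI / c) by (apply Rdiv_lt_0_compat; lra).
  assert (Hal : 1 < al) by (unfold al; rewrite <- exp_0; apply exp_increasing; exact HPc).
  set (M2 := Rabs beta + Ms). assert (HM2 : 0 <= M2) by (unfold M2; pose proof (Rabs_pos beta); lra).
  set (K0 := 2 * al). set (L0 := ln K0).
  assert (HL0 : 0 < L0) by (unfold L0; rewrite <- ln_1; apply ln_increasing; unfold K0; lra).
  set (Kc := 2 * c * c * M2).
  assert (HKc : 0 <= Kc) by (unfold Kc; repeat apply Rmult_le_pos; lra).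
  assert (HcK : 0 < c / (16 * K0)) by (apply Rdiv_lt_0_compat; unfold K0; lra).
  set (K := 1 + K0 + 2 * c + 4 * c + Kc + 16 * K0 / c + (1 + Rabs (ln (c / (16 * K0))))
    + 2 * (Kc / c) * L0).
  assert (H16 : 0 < 16 * K0 / c) by (apply Rdiv_lt_0_compat; unfold K0; lra).
  assert (HKcc : 0 <= 2 * (Kc / c) * L0).
  { repeat apply Rmult_le_pos; try lra. apply Rlt_le, Rinv_0_lt_compat, Hc. }
  pose proof (Rabs_pos (ln (c / (16 * K0)))) as Hlp.
  assert (HKall : 1 <= K /\ K0 <= K /\ 2 * c <= K /\ 4 * c + Kc <= K /\ Kc <= K /\ 16 * K0 / c <= K /\
    1 + Rabs (ln (c / (16 * K0))) <= K /\ 2 * (Kc / c) * L0 <= K).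
  { unfold K. unfold K0 in *. repeat split; lra. }
  destruct HKall as (HK1 & HK2 & HK3 & HK4 & HK5 & HK6 & HK7 & HK8). clearbody K.
  set (sm := Rmin (/ 2) (Rmin (PI / (4 * c)) (Rmin 1 (al - 1) / 8))).
  assert (Hsm : 0 < sm /\ sm <= / 2 /\ sm <= PI / (4 * c) /\ sm <= 1 / 8 /\ sm <= (al - 1) / 8).
  { assert (0 < PI / (4 * c)) by (apply Rdiv_lt_0_compat; lra).
    assert (0 < Rmin 1 (al - 1) / 8).
    { apply Rdiv_lt_0_compat; [apply Rmin_pos|]; lra. }
    pose proof (Rmin_l 1 (al - 1)). pose proof (Rmin_r 1 (al - 1)).
    unfold sm. split; [repeat apply Rmin_pos; lra|].
    split; [apply Rmin_l|].
    pose proof (Rmin_r (/ 2) (Rmin (PI / (4 * c)) (Rmin 1 (al - 1) / 8))) as G1.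
    pose proof (Rmin_l (PI / (4 * c)) (Rmin 1 (al - 1) / 8)) as G2.
    pose proof (Rmin_r (PI / (4 * c)) (Rmin 1 (al - 1) / 8)) as G3.
    repeat split; lra. }
  destruct Hsm as (Hs0 & Hs1 & Hs2 & Hs3 & Hs4). clearbody sm.
  destruct (log_ratio_small (M2 + K) sm ltac:(lra) Hs0) as (m1 & Hm1 & Hsmall).
  exists K, (m1 + 8 + 16 / (al - 1)).
  assert (H16a : 0 < 16 / (al - 1)) by (apply Rdiv_lt_0_compat; lra).
  split; [exact HK1|]. split; [lra|].
  intros m N sg Hm Hsg HN lam th.
  destruct (Hsmall m ltac:(lra)) as [Hlam Hsml]. fold lam in Hlam, Hsml.
  assert (Hm0 : 0 < m) by lra.
  assert (Hlm : 0 < lam / m) by (apply Rdiv_lt_0_compat; lra).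
  assert (Hsm1 : M2 * (lam / m) <= sm).
  { assert (0 <= K * (lam / m)) by (apply Rmult_le_pos; lra). lra. }
  assert (Hsm2 : K * (lam / m) <= sm).
  { assert (0 <= M2 * (lam / m)) by (apply Rmult_le_pos; lra). lra. }
  (* The relative deviation of [N] from [al m], due to the logarithmic term and to the phase. *)
  set (mu := (beta * lam + sg) / (al * m)).
  assert (Halm : 0 < al * m) by (apply Rmult_lt_0_compat; lra).
  assert (HNm : N = m * (al * (1 + mu))).
  { unfold mu. rewrite HN. fold al lam. field. lra. }
  assert (Hmu : Rabs mu <= M2 * (lam / m)).
  { unfold mu, Rdiv. rewrite Rabs_mult, (Rabs_pos_eq (/ (al * m))) by (apply Rlt_le, Rinv_0_lt_compat; lra).
    rewrite <- Rmult_assoc.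
    apply Rmult_le_compat; [apply Rabs_pos | apply Rlt_le, Rinv_0_lt_compat; lra | |].
    - eapply Rle_trans; [apply Rabs_triang|]. rewrite Rabs_mult, (Rabs_pos_eq lam) by lra.
      unfold M2. rewrite Rmult_plus_distr_r. apply Rplus_le_compat; [lra|].
      apply Rle_trans with (Ms * 1); [lra|]. apply Rmult_le_compat_l; lra.
    - apply Rinv_le_contravar; [lra|]. rewrite <- (Rmult_1_l m) at 1. apply Rmult_le_compat_r; lra. }
  assert (Hmu2 : Rabs mu <= sm) by lra.
  pose proof Hmu2 as Hmu3. apply Rabs_le_between in Hmu3.
  assert (HNlo : m + 4 < N /\ m * ((al - 1) / 2) <= N - m).
  { assert (H1 : 1 + (al - 1) / 2 <= al * (1 + mu)).
    { assert (al * (1 - sm) <= al * (1 + mu)) by (apply Rmult_le_compat_l; lra).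
      assert (al * sm <= (al - 1) * / 4 + sm) .
      { replace (al * sm) with ((al - 1) * sm + sm) by ring. apply Rplus_le_compat_r.
        apply Rmult_le_compat_l; lra. }
      lra. }
    apply (Rmult_le_compat_l m) in H1; [|lra]. rewrite <- HNm in H1.
    assert (m * ((al - 1) / 2) > 4).
    { apply Rlt_gt. apply Rlt_le_trans with (16 / (al - 1) * ((al - 1) / 2)).
      - replace (16 / (al - 1) * ((al - 1) / 2)) with 8 by (field; lra). lra.
      - apply Rmult_le_compat_r; lra. }
    lra. }
  destruct HNlo as [HNlo HNlo'].
  assert (HNhi : N <= K0 * m).
  { rewrite HNm. unfold K0. rewrite (Rmult_comm m). apply Rmult_le_compat_r; [lra|].
    rewrite (Rmult_comm 2). apply Rmult_le_compat_l; lra. }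
  set (Lr := ln (N / m)).
  assert (HLr : Lr = PI / c + ln (1 + mu)).
  { unfold Lr. rewrite HNm. replace (m * (al * (1 + mu)) / m) with (al * (1 + mu)) by (field; lra).
    rewrite ln_mult by lra. unfold al. rewrite ln_exp. reflexivity. }
  assert (Hln1 : Rabs (ln (1 + mu)) <= 2 * Rabs mu) by (apply ln_near1; lra).
  assert (HLb : PI / (2 * c) <= Lr).
  { rewrite HLr. apply Rabs_le_between in Hln1.
    replace (PI / (2 * c)) with (PI / c - 2 * (PI / (4 * c))) by (field; lra). lra. }
  assert (HP2c : 0 < PI / (2 * c)) by (apply Rdiv_lt_0_compat; lra).
  assert (HLu : Lr <= 2 * (PI / c)).
  { rewrite HLr. apply Rabs_le_between in Hln1.
    replace (2 * (PI / c)) with (PI / c + 4 * (PI / (4 * c))) by (field; lra).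
    assert (0 < PI / (4 * c)) by (apply Rdiv_lt_0_compat; lra). lra. }
  set (ck := transit_speed m N).
  assert (Hck : ck = PI / Lr) by reflexivity.
  assert (HckL : ck * Lr = PI) by (rewrite Hck; field; lra).
  assert (Hck1 : c / 2 <= ck).
  { rewrite Hck. replace (c / 2) with (PI / (2 * (PI / c))) by (field; lra).
    apply Rmult_le_compat_l; [lra|]. apply Rinv_le_contravar; lra. }
  assert (Hck2 : ck <= 2 * c).
  { rewrite Hck. replace (2 * c) with (PI / (PI / (2 * c))) by (field; lra).
    apply Rmult_le_compat_l; [lra|]. apply Rinv_le_contravar; lra. }
  assert (Hckc : Rabs (ck - c) <= Kc * (lam / m)).
  { assert (E : ck - c = - (c * ln (1 + mu) / Lr)).
    { assert (PIe : PI = c * (Lr - ln (1 + mu))) by (rewrite HLr; field; lra).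
      rewrite Hck, PIe. field. lra. }
    rewrite E, Rabs_Ropp. unfold Rdiv at 1. rewrite !Rabs_mult, (Rabs_pos_eq c) by lra.
    rewrite (Rabs_pos_eq (/ Lr)) by (apply Rlt_le, Rinv_0_lt_compat; lra).
    apply Rle_trans with (c * (2 * (M2 * (lam / m))) * / (PI / (2 * c))).
    - apply Rmult_le_compat.
      + apply Rmult_le_pos; [lra | apply Rabs_pos].
      + apply Rlt_le, Rinv_0_lt_compat; lra.
      + apply Rmult_le_compat_l; lra.
      + apply Rinv_le_contravar; lra.
    - replace (c * (2 * (M2 * (lam / m))) * / (PI / (2 * c))) with
        (c * c * M2 * (4 / PI) * (lam / m)) by (field; lra).
      apply Rmult_le_compat_r; [lra|]. unfold Kc.
      replace (2 * c * c * M2) with (c * c * M2 * 2) by ring.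
      apply Rmult_le_compat_l; [repeat apply Rmult_le_pos; lra|].
      apply Rmult_le_reg_r with PI; [lra|]. field_simplify; lra. }
  split; [exact Hlam|]. split; [lra|]. split; [exact HNlo|]. split; [exact HNlo'|].
  split; [eapply Rle_trans; [exact HNhi|]; apply Rmult_le_compat_r; lra|].
  split; [lra|]. split.
  { eapply Rle_trans; [exact Hckc|]. unfold Rdiv at 2. rewrite Rmult_assoc.
    apply Rmult_le_compat_r; [unfold Rdiv in Hlm; lra | lra]. }
  intros n Hn rho.
  assert (Hn0 : 0 < n) by lra.
  assert (Hni : 0 < / n <= / m).
  { split; [apply Rinv_0_lt_compat; lra | apply Rinv_le_contravar; lra]. }
  assert (Hn2 : / n <= / 2) by (apply Rinv_le_contravar; lra).
  assert (HD : th (n + 1) - th n = ck * ln (1 + / n)).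
  { unfold th, transit_angle. fold ck. rewrite !ln_div by lra.
    replace (1 + / n) with ((n + 1) / n) by (field; lra). rewrite ln_div by lra. ring. }
  assert (Hl1 : 0 <= ln (1 + / n) <= / n).
  { split; [rewrite <- ln_1 at 1; apply ln_le; lra|].
    pose proof (ln_le_minus_1 (1 + / n) ltac:(lra)). lra. }
  assert (Hl2 : Rabs (ln (1 + / n) - / n) <= 2 * (/ n) ^ 2).
  { apply ln_near. rewrite Rabs_pos_eq; lra. }
  (* From [ln y >= 1 - 1 / y] at [y = n / m], since [n] is at most [K0 m]. *)
  assert (Hthlo : c / 2 * ((n - m) / (K0 * m)) <= th n).
  { unfold th, transit_angle. fold ck.
    assert (0 < n / m) by (apply Rdiv_lt_0_compat; lra).
    pose proof (ln_ge_1_minus_inv (n / m) H) as G.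
    replace (1 - / (n / m)) with ((n - m) * / n) in G by (field; lra).
    assert (HK0m : 0 < K0 * m) by lra.
    apply Rmult_le_compat; [lra | apply Rdiv_le_0_compat; lra | lra |].
    eapply Rle_trans; [|exact G]. apply Rmult_le_compat_l; [lra|]. apply Rinv_le_contravar; lra. }
  (* The same inequality at [y = N / (n + 1)]. It yields [N - n - 1], which is at least half of
     [N - n] because [n <= N - 2]. *)
  assert (Hthhi : c / 2 * ((N - n) / 2 / (K0 * m)) <= PI - th (n + 1)).
  { unfold th, transit_angle. fold ck.
    rewrite <- HckL. unfold Lr. rewrite !ln_div by lra.
    replace (ck * (ln N - ln m) - ck * (ln (n + 1) - ln m)) with (ck * (ln N - ln (n + 1))) by ring.
    rewrite <- ln_div by lra.
    assert (0 < N / (n + 1)) by (apply Rdiv_lt_0_compat; lra).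
    pose proof (ln_ge_1_minus_inv (N / (n + 1)) H) as G.
    replace (1 - / (N / (n + 1))) with ((N - n - 1) * / N) in G by (field; lra).
    assert (HK0m : 0 < K0 * m) by lra.
    apply Rmult_le_compat; [lra | apply Rdiv_le_0_compat; lra | lra |].
    eapply Rle_trans; [|exact G].
    apply Rmult_le_compat; [lra | apply Rlt_le, Rinv_0_lt_compat; lra | lra |].
    apply Rinv_le_contravar; lra. }
  assert (Hr : rho <= n - m /\ rho <= N - n) by (split; [apply Rmin_l | apply Rmin_r]).
  assert (Hr1 : 1 <= rho) by (unfold rho; apply Rmin_glb; lra).
  assert (HK0m : 0 < K0 * m) by lra.
  assert (HK0i : 0 < / (K0 * m)) by (apply Rinv_0_lt_compat; exact HK0m).
  assert (Hrlo : c / 2 * (rho / 2 / (K0 * m)) <= th n /\ c / 2 * (rho / 2 / (K0 * m)) <= PI - th (n + 1)).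
  { split.
    - eapply Rle_trans; [|exact Hthlo]. apply Rmult_le_compat_l; [lra|].
      apply Rmult_le_compat_r; lra.
    - eapply Rle_trans; [|exact Hthhi]. apply Rmult_le_compat_l; [lra|].
      apply Rmult_le_compat_r; lra. }
  assert (Hrp : 0 < c / 2 * (rho / 2 / (K0 * m))).
  { repeat apply Rmult_lt_0_compat; lra. }
  assert (Hth0 : 0 <= ck * ln (1 + / n)) by (apply Rmult_le_pos; lra).
  split; [apply Rle_trans with N; [lra|]; eapply Rle_trans; [exact HNhi|]; apply Rmult_le_compat_r; lra|].
  split; [lra|]. split.
  { rewrite HD. apply Rle_trans with (2 * c * / m); [apply Rmult_le_compat; lra|].
    unfold Rdiv. apply Rmult_le_compat_r; lra. }
  split.
  { rewrite HD. replace (ck * ln (1 + / n) - c / n) with (ck * (ln (1 + / n) - / n) + (ck - c) * / n)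
      by (field; lra).
    eapply Rle_trans; [apply Rabs_triang|]. rewrite !Rabs_mult, (Rabs_pos_eq ck), (Rabs_pos_eq (/ n)) by lra.
    apply Rle_trans with (2 * c * (2 * (/ m) ^ 2) + Kc * (lam / m) * / m).
    - apply Rplus_le_compat.
      + apply Rmult_le_compat; [lra | apply Rabs_pos | lra |].
        eapply Rle_trans; [exact Hl2|]. apply Rmult_le_compat_l; [lra|]. apply pow_incr. lra.
      + apply Rmult_le_compat; [apply Rabs_pos | lra | exact Hckc | lra].
    - replace (K * lam / m ^ 2) with (K * (lam * (/ m) ^ 2)) by (field; lra).
      replace (Kc * (lam / m) * / m) with (Kc * (lam * (/ m) ^ 2)) by (field; lra).
      assert (Hi2 : 0 <= (/ m) ^ 2) by apply pow2_ge_0.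
      assert (Hi3 : (/ m) ^ 2 <= lam * (/ m) ^ 2).
      { rewrite <- (Rmult_1_l ((/ m) ^ 2)) at 1. apply Rmult_le_compat_r; lra. }
      apply Rle_trans with ((4 * c + Kc) * (lam * (/ m) ^ 2)); [|apply Rmult_le_compat_r; lra].
      assert (4 * c * (/ m) ^ 2 <= 4 * c * (lam * (/ m) ^ 2)) by (apply Rmult_le_compat_l; lra). lra. }
  split.
  { intros x Hx. split; [lra|].
    assert (Hsx : c / (16 * K0) * (rho / m) <= sin x).
    { pose proof (sin_lower_PI x ltac:(lra)) as G.
      assert (c / 2 * (rho / 2 / (K0 * m)) <= Rmin x (PI - x)) by (apply Rmin_glb; lra).
      replace (c / (16 * K0) * (rho / m)) with (c / 2 * (rho / 2 / (K0 * m)) / 4) by (field; unfold K0; lra).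
      lra. }
    assert (Hrm : 0 < rho / m) by (apply Rdiv_lt_0_compat; lra).
    split.
    - eapply Rle_trans; [|exact Hsx].
      replace (rho / (K * m)) with (/ K * (rho / m)) by (field; lra).
      apply Rmult_le_compat_r; [lra|].
      replace (c / (16 * K0)) with (/ (16 * K0 / c)) by (field; unfold K0; lra).
      apply Rinv_le_contravar; lra.
    (* Since [rho >= 1], the sine is at least a constant times [1 / m], so its logarithm is bounded
       by a multiple of [ln m]. *)
    - assert (Hsx2 : c / (16 * K0) / m <= sin x).
      { eapply Rle_trans; [|exact Hsx]. unfold Rdiv at 1. apply Rmult_le_compat_l; [lra|].
        rewrite <- (Rmult_1_l (/ m)). unfold Rdiv. apply Rmult_le_compat_r; [|lra].
        apply Rlt_le, Rinv_0_lt_compat; lra. }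
      assert (Hcm : 0 < c / (16 * K0) / m) by (apply Rdiv_lt_0_compat; lra).
      assert (G1 : ln (c / (16 * K0)) - lam <= ln (sin x)).
      { unfold lam. rewrite <- ln_div by lra. apply ln_le; lra. }
      assert (G2 : ln (sin x) <= 0).
      { rewrite <- ln_1. apply ln_le; [lra | apply SIN_bound]. }
      pose proof (Rle_abs (- ln (c / (16 * K0)))) as G3. rewrite Rabs_Ropp in G3.
      rewrite Rabs_left1 by exact G2.
      apply Rle_trans with ((1 + Rabs (ln (c / (16 * K0)))) * lam); [|apply Rmult_le_compat_r; lra].
      assert (Rabs (ln (c / (16 * K0))) * 1 <= Rabs (ln (c / (16 * K0))) * lam)
        by (apply Rmult_le_compat_l; lra).
      lra. }
  { assert (Hnm : 0 < n / m) by (apply Rdiv_lt_0_compat; lra).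
    (* If the speed were [c], then [exp (- theta / c)] would be exactly [m / n]; [exp y] is the
       correction due to the rescaled speed. *)
    set (y := - ((ck / c - 1) * ln (n / m))).
    assert (Ey : exp (- (th n / c)) = m / n * exp y).
    { replace (m / n) with (exp (- ln (n / m))).
      - rewrite <- exp_plus. f_equal. unfold y, th, transit_angle. fold ck. field. lra.
      - rewrite exp_Ropp, exp_ln by exact Hnm. field. lra. }
    assert (Hln : 0 <= ln (n / m) <= L0).
    { split.
      - rewrite <- ln_1. apply ln_le; [lra|]. apply Rmult_le_reg_r with m; [lra|].
        replace (n / m * m) with n by (field; lra). lra.
      - unfold L0. apply ln_le; [exact Hnm|]. apply Rmult_le_reg_r with m; [lra|].
        replace (n / m * m) with n by (field; lra). lra. }
    assert (Hy : Rabs y <= Kc / c * L0 * (lam / m)).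
    { unfold y. rewrite Rabs_Ropp, Rabs_mult, (Rabs_pos_eq (ln (n / m))) by lra.
      replace (ck / c - 1) with ((ck - c) * / c) by (field; lra).
      rewrite Rabs_mult, (Rabs_pos_eq (/ c)) by (apply Rlt_le, Rinv_0_lt_compat, Hc).
      apply Rle_trans with (Kc * (lam / m) * / c * L0).
      - apply Rmult_le_compat; [| lra | | lra].
        + apply Rmult_le_pos; [apply Rabs_pos | apply Rlt_le, Rinv_0_lt_compat, Hc].
        + apply Rmult_le_compat_r; [apply Rlt_le, Rinv_0_lt_compat, Hc | exact Hckc].
      - right. field. lra. }
    assert (Hy2 : 2 * Rabs y <= K * (lam / m)).
    { apply Rle_trans with (2 * (Kc / c) * L0 * (lam / m)); [lra|]. apply Rmult_le_compat_r; lra. }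
    pose proof (exp_near y ltac:(lra)) as G.
    rewrite Ey. replace (m / n * exp y - m / n) with (m / n * (exp y - 1)) by ring.
    assert (Hmn : 0 < m / n <= 1).
    { split; [apply Rdiv_lt_0_compat; lra|]. apply Rmult_le_reg_r with n; [lra|].
      replace (m / n * n) with m by (field; lra). lra. }
    rewrite Rabs_mult, (Rabs_pos_eq (m / n)) by lra.
    apply Rle_trans with (1 * (K * (lam / m))).
    - apply Rmult_le_compat; [lra | apply Rabs_pos | lra | lra].
    - right. field. lra. }
Qed.

(** Here [zeta] is the inverse of the base coordinate. Its asymptotic expansion, with an error of at
    most [1], suffices for all bounds during the transit; the sharper [o(1)] is used only at the two
    ends. *)
Lemma zeta_env (A : C) (Mp K : R) : 0 <= Mp -> 1 <= K ->
  exists K' m1, 1 <= K' /\ 1 <= m1 /\ forall (m n : R) (zeta ph : C),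
  m1 <= m -> m <= n <= K * m -> Cmod ph <= Mp -> Cmod (zeta - (n + A * ln n + ph)) <= 1 ->
  0 < Re zeta /\ Cmod (zeta - n) <= K' * ln m /\ 0 < Cmod (/ zeta) <= K' / m /\
  Cmod (/ zeta - (/ n)%R) <= K' * ln m / m ^ 2 /\ Cmod (Clog zeta - ln n) <= K' * (ln m / m).
Proof.
  intros HMp HK.
  assert (HL : 0 <= ln K) by (rewrite <- ln_1; apply ln_le; lra).
  assert (HA : 0 <= Cmod A) by apply Cmod_ge_0.
  set (K3 := Cmod A * (1 + ln K) + Mp + 1).
  assert (HAL : 0 <= Cmod A * (1 + ln K)) by (apply Rmult_le_pos; lra).
  assert (HK3 : 1 <= K3) by (unfold K3; lra).
  destruct (log_ratio_small K3 (/ 2)) as (m1 & Hm1 & Hsm); [lra | lra |].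
  exists (2 + 3 * K3), m1. split; [lra|]. split; [exact Hm1|].
  intros m n zeta ph Hm Hn Hph Hz.
  destruct (Hsm m Hm) as [Hlam Hsml]. set (lam := ln m) in *.
  assert (Hm0 : 0 < m) by lra.
  assert (Hlnn : 0 <= ln n <= (1 + ln K) * lam).
  { split; [rewrite <- ln_1; apply ln_le; lra|].
    apply Rle_trans with (ln (K * m)); [apply ln_le; lra|].
    rewrite ln_mult by lra. fold lam. assert (ln K * 1 <= ln K * lam) by (apply Rmult_le_compat_l; lra). lra. }
  assert (Hzn : Cmod (zeta - n) <= K3 * lam).
  { replace (zeta - n)%C with ((zeta - (n + A * ln n + ph)) + A * ln n + ph)%C by ring.
    eapply Rle_trans; [apply Cadd_le; [apply Cadd_le; [exact Hz|]|exact Hph]|].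
    - apply Cmul_le; [apply Rle_refl|]. rewrite Cmod_R, Rabs_pos_eq by lra. apply Hlnn.
    - unfold K3. assert (Mp * 1 <= Mp * lam) by (apply Rmult_le_compat_l; lra). lra. }
  assert (Hzn2 : K3 * lam <= m / 2).
  { apply Rmult_le_reg_r with (/ m); [apply Rinv_0_lt_compat; lra|].
    replace (m / 2 * / m) with (/ 2) by (field; lra).
    replace (K3 * lam * / m) with (K3 * (lam / m)) by (field; lra). exact Hsml. }
  assert (Hcn : Cmod n = n) by (rewrite Cmod_R, Rabs_pos_eq; lra).
  assert (Hzlo : n / 2 <= Cmod zeta).
  { pose proof (Cmod_rev n zeta) as H. rewrite Cmod_minus_sym, Hcn in H. lra. }
  assert (Hznz : zeta <> 0) by (apply (Cneq_0 _ (n / 2)); lra).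
  assert (Hnn : RtoC n <> 0) by (apply (Cneq_0 _ n); lra).
  assert (Hi : Cmod (/ zeta) <= 2 / m).
  { apply Rle_trans with (/ (n / 2)); [apply Cinv_le; lra|].
    replace (2 / m) with (/ (m / 2)) by (field; lra). apply Rinv_le_contravar; lra. }
  assert (Hin : 0 < / n <= / m).
  { split; [apply Rinv_0_lt_compat; lra | apply Rinv_le_contravar; lra]. }
  assert (Him : 0 < / m) by (apply Rinv_0_lt_compat; lra).
  split; [|split; [|split; [split|split]]].
  - pose proof (Re_close zeta n). lra.
  - eapply Rle_trans; [exact Hzn|]. apply Rmult_le_compat_r; lra.
  - apply Cmod_gt_0. intros E. apply (f_equal (fun u => zeta * u)%C) in E.
    rewrite Cinv_r, Cmult_0_r in E by exact Hznz. apply C1_nz. exact E.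
  - eapply Rle_trans; [exact Hi|]. unfold Rdiv. apply Rmult_le_compat_r; lra.
  - replace (/ zeta - (/ n)%R)%C with (- ((zeta - n) * / zeta * (/ n)%R))%C
      by (rewrite RtoC_inv by lra; field; auto).
    rewrite Cmod_opp.
    apply Rle_trans with (K3 * lam * (2 / m) * / m).
    + apply Cmul_le; [apply Cmul_le; assumption|]. rewrite Cmod_R, Rabs_pos_eq; lra.
    + replace (K3 * lam * (2 / m) * / m) with (2 * K3 * (lam * (/ m * / m))) by (field; lra).
      replace ((2 + 3 * K3) * lam / m ^ 2) with ((2 + 3 * K3) * (lam * (/ m * / m))) by (field; lra).
      apply Rmult_le_compat_r; [|lra]. repeat apply Rmult_le_pos; lra.
  - eapply Rle_trans; [apply Clog_near_R; lra|].
    apply Rle_trans with (3 * (K3 * lam * / m)).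
    + apply Rmult_le_compat_l; [lra|]. apply Rmult_le_compat; [apply Cmod_ge_0 | lra | exact Hzn | lra].
    + unfold Rdiv. replace (3 * (K3 * lam * / m)) with (3 * K3 * (lam * / m)) by ring.
      apply Rmult_le_compat_r; [|lra]. apply Rmult_le_pos; lra.
Qed.

(** The local expansion of [q] is valid only for small [w]. Along the transit [w] is of order
    [z / sin theta], that is [1 / rho], hence small as long as [rho >= L]. *)
Lemma transit_rel_bound (c S Co : R) (z w eps : C) :
  0 < c -> 0 < S -> S ^ 2 + Co ^ 2 = 1 -> Cmod eps <= S / 2 -> transit_rel c S Co z w eps ->
  Cmod w <= Cmod z * (1 + 4 * c * / S).
Proof.
  intros Hc HS HSC He Hrel. unfold transit_rel in Hrel.
  assert (HCo : Rabs Co <= 1) by (apply Rabs_le; nra).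
  assert (HS1 : S <= 1) by nra.
  assert (Hh : S / 2 <= Cmod (S + eps * Co)).
  { pose proof (Cmod_rev S (S + eps * Co)) as H.
    replace (S - (S + eps * Co))%C with (- (eps * Co))%C in H by ring.
    rewrite Cmod_opp, Cmod_R, Rabs_pos_eq in H by lra.
    assert (Cmod (eps * Co) <= S / 2 * 1) by (apply Cmul_le; [exact He | rewrite Cmod_R; exact HCo]). lra. }
  assert (Hhn : (S + eps * Co)%C <> 0) by (apply (Cneq_0 _ (S / 2)); lra).
  replace w with (z * (c * (eps * S - Co) * / (S + eps * Co) - / 2))%C.
  2: { apply Ceq_minus.
       replace (z * (c * (eps * S - Co) * / (S + eps * Co) - / 2) - w)%C
         with ((c * z * (eps * S - Co) - (w + z / 2) * (S + eps * Co)) / (S + eps * Co))%C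
         by (field; auto).
       rewrite Hrel. unfold Cdiv. ring. }
  apply Cmul_le; [apply Rle_refl|].
  assert (Hi : Cmod (/ (S + eps * Co)) <= / (S / 2)) by (apply Cinv_le; lra).
  assert (Hi2 : Cmod (/ 2) <= 1).
  { replace 1 with (/ 1) by field. apply Cinv_le; [lra|]. rewrite Cmod_R, Rabs_pos_eq; lra. }
  assert (He2 : Cmod (eps * S - Co) <= 2).
  { eapply Rle_trans; [apply Csub_le; [apply Cmul_le; [exact He|]|]|]; try (rewrite Cmod_R).
    - rewrite Rabs_pos_eq by lra. exact HS1.
    - exact HCo.
    - lra. }
  assert (Hcc : Cmod c <= c) by (rewrite Cmod_R, Rabs_pos_eq; lra).
  clear He. eapply Rle_trans; [apply Csub_le; [apply Cmul_le; [apply Cmul_le; [exact Hcc | exact He2]|exact Hi]|exact Hi2]|].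
  right. field. lra.
Qed.

(** The distance to the ends is a minimum of two terms, so its inverse square is bounded by the sum
    of two telescoping differences, one for each end. *)
Lemma telescope_inv_sqr (x y : R) : 1 <= x -> 2 <= y ->
  / (Rmin x y) ^ 2 <= 2 * (/ x - / (x + 1)) + 2 * (/ (y - 1) - / y).
Proof.
  intros Hx Hy.
  assert (H1 : / x ^ 2 <= 2 * (/ x - / (x + 1))).
  { replace (2 * (/ x - / (x + 1))) with (2 * / (x * (x + 1))) by (field; lra).
    replace (2 * / (x * (x + 1))) with (/ (x * (x + 1) / 2)) by (field; lra).
    apply Rinv_le_contravar; [|simpl]; nra. }
  assert (H2 : / y ^ 2 <= 2 * (/ (y - 1) - / y)).
  { replace (2 * (/ (y - 1) - / y)) with (/ (y * (y - 1) / 2)) by (field; lra).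
    apply Rinv_le_contravar; [|simpl]; nra. }
  assert (H3 : 0 <= / x ^ 2) by (apply Rlt_le, Rinv_0_lt_compat; nra).
  assert (H4 : 0 <= / y ^ 2) by (apply Rlt_le, Rinv_0_lt_compat; nra).
  unfold Rmin. destruct (Rle_dec x y); lra.
Qed.

(** Summation of [bulk_step] by induction. The a priori bound [eps = O(lam / m)] that each step
    requires is recovered from the accumulated estimate, because the potential itself varies by only
    [O(lam / m)] during the transit. *)
Lemma bulk_sum (a b03 b30 : C) (b c beta C0 Mp Ms Ke d0 KPhi : R) (Phi : R -> R) :
  0 < c -> b = c ^ 2 + 1 / 4 -> 0 <= C0 -> 0 <= Mp -> 0 <= Ms -> 0 <= Ke -> 0 < d0 -> 0 <= KPhi ->
  (forall x, 0 < x < PI -> is_derive Phi x (exp (- (x / c)) * ln (sin x) / c)) ->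
  (forall x, 0 < x < PI -> Rabs (Phi x) <= KPhi) ->
  exists M l0, 0 < M /\ 1 <= l0 /\
  forall (m N l : nat) (sg : R) (ph : C) (Z W : nat -> C),
  let mr := INR m in let lam := ln mr in let th := fun n => transit_angle mr (INR N) (INR n) in
  let pot := fun n => transit_pot a b03 b30 b c mr Phi (INR n) (th n) (Z n) in
  l0 <= mr -> l0 * lam <= INR l -> l0 * INR l <= mr ->
  Rabs sg <= Ms -> INR N = exp (PI / c) * mr + beta * lam + sg -> Cmod ph <= Mp ->
  (forall n, (m <= n <= N)%nat -> Z n <> 0 /\
     Cmod (/ Z n - (INR n + (1 - a) * ln (INR n) + ph)) <= 1) ->
  (forall n, (m <= n < N)%nat ->
     Cmod (Z (S n) - (Z n - Z n ^ 2 + a * Z n ^ 3)) <= C0 * Cmod (Z n) ^ 4) ->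
  (forall n, (m <= n < N)%nat -> Cmod (Z n) < d0 -> Cmod (W n) < d0 ->
     Cmod (W (S n) - (W n + W n ^ 2 + b * Z n ^ 2 + b03 * W n ^ 3 + b30 * Z n ^ 3))
       <= C0 * (Cmod (Z n) + Cmod (W n)) ^ 4) ->
  forall eps0, let s := (m + l)%nat in
  transit_rel c (sin (th s)) (cos (th s)) (Z s) (W s) eps0 -> Cmod eps0 <= Ke * lam / mr ->
  let e := (N - l)%nat in
  (s <= e <= N)%nat /\
  exists eps1, transit_rel c (sin (th e)) (cos (th e)) (Z e) (W e) eps1 /\
    Cmod eps1 <= M * lam / mr /\
    Cmod (eps1 - eps0 - (pot e - pot s)) <= M * (lam / (mr * INR l) + lam ^ 2 / mr ^ 2).
Proof.
  intros Hc Hb HC0 HMp HMs HKe Hd0 HKP HPhi HPhiB.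
  destruct (transit_env c beta Ms Hc HMs) as (Kt & mt & HKt & Hmt & Henv).
  destruct (zeta_env (1 - a) Mp Kt HMp HKt) as (Kz & mz & HKz & Hmz & Hzenv).
  set (t1 := Cmod (trig1 a b03 b30 b c)). set (t2 := Cmod (trig2 a b03 b30 b c)).
  set (t3 := Cmod (cst1 a b03 b30 b)). set (Bm := Cmod (1 - b03)).
  assert (Hpos : 0 <= t1 /\ 0 <= t2 /\ 0 <= t3 /\ 0 <= Bm) by (repeat split; apply Cmod_ge_0).
  destruct Hpos as (Pt1 & Pt2 & Pt3 & PBm).
  assert (HLK : 0 <= ln Kt) by (rewrite <- ln_1; apply ln_le; lra).
  set (KF1 := c * Kz + c * (t1 + t2 + t3) + c * Bm * (Kt + KPhi)).
  set (KF := 2 * KF1 + Kt * ln Kt).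
  assert (P1 : 0 <= c * Kz) by (apply Rmult_le_pos; lra).
  assert (P2 : 0 <= c * (t1 + t2 + t3)) by (apply Rmult_le_pos; lra).
  assert (P3 : 0 <= c * Bm * (Kt + KPhi)) by (repeat apply Rmult_le_pos; lra).
  assert (P4 : 0 <= Kt * ln Kt) by (apply Rmult_le_pos; lra).
  set (K := Kt + Kz + Ke + KF + 1).
  assert (HKF1 : 0 <= KF1) by (unfold KF1; lra).
  assert (HKF : 0 <= KF) by (unfold KF; lra).
  assert (HK : 1 <= K /\ Kt <= K /\ Kz <= K) by (unfold K; lra).
  destruct HK as (HK1 & HKtK & HKzK).
  destruct (bulk_step a b03 b30 b c C0 K Hc Hb HC0 HK1) as (M1 & m0 & HM1 & Hm0 & Hstep).
  set (Wb := 2 * (Kz + 4 * c * Kz * Kt) / d0).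
  assert (HWb : 0 < Wb).
  { unfold Wb. apply Rdiv_lt_0_compat; [|exact Hd0].
    assert (0 < c * Kz * Kt) by (repeat apply Rmult_lt_0_compat; lra). lra. }
  assert (Hal : 1 < exp (PI / c)).
  { rewrite <- exp_0. apply exp_increasing. apply Rdiv_lt_0_compat; [apply PI_RGT_0 | exact Hc]. }
  assert (H8 : 0 < 8 / (exp (PI / c) - 1)) by (apply Rdiv_lt_0_compat; lra).
  set (l0 := 8 / (exp (PI / c) - 1) + mt + mz + m0 + 2 * K * Kt + Wb + 8 * M1 + 2 * M1 * Kt + 2).
  assert (HKK : 1 <= K * Kt) by (rewrite <- (Rmult_1_l 1); apply Rmult_le_compat; lra).
  assert (HMK : 0 < M1 * Kt) by (apply Rmult_lt_0_compat; lra).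
  assert (Hl0 : mt <= l0 /\ mz <= l0 /\ m0 <= l0 /\ 2 * K * Kt <= l0 /\ Wb + 1 <= l0 /\
    8 * M1 <= l0 /\ 2 * M1 * Kt <= l0 /\ 2 <= l0 /\ 8 / (exp (PI / c) - 1) <= l0) by (unfold l0; repeat split; lra).
  destruct Hl0 as (L1 & L2 & L3 & L4 & L5 & L6 & L7 & L8 & L9). clearbody l0.
  exists (K + M1 * (4 + Kt)), l0.
  assert (HM4 : 0 < M1 * (4 + Kt)) by (apply Rmult_lt_0_compat; lra).
  split; [lra|]. split; [lra|].
  intros m N l sg ph Z W mr lam th pot Hmr Hl Hlm Hsg HN Hph HZ HZd HWd eps0 s Hrel0 Heps0 e.
  destruct (Henv mr (INR N) sg ltac:(lra) Hsg HN) as (Hlam & Hsmall & HNlo & HNlo' & HNhi & _ & Hck & Hn).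
  fold lam in Hlam, Hsmall, Hck, Hn.
  assert (Hl1 : l0 <= INR l).
  { apply Rle_trans with (2 := Hl). rewrite <- (Rmult_1_r l0) at 1. apply Rmult_le_compat_l; lra. }
  assert (Hmr0 : 0 < mr) by lra.
  assert (Hl4 : 2 * INR l + 4 <= INR N - mr).
  { assert (G1 : l0 * INR l * ((exp (PI / c) - 1) / 2) <= INR N - mr).
    { eapply Rle_trans; [|exact HNlo']. apply Rmult_le_compat_r; lra. }
    assert (G2 : 4 * INR l <= l0 * INR l * ((exp (PI / c) - 1) / 2)).
    { replace (4 * INR l) with (8 / (exp (PI / c) - 1) * INR l * ((exp (PI / c) - 1) / 2)) by (field; lra).
      apply Rmult_le_compat_r; [lra|]. apply Rmult_le_compat_r; lra. }
    lra. }
  assert (Hse : (s <= e <= N)%nat).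
  { unfold s, e. split; [|lia]. apply INR_le. rewrite plus_INR, minus_INR.
    - fold mr. lra.
    - apply INR_le. lra. }
  split; [exact Hse|].
  assert (HlN : (l <= N)%nat) by (apply INR_le; lra).
  assert (HrangeR : forall n, (s <= n <= e)%nat -> mr + INR l <= INR n <= INR N - INR l).
  { intros n [H1 H2]. apply le_INR in H1. apply le_INR in H2. unfold s, e in *.
    rewrite plus_INR in H1. rewrite minus_INR in H2 by exact HlN. fold mr in H1. lra. }
  assert (Hlm0 : 0 < lam / mr) by (apply Rdiv_lt_0_compat; lra).
  assert (Him : / mr <= lam / mr).
  { unfold Rdiv. rewrite <- (Rmult_1_l (/ mr)) at 1. apply Rmult_le_compat_r; [|lra].
    apply Rlt_le, Rinv_0_lt_compat; lra. }
  assert (Hzf : forall n, (s <= n <= e)%nat ->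
    0 < Re (/ Z n) /\ 0 < Cmod (Z n) <= Kz / mr /\ Cmod (Z n - (/ INR n)%R) <= Kz * lam / mr ^ 2 /\
    Cmod (Clog (/ Z n) - ln (INR n)) <= Kz * (lam / mr)).
  { intros n Hs. pose proof (HrangeR n Hs) as Hr.
    destruct (HZ n ltac:(unfold s, e in Hs; lia)) as [Hzn Hz1].
    destruct (Hzenv mr (INR n) (/ Z n)%C ph ltac:(lra) ltac:(lra) Hph Hz1) as (G1 & _ & G2 & G3 & G4).
    replace (/ / Z n)%C with (Z n) in G2, G3 by (field; exact Hzn). auto. }
  (* The large terms [c ln n] and [theta] nearly cancel: their difference varies by the speed
     mismatch times [ln (n / s)]. Every other term of the potential is already [O(lam / m)]. *)
  assert (Hpot : forall n, (s <= n <= e)%nat -> Cmod (pot n - pot s) <= KF * (lam / mr)).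
  { assert (Hpot1 : forall n, (s <= n <= e)%nat ->
      Cmod (pot n - (c * ln (INR n) - th n)%R) <= KF1 * (lam / mr)).
    { intros n Hs. destruct (Hzf n Hs) as (_ & _ & _ & G4). pose proof (HrangeR n Hs) as Hr.
      destruct (Hn (INR n) ltac:(lra)) as (_ & Q2 & _ & _ & Q5 & _).
      fold (th n) in Q2, Q5.
      destruct (Q5 (th n) ltac:(lra)) as (Q6 & _ & Q7).
      unfold pot, transit_pot.
      set (x := th n) in *.
      assert (Hinr : 0 < / INR n <= / mr).
      { split; [apply Rinv_0_lt_compat; lra | apply Rinv_le_contravar; lra]. }
      assert (Hcc : Cmod c <= c) by (rewrite Cmod_R, Rabs_pos_eq; lra).
      assert (Hu : forall u, Rabs u <= 1 -> Cmod (u / INR n)%R <= / mr).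
      { intros u Hu. rewrite Cmod_R. unfold Rdiv. rewrite Rabs_mult, (Rabs_pos_eq (/ INR n)) by lra.
        rewrite <- (Rmult_1_l (/ mr)). apply Rmult_le_compat; [apply Rabs_pos | lra | exact Hu | lra]. }
      destruct sin_sqr_derive as (_ & _ & Ds). destruct sin_cos_derive as (_ & _ & Dc).
      assert (H1 : Cmod (sin x ^ 2 / INR n)%R <= / mr) by (apply Hu; apply Ds).
      assert (H2 : Cmod (sin x * cos x / INR n)%R <= / mr) by (apply Hu; apply Dc).
      assert (H3 : Cmod (/ INR n)%R <= / mr) by (rewrite Cmod_R, Rabs_pos_eq; lra).
      assert (H4 : Cmod (ln (sin x) / INR n + Phi x / mr)%R <= (Kt + KPhi) * (lam / mr)).
      { rewrite Cmod_R. eapply Rle_trans; [apply Rabs_triang|]. rewrite Rmult_plus_distr_r.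
        apply Rplus_le_compat.
        - unfold Rdiv. rewrite Rabs_mult, (Rabs_pos_eq (/ INR n)) by lra. rewrite <- Rmult_assoc.
          apply Rmult_le_compat; [apply Rabs_pos | lra | exact Q7 | lra].
        - unfold Rdiv. rewrite Rabs_mult, (Rabs_pos_eq (/ mr)) by (apply Rlt_le, Rinv_0_lt_compat; lra).
          apply Rmult_le_compat; [apply Rabs_pos | apply Rlt_le, Rinv_0_lt_compat; lra |
            apply HPhiB; exact Q6 | exact Him]. }
      replace (c * Clog (/ Z n) - x + c * (trig1 a b03 b30 b c * (sin x ^ 2 / INR n)%R
          + trig2 a b03 b30 b c * (sin x * cos x / INR n)%R - cst1 a b03 b30 b * (/ INR n)%R)
          + c * (1 - b03) * (ln (sin x) / INR n + Phi x / mr)%R - (c * ln (INR n) - x)%R)%C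
        with (c * (Clog (/ Z n) - ln (INR n)) + c * (trig1 a b03 b30 b c * (sin x ^ 2 / INR n)%R
          + trig2 a b03 b30 b c * (sin x * cos x / INR n)%R - cst1 a b03 b30 b * (/ INR n)%R)
          + c * (1 - b03) * (ln (sin x) / INR n + Phi x / mr)%R)%C
        by (rewrite RtoC_minus, RtoC_mult; ring).
      eapply Rle_trans.
      { apply Cadd_le; [apply Cadd_le|].
        - apply Cmul_le; [exact Hcc | exact G4].
        - apply Cmul_le; [exact Hcc|]. apply Csub_le; [apply Cadd_le|];
          (apply Cmul_le; [apply Rle_refl | eassumption]).
        - apply Cmul_le; [apply Cmul_le; [exact Hcc | apply Rle_refl] | exact H4]. }
      fold t1 t2 t3 Bm. unfold KF1.
      assert (c * (t1 * / mr + t2 * / mr + t3 * / mr) <= c * (t1 + t2 + t3) * (lam / mr)).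
      { replace (t1 * / mr + t2 * / mr + t3 * / mr) with ((t1 + t2 + t3) * / mr) by ring.
        rewrite <- Rmult_assoc. apply Rmult_le_compat_l; [exact P2 | exact Him]. }
      lra. }
    intros n Hs. pose proof (HrangeR n Hs) as Hr.
    pose proof (Hpot1 n Hs) as B1. pose proof (Hpot1 s ltac:(lia)) as B2.
    pose proof (HrangeR s ltac:(lia)) as Hrs.
    assert (B3 : Rabs (c * ln (INR n) - th n - (c * ln (INR s) - th s)) <= Kt * ln Kt * (lam / mr)).
    { unfold th, transit_angle. rewrite !ln_div by lra. set (ck := transit_speed mr (INR N)) in *.
      replace (c * ln (INR n) - ck * (ln (INR n) - ln mr) - (c * ln (INR s) - ck * (ln (INR s) - ln mr)))
        with (- (ck - c) * (ln (INR n) - ln (INR s))) by ring.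
      rewrite Rabs_mult, Rabs_Ropp.
      apply Rle_trans with (Kt * lam / mr * ln Kt).
      - apply Rmult_le_compat; [apply Rabs_pos | apply Rabs_pos | exact Hck |].
        assert (Hns : INR s <= INR n) by (apply le_INR; lia).
        assert (ln (INR s) <= ln (INR n)) by (apply ln_le; lra).
        rewrite Rabs_pos_eq by lra.
        assert (ln mr <= ln (INR s)) by (apply ln_le; lra).
        assert (ln (INR n) <= ln (Kt * mr)) by (apply ln_le; lra).
        rewrite ln_mult in H1 by lra. lra.
      - right. field. lra. }
    replace (pot n - pot s)%C with ((pot n - (c * ln (INR n) - th n)%R) - (pot s - (c * ln (INR s) - th s)%R)
      + (c * ln (INR n) - th n - (c * ln (INR s) - th s))%R)%C by (rewrite !RtoC_minus; ring).
    eapply Rle_trans; [apply Cadd_le; [apply Csub_le; [exact B1 | exact B2] | rewrite Cmod_R; exact B3]|].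
    unfold KF. lra. }
  (* An increasing function whose increment dominates the error of one step, by [telescope_inv_sqr];
     its total variation is the announced bound. *)
  set (Psi := fun n => lam / mr * (- (2 * / (INR n - mr)) + 2 * / (INR N - INR n)) + INR n * (lam ^ 2 / mr ^ 3)).
  assert (Hl3 : 0 <= lam ^ 2 / mr ^ 3).
  { apply Rdiv_le_0_compat; [apply pow2_ge_0 | apply pow_lt; lra]. }
  assert (HPsi : forall n, (s <= n <= e)%nat ->
    Psi n - Psi s <= 4 * (lam / (mr * INR l)) + Kt * (lam ^ 2 / mr ^ 2)).
  { intros n Hs. pose proof (HrangeR n Hs) as Hr. pose proof (HrangeR s ltac:(lia)) as Hrs.
    assert (Es : INR s - mr = INR l) by (unfold s; rewrite plus_INR; fold mr; ring).
    unfold Psi. rewrite Es.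
    assert (G1 : 0 < / (INR n - mr)) by (apply Rinv_0_lt_compat; lra).
    assert (G2 : / (INR N - INR n) <= / INR l) by (apply Rinv_le_contravar; lra).
    assert (G3 : 0 < / (INR N - INR s)) by (apply Rinv_0_lt_compat; lra).
    assert (G4 : (INR n - INR s) * (lam ^ 2 / mr ^ 3) <= Kt * (lam ^ 2 / mr ^ 2)).
    { replace (Kt * (lam ^ 2 / mr ^ 2)) with (Kt * mr * (lam ^ 2 / mr ^ 3)) by (field; lra).
      apply Rmult_le_compat_r; lra. }
    replace (4 * (lam / (mr * INR l))) with (lam / mr * (4 * / INR l)) by (field; lra).
    assert (lam / mr * (- (2 * / (INR n - mr)) + 2 * / (INR N - INR n) + 2 * / INR l - 2 * / (INR N - INR s))
      <= lam / mr * (4 * / INR l)) by (apply Rmult_le_compat_l; lra).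
    lra. }
  assert (Hlam_m : l0 * (lam / mr) <= 1).
  { apply Rmult_le_reg_r with mr; [lra|]. replace (l0 * (lam / mr) * mr) with (l0 * lam) by (field; lra).
    assert (1 * INR l <= l0 * INR l) by (apply Rmult_le_compat_r; lra). lra. }
  (* For [l] and [m / lam] large the accumulated error is at most [lam / m], one unit in the
     constant [K]; this closes the bootstrap. *)
  assert (Htot : forall n, (s <= n <= e)%nat -> M1 * (Psi n - Psi s) <= lam / mr).
  { intros n Hs. apply Rle_trans with (M1 * (4 * (lam / (mr * INR l)) + Kt * (lam ^ 2 / mr ^ 2))).
    - apply Rmult_le_compat_l; [lra | apply HPsi, Hs].
    - replace (M1 * (4 * (lam / (mr * INR l)) + Kt * (lam ^ 2 / mr ^ 2))) with
        (lam / mr * (4 * M1 / INR l + M1 * Kt * (lam / mr))) by (field; lra).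
      rewrite <- (Rmult_1_r (lam / mr)) at 3. apply Rmult_le_compat_l; [lra|].
      assert (4 * M1 / INR l <= / 2).
      { apply Rmult_le_reg_r with (INR l); [lra|]. replace (4 * M1 / INR l * INR l) with (4 * M1) by (field; lra). lra. }
      assert (2 * M1 * Kt * (lam / mr) <= l0 * (lam / mr)) by (apply Rmult_le_compat_r; lra). lra. }
  assert (Hmain : forall j, (s + j <= e)%nat -> exists eps, let n := (s + j)%nat in
    transit_rel c (sin (th n)) (cos (th n)) (Z n) (W n) eps /\
    Cmod (eps - eps0 - (pot n - pot s)) <= M1 * (Psi n - Psi s)).
  { induction j as [|j IH]; intros Hj.
    - exists eps0. rewrite Nat.add_0_r. split; [exact Hrel0|].
      replace (eps0 - eps0 - (pot s - pot s))%C with (RtoC 0) by ring. rewrite Cmod_0. lra.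
    - destruct (IH ltac:(lia)) as (eps & Hrel & Heps). clear IH.
      rewrite Nat.add_succ_r in *. set (n := (s + j)%nat) in *. cbv zeta in Hrel, Heps.
      assert (Hns : (s <= n <= e)%nat) by lia. assert (Hns' : (s <= S n <= e)%nat) by lia.
      pose proof (HrangeR n Hns) as Hr. pose proof (HrangeR (S n) Hns') as Hr'.
      assert (ESn : INR (S n) = INR n + 1) by apply S_INR.
      destruct (Hn (INR n) ltac:(lra)) as (Q1 & Q2 & Q3 & Q4 & Q5 & Q6).
      rewrite <- ESn in Q2, Q3, Q4, Q5. fold (th n) (th (S n)) in Q2, Q3, Q4, Q5, Q6.
      set (rho := Rmin (INR n - mr) (INR N - INR n)) in *.
      assert (Hrho : INR l <= rho) by (apply Rmin_glb; lra).
      assert (Heb : Cmod eps <= K * lam / mr).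
      { replace eps with ((eps - eps0 - (pot n - pot s)) + eps0 + (pot n - pot s))%C by ring.
        eapply Rle_trans; [apply Cadd_le; [apply Cadd_le; [exact Heps | exact Heps0] | apply Hpot, Hns]|].
        pose proof (Htot n Hns). unfold K.
        replace ((Kt + Kz + Ke + KF + 1) * lam / mr) with
          (Ke * lam / mr + KF * (lam / mr) + lam / mr + (Kt + Kz) * (lam / mr)) by (field; lra).
        assert (0 <= (Kt + Kz) * (lam / mr)) by (apply Rmult_le_pos; lra). lra. }
      destruct (Hzf n Hns) as (Z1 & Z2 & Z3 & _). destruct (Hzf (S n) Hns') as (Z1' & _).
      destruct (Q5 (th n) ltac:(lra)) as (Q7 & Q8 & _).
      assert (HS0 : 0 < sin (th n)) by (apply sin_gt_0; lra).
      (* Checks that the fiber coordinate is still in the domain of the local expansion before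
         applying it. *)
      assert (HWn : Cmod (W n) < d0).
      { assert (HKm : 0 < Kt * mr) by (apply Rmult_lt_0_compat; lra).
        assert (Hre : Cmod eps <= sin (th n) / 2).
        { eapply Rle_trans; [exact Heb|]. apply Rle_trans with (rho / (Kt * mr) / 2); [|lra].
          apply Rmult_le_reg_r with (2 * Kt * mr); [lra|].
          replace (K * lam / mr * (2 * Kt * mr)) with (2 * K * Kt * lam) by (field; lra).
          replace (rho / (Kt * mr) / 2 * (2 * Kt * mr)) with rho by (field; lra).
          eapply Rle_trans; [|exact Hrho]. eapply Rle_trans; [|exact Hl]. apply Rmult_le_compat_r; lra. }
        pose proof (sin2_cos2 (th n)) as Hsc. unfold Rsqr in Hsc.
        assert (Hsc2 : sin (th n) ^ 2 + cos (th n) ^ 2 = 1) by (simpl; lra).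
        pose proof (transit_rel_bound c _ _ _ _ _ Hc HS0 Hsc2 Hre Hrel) as HW.
        eapply Rle_lt_trans; [exact HW|].
        assert (Hsi : / sin (th n) <= Kt * mr / INR l).
        { replace (Kt * mr / INR l) with (/ (INR l / (Kt * mr))) by (field; lra).
          apply Rinv_le_contravar; [apply Rdiv_lt_0_compat; lra|].
          eapply Rle_trans; [|exact Q8]. apply Rmult_le_compat_r; [apply Rlt_le, Rinv_0_lt_compat; lra | exact Hrho]. }
        apply Rle_lt_trans with (Kz / mr * (1 + 4 * c * (Kt * mr / INR l))).
        - apply Rmult_le_compat; [apply Cmod_ge_0 | | apply Z2 |].
          + assert (0 < / sin (th n)) by (apply Rinv_0_lt_compat; lra).
            assert (0 <= 4 * c * / sin (th n)) by (repeat apply Rmult_le_pos; lra). lra.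
          + apply Rplus_le_compat_l. apply Rmult_le_compat_l; lra.
        - replace (Kz / mr * (1 + 4 * c * (Kt * mr / INR l))) with (Kz * / mr + 4 * c * Kz * Kt * / INR l) by (field; lra).
          assert (HlWb : / INR l < / Wb) by (apply Rinv_lt_contravar; [apply Rmult_lt_0_compat|]; lra).
          assert (HmWb : / mr < / Wb) by (apply Rinv_lt_contravar; [apply Rmult_lt_0_compat|]; lra).
          assert (0 < c * Kz * Kt) by (repeat apply Rmult_lt_0_compat; lra).
          apply Rlt_trans with ((Kz + 4 * c * Kz * Kt) * / Wb).
          + rewrite Rmult_plus_distr_r. apply Rplus_lt_compat; apply Rmult_lt_compat_l; lra.
          + unfold Wb. replace ((Kz + 4 * c * Kz * Kt) * / (2 * (Kz + 4 * c * Kz * Kt) / d0)) with (d0 / 2) by (field; lra). lra. }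
      assert (HZn : Cmod (Z n) < d0).
      { eapply Rle_lt_trans; [apply Z2|].
        apply Rmult_lt_reg_r with (mr * / d0); [apply Rmult_lt_0_compat; [lra | apply Rinv_0_lt_compat; lra]|].
        replace (Kz / mr * (mr * / d0)) with (Kz / d0) by (field; lra).
        replace (d0 * (mr * / d0)) with mr by (field; lra).
        assert (Kz / d0 <= Wb).
        { unfold Wb, Rdiv. apply Rmult_le_compat_r; [apply Rlt_le, Rinv_0_lt_compat; lra|].
          assert (0 < c * Kz * Kt) by (repeat apply Rmult_lt_0_compat; lra). lra. }
        lra. }
      assert (Hnat : (m <= n < N)%nat) by (unfold n, s, e in *; lia).
      assert (HmonK : forall u v, 0 <= u -> 0 <= v -> Kt * u * v <= K * u * v).
      { intros u v Hu Hv. apply Rmult_le_compat_r; [exact Hv|]. apply Rmult_le_compat_r; lra. }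
      assert (Him0 : 0 < / mr) by (apply Rinv_0_lt_compat; lra).
      destruct (Hstep mr (INR n) lam rho (th n) (th (S n)) (Z n) (W n) (Z (S n)) (W (S n)) eps Phi)
        as (eps' & Hrel' & Heps'); try assumption.
      { lra. }
      { lra. }
      { eapply Rle_trans; [|exact Hrho]. eapply Rle_trans; [|exact Hl]. apply Rmult_le_compat_r; lra. }
      { eapply Rle_trans; [exact Q1|]. apply Rmult_le_compat_r; lra. }
      { eapply Rle_trans; [exact Q3|]. apply Rmult_le_compat_r; lra. }
      { eapply Rle_trans; [exact Q4|]. unfold Rdiv. apply HmonK; [lra|].
        apply Rlt_le, Rinv_0_lt_compat, pow_lt; lra. }
      { intros x Hx. destruct (Q5 x Hx) as (_ & Hq & _). eapply Rle_trans; [|exact Hq].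
        unfold Rdiv. apply Rmult_le_compat_l; [lra|]. apply Rinv_le_contravar; [apply Rmult_lt_0_compat; lra|].
        apply Rmult_le_compat_r; lra. }
      { intros x Hx. destruct (Q5 x Hx) as (_ & _ & Hq). eapply Rle_trans; [exact Hq|].
        apply Rmult_le_compat_r; lra. }
      { intros x _ Hx. apply HPhi. apply (Q5 x Hx). }
      { eapply Rle_trans; [exact Q6|]. unfold Rdiv. apply HmonK; lra. }
      { split; [apply Z2|]. eapply Rle_trans; [apply Z2|]. apply Rmult_le_compat_r; lra. }
      { eapply Rle_trans; [exact Z3|]. unfold Rdiv. apply Rmult_le_compat_r; [apply Rlt_le, Rinv_0_lt_compat, pow_lt; lra|].
        apply Rmult_le_compat_r; lra. }
      { apply HZd, Hnat. }
      { apply HWd; assumption. }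
      exists eps'. split; [exact Hrel'|]. rewrite <- ESn in Heps'. fold (pot (S n)) (pot n) in Heps'.
      replace (eps' - eps0 - (pot (S n) - pot s))%C with
        ((eps' - eps - (pot (S n) - pot n)) + (eps - eps0 - (pot n - pot s)))%C by ring.
      eapply Rle_trans; [apply Cadd_le; [exact Heps' | exact Heps]|].
      rewrite <- Rmult_plus_distr_l. apply Rmult_le_compat_l; [lra|].
      pose proof (telescope_inv_sqr (INR n - mr) (INR N - INR n) ltac:(lra) ltac:(lra)) as HT.
      fold rho in HT. unfold Psi. rewrite ESn.
      replace (INR n + 1 - mr) with (INR n - mr + 1) by ring.
      replace (INR N - (INR n + 1)) with (INR N - INR n - 1) by ring.
      assert (Hrho0 : 0 < rho) by lra.
      replace (lam / (mr * rho ^ 2)) with (lam / mr * / rho ^ 2) by (field; lra).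
      apply (Rmult_le_compat_l (lam / mr)) in HT; [|lra]. lra. }
  destruct (Hmain (e - s)%nat ltac:(lia)) as (eps1 & Hrel1 & Heps1).
  replace (s + (e - s))%nat with e in Hrel1, Heps1 by lia. cbv zeta in Hrel1, Heps1.
  exists eps1. split; [exact Hrel1|].
  assert (Hee : (s <= e <= e)%nat) by lia. split.
  - replace eps1 with ((eps1 - eps0 - (pot e - pot s)) + eps0 + (pot e - pot s))%C by ring.
    eapply Rle_trans; [apply Cadd_le; [apply Cadd_le; [exact Heps1 | exact Heps0] | apply Hpot, Hee]|].
    pose proof (Htot e Hee). unfold K.
    replace ((Kt + Kz + Ke + KF + 1 + M1 * (4 + Kt)) * lam / mr) with
      (Ke * lam / mr + KF * (lam / mr) + lam / mr + (Kt + Kz + M1 * (4 + Kt)) * (lam / mr)) by (field; lra).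
    assert (0 <= (Kt + Kz + M1 * (4 + Kt)) * (lam / mr)) by (apply Rmult_le_pos; lra). lra.
  - eapply Rle_trans; [exact Heps1|].
    apply Rle_trans with (M1 * (4 * (lam / (mr * INR l)) + Kt * (lam ^ 2 / mr ^ 2))).
    + apply Rmult_le_compat_l; [lra | apply HPsi, Hee].
    + assert (G1 : 0 <= lam / (mr * INR l)).
      { apply Rdiv_le_0_compat; [lra|]. apply Rmult_lt_0_compat; lra. }
      assert (G2 : 0 <= lam ^ 2 / mr ^ 2).
      { apply Rdiv_le_0_compat; [apply pow2_ge_0 | apply pow_lt; lra]. }
      set (u := lam / (mr * INR l)) in *. set (v := lam ^ 2 / mr ^ 2) in *.
      apply Rle_trans with (M1 * (4 + Kt) * (u + v)).
      * rewrite Rmult_assoc. apply Rmult_le_compat_l; [lra|].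
        assert (0 <= Kt * u) by (apply Rmult_le_pos; lra). lra.
      * apply Rmult_le_compat_r; lra.
Qed.

(** * Asymptotics along a sequence of transits *)

Definition o1 (f : nat -> C) : Prop :=
  forall eps, 0 < eps -> eventually (fun k => Cmod (f k) < eps).

Lemma o1_ext (f g : nat -> C) : eventually (fun k => f k = g k) -> o1 f -> o1 g.
Proof.
  intros E Hf eps He. generalize (filter_and _ _ E (Hf eps He)). apply filter_imp.
  intros k [Ek Hk]. rewrite <- Ek. exact Hk.
Qed.

Lemma o1_plus (f g : nat -> C) : o1 f -> o1 g -> o1 (fun k => f k + g k)%C.
Proof.
  intros Hf Hg eps He. assert (He2 : 0 < eps / 2) by lra.
  generalize (filter_and _ _ (Hf _ He2) (Hg _ He2)). apply filter_imp.
  intros k [H1 H2]. eapply Rle_lt_trans; [apply Cmod_triangle|]. lra.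
Qed.

Lemma o1_bounded_mult (f g : nat -> C) (M : R) :
  eventually (fun k => Cmod (f k) <= M) -> o1 g -> o1 (fun k => f k * g k)%C.
Proof.
  intros Hf Hg eps He.
  assert (HM : 0 < Rabs M + 1) by (pose proof (Rabs_pos M); lra).
  assert (He2 : 0 < eps / (Rabs M + 1)) by (apply Rdiv_lt_0_compat; lra).
  generalize (filter_and _ _ Hf (Hg _ He2)).
  apply filter_imp. intros k [H1 H2]. rewrite Cmod_mult.
  pose proof (Rle_abs M). pose proof (Cmod_ge_0 (g k)).
  apply Rle_lt_trans with ((Rabs M + 1) * Cmod (g k)); [apply Rmult_le_compat_r; lra|].
  apply (Rmult_lt_compat_l (Rabs M + 1)) in H2; [|lra].
  replace ((Rabs M + 1) * (eps / (Rabs M + 1))) with eps in H2 by (field; lra). exact H2.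
Qed.

Lemma o1_scal (a : C) (g : nat -> C) : o1 g -> o1 (fun k => a * g k)%C.
Proof.
  intros Hg. apply (o1_bounded_mult (fun _ => a) g (Cmod a)); [|exact Hg].
  exists 0%nat. intros. lra.
Qed.

Lemma o1_opp (g : nat -> C) : o1 g -> o1 (fun k => - g k)%C.
Proof.
  intros Hg eps He. generalize (Hg eps He). apply filter_imp. intros k H. rewrite Cmod_opp. exact H.
Qed.

Lemma o1_minus (f g : nat -> C) : o1 f -> o1 g -> o1 (fun k => f k - g k)%C.
Proof. intros Hf Hg. apply (o1_plus f (fun k => - g k)%C); [exact Hf | apply o1_opp, Hg]. Qed.

Section Scales.

(** [m] is the starting time and [L] the length of the stages at both ends of a
    transit; [bO f p q] means [f = O(m ^ - p L ^ q)]. *)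
Variables (m L : nat -> R).
Hypotheses (Hm : eventually (fun k => 1 <= m k)) (HL : eventually (fun k => 1 <= L k))
  (HL4 : eventually (fun k => L k ^ 4 <= m k))
  (HLinf : forall x, eventually (fun k => x <= L k)).

Definition scale (p q : nat) (k : nat) : R := (/ m k) ^ p * L k ^ q.

Definition bO (f : nat -> C) (p q : nat) : Prop :=
  exists M, 0 <= M /\ eventually (fun k => Cmod (f k) <= M * scale p q k).

Lemma scale_mult p q p' q' k : scale p q k * scale p' q' k = scale (p + p') (q + q') k.
Proof. unfold scale. rewrite !pow_add. ring. Qed.

Lemma bO_ext f g p q : eventually (fun k => f k = g k) -> bO f p q -> bO g p q.
Proof.
  intros E (M & HM & H). exists M. split; [exact HM|].
  generalize (filter_and _ _ E H). apply filter_imp. intros k [Ek Hk]. rewrite <- Ek. exact Hk.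
Qed.

Lemma bO_plus f g p q : bO f p q -> bO g p q -> bO (fun k => f k + g k)%C p q.
Proof.
  intros (M & HM & H) (M' & HM' & H'). exists (M + M'). split; [lra|].
  generalize (filter_and _ _ H H'). apply filter_imp. intros k [H1 H2].
  eapply Rle_trans; [apply Cadd_le; eassumption|]. lra.
Qed.

Lemma bO_opp f p q : bO f p q -> bO (fun k => - f k)%C p q.
Proof.
  intros (M & HM & H). exists M. split; [exact HM|]. revert H. apply filter_imp.
  intros k. rewrite Cmod_opp. auto.
Qed.

Lemma bO_minus f g p q : bO f p q -> bO g p q -> bO (fun k => f k - g k)%C p q.
Proof. intros Hf Hg. apply (bO_plus f (fun k => - g k)%C); [exact Hf | apply bO_opp, Hg]. Qed.

Lemma bO_mult f g p q p' q' : bO f p q -> bO g p' q' -> bO (fun k => f k * g k)%C (p + p') (q + q').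
Proof.
  intros (M & HM & H) (M' & HM' & H'). exists (M * M'). split; [apply Rmult_le_pos; assumption|].
  generalize (filter_and _ _ H H'). apply filter_imp. intros k [H1 H2].
  eapply Rle_trans; [apply Cmul_le; eassumption|]. rewrite <- scale_mult. right. ring.
Qed.

Lemma bO_bounded f M : eventually (fun k => Cmod (f k) <= M) -> bO f 0 0.
Proof.
  intros H. exists (Rabs M). split; [apply Rabs_pos|]. revert H. apply filter_imp.
  intros k Hk. unfold scale. simpl. rewrite !Rmult_1_r. pose proof (Rle_abs M). lra.
Qed.

Lemma bO_const (a : C) : bO (fun _ => a) 0 0.
Proof. apply bO_bounded with (Cmod a). exists 0%nat. intros. lra. Qed.

Lemma bO_scal (a : C) f p q : bO f p q -> bO (fun k => a * f k)%C p q.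
Proof. intros H. apply (bO_mult (fun _ => a) f 0 0 p q); [apply bO_const | exact H]. Qed.

Lemma bO_L : bO (fun k => L k) 0 1.
Proof.
  exists 1. split; [lra|]. revert HL. apply filter_imp. intros k Hk. unfold scale. simpl.
  rewrite Cmod_R, Rabs_pos_eq; lra.
Qed.

Lemma bO_inv_m : bO (fun k => (/ m k)%R) 1 0.
Proof.
  exists 1. split; [lra|]. revert Hm. apply filter_imp. intros k Hk. unfold scale. simpl.
  rewrite Cmod_R, Rabs_pos_eq; [lra|]. apply Rlt_le, Rinv_0_lt_compat; lra.
Qed.

(** As [L ^ 4 <= m], one power of [/ m] pays for four powers of [L]. *)
Lemma bO_weaken f p q p' q' : bO f p q -> (p' <= p)%nat -> (q + 4 * p' <= q' + 4 * p)%nat -> bO f p' q'.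
Proof.
  intros (M & HM & H) Hp Hq. exists M. split; [exact HM|].
  generalize (filter_and _ _ H (filter_and _ _ Hm (filter_and _ _ HL HL4))). apply filter_imp.
  intros k (H1 & H2 & H3 & H4). eapply Rle_trans; [exact H1|]. apply Rmult_le_compat_l; [exact HM|].
  unfold scale.
  assert (Hi : 0 < / m k) by (apply Rinv_0_lt_compat; lra).
  assert (HiL : / m k * L k ^ 4 <= 1).
  { apply Rmult_le_reg_l with (m k); [lra|]. rewrite <- Rmult_assoc, Rinv_r by lra. lra. }
  assert (HLp : forall j, 0 < L k ^ j) by (intros j; apply pow_lt; lra).
  replace p with (p' + (p - p'))%nat by lia. rewrite pow_add, Rmult_assoc.
  apply Rmult_le_compat_l; [apply pow_le; lra|].
  apply Rle_trans with ((/ m k) ^ (p - p') * (L k ^ 4) ^ (p - p') * L k ^ q').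
  - rewrite Rmult_assoc. apply Rmult_le_compat_l; [apply pow_le; lra|].
    rewrite <- pow_mult, <- pow_add. apply Rle_pow; [exact H3 | lia].
  - rewrite <- Rpow_mult_distr. rewrite <- (Rmult_1_l (L k ^ q')) at 2.
    apply Rmult_le_compat_r; [apply Rlt_le, HLp|].
    rewrite <- (pow1 (p - p')). apply pow_incr. split; [|exact HiL].
    apply Rmult_le_pos; [lra | apply Rlt_le, HLp].
Qed.

Lemma bO_o1 f p q : bO f p q -> (q < 4 * p)%nat -> o1 f.
Proof.
  intros (M & HM & H) Hpq eps He.
  destruct p as [|p]; [lia|].
  generalize (filter_and _ _ H (filter_and _ _ Hm (filter_and _ _ HL (filter_and _ _ HL4 (HLinf ((M + 1) / eps)))))).
  apply filter_imp. intros k (H1 & H2 & H3 & H4 & H5).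
  assert (Hi : 0 < / m k) by (apply Rinv_0_lt_compat; lra).
  assert (HiL : / m k * L k ^ 4 <= 1).
  { apply Rmult_le_reg_l with (m k); [lra|]. rewrite <- Rmult_assoc, Rinv_r by lra. lra. }
  assert (HLp : forall j, 0 < L k ^ j) by (intros j; apply pow_lt; lra).
  assert (Hs : scale (S p) q k * L k <= 1).
  { unfold scale. apply Rle_trans with ((/ m k) ^ S p * (L k ^ 4) ^ S p).
    - rewrite Rmult_assoc. apply Rmult_le_compat_l; [apply pow_le; lra|].
      replace (L k ^ q * L k) with (L k ^ (q + 1)) by (rewrite pow_add; ring).
      rewrite <- pow_mult. apply Rle_pow; [exact H3 | lia].
    - rewrite <- Rpow_mult_distr. rewrite <- (pow1 (S p)). apply pow_incr. split; [|exact HiL].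
      apply Rmult_le_pos; [lra | apply Rlt_le, HLp]. }
  assert (Hs2 : scale (S p) q k <= / L k).
  { apply Rmult_le_reg_r with (L k); [lra|]. rewrite Rinv_l by lra. exact Hs. }
  eapply Rle_lt_trans; [exact H1|]. apply Rle_lt_trans with (M * / L k); [apply Rmult_le_compat_l; assumption|].
  apply Rmult_lt_reg_r with (L k); [lra|]. rewrite Rmult_assoc, Rinv_l by lra.
  apply (Rmult_le_compat_l eps) in H5; [|lra].
  replace (eps * ((M + 1) / eps)) with (M + 1) in H5 by (field; lra). lra.
Qed.

Lemma bO_times_m f p q : bO f (S p) q -> bO (fun k => m k * f k)%C p q.
Proof.
  intros (M & HM & H). exists M. split; [exact HM|].
  generalize (filter_and _ _ H Hm). apply filter_imp. intros k (H1 & H2).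
  rewrite Cmod_mult, Cmod_R, Rabs_pos_eq by lra.
  apply Rle_trans with (m k * (M * scale (S p) q k)); [apply Rmult_le_compat_l; lra|].
  unfold scale. simpl. right. field. lra.
Qed.

Lemma bO_inv f (a : C) p q : a <> 0 -> bO (fun k => f k - a)%C p q -> (q < 4 * p)%nat ->
  bO (fun k => / f k - / a)%C p q /\ eventually (fun k => f k <> RtoC 0).
Proof.
  intros Ha Hf Hpq. pose proof (bO_o1 _ _ _ Hf Hpq) as Ho.
  assert (Ham : 0 < Cmod a) by (apply Cmod_gt_0; exact Ha).
  assert (Hlow : eventually (fun k => Cmod a / 2 <= Cmod (f k))).
  { assert (Ha2 : 0 < Cmod a / 2) by lra. generalize (Ho _ Ha2). apply filter_imp. intros k Hk.
    pose proof (Cmod_rev a (f k)) as H. rewrite Cmod_minus_sym in H. lra. }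
  split.
  - destruct Hf as (M & HM & H). exists (M * (2 / Cmod a ^ 2)).
    split; [apply Rmult_le_pos; [exact HM | apply Rdiv_le_0_compat; [lra | apply pow_lt; lra]]|].
    generalize (filter_and _ _ H Hlow). apply filter_imp. intros k (H1 & H2).
    assert (Hfn : f k <> 0) by (apply (Cneq_0 _ (Cmod a / 2)); lra).
    replace (/ f k - / a)%C with (- ((f k - a) * / a * / f k))%C by (field; auto).
    rewrite Cmod_opp.
    apply Rle_trans with (M * scale p q k * / Cmod a * / (Cmod a / 2)).
    + apply Cmul_le; [apply Cmul_le; [exact H1 | apply Cinv_le; lra] | apply Cinv_le; lra].
    + right. field. lra.
  - revert Hlow. apply filter_imp. intros k Hk. apply (Cneq_0 _ (Cmod a / 2)); lra.
Qed.

Lemma bO_ln (x : nat -> R) p q : bO (fun k => x k) p q -> (q < 4 * p)%nat ->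
  bO (fun k => ln (1 + x k)) p q /\ bO (fun k => ln (1 + x k) - x k)%C (p + p) (q + q) /\
  eventually (fun k => Rabs (x k) <= / 2).
Proof.
  intros Hx Hpq. assert (Hhalf : 0 < / 2) by lra. pose proof (bO_o1 _ _ _ Hx Hpq _ Hhalf) as Hs.
  assert (Hs' : eventually (fun k => Rabs (x k) <= / 2)).
  { revert Hs. apply filter_imp. intros k. rewrite Cmod_R. lra. }
  destruct Hx as (M & HM & H). split; [|split; [|exact Hs']].
  - exists (2 * M). split; [lra|]. generalize (filter_and _ _ H Hs'). apply filter_imp.
    intros k (H1 & H2). rewrite Cmod_R in *. pose proof (ln_near1 _ H2). lra.
  - exists (2 * M ^ 2). split; [pose proof (pow2_ge_0 M); lra|]. generalize (filter_and _ _ H Hs'). apply filter_imp.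
    intros k (H1 & H2). rewrite <- RtoC_minus. rewrite Cmod_R in *.
    eapply Rle_trans; [apply ln_near, H2|]. rewrite <- scale_mult, <- pow2_abs.
    assert (Rabs (x k) ^ 2 <= (M * scale p q k) ^ 2) by (apply pow_incr; split; [apply Rabs_pos | exact H1]).
    lra.
Qed.

Lemma bO_sin_cos (x : nat -> R) : bO (fun k => x k) 1 1 ->
  bO (fun k => sin (x k) - x k)%C 2 2 /\ bO (fun k => cos (x k) - 1)%C 2 2.
Proof.
  intros Hx. assert (H14 : (1 < 4 * 1)%nat) by lia. pose proof (bO_o1 _ _ _ Hx H14 1 Rlt_0_1) as Hs.
  pose proof (bO_mult _ _ _ _ _ _ Hx Hx) as Hx2. simpl in Hx2.
  destruct Hx2 as (M & HM & H). split.
  - exists M. split; [exact HM|]. generalize (filter_and _ _ H Hs). apply filter_imp.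
    intros k (H1 & H2). rewrite <- RtoC_minus. rewrite <- RtoC_mult in H1. rewrite !Cmod_R in *.
    eapply Rle_trans; [|exact H1]. rewrite Rabs_mult.
    assert (Hsin : forall y, 0 <= y <= 1 -> Rabs (sin y - y) <= y * y).
    { intros y Hy. pose proof (sin_near y Hy). apply Rabs_le.
      assert (y ^ 3 <= y * y) by (simpl; nra). split; [lra|]. nra. }
    destruct (Rle_dec 0 (x k)) as [Hp|Hp].
    + rewrite Rabs_pos_eq in H2 by exact Hp. rewrite (Rabs_pos_eq (x k)) by exact Hp. apply Hsin. lra.
    + rewrite Rabs_left1 in H2 by lra. rewrite (Rabs_left1 (x k)) by lra.
      rewrite <- Rabs_Ropp. replace (- (sin (x k) - x k)) with (sin (- x k) - - x k) by (rewrite sin_neg; ring).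
      apply Hsin. lra.
  - exists M. split; [exact HM|]. revert H. apply filter_imp. intros k H1.
    rewrite <- RtoC_minus. rewrite <- RtoC_mult in H1. rewrite !Cmod_R in *.
    eapply Rle_trans; [|exact H1]. pose proof (cos_near (x k)).
    rewrite Rabs_left1 by lra. rewrite Rabs_pos_eq by nra. simpl in *. lra.
Qed.

Ltac rfold := repeat (rewrite <- RtoC_opp || rewrite <- RtoC_mult || rewrite <- RtoC_minus || rewrite <- RtoC_plus).

Variables (c beta : R) (N lam sg : nat -> R).
Let al := exp (PI / c).
Hypotheses (Hc : 0 < c) (Hlam : forall k, lam k = ln (m k))
  (Hlam1 : eventually (fun k => 1 <= lam k <= L k))
  (HN : forall k, N k = al * m k + beta * lam k + sg k)
  (Hsg : exists Ms, forall k, Rabs (sg k) <= Ms).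

(** Relative deviations at the times that matter: [N = al m (1 + mu)], the transit starts at
    [s = m (1 + t)] and ends at [e = al m (1 + v)]. All three are [O(L / m)]. *)
Let mu k := (beta * lam k + sg k) / (al * m k).
Let t k := L k * / m k.
Let s k := m k + L k.
Let e k := N k - L k.
Let v k := mu k - t k / al.
Let ck k := transit_speed (m k) (N k).
Let ths k := transit_angle (m k) (N k) (s k).
Let the k := transit_angle (m k) (N k) (e k).

Lemma al_gt_1 : 1 < al.
Proof.
  unfold al. rewrite <- exp_0. apply exp_increasing. apply Rdiv_lt_0_compat; [apply PI_RGT_0 | exact Hc].
Qed.

Lemma bO_lam : bO (fun k => lam k) 0 1.
Proof.
  exists 1. split; [lra|]. revert Hlam1. apply filter_imp. intros k Hk. unfold scale. simpl.
  rewrite Cmod_R, Rabs_pos_eq; lra.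
Qed.

Lemma bO_sg : bO (fun k => sg k) 0 0.
Proof.
  destruct Hsg as (Ms & H). apply (bO_bounded _ Ms). exists 0%nat. intros k _. rewrite Cmod_R. apply H.
Qed.

Lemma bO_t : bO (fun k => t k) 1 1.
Proof.
  apply (bO_ext (fun k => L k * (/ m k)%R)%C).
  - exists 0%nat. intros k _. unfold t. rfold. reflexivity.
  - apply (bO_mult _ _ 0 1 1 0); [apply bO_L | apply bO_inv_m].
Qed.

Lemma bO_mu : bO (fun k => mu k) 1 1.
Proof.
  pose proof al_gt_1 as Hal.
  apply (bO_ext (fun k => (/ al)%R * ((beta * lam k + sg k) * (/ m k)%R))%C).
  - generalize Hm. apply filter_imp. intros k Hk. unfold mu. rfold. f_equal. field. lra.
  - apply bO_scal. apply (bO_mult _ _ 0 1 1 0); [|apply bO_inv_m].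
    apply bO_plus; [apply bO_scal, bO_lam | apply (bO_weaken _ 0 0); [apply bO_sg | lia | lia]].
Qed.

Lemma bO_v : bO (fun k => v k) 1 1.
Proof.
  pose proof al_gt_1 as Hal.
  apply (bO_ext (fun k => mu k - (/ al)%R * t k)%C).
  - exists 0%nat. intros k _. unfold v. rfold. f_equal. field. lra.
  - apply bO_minus; [apply bO_mu | apply bO_scal, bO_t].
Qed.

Lemma transit_logs : eventually (fun k =>
  0 < m k /\ 0 < s k /\ 0 < e k /\ 0 < N k /\
  ln (N k) - lam k = PI / c + ln (1 + mu k) /\ ln (s k) - lam k = ln (1 + t k) /\
  ln (e k) - lam k = PI / c + ln (1 + v k) /\
  N k = al * m k * (1 + mu k) /\ e k = al * m k * (1 + v k) /\ s k = m k * (1 + t k)).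
Proof.
  pose proof al_gt_1 as Hal.
  destruct (bO_ln _ 1 1 bO_mu ltac:(lia)) as (_ & _ & H1).
  destruct (bO_ln _ 1 1 bO_v ltac:(lia)) as (_ & _ & H2).
  generalize (filter_and _ _ H1 (filter_and _ _ H2 (filter_and _ _ Hm HL))). apply filter_imp.
  intros k (G1 & G2 & G3 & G4). apply Rabs_le_between in G1. apply Rabs_le_between in G2.
  assert (Ham : 0 < al * m k) by (apply Rmult_lt_0_compat; lra).
  assert (Ht : 0 < t k) by (unfold t; apply Rmult_lt_0_compat; [|apply Rinv_0_lt_compat]; lra).
  assert (E1 : N k = al * m k * (1 + mu k)) by (unfold mu; rewrite HN; field; lra).
  assert (E2 : e k = al * m k * (1 + v k)) by (unfold e, v, t; rewrite E1; field; lra).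
  assert (E3 : s k = m k * (1 + t k)) by (unfold s, t; field; lra).
  assert (Hlal : ln al = PI / c) by (unfold al; apply ln_exp).
  assert (HN0 : 0 < N k) by (rewrite E1; apply Rmult_lt_0_compat; lra).
  assert (He0 : 0 < e k) by (rewrite E2; apply Rmult_lt_0_compat; lra).
  assert (Hs0 : 0 < s k) by (unfold s; lra).
  repeat split; try assumption; try lra.
  - rewrite E1, !ln_mult, Hlal, Hlam by lra. ring.
  - rewrite E3, ln_mult, Hlam by lra. ring.
  - rewrite E2, !ln_mult, Hlal, Hlam by lra. ring.
Qed.

Lemma bO_ck : bO (fun k => ck k - c)%C 1 1 /\ eventually (fun k => ck k * (PI / c + ln (1 + mu k)) = PI).
Proof.
  pose proof al_gt_1 as Hal. pose proof PI_RGT_0 as HPI.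
  assert (HPc : 0 < PI / c) by (apply Rdiv_lt_0_compat; lra).
  destruct (bO_ln _ 1 1 bO_mu ltac:(lia)) as (H1 & _ & _).
  destruct (bO_inv (fun k => RtoC (PI / c + ln (1 + mu k))) (PI / c)%R 1 1) as [H2 H3].
  { intros E. apply RtoC_inj in E. lra. }
  { apply (bO_ext (fun k => ln (1 + mu k))); [|exact H1].
    exists 0%nat. intros k _. rewrite RtoC_plus. ring. }
  { lia. }
  split.
  - apply (bO_ext (fun k => PI * (/ RtoC (PI / c + ln (1 + mu k)) - / RtoC (PI / c)))%C).
    + generalize (filter_and _ _ transit_logs H3). apply filter_imp.
      intros k ((G1 & G2 & G3 & G4 & G5 & _) & G6).
      assert (G7 : PI / c + ln (1 + mu k) <> 0) by (intros E; apply G6; rewrite E; reflexivity).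
      rewrite <- !RtoC_inv by lra. rfold. f_equal.
      unfold ck, transit_speed. rewrite ln_div by assumption. rewrite <- Hlam, G5. set (u := PI / c + ln (1 + mu k)) in *. field. lra.
    + apply bO_scal, H2.
  - generalize (filter_and _ _ transit_logs H3). apply filter_imp.
    intros k ((G1 & G2 & G3 & G4 & G5 & _) & G6).
    assert (G7 : PI / c + ln (1 + mu k) <> 0) by (intros E; apply G6; rewrite E; reflexivity).
    unfold ck, transit_speed. rewrite ln_div by assumption. rewrite <- Hlam, G5.
    set (u := PI / c + ln (1 + mu k)) in *. field. exact G7.
Qed.

Lemma bO_ths : bO (fun k => ths k - c * t k)%C 2 2.
Proof.
  destruct (bO_ln _ 1 1 bO_t ltac:(lia)) as (H1 & H2 & _).
  apply (bO_ext (fun k => (ck k - c) * ln (1 + t k) + c * (ln (1 + t k) - t k))%C).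
  - generalize transit_logs. apply filter_imp. intros k (G1 & G2 & G3 & G4 & _ & G5 & _).
    unfold ths, transit_angle. fold (ck k). rewrite ln_div, <- Hlam, G5 by assumption.
    rfold. f_equal. ring.
  - apply bO_plus; [apply (bO_mult _ _ 1 1 1 1); [apply bO_ck | exact H1] | apply bO_scal, H2].
Qed.

(** Near the exit time [N], about [al m], one unit of time turns the angle by [c / (al m)], so [L]
    steps before [N] the remaining angle is [(c / al) L / m]. The contributions of [mu] cancel to
    first order since the angle is exactly [PI] at [N]. *)
Lemma bO_the : bO (fun k => (PI - the k)%R - (c / al)%R * t k)%C 2 2.
Proof.
  pose proof al_gt_1 as Hal.
  destruct (bO_ln _ 1 1 bO_mu ltac:(lia)) as (M1 & M2 & _).
  destruct (bO_ln _ 1 1 bO_v ltac:(lia)) as (V1 & V2 & _).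
  apply (bO_ext (fun k => (ck k - c) * (ln (1 + mu k) - ln (1 + v k))
    + c * ((ln (1 + mu k) - mu k) - (ln (1 + v k) - v k)))%C).
  - generalize (filter_and _ _ transit_logs (proj2 bO_ck)). apply filter_imp.
    intros k ((G1 & G2 & G3 & G4 & G5 & G6 & G7 & _) & G8).
    unfold the, transit_angle. fold (ck k). rewrite ln_div, <- Hlam, G7 by assumption.
    replace (PI - ck k * (PI / c + ln (1 + v k))) with (ck k * (ln (1 + mu k) - ln (1 + v k))) by lra.
    rfold. f_equal. unfold v. field. lra.
  - apply bO_plus; [apply (bO_mult _ _ 1 1 1 1); [apply bO_ck | apply bO_minus; assumption]|].
    apply bO_scal, bO_minus; assumption.
Qed.

Lemma bO_of_diff (f g : nat -> C) p q p' q' : bO (fun k => f k - g k)%C p q -> bO g p' q' ->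
  (p' <= p)%nat -> (q + 4 * p' <= q' + 4 * p)%nat -> bO f p' q'.
Proof.
  intros H Hg Hp Hq. apply (bO_ext (fun k => (f k - g k) + g k)%C); [exists 0%nat; intros; ring|].
  apply bO_plus; [apply (bO_weaken _ p q); assumption | exact Hg].
Qed.

Lemma transit_trig_entry : bO (fun k => sin (ths k) - c * t k)%C 2 2 /\ bO (fun k => cos (ths k) - 1)%C 2 2 /\
  bO (fun k => sin (ths k)) 1 1.
Proof.
  assert (H0 : bO (fun k => c * t k)%C 1 1) by apply bO_scal, bO_t.
  assert (H1 : bO (fun k => ths k) 1 1) by (apply (bO_of_diff _ _ 2 2 1 1 bO_ths H0); lia).
  destruct (bO_sin_cos _ H1) as [H2 H3].
  assert (H4 : bO (fun k => sin (ths k) - c * t k)%C 2 2).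
  { apply (bO_ext (fun k => (sin (ths k) - ths k) + (ths k - c * t k))%C); [exists 0%nat; intros; ring|].
    apply bO_plus; [exact H2 | apply bO_ths]. }
  split; [exact H4|]. split; [exact H3|]. apply (bO_of_diff _ _ 2 2 1 1 H4 H0); lia.
Qed.

Lemma transit_trig_exit : bO (fun k => sin (the k) - (c / al)%R * t k)%C 2 2 /\ bO (fun k => cos (the k) + 1)%C 2 2 /\
  bO (fun k => sin (the k)) 1 1.
Proof.
  assert (H0 : bO (fun k => (c / al)%R * t k)%C 1 1) by apply bO_scal, bO_t.
  assert (H1 : bO (fun k => (PI - the k)%R) 1 1) by (apply (bO_of_diff _ _ 2 2 1 1 bO_the H0); lia).
  destruct (bO_sin_cos _ H1) as [H2 H3].
  assert (H4 : bO (fun k => sin (the k) - (c / al)%R * t k)%C 2 2).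
  { apply (bO_ext (fun k => (sin (PI - the k) - (PI - the k)%R) + ((PI - the k)%R - (c / al)%R * t k))%C).
    - exists 0%nat. intros k _. rewrite sin_PI_x. ring.
    - apply bO_plus; [exact H2 | apply bO_the]. }
  split; [exact H4|]. split.
  - apply (bO_ext (fun k => - (cos (PI - the k) - 1))%C); [|apply bO_opp, H3].
    exists 0%nat. intros k _. rewrite Rtrigo_facts.cos_pi_minus, RtoC_opp. ring.
  - apply (bO_of_diff _ _ 2 2 1 1 H4 H0); lia.
Qed.

Lemma transit_time_ratios : bO (fun k => (m k / s k)%R - 1)%C 1 1 /\ bO (fun k => (m k / e k)%R - (/ al)%R)%C 1 1.
Proof.
  pose proof al_gt_1 as Hal.
  split.
  - destruct (bO_inv (fun k => 1 + t k)%C 1 1 1) as [H1 H2]; [exact C1_nz | | lia |].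
    + apply (bO_ext (fun k => t k)); [exists 0%nat; intros; ring | apply bO_t].
    + apply (bO_ext (fun k => / (1 + t k) - / 1)%C); [|exact H1].
      generalize (filter_and _ _ transit_logs H2). apply filter_imp.
      intros k ((G1 & G2 & _ & _ & _ & _ & _ & _ & _ & G3) & G4). rewrite G3.
      rewrite G3 in G2. assert (1 + t k <> 0).
      { intros E. rewrite E, Rmult_0_r in G2. lra. }
      rewrite RtoC_div, RtoC_mult, RtoC_plus by lra.
      assert (RtoC (m k) <> 0) by (intros E; apply RtoC_inj in E; lra).
      field. auto.
  - destruct (bO_inv (fun k => 1 + v k)%C 1 1 1) as [H1 H2]; [exact C1_nz | | lia |].
    + apply (bO_ext (fun k => v k)); [exists 0%nat; intros; ring | apply bO_v].
    + apply (bO_ext (fun k => (/ al)%R * (/ (1 + v k) - / 1))%C); [|apply bO_scal, H1].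
      generalize (filter_and _ _ transit_logs H2). apply filter_imp.
      intros k ((G1 & _ & G2 & _ & _ & _ & _ & _ & G3 & _) & G4). rewrite G3.
      rewrite G3 in G2. assert (1 + v k <> 0).
      { intros E. rewrite E, Rmult_0_r in G2. lra. }
      rewrite RtoC_div, !RtoC_mult, RtoC_plus, RtoC_inv by (try lra; intros E; rewrite E in G2; lra).
      assert (RtoC (m k) <> 0) by (intros E; apply RtoC_inj in E; lra).
      assert (RtoC al <> 0) by (intros E; apply RtoC_inj in E; lra).
      field. auto.
Qed.

Lemma o1_bO (f : nat -> C) : o1 f -> bO f 0 0.
Proof.
  intros H. apply bO_bounded with 1. generalize (H 1 Rlt_0_1). apply filter_imp. intros k Hk. lra.
Qed.

(** * Passage between the coordinates [X] and [eps] at both ends *)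

Variables (a b03 b30 : C) (b : R) (ph phq Zs Ze Xs : nat -> C).
Hypotheses (Hph : exists M, forall k, Cmod (ph k) <= M) (Hphq : exists M, forall k, Cmod (phq k) <= M)
  (HZs0 : eventually (fun k => Zs k <> 0)) (HZe0 : eventually (fun k => Ze k <> 0))
  (HZs : o1 (fun k => / Zs k - (s k + (1 - a) * ln (s k) + ph k))%C)
  (HZe : o1 (fun k => / Ze k - (e k + (1 - a) * ln (e k) + ph k))%C)
  (HXs : o1 (fun k => Xs k - (L k + (1 - b03) * ln (L k) + phq k))%C).

Lemma bO_ph : bO ph 0 0.
Proof. destruct Hph as (M & H). apply (bO_bounded _ M). exists 0%nat. auto. Qed.

Lemma bO_phq : bO phq 0 0.
Proof. destruct Hphq as (M & H). apply (bO_bounded _ M). exists 0%nat. auto. Qed.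

Lemma bO_ln_s : bO (fun k => ln (s k) - lam k)%C 1 1 /\ bO (fun k => ln (e k) - lam k - (PI / c)%R)%C 1 1.
Proof.
  destruct (bO_ln _ 1 1 bO_t ltac:(lia)) as (H1 & _). destruct (bO_ln _ 1 1 bO_v ltac:(lia)) as (H2 & _).
  split.
  - apply (bO_ext (fun k => ln (1 + t k))); [|exact H1]. generalize transit_logs. apply filter_imp.
    intros k (_ & _ & _ & _ & _ & G & _). rfold. f_equal. lra.
  - apply (bO_ext (fun k => ln (1 + v k))); [|exact H2]. generalize transit_logs. apply filter_imp.
    intros k (_ & _ & _ & _ & _ & _ & G & _). rfold. f_equal. lra.
Qed.

Lemma bO_ln_L : bO (fun k => ln (L k)) 0 1 /\ eventually (fun k => 0 <= ln (L k) <= lam k).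
Proof.
  assert (H : eventually (fun k => 0 <= ln (L k) <= lam k)).
  { generalize (filter_and _ _ HL HL4). apply filter_imp. intros k [H1 H2]. rewrite Hlam. split.
    - rewrite <- ln_1. apply ln_le; lra.
    - apply ln_le; [lra|]. apply Rle_trans with (2 := H2). rewrite <- (pow_1 (L k)) at 1.
      apply Rle_pow; [exact H1 | lia]. }
  split; [|exact H]. exists 1. split; [lra|]. generalize (filter_and _ _ H Hlam1). apply filter_imp.
  intros k [H1 H2]. unfold scale. simpl. rewrite Cmod_R, Rabs_pos_eq; lra.
Qed.

Lemma zeta_shift : bO (fun k => / Zs k - m k)%C 0 1 /\ bO (fun k => / Ze k - (al * m k)%R)%C 0 1 /\
  bO (fun k => / Ze k - N k)%C 0 1 /\
  bO (fun k => / Zs k - s k)%C 0 1 /\ bO (fun k => / Ze k - e k)%C 0 1.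
Proof.
  destruct bO_ln_s as [H1 H2].
  assert (Hls : bO (fun k => ln (s k)) 0 1).
  { apply (bO_of_diff _ (fun k => lam k) 1 1 0 1 H1 bO_lam); lia. }
  assert (Hle : bO (fun k => ln (e k)) 0 1).
  { apply (bO_of_diff _ (fun k => lam k + (PI / c)%R)%C 1 1 0 1).
    - apply (bO_ext (fun k => ln (e k) - lam k - (PI / c)%R)%C); [exists 0%nat; intros; ring | exact H2].
    - apply bO_plus; [apply bO_lam | apply (bO_weaken _ 0 0); [apply bO_const | lia | lia]].
    - lia.
    - lia. }
  assert (Hzs : bO (fun k => / Zs k - s k)%C 0 1).
  { apply (bO_ext (fun k => (/ Zs k - (s k + (1 - a) * ln (s k) + ph k)) + (1 - a) * ln (s k) + ph k)%C);
      [exists 0%nat; intros; ring|].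
    apply bO_plus; [apply bO_plus|].
    - apply (bO_weaken _ 0 0); [apply o1_bO, HZs | lia | lia].
    - apply bO_scal, Hls.
    - apply (bO_weaken _ 0 0); [apply bO_ph | lia | lia]. }
  assert (Hze : bO (fun k => / Ze k - e k)%C 0 1).
  { apply (bO_ext (fun k => (/ Ze k - (e k + (1 - a) * ln (e k) + ph k)) + (1 - a) * ln (e k) + ph k)%C);
      [exists 0%nat; intros; ring|].
    apply bO_plus; [apply bO_plus|].
    - apply (bO_weaken _ 0 0); [apply o1_bO, HZe | lia | lia].
    - apply bO_scal, Hle.
    - apply (bO_weaken _ 0 0); [apply bO_ph | lia | lia]. }
  assert (HzN : bO (fun k => / Ze k - N k)%C 0 1).
  { apply (bO_ext (fun k => (/ Ze k - e k) - L k)%C).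
    - exists 0%nat. intros k _. unfold e. rewrite RtoC_minus. ring.
    - apply bO_minus; [exact Hze | apply bO_L]. }
  split; [|split; [|split; [|split]]]; try assumption.
  - apply (bO_ext (fun k => (/ Zs k - s k) + L k)%C).
    + exists 0%nat. intros k _. unfold s. rewrite RtoC_plus. ring.
    + apply bO_plus; [exact Hzs | apply bO_L].
  - apply (bO_ext (fun k => (/ Ze k - N k) + (beta * lam k + sg k))%C).
    + exists 0%nat. intros k _. rewrite HN, !RtoC_plus, !RtoC_mult. ring.
    + apply bO_plus; [exact HzN|]. apply bO_plus; [apply bO_scal, bO_lam|].
      apply (bO_weaken _ 0 0); [apply bO_sg | lia | lia].
Qed.

Lemma m_inv_C : eventually (fun k => RtoC (m k) <> 0 /\ (m k * (/ m k)%R = 1)%C).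
Proof.
  generalize Hm. apply filter_imp. intros k Hk.
  assert (H : RtoC (m k) <> 0) by (intros E; apply RtoC_inj in E; lra).
  split; [exact H|]. rfold. f_equal. field. lra.
Qed.

Lemma bO_mult_m_inv (f : nat -> C) p q : bO f p q -> bO (fun k => f k * (/ m k)%R)%C (S p) q.
Proof.
  intros H. replace (S p) with (p + 1)%nat by lia. replace q with (q + 0)%nat by lia.
  apply bO_mult; [exact H | apply bO_inv_m].
Qed.

(** The first bound keeps [Xs] away from [0]. The second, logarithmic, gives the initial bound
    [eps = O(ln m / m)] with which the transit is entered. *)
Lemma Xs_near_L : eventually (fun k => Cmod (Xs k - L k) <= L k / 2) /\
  exists M, 0 <= M /\ eventually (fun k => Cmod (Xs k - L k) <= M * lam k).
Proof.
  destruct Hphq as (Mq & HMq). set (Bm := Cmod (1 - b03)).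
  assert (HB : 0 <= Bm) by apply Cmod_ge_0.
  assert (HMq0 : 0 <= Mq) by (eapply Rle_trans; [apply Cmod_ge_0 | apply (HMq 0%nat)]).
  assert (H : eventually (fun k => Cmod (Xs k - L k) <= Mq + 1 + Bm * ln (L k))).
  { generalize (filter_and _ _ (HXs 1 Rlt_0_1) (proj2 bO_ln_L)). apply filter_imp. intros k [H1 H2].
    replace (Xs k - L k)%C with ((Xs k - (L k + (1 - b03) * ln (L k) + phq k)) + (1 - b03) * ln (L k) + phq k)%C by ring.
    eapply Rle_trans; [apply Cadd_le; [apply Cadd_le; [apply Rlt_le, H1 | apply Cmul_le; [apply Rle_refl|]]|apply HMq]|].
    - rewrite Cmod_R, Rabs_pos_eq by lra. apply Rle_refl.
    - fold Bm. lra. }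
  split.
  - destruct (log_affine_small (Mq + 1) Bm (/ 2) HB ltac:(lra)) as (x0 & Hx0 & Hx).
    generalize (filter_and _ _ H (filter_and _ _ (HLinf x0) HL)). apply filter_imp. intros k (H1 & H2 & H3).
    eapply Rle_trans; [exact H1|]. specialize (Hx _ H2).
    assert (ln (L k) <= ln (2 * L k)) by (apply ln_le; lra).
    assert (Bm * ln (L k) <= Bm * ln (2 * L k)) by (apply Rmult_le_compat_l; assumption). lra.
  - exists (Mq + 1 + Bm). split; [lra|].
    generalize (filter_and _ _ H (filter_and _ _ (proj2 bO_ln_L) Hlam1)). apply filter_imp. intros k (H1 & H2 & H3).
    eapply Rle_trans; [exact H1|].
    assert ((Mq + 1) * 1 <= (Mq + 1) * lam k) by (apply Rmult_le_compat_l; lra).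
    assert (Bm * ln (L k) <= Bm * lam k) by (apply Rmult_le_compat_l; lra). lra.
Qed.

(** With [w = - / X] and [aa = c X / (/ z - X / 2)], the relation is solved by
    [eps = (aa Co - S) / (aa S + Co)], the tangent of [atan aa - theta]. Since [/ z] is about [m]
    and [theta] about [c L / m], the product [m eps] is close to [c X - c L]. *)
Lemma entry_coordinate : exists eps : nat -> C,
  eventually (fun k => transit_rel c (sin (ths k)) (cos (ths k)) (Zs k) (- / Xs k) (eps k)) /\
  o1 (fun k => m k * eps k - c * (Xs k - L k))%C.
Proof.
  destruct zeta_shift as (Hz & _). destruct transit_trig_entry as (HS & HCo & HS1).
  assert (HXL : bO (fun k => Xs k - L k)%C 0 1).
  { apply (bO_ext (fun k => (Xs k - (L k + (1 - b03) * ln (L k) + phq k)) + (1 - b03) * ln (L k) + phq k)%C);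
      [exists 0%nat; intros; ring|].
    apply bO_plus; [apply bO_plus|].
    - apply (bO_weaken _ 0 0); [apply o1_bO, HXs | lia | lia].
    - apply bO_scal, bO_ln_L.
    - apply (bO_weaken _ 0 0); [apply bO_phq | lia | lia]. }
  assert (HX : bO Xs 0 1) by (apply (bO_of_diff _ (fun k => L k) 0 1 0 1 HXL bO_L); lia).
  (* The denominator of [aa] divided by [m]; it tends to [1]. *)
  set (g := fun k => ((/ Zs k - Xs k / 2) * (/ m k)%R)%C).
  assert (Hg : bO (fun k => g k - 1)%C 1 1).
  { apply (bO_ext (fun k => ((/ Zs k - m k) - / 2 * Xs k) * (/ m k)%R)%C).
    - generalize m_inv_C. apply filter_imp. intros k [G1 G2]. unfold g. rewrite <- G2.
      unfold Cdiv. ring.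
    - apply bO_mult_m_inv. apply bO_minus; [exact Hz | apply bO_scal, HX]. }
  destruct (bO_inv g 1 1 1 C1_nz Hg ltac:(lia)) as [Hgi Hg0].
  set (aa := fun k => (c * Xs k * (/ m k)%R * / g k)%C).
  assert (Hgi0 : bO (fun k => / g k)%C 0 0).
  { apply (bO_of_diff _ (fun _ => / 1)%C 1 1 0 0 Hgi); [apply bO_const | lia | lia]. }
  assert (Haa : bO aa 1 1).
  { apply (bO_mult (fun k => c * Xs k * (/ m k)%R)%C _ 1 1 0 0); [|exact Hgi0].
    apply bO_mult_m_inv, bO_scal, HX. }
  assert (Hmaa : bO (fun k => m k * aa k - c * Xs k)%C 1 2).
  { apply (bO_ext (fun k => c * Xs k * (/ g k - / 1))%C).
    - generalize m_inv_C. apply filter_imp. intros k [G1 G2]. unfold aa.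
      replace (m k * (c * Xs k * (/ m k)%R * / g k))%C with (m k * (/ m k)%R * (c * Xs k * / g k))%C by ring.
      rewrite G2. replace (/ 1)%C with (RtoC 1) by (field; exact C1_nz). ring.
    - apply (bO_mult (fun k => c * Xs k)%C _ 0 1 1 1); [apply bO_scal, HX | exact Hgi]. }
  set (D := fun k => (aa k * sin (ths k) + cos (ths k))%C).
  assert (HaS : bO (fun k => aa k * sin (ths k))%C 2 2) by (apply (bO_mult _ _ 1 1 1 1); assumption).
  assert (HD : bO (fun k => D k - 1)%C 2 2).
  { apply (bO_ext (fun k => aa k * sin (ths k) + (cos (ths k) - 1))%C); [exists 0%nat; intros; unfold D; ring|].
    apply bO_plus; assumption. }
  destruct (bO_inv D 1 2 2 C1_nz HD ltac:(lia)) as [HDi HD0].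
  assert (HDi0 : bO (fun k => / D k)%C 0 0).
  { apply (bO_of_diff _ (fun _ => / 1)%C 2 2 0 0 HDi); [apply bO_const | lia | lia]. }
  exists (fun k => (aa k * cos (ths k) - sin (ths k)) / D k)%C. split.
  - assert (HX0 : eventually (fun k => Xs k <> RtoC 0)).
    { generalize (filter_and _ _ HL (proj1 Xs_near_L)). apply filter_imp. intros k [G1 G2] E.
      rewrite E in G2. replace (0 - L k)%C with (- L k)%C in G2 by ring.
      rewrite Cmod_opp, Cmod_R, Rabs_pos_eq in G2; lra. }
    generalize (filter_and _ _ HX0 (filter_and _ _ HZs0 (filter_and _ _ HD0 (filter_and _ _ Hg0 m_inv_C)))).
    apply filter_imp. intros k (G1 & G2 & G3 & G4 & G5 & G6). unfold transit_rel.
    assert (Haak : (aa k * (/ Zs k - Xs k / 2) = c * Xs k)%C).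
    { assert (E : (/ Zs k - Xs k / 2 = g k * m k)%C).
      { unfold g. replace ((/ Zs k - Xs k / 2) * (/ m k)%R * m k)%C with
          ((/ Zs k - Xs k / 2) * (m k * (/ m k)%R))%C by ring. rewrite G6. ring. }
      rewrite E. unfold aa. replace (c * Xs k * (/ m k)%R * / g k * (g k * m k))%C with
        (c * Xs k * (m k * (/ m k)%R) * (g k * / g k))%C by ring.
      rewrite G6, Cinv_r by exact G4. ring. }
    set (S := RtoC (sin (ths k))) in *. set (Co := RtoC (cos (ths k))) in *.
    assert (E1 : (S + (aa k * Co - S) / D k * Co = aa k * (S ^ 2 + Co ^ 2) / D k)%C).
    { change (D k) with (aa k * S + Co)%C. field. exact G3. }
    assert (E2 : ((aa k * Co - S) / D k * S - Co = - ((S ^ 2 + Co ^ 2) / D k))%C).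
    { change (D k) with (aa k * S + Co)%C. field. exact G3. }
    rewrite E1, E2.
    replace (- / Xs k + Zs k / 2)%C with (- (Zs k * / Xs k * (/ Zs k - Xs k / 2)))%C by (field; auto).
    replace (- (Zs k * / Xs k * (/ Zs k - Xs k / 2)) * (aa k * (S ^ 2 + Co ^ 2) / D k))%C with
      (- (Zs k * / Xs k * (aa k * (/ Zs k - Xs k / 2)) * (S ^ 2 + Co ^ 2) / D k))%C by (unfold Cdiv; ring).
    rewrite Haak. field. auto.
  - apply (bO_o1 _ 1 2); [|lia].
    (* An exact rewriting in which every summand contains a difference already estimated; the worst
       of them is [O(L ^ 2 / m)]. *)
    apply (bO_ext (fun k => ((m k * aa k - c * Xs k) * cos (ths k)
      - m k * (sin (ths k) - c * t k) + c * L k * (cos (ths k) - 1)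
      - c * (Xs k - L k) * (aa k * sin (ths k))) * / D k)%C).
    + generalize (filter_and _ _ HD0 m_inv_C). apply filter_imp. intros k (G3 & G5 & G6).
      unfold t. rewrite RtoC_mult.
      replace (m k * (sin (ths k) - c * (L k * (/ m k)%R)))%C with
        (m k * sin (ths k) - c * L k * (m k * (/ m k)%R))%C by ring.
      rewrite G6. unfold D in *. field. exact G3.
    + apply (bO_mult _ _ 1 2 0 0); [|exact HDi0].
      apply bO_minus; [apply bO_plus; [apply bO_minus|]|].
      * apply (bO_mult _ _ 1 2 0 0); [exact Hmaa|].
        apply (bO_of_diff _ (fun _ => RtoC 1) 2 2 0 0 HCo); [apply bO_const | lia | lia].
      * apply bO_times_m, HS.
      * apply (bO_weaken _ 2 3); [|lia|lia].
        apply (bO_mult (fun k => c * L k)%C _ 0 1 2 2); [apply bO_scal, bO_L | exact HCo].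
      * apply (bO_weaken _ 2 3); [|lia|lia].
        apply (bO_mult (fun k => c * (Xs k - L k))%C _ 0 1 2 2); [apply bO_scal, HXL | exact HaS].
Qed.

(** The relation is solved for the fiber coordinate instead: [W h = Z den] with [h = S + eps Co].
    Near [theta = PI] this gives [h] close to [(c / al) L / m - eps], [/ Z] close to [al m] and
    [den] close to [c], so [- / W] is close to [- L + (al / c) m eps]. *)
Lemma exit_coordinate (eps W : nat -> C) : bO eps 1 1 ->
  eventually (fun k => transit_rel c (sin (the k)) (cos (the k)) (Ze k) (W k) (eps k)) ->
  eventually (fun k => W k <> 0) /\
  o1 (fun k => - / W k + L k - (al / c)%R * (m k * eps k))%C.
Proof.
  intros Heps Hrel. pose proof al_gt_1 as Hal.
  assert (Halc : RtoC al <> 0) by (intros E; apply RtoC_inj in E; lra).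
  assert (Hcc : RtoC c <> 0) by (intros E; apply RtoC_inj in E; lra).
  destruct zeta_shift as (_ & Hz & HzN & _). destruct transit_trig_exit as (HS & HCo & HS1).
  assert (HCo0 : bO (fun k => cos (the k)) 0 0).
  { apply (bO_of_diff _ (fun _ => - (1))%C 2 2 0 0); [|apply bO_const|lia|lia].
    apply (bO_ext (fun k => cos (the k) + 1)%C); [exists 0%nat; intros; ring | exact HCo]. }
  set (h := fun k => (sin (the k) + eps k * cos (the k))%C).
  assert (Hh : bO h 1 1).
  { apply bO_plus; [exact HS1 | apply (bO_mult _ _ 1 1 0 0); assumption]. }
  set (den := fun k => (c * (eps k * sin (the k) - cos (the k)) - h k / 2)%C).
  assert (Hden : bO (fun k => den k - c)%C 1 1).
  { apply (bO_ext (fun k => c * (eps k * sin (the k)) - c * (cos (the k) + 1) - / 2 * h k)%C).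
    - exists 0%nat. intros k _. unfold den, Cdiv. ring.
    - apply bO_minus; [apply bO_minus|].
      + apply bO_scal. apply (bO_weaken _ 2 2); [apply (bO_mult _ _ 1 1 1 1); assumption | lia | lia].
      + apply bO_scal. apply (bO_weaken _ 2 2); [exact HCo | lia | lia].
      + apply bO_scal, Hh. }
  destruct (bO_inv den c 1 1 Hcc Hden ltac:(lia)) as [Hdi Hd0].
  assert (Hdi0 : bO (fun k => / den k)%C 0 0).
  { apply (bO_of_diff _ (fun _ => / c)%C 1 1 0 0 Hdi); [apply bO_const | lia | lia]. }
  assert (Hw : eventually (fun k => W k <> 0 /\ (W k * h k = Ze k * den k)%C)).
  { generalize (filter_and _ _ Hrel (filter_and _ _ Hd0 HZe0)). apply filter_imp. intros k (G1 & G2 & G3).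
    assert (E : (W k * h k = Ze k * den k)%C).
    { unfold transit_rel in G1. unfold den.
      replace (W k * h k)%C with ((W k + Ze k / 2) * h k - Ze k * h k / 2)%C by (unfold Cdiv; ring).
      unfold h at 1. rewrite G1. unfold Cdiv. ring. }
    split; [|exact E]. intros E0. rewrite E0, Cmult_0_l in E.
    symmetry in E. apply Cmult_neq_0 in E; assumption. }
  split; [revert Hw; apply filter_imp; tauto|].
  apply (bO_o1 _ 1 2); [|lia].
  (* Again an exact rewriting. The zero of the sine is at [N], so [/ Z] is compared with [N] in
     front of the sine and with [al m] in front of [eps]. *)
  apply (bO_ext (fun k => / den k * (- ((/ Ze k - N k) * sin (the k)
      + ((m k * (sin (the k) - (c / al)%R * t k)) * (N k * (/ m k)%R)
         + (c / al)%R * L k * (N k * (/ m k)%R - al))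
      + eps k * ((m k * (cos (the k) + 1)) * (/ Ze k * (/ m k)%R) - (/ Ze k - (al * m k)%R)))
      + (L k - (al / c)%R * (m k * eps k)) * (den k - c)))%C).
  - generalize (filter_and _ _ Hw (filter_and _ _ Hd0 (filter_and _ _ HZe0 m_inv_C))). apply filter_imp.
    intros k ((G1 & G2) & G3 & G4 & G5 & G6).
    assert (E : (- / W k = - (/ Ze k * h k * / den k))%C).
    { replace (/ Ze k * h k * / den k)%C with (/ Ze k * / den k * / W k * (W k * h k))%C by (field; auto).
      rewrite G2. field. auto. }
    rewrite E. unfold t. rewrite !RtoC_mult, !RtoC_div by lra.
    set (S := RtoC (sin (the k))) in *. set (Co := RtoC (cos (the k))) in *.
    assert (E2 : ((/ Ze k - N k) * S
      + ((m k * (S - c / al * (L k * (/ m k)%R))) * (N k * (/ m k)%R)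
         + c / al * L k * (N k * (/ m k)%R - al))
      + eps k * ((m k * (Co + 1)) * (/ Ze k * (/ m k)%R) - (/ Ze k - al * m k))
      = / Ze k * h k - c * L k + eps k * al * m k)%C).
    { change (h k) with (S + eps k * Co)%C.
      replace (m k * (S - c / al * (L k * (/ m k)%R)) * (N k * (/ m k)%R))%C with
        ((m k * (/ m k)%R) * (S * N k) - (m k * (/ m k)%R) * (c / al * L k * (N k * (/ m k)%R)))%C by (unfold Cdiv; ring).
      replace (m k * (Co + 1) * (/ Ze k * (/ m k)%R))%C with ((m k * (/ m k)%R) * ((Co + 1) * / Ze k))%C by ring.
      rewrite G6. field. auto. }
    rewrite E2. field. auto.
  - apply (bO_mult _ _ 0 0 1 2); [exact Hdi0|].
    assert (HNi : bO (fun k => N k * (/ m k)%R - al)%C 1 1).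
    { apply (bO_ext (fun k => al * mu k)%C); [|apply bO_scal, bO_mu].
      generalize (filter_and _ _ transit_logs Hm). apply filter_imp.
      intros k ((_ & _ & _ & _ & _ & _ & _ & G & _) & G2). rewrite G. rfold. f_equal. field. lra. }
    assert (HNi0 : bO (fun k => N k * (/ m k)%R)%C 0 0).
    { apply (bO_of_diff _ (fun _ => RtoC al) 1 1 0 0 HNi); [apply bO_const | lia | lia]. }
    assert (Hzi : bO (fun k => / Ze k * (/ m k)%R)%C 0 0).
    { apply (bO_of_diff _ (fun _ => RtoC al) 1 1 0 0); [|apply bO_const | lia | lia].
      apply (bO_ext (fun k => (/ Ze k - (al * m k)%R) * (/ m k)%R)%C); [|apply bO_mult_m_inv, Hz].
      generalize m_inv_C. apply filter_imp. intros k [G1 G2]. rewrite RtoC_mult.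
      replace ((/ Ze k - al * m k) * (/ m k)%R)%C with (/ Ze k * (/ m k)%R - al * (m k * (/ m k)%R))%C by ring.
      rewrite G2. ring. }
    apply bO_plus; [apply bO_opp, bO_plus; [apply bO_plus; [|apply bO_plus]|]|].
    + apply (bO_mult _ _ 0 1 1 1); assumption.
    + apply (bO_mult _ _ 1 2 0 0); [apply bO_times_m, HS | exact HNi0].
    + apply (bO_mult (fun k => (c / al)%R * L k)%C _ 0 1 1 1); [apply bO_scal, bO_L | exact HNi].
    + apply (bO_mult _ _ 1 1 0 1); [exact Heps|]. apply bO_minus; [|exact Hz].
      apply (bO_weaken _ 1 2); [|lia|lia]. apply (bO_mult _ _ 1 2 0 0); [apply bO_times_m, HCo | exact Hzi].
    + apply (bO_mult (fun k => L k - (al / c)%R * (m k * eps k))%C _ 0 1 1 1); [|exact Hden].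
      apply bO_minus; [apply bO_L | apply bO_scal, bO_times_m, Heps].
Qed.

(** After multiplication by [m], the first-order term of the logarithm retains the bounded part of
    [/ z - n] and turns the [o(1)] of the base asymptotics into [o(1)], because [m / n] is bounded.
    The second-order term is [O(L ^ 2 / m)]. *)
Lemma Clog_zeta (z : nat -> C) (n : nat -> R) :
  (exists M, 0 < M /\ eventually (fun k => m k <= M * n k)) ->
  bO (fun k => / z k - n k)%C 0 1 -> o1 (fun k => / z k - (n k + (1 - a) * ln (n k) + ph k))%C ->
  eventually (fun k => 0 < n k) ->
  o1 (fun k => m k * (Clog (/ z k) - ln (n k) - ((1 - a) * ln (n k) + ph k) * (/ n k)%R))%C.
Proof.
  intros (M & HM & Hmn) Hz Hz1 Hn.
  set (r := fun k => (m k / n k)%R).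
  assert (Hr : eventually (fun k => Cmod (r k) <= M)).
  { generalize (filter_and _ _ Hmn (filter_and _ _ Hn Hm)). apply filter_imp. intros k (G1 & G2 & G3).
    unfold r. rewrite Cmod_R, Rabs_pos_eq by (apply Rdiv_le_0_compat; lra).
    apply Rmult_le_reg_r with (n k); [lra|]. unfold Rdiv. rewrite Rmult_assoc, Rinv_l by lra. lra. }
  set (x := fun k => ((/ z k - n k) * (/ n k)%R)%C).
  assert (Hx : bO x 1 1).
  { apply (bO_ext (fun k => r k * ((/ z k - n k) * (/ m k)%R))%C).
    - generalize (filter_and _ _ Hn Hm). apply filter_imp. intros k (G2 & G3). unfold x, r.
      rewrite (Cmult_comm (r k)). unfold r. rewrite <- Cmult_assoc. f_equal. rfold. f_equal. field. lra.
    - apply (bO_mult _ _ 0 0 1 1); [apply (bO_bounded _ M); exact Hr | apply bO_mult_m_inv, Hz]. }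
  assert (Hhalf : 0 < / 2) by lra. assert (H14 : (1 < 4 * 1)%nat) by lia.
  pose proof (bO_o1 _ _ _ Hx H14 _ Hhalf) as Hxs.
  assert (H2 : bO (fun k => Clog (/ z k) - ln (n k) - x k)%C 2 2).
  { destruct (bO_mult _ _ _ _ _ _ Hx Hx) as (Mx & HMx & G). simpl in G.
    exists (4 * Mx). split; [lra|]. generalize (filter_and _ _ G (filter_and _ _ Hxs Hn)). apply filter_imp.
    intros k (G1 & G2 & G3).
    assert (Hnn : RtoC (n k) <> 0) by (intros E; apply RtoC_inj in E; lra).
    set (d := (/ z k - n k)%C) in *.
    assert (Ex : x k = (d / n k)%C) by (unfold x; rewrite RtoC_inv by lra; reflexivity).
    assert (Hcn : Cmod (n k) = n k) by (rewrite Cmod_R, Rabs_pos_eq; lra).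
    assert (Hd : Cmod d <= n k / 2).
    { rewrite Ex, Cmod_div, Hcn in G2 by exact Hnn.
      apply Rmult_le_reg_r with (/ n k); [apply Rinv_0_lt_compat; lra|].
      replace (n k / 2 * / n k) with (/ 2) by (field; lra). unfold Rdiv in G2. lra. }
    assert (HRe : 0 < Re (n k + d)).
    { pose proof (Re_close (n k + d) (n k)) as G4. replace (n k + d - n k)%C with d in G4 by ring. lra. }
    pose proof (Clog_diff (n k) d) as HC. rewrite Hcn in HC. specialize (HC G3 HRe Hd).
    replace (n k + d)%C with (/ z k)%C in HC by (unfold d; ring).
    rewrite Clog_RtoC in HC by exact G3. rewrite <- Ex in HC.
    eapply Rle_trans; [exact HC|].
    replace (Cmod d ^ 2 / n k ^ 2) with (Cmod (x k * x k)).
    - rewrite Rmult_assoc. apply Rmult_le_compat_l; lra.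
    - rewrite Cmod_mult, Ex, Cmod_div, Hcn by exact Hnn. field. lra. }
  apply (o1_ext (fun k => m k * (Clog (/ z k) - ln (n k) - x k)
    + r k * (/ z k - (n k + (1 - a) * ln (n k) + ph k)))%C).
  - generalize Hn. apply filter_imp. intros k G. unfold x, r, Rdiv. rewrite RtoC_mult. ring.
  - apply o1_plus.
    + apply (bO_o1 _ 1 2); [apply bO_times_m, H2 | lia].
    + apply (o1_bounded_mult _ _ M); [exact Hr | exact Hz1].
Qed.

(** * Total variation of the potential over a transit *)

Variables (Phi : R -> R) (I0 I1 : R).
Hypotheses (HPhis : o1 (fun k => Phi (ths k) - I0)%C) (HPhie : o1 (fun k => Phi (the k) - I1)%C).

Let pots k := transit_pot a b03 b30 b c (m k) Phi (s k) (ths k) (Zs k).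
Let pote k := transit_pot a b03 b30 b c (m k) Phi (e k) (the k) (Ze k).
(** Not a limit, since terms in [lam = ln m] and [ln L] remain. Those in [lam] have coefficient
    [(c / al) ((al - 1) (a - b03) + beta)], which vanishes for the prescribed [beta]; those in
    [ln L] combine with the logarithm carried by [Xs] into the one expected at the exit. *)
Let main k :=
  (c * ((1 - a) * (lam k + (PI / c)%R) + ph k) * (/ al)%R - c * ((1 - a) * lam k + ph k)
   + c * (beta * lam k + sg k) * (/ al)%R + c * cst1 a b03 b30 b * (1 - (/ al)%R)
   + c * (1 - b03) * ((/ al)%R * (ln c + ln (L k) - lam k - (PI / c)%R)
       - (ln c + ln (L k) - lam k) + (I1 - I0)))%C.

(** Applied to the sines at both ends, equivalent to [g L / m] with [g = c] at the entry and
    [g = c / al] at the exit. The logarithms of these two slopes are the source of [ln c] in [Gamma]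
    and of a term in [PI / c]. *)
Lemma bO_ln_quot (x : nat -> R) (g : R) : 0 < g -> bO (fun k => x k - g * t k)%C 2 2 ->
  bO (fun k => ln (x k) - (ln g + ln (L k) - lam k))%C 1 1.
Proof.
  intros Hg (M & HM & H).
  set (y := fun k => (x k - g * t k) / (g * t k)).
  assert (Hy : bO (fun k => y k) 1 1).
  { exists (M / g). split; [apply Rdiv_le_0_compat; lra|].
    generalize (filter_and _ _ H (filter_and _ _ Hm HL)). apply filter_imp. intros k (G1 & G2 & G3).
    assert (Ht : 0 < t k) by (unfold t; apply Rmult_lt_0_compat; [|apply Rinv_0_lt_compat]; lra).
    assert (Hgt : 0 < g * t k) by (apply Rmult_lt_0_compat; lra).
    rewrite Cmod_R. unfold y, Rdiv at 1. rewrite Rabs_mult, (Rabs_pos_eq (/ (g * t k))) by (apply Rlt_le, Rinv_0_lt_compat; lra).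
    rewrite <- RtoC_mult, <- RtoC_minus, Cmod_R in G1.
    apply Rle_trans with (M * scale 2 2 k * / (g * t k)).
    - apply Rmult_le_compat_r; [apply Rlt_le, Rinv_0_lt_compat; lra | exact G1].
    - unfold scale, t. right. simpl. field. lra. }
  destruct (bO_ln y 1 1 Hy ltac:(lia)) as (H1 & _ & H3).
  apply (bO_ext (fun k => ln (1 + y k))); [|exact H1].
  generalize (filter_and _ _ H3 (filter_and _ _ Hm HL)). apply filter_imp. intros k (G1 & G2 & G3).
  apply Rabs_le_between in G1.
  assert (Ht : 0 < t k) by (unfold t; apply Rmult_lt_0_compat; [|apply Rinv_0_lt_compat]; lra).
  assert (Hgt : 0 < g * t k) by (apply Rmult_lt_0_compat; lra).
  assert (E : x k = g * t k * (1 + y k)) by (unfold y; field; lra).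
  rewrite E, ln_mult, ln_mult by lra. unfold t. rewrite ln_mult, ln_Rinv, <- Hlam by
    (try apply Rinv_0_lt_compat; lra).
  rfold. f_equal. ring.
Qed.

(** The pieces of the potential are treated separately, with [m / s] tending to [1] and [m / e] to
    [/ al]. The terms in [sin ^ 2] and [sin cos] disappear because the sine is [O(L / m)] at both
    ends, so [trig1] and [trig2] leave no trace in [Gamma]. *)
Lemma pot_limit : o1 (fun k => m k * (pote k - pots k) - main k)%C.
Proof.
  pose proof al_gt_1 as Hal.
  destruct bO_ln_s as [Ls Le]. destruct transit_time_ratios as [Rs Re].
  destruct transit_trig_entry as (S1 & S2 & S3). destruct transit_trig_exit as (E1 & E2 & E3).
  destruct zeta_shift as (_ & _ & _ & Zs1 & Ze1).
  set (rs := fun k => RtoC (m k / s k)) in *. set (re := fun k => RtoC (m k / e k)) in *.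
  assert (Rs0 : bO rs 0 0).
  { apply (bO_of_diff _ (fun _ => RtoC 1) 1 1 0 0 Rs); [apply bO_const | lia | lia]. }
  assert (Re0 : bO re 0 0).
  { apply (bO_of_diff _ (fun _ => RtoC (/ al)) 1 1 0 0 Re); [apply bO_const | lia | lia]. }
  assert (Cs0 : bO (fun k => cos (ths k)) 0 0).
  { apply (bO_of_diff _ (fun _ => RtoC 1) 2 2 0 0 S2); [apply bO_const | lia | lia]. }
  assert (Ce0 : bO (fun k => cos (the k)) 0 0).
  { apply (bO_of_diff _ (fun _ => (- (1))%C) 2 2 0 0); [|apply bO_const | lia | lia].
    apply (bO_ext (fun k => cos (the k) + 1)%C); [exists 0%nat; intros; ring | exact E2]. }
  assert (Hpos : eventually (fun k => 0 < s k /\ 0 < e k /\ 0 < m k)).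
  { generalize transit_logs. apply filter_imp. tauto. }
  assert (Qs : o1 (fun k => m k * (Clog (/ Zs k) - ln (s k) - ((1 - a) * ln (s k) + ph k) * (/ s k)%R))%C).
  { apply Clog_zeta; try assumption.
    - exists 1. split; [lra|]. generalize HL. apply filter_imp. intros k G. unfold s. lra.
    - revert Hpos. apply filter_imp. tauto. }
  assert (Qe : o1 (fun k => m k * (Clog (/ Ze k) - ln (e k) - ((1 - a) * ln (e k) + ph k) * (/ e k)%R))%C).
  { apply Clog_zeta; try assumption.
    - exists 2. split; [lra|].
      destruct (bO_ln _ 1 1 bO_v ltac:(lia)) as (_ & _ & Hv).
      generalize (filter_and _ _ Hv transit_logs). apply filter_imp.
      intros k (G1 & G2 & _ & _ & _ & _ & _ & _ & _ & G3 & _). rewrite G3.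
      apply Rabs_le_between in G1.
      replace (2 * (al * m k * (1 + v k))) with (m k * (al * (2 * (1 + v k)))) by ring.
      rewrite <- (Rmult_1_r (m k)) at 1. apply Rmult_le_compat_l; [lra|].
      assert (al * 1 <= al * (2 * (1 + v k))) by (apply Rmult_le_compat_l; lra). lra.
    - revert Hpos. apply filter_imp. tauto. }
  assert (Hlp : bO (fun k => (1 - a) * lam k + ph k)%C 0 1).
  { apply bO_plus; [apply bO_scal, bO_lam | apply (bO_weaken _ 0 0); [apply bO_ph | lia | lia]]. }
  assert (DAs : bO (fun k => (1 - a) * (ln (s k) - lam k) * rs k + ((1 - a) * lam k + ph k) * (rs k - 1))%C 1 2).
  { apply bO_plus.
    - apply (bO_weaken _ 1 1); [|lia|lia]. apply (bO_mult (fun k => (1 - a) * (ln (s k) - lam k))%C _ 1 1 0 0);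
        [apply bO_scal, Ls | exact Rs0].
    - apply (bO_mult _ _ 0 1 1 1); [exact Hlp | exact Rs]. }
  assert (DAe : bO (fun k => (1 - a) * (ln (e k) - lam k - (PI / c)%R) * re k
      + ((1 - a) * (lam k + (PI / c)%R) + ph k) * (re k - (/ al)%R))%C 1 2).
  { apply bO_plus.
    - apply (bO_weaken _ 1 1); [|lia|lia].
      apply (bO_mult (fun k => (1 - a) * (ln (e k) - lam k - (PI / c)%R))%C _ 1 1 0 0); [apply bO_scal, Le | exact Re0].
    - apply (bO_mult _ _ 0 1 1 1); [|exact Re].
      apply (bO_ext (fun k => ((1 - a) * lam k + ph k) + (1 - a) * (PI / c)%R)%C); [exists 0%nat; intros; ring|].
      apply bO_plus; [exact Hlp | apply (bO_weaken _ 0 0); [apply bO_const | lia | lia]]. }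
  (* The effect of the rescaled speed [ck]. From [ck (PI / c + ln (1 + mu)) = PI], the mismatch
     [c - ck] times the total logarithm [PI / c] equals [ck ln (1 + mu)], about [c mu], and
     [m mu = (beta lam + sg) / al]. This is how the phase reaches the limit. *)
  assert (Dth : o1 (fun k => m k * (c * (ln (e k) - ln (s k)) - (the k - ths k)) - c * (beta * lam k + sg k) * (/ al)%R)%C).
  { destruct (bO_ln _ 1 1 bO_mu ltac:(lia)) as (M1 & M2 & _). destruct bO_ck as [Hck1 Hck2].
    apply (bO_o1 _ 1 2); [|lia].
    apply (bO_ext (fun k => m k * (- (ck k - c) * ((ln (e k) - lam k - (PI / c)%R) - (ln (s k) - lam k))
      + (ck k - c) * ln (1 + mu k) + c * (ln (1 + mu k) - mu k)))%C).
    - generalize (filter_and _ _ Hck2 (filter_and _ _ transit_logs Hm)). apply filter_imp.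
      intros k (G1 & (_ & G2 & G3 & _) & G4).
      assert (Eth : the k - ths k = ck k * (ln (e k) - ln (s k))).
      { unfold the, ths, transit_angle. fold (ck k). rewrite !ln_div by lra. ring. }
      replace (RtoC (the k) - RtoC (ths k))%C with (RtoC (ck k * (ln (e k) - ln (s k)))) by (rewrite <- RtoC_minus; f_equal; lra).
      rfold. f_equal.
      assert (Emu : m k * mu k = (beta * lam k + sg k) * / al) by (unfold mu; field; lra).
      replace (c * (beta * lam k + sg k) * / al) with (c * (m k * mu k)) by (rewrite Emu; ring).
      assert (E0 : ck k * ln (1 + mu k) = (c - ck k) * (PI / c)).
      { replace ((c - ck k) * (PI / c)) with (PI - ck k * (PI / c)) by (field; lra). lra. }
      replace ((ck k - c) * ln (1 + mu k)) with ((c - ck k) * (PI / c) - c * ln (1 + mu k)) by (rewrite <- E0; ring).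
      ring.
    - apply bO_times_m. apply bO_plus; [apply bO_plus|].
      + apply (bO_mult (fun k => - (ck k - c))%C _ 1 1 1 1); [apply bO_opp, Hck1 | apply bO_minus; assumption].
      + apply (bO_mult _ _ 1 1 1 1); assumption.
      + apply bO_scal, M2. }
  assert (Ks : bO (fun k => rs k * (trig1 a b03 b30 b c * (sin (ths k) * sin (ths k))
      + trig2 a b03 b30 b c * (sin (ths k) * cos (ths k))) - cst1 a b03 b30 b * (rs k - 1))%C 1 1).
  { apply bO_minus; [|apply bO_scal, Rs].
    apply (bO_mult _ _ 0 0 1 1); [exact Rs0|]. apply bO_plus; apply bO_scal.
    - apply (bO_weaken _ 2 2); [apply (bO_mult _ _ 1 1 1 1); assumption | lia | lia].
    - apply (bO_mult _ _ 1 1 0 0); assumption. }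
  assert (Kee : bO (fun k => re k * (trig1 a b03 b30 b c * (sin (the k) * sin (the k))
      + trig2 a b03 b30 b c * (sin (the k) * cos (the k))) - cst1 a b03 b30 b * (re k - (/ al)%R))%C 1 1).
  { apply bO_minus; [|apply bO_scal, Re].
    apply (bO_mult _ _ 0 0 1 1); [exact Re0|]. apply bO_plus; apply bO_scal.
    - apply (bO_weaken _ 2 2); [apply (bO_mult _ _ 1 1 1 1); assumption | lia | lia].
    - apply (bO_mult _ _ 1 1 0 0); assumption. }
  assert (Hll : bO (fun k => ln c + ln (L k) - lam k)%C 0 1).
  { apply bO_minus; [apply bO_plus; [apply (bO_weaken _ 0 0); [apply bO_const | lia | lia] | apply bO_ln_L] | apply bO_lam]. }
  pose proof (bO_ln_quot _ c Hc S1) as Ns.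
  assert (Hcal : 0 < c / al) by (apply Rdiv_lt_0_compat; lra).
  pose proof (bO_ln_quot _ (c / al) Hcal E1) as Ne.
  assert (Lns : bO (fun k => rs k * ln (sin (ths k)) - (ln c + ln (L k) - lam k))%C 1 2).
  { apply (bO_ext (fun k => rs k * (ln (sin (ths k)) - (ln c + ln (L k) - lam k))
      + (rs k - 1) * (ln c + ln (L k) - lam k))%C); [exists 0%nat; intros; ring|].
    apply bO_plus.
    - apply (bO_weaken _ 1 1); [apply (bO_mult _ _ 0 0 1 1); assumption | lia | lia].
    - apply (bO_mult _ _ 1 1 0 1); assumption. }
  assert (Lne : bO (fun k => re k * ln (sin (the k)) - (/ al)%R * (ln c + ln (L k) - lam k - (PI / c)%R))%C 1 2).
  { apply (bO_ext (fun k => re k * (ln (sin (the k)) - (ln (c / al) + ln (L k) - lam k))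
      + (re k - (/ al)%R) * ((ln c + ln (L k) - lam k) - (PI / c)%R))%C).
    - exists 0%nat. intros k _. rewrite ln_div by lra. unfold al at 1. rewrite ln_exp, RtoC_minus. ring.
    - apply bO_plus.
      + apply (bO_weaken _ 1 1); [apply (bO_mult _ _ 0 0 1 1); assumption | lia | lia].
      + apply (bO_mult _ _ 1 1 0 1); [assumption|].
        apply bO_minus; [exact Hll | apply (bO_weaken _ 0 0); [apply bO_const | lia | lia]]. }
  apply (o1_ext (fun k =>
    c * (m k * (Clog (/ Ze k) - ln (e k) - ((1 - a) * ln (e k) + ph k) * (/ e k)%R))
    - c * (m k * (Clog (/ Zs k) - ln (s k) - ((1 - a) * ln (s k) + ph k) * (/ s k)%R))
    + c * ((1 - a) * (ln (e k) - lam k - (PI / c)%R) * re k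
      + ((1 - a) * (lam k + (PI / c)%R) + ph k) * (re k - (/ al)%R))
    - c * ((1 - a) * (ln (s k) - lam k) * rs k + ((1 - a) * lam k + ph k) * (rs k - 1))
    + (m k * (c * (ln (e k) - ln (s k)) - (the k - ths k)) - c * (beta * lam k + sg k) * (/ al)%R)
    + c * (re k * (trig1 a b03 b30 b c * (sin (the k) * sin (the k))
      + trig2 a b03 b30 b c * (sin (the k) * cos (the k))) - cst1 a b03 b30 b * (re k - (/ al)%R))
    - c * (rs k * (trig1 a b03 b30 b c * (sin (ths k) * sin (ths k))
      + trig2 a b03 b30 b c * (sin (ths k) * cos (ths k))) - cst1 a b03 b30 b * (rs k - 1))
    + c * (1 - b03) * (re k * ln (sin (the k)) - (/ al)%R * (ln c + ln (L k) - lam k - (PI / c)%R))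
    - c * (1 - b03) * (rs k * ln (sin (ths k)) - (ln c + ln (L k) - lam k))
    + c * (1 - b03) * (Phi (the k) - I1) - c * (1 - b03) * (Phi (ths k) - I0))%C).
  - generalize (filter_and _ _ Hpos m_inv_C). apply filter_imp. intros k ((G1 & G2 & G3) & G4 & G5).
    unfold pote, pots, transit_pot, main, rs, re, Rdiv.
    set (k1 := trig1 a b03 b30 b c). set (k2 := trig2 a b03 b30 b c). set (k3 := cst1 a b03 b30 b).
    simpl pow. rewrite !Rmult_1_r. rewrite !RtoC_plus, !RtoC_mult.
    replace (RtoC (Phi (the k)) * RtoC (/ m k))%C with (Phi (the k) * (/ m k)%R)%C by reflexivity.
    apply Ceq_minus.
    set (im := RtoC (/ m k)) in *. set (mk := RtoC (m k)) in *.
    match goal with |- ?x = _ => replace x with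
      ((c * (1 - b03) * (Phi (the k) - Phi (ths k)) * (1 - mk * im))%C) end.
    + rewrite G5. ring.
    + ring.
  - assert (Hc11 : forall f, bO f 1 1 -> o1 f) by (intros f Hf; apply (bO_o1 _ 1 1 Hf); lia).
    assert (Hc12 : forall f, bO f 1 2 -> o1 f) by (intros f Hf; apply (bO_o1 _ 1 2 Hf); lia).
    apply o1_minus; [apply o1_plus; [apply o1_minus; [apply o1_plus; [apply o1_minus; [apply o1_plus;
      [apply o1_plus; [apply o1_minus; [apply o1_plus; [apply o1_minus|]|]|]|]|]|]|]|]|].
    + apply o1_scal, Qe.
    + apply o1_scal, Qs.
    + apply o1_scal, Hc12, DAe.
    + apply o1_scal, Hc12, DAs.
    + exact Dth.
    + apply o1_scal, Hc11, Kee.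
    + apply o1_scal, Hc11, Ks.
    + apply o1_scal, Hc12, Lne.
    + apply o1_scal, Hc12, Lns.
    + apply o1_scal, HPhie.
    + apply o1_scal, HPhis.
Qed.

Hypotheses (Hb : b <> 0) (Hbeta : ((b03 - a) * (al - 1))%C = beta).

(** The four comparisons, at the exit, along the transit, at the entry and for the potential, are
    added with the factor [al / c] that converts [m eps] into [X] at the exit. The entry coordinate
    is multiplied by [al], whence the coefficients [al] of [phq] and [1 - al] of [ph]. *)
Lemma bulk_limit (epss epse W : nat -> C) :
  o1 (fun k => m k * epss k - c * (Xs k - L k))%C ->
  bO epse 1 1 ->
  eventually (fun k => transit_rel c (sin (the k)) (cos (the k)) (Ze k) (W k) (epse k)) ->
  o1 (fun k => m k * (epse k - epss k - (pote k - pots k)))%C ->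
  eventually (fun k => W k <> 0) /\
  o1 (fun k => - / W k - (- L k + (1 - b03) * ln (L k)
    + (al * phq k + (1 - al) * ph k
       + ((al - 1) * ((a - b03 + b30) / (2 * b) + a + 1 / 2 * (1 - b03) + (b03 - 1) * ln c)
          + (b03 - a) * (PI / c)%R + al * (1 - b03) * (I1 - I0)) + sg k)))%C.
Proof.
  intros P3 Hepse Hrel P2. pose proof al_gt_1 as Hal.
  destruct (exit_coordinate epse W Hepse Hrel) as [HW P1]. split; [exact HW|].
  assert (Halc : RtoC al <> 0) by (intros E; apply RtoC_inj in E; lra).
  assert (Hcc : RtoC c <> 0) by (intros E; apply RtoC_inj in E; lra).
  assert (Hbc : RtoC b <> 0) by (intros E; apply RtoC_inj in E; lra).
  apply (o1_ext (fun k =>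
    (- / W k + L k - (al / c)%R * (m k * epse k))
    + (al / c)%R * (m k * (epse k - epss k - (pote k - pots k)))
    + (al / c)%R * (m k * epss k - c * (Xs k - L k))
    + (al / c)%R * (m k * (pote k - pots k) - main k)
    + al * (Xs k - (L k + (1 - b03) * ln (L k) + phq k)))%C).
  - exists 0%nat. intros k _. unfold main, cst1. rewrite <- Hbeta.
    set (iw := Cinv (W k)). rewrite RtoC_div, RtoC_inv by lra. field. auto.
  - apply o1_plus; [apply o1_plus; [apply o1_plus; [apply o1_plus|]|]|].
    + exact P1.
    + apply o1_scal, P2.
    + apply o1_scal, P3.
    + apply o1_scal, pot_limit.
    + apply o1_scal, HXs.
Qed.
End Scales.

(** * Skew products *)

Lemma resit_1 (b03 : C) : resit 1 b03 = (1 - b03)%C.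
Proof. unfold resit. field. Qed.

(** Division by [0] gives [0] here, so [Xc 1 0 = 0] and a value close to a nonzero [x] excludes
    [w = 0]. *)
Lemma Xc_near_neq_0 (w : C) (x : R) : x <> 0 -> Cmod (Xc 1 w - x) <= Rabs x / 4 -> w <> 0.
Proof.
  intros Hx H E. subst w. unfold Xc in H.
  replace (- (1 / (1 * 0)) - x)%C with (- x)%C in H.
  - rewrite Cmod_opp, Cmod_R in H. apply Rabs_pos_lt in Hx. lra.
  - rewrite Cmult_0_r. unfold Cdiv. replace (/ 0)%C with (RtoC 0); [ring|].
    unfold Cinv. simpl. unfold Rdiv. apply injective_projections; simpl; ring.
Qed.

(** The terms in [z] are treated as part of the quartic remainder of [q_0]: its coefficient becomes
    [O(1 + nu ^ 2 / |w| ^ 4)], which [Xc_step] tolerates. As [1 / |w|] is at most a multiple of [l],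
    the base contributes [nu ^ 2 l ^ 2] to the increment of [X]. *)
Lemma fiber_step (b C0 d0 : R) (b03 b30 : C) : 0 <= C0 -> 0 < d0 ->
  exists M X0 de, 0 < M /\ 8 <= X0 /\ 0 < de /\
  forall (z w w' : C) (nu x l : R),
  X0 <= Rabs x <= l -> Cmod z <= nu -> nu * l <= de -> Cmod (Xc 1 w - x) <= Rabs x / 4 ->
  (Cmod z < d0 -> Cmod w < d0 ->
    Cmod (w' - (w + w ^ 2 + b * z ^ 2 + b03 * w ^ 3 + b30 * z ^ 3)) <= C0 * (Cmod z + Cmod w) ^ 4) ->
  Cmod (Xc 1 w' - Xc 1 w - 1 - (1 - b03) / Xc 1 w) <= 2 * M * (/ x ^ 2 + nu ^ 2 * l ^ 2).
Proof.
  intros HC0 Hd0.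
  assert (H1n : RtoC 1 <> 0) by (intros E; apply RtoC_inj in E; lra).
  destruct (Xc_step 1 b03 H1n) as (Ms & ds & HMs & Hds & Hstep).
  set (K0 := Rabs b + Cmod b30 + 16 * C0 + 1).
  assert (HK0 : 1 <= K0).
  { unfold K0. pose proof (Rabs_pos b). pose proof (Cmod_ge_0 b30). lra. }
  assert (HK0i : 0 < / K0 <= 1).
  { split; [apply Rinv_0_lt_compat; lra|]. rewrite <- Rinv_1. apply Rinv_le_contravar; lra. }
  assert (Hid : 0 < / ds /\ 0 < / d0) by (split; apply Rinv_0_lt_compat; assumption).
  exists (Ms * (1 + K0)), (8 + 32 * K0 + 2 * / ds + 2 * / d0), (Rmin (/ (16 * K0)) (d0 / 2)).
  assert (Hde : 0 < / (16 * K0)) by (apply Rinv_0_lt_compat; lra).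
  split; [apply Rmult_lt_0_compat; lra|]. split; [lra|]. split; [apply Rmin_pos; lra|].
  intros z w w' nu x l Hx Hz Hnu HX Hw'.
  pose proof (Rmin_l (/ (16 * K0)) (d0 / 2)) as Hd1. pose proof (Rmin_r (/ (16 * K0)) (d0 / 2)) as Hd2.
  set (de := Rmin _ _) in *.
  assert (Hx0 : x <> 0) by (intros E; rewrite E, Rabs_R0 in Hx; lra).
  assert (Hw0 : w <> 0) by (apply (Xc_near_neq_0 w x); assumption).
  assert (HW : 0 < Cmod w) by (apply Cmod_gt_0; exact Hw0).
  set (W := Cmod w) in *. set (ax := Rabs x) in *.
  assert (HXm : Cmod (Xc 1 w) = / W).
  { rewrite Xc_mod by assumption. rewrite Cmod_1, Rmult_1_l. reflexivity. }
  assert (HiW : 3 / 4 * ax <= / W <= 5 / 4 * ax).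
  { pose proof (Cmod_rev x (Xc 1 w)) as G1. pose proof (Cmod_rev (Xc 1 w) x) as G2.
    rewrite Cmod_minus_sym in G1. rewrite HXm, Cmod_R in G1. rewrite HXm, Cmod_R in G2. fold ax in G1, G2. lra. }
  assert (Hnu0 : 0 <= nu) by (eapply Rle_trans; [apply Cmod_ge_0 | exact Hz]).
  assert (HWu : W * (3 / 4 * ax) <= 1).
  { apply Rle_trans with (W * / W); [apply Rmult_le_compat_l; lra | right; field; lra]. }
  assert (HWl : 1 <= W * (5 / 4 * ax)).
  { apply Rle_trans with (W * / W); [right; field; lra | apply Rmult_le_compat_l; lra]. }
  assert (HWl2 : 1 <= W * (5 / 4 * l)).
  { eapply Rle_trans; [exact HWl|]. apply Rmult_le_compat_l; lra. }
  assert (Hnl : nu * 8 <= de).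
  { eapply Rle_trans; [|exact Hnu]. apply Rmult_le_compat_l; lra. }
  assert (Hde16 : / (16 * K0) <= / 16).
  { apply Rinv_le_contravar; lra. }
  assert (HnW : nu <= W).
  { apply Rmult_le_reg_r with (5 / 4 * l); [lra|]. lra. }
  assert (HWs : forall y, 0 < y -> 2 * / y <= ax -> W < y).
  { intros y Hy Hyx. apply Rmult_lt_reg_r with (3 / 4 * ax); [lra|].
    eapply Rle_lt_trans; [exact HWu|]. apply Rlt_le_trans with (y * (3 / 4 * (2 * / y))).
    - replace (y * (3 / 4 * (2 * / y))) with (3 / 2) by (field; lra). lra.
    - apply Rmult_le_compat_l; lra. }
  assert (HWd0 : W < d0) by (apply HWs; lra).
  assert (HWds : W <= ds) by (apply Rlt_le, HWs; lra).
  assert (HW1 : W <= / (16 * K0)).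
  { apply Rlt_le, HWs; [lra|]. rewrite Rinv_inv. lra. }
  assert (HW2 : W <= / 16) by lra.
  specialize (Hw' ltac:(lra) HWd0). fold W in Hw'.
  assert (HwC : forall n, (w ^ n)%C <> 0) by (intros n; apply Cpow_nz; exact Hw0).
  (* All that is not the expansion of [q_0] to third order, including the base forcing, is put in
     this coefficient. *)
  set (r := ((w' - (w + w ^ 2 + b03 * w ^ 3)) / w ^ 4)%C).
  assert (Hr : Cmod r <= K0 * (nu ^ 2 / W ^ 4 + 1)).
  { unfold r. rewrite Cmod_div, Cmod_pow by apply HwC. fold W.
    assert (H4 : 0 < W ^ 4) by (apply pow_lt; exact HW).
    apply Rmult_le_reg_r with (W ^ 4); [exact H4|].
    unfold Rdiv at 1. rewrite Rmult_assoc, Rinv_l, Rmult_1_r by lra.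
    replace (K0 * (nu ^ 2 / W ^ 4 + 1) * W ^ 4) with (K0 * nu ^ 2 + K0 * W ^ 4) by (field; lra).
    replace (w' - (w + w ^ 2 + b03 * w ^ 3))%C with
      ((w' - (w + w ^ 2 + b * z ^ 2 + b03 * w ^ 3 + b30 * z ^ 3)) + b * z ^ 2 + b30 * z ^ 3)%C by ring.
    assert (G1 : (Cmod z + W) ^ 4 <= 16 * W ^ 4).
    { replace (16 * W ^ 4) with ((2 * W) ^ 4) by ring. apply pow_incr. pose proof (Cmod_ge_0 z). lra. }
    assert (G2 : Cmod (b * z ^ 2) <= Rabs b * nu ^ 2).
    { rewrite Cmod_mult, Cmod_R, Cmod_pow. apply Rmult_le_compat_l; [apply Rabs_pos|].
      apply pow_incr. split; [apply Cmod_ge_0 | exact Hz]. }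
    assert (G3 : Cmod (b30 * z ^ 3) <= Cmod b30 * nu ^ 2).
    { rewrite Cmod_mult, Cmod_pow. apply Rmult_le_compat_l; [apply Cmod_ge_0|].
      apply Rle_trans with (nu ^ 3); [apply pow_incr; split; [apply Cmod_ge_0 | exact Hz]|].
      replace (nu ^ 3) with (nu ^ 2 * nu) by ring. rewrite <- (Rmult_1_r (nu ^ 2)) at 2.
      apply Rmult_le_compat_l; [apply pow2_ge_0 | lra]. }
    eapply Rle_trans; [apply Cadd_le; [apply Cadd_le; [exact Hw' | exact G2] | exact G3]|].
    assert (C0 * (Cmod z + W) ^ 4 <= C0 * (16 * W ^ 4)) by (apply Rmult_le_compat_l; assumption).
    assert (0 <= nu ^ 2) by apply pow2_ge_0.
    unfold K0. pose proof (Rabs_pos b). pose proof (Cmod_ge_0 b30).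
    assert (0 <= (Rabs b + Cmod b30 + 1) * W ^ 4) by (apply Rmult_le_pos; lra).
    assert (0 <= (16 * C0 + 1) * nu ^ 2) by (apply Rmult_le_pos; lra). lra. }
  assert (HrW : forall n, (n <= 3)%nat -> Cmod r * W ^ n <= K0 * (nu ^ 2 / W ^ (4 - n)) + K0 * W ^ n).
  { intros n Hn. assert (H4 : 0 < W ^ n) by (apply pow_lt; exact HW).
    eapply Rle_trans; [apply Rmult_le_compat_r; [lra | exact Hr]|]. right.
    replace (W ^ 4) with (W ^ n * W ^ (4 - n)) by (rewrite <- pow_add; f_equal; lia).
    assert (0 < W ^ (4 - n)) by (apply pow_lt; exact HW). field. lra. }
  assert (Hnu1 : nu ^ 2 / W <= nu).
  { apply Rmult_le_reg_r with W; [exact HW|]. unfold Rdiv. rewrite Rmult_assoc, Rinv_l by lra.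
    simpl. rewrite !Rmult_1_r. apply Rmult_le_compat_l; assumption. }
  destruct (Hstep w r) as [_ Hs].
  { fold W. lra. }
  { fold W. eapply Rle_trans; [apply HrW; lia|]. simpl (4 - 3)%nat. rewrite pow_1.
    assert (W ^ 3 <= W * / 256).
    { simpl. rewrite Rmult_1_r. apply Rmult_le_compat_l; [lra|].
      apply Rle_trans with (/ 16 * / 16); [apply Rmult_le_compat; lra | lra]. }
    apply Rle_trans with (K0 * (/ (16 * K0) * / 8) + K0 * (/ (16 * K0) * / 256)).
    - apply Rplus_le_compat; apply Rmult_le_compat_l; lra.
    - replace (K0 * (/ (16 * K0) * / 8) + K0 * (/ (16 * K0) * / 256)) with (/ 128 + / 4096) by (field; lra). lra. }
  cbv zeta in Hs.
  replace (w + 1 * w ^ 2 + b03 * w ^ 3 + r * w ^ 4)%C with w' in Hs by (unfold r; field; exact Hw0).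
  rewrite resit_1 in Hs. fold W in Hs. eapply Rle_trans; [exact Hs|].
  specialize (HrW 2%nat ltac:(lia)). simpl (4 - 2)%nat in HrW.
  assert (HW2x : W ^ 2 <= 16 / 9 * / x ^ 2).
  { rewrite <- (pow2_abs x). fold ax. apply Rmult_le_reg_r with ((3 / 4 * ax) ^ 2); [apply pow_lt; lra|].
    rewrite <- Rpow_mult_distr. replace (16 / 9 * / ax ^ 2 * (3 / 4 * ax) ^ 2) with (1 ^ 2) by (field; lra).
    apply pow_incr. split; [apply Rmult_le_pos; lra | exact HWu]. }
  assert (HW2l : nu ^ 2 / W ^ 2 <= nu ^ 2 * (25 / 16 * l ^ 2)).
  { unfold Rdiv. apply Rmult_le_compat_l; [apply pow2_ge_0|].
    rewrite <- pow_inv. replace (25 * / 16 * l ^ 2) with ((5 / 4 * l) ^ 2) by field.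
    apply pow_incr. split; [lra|]. lra. }
  assert (HrW2 : (1 + Cmod r) * W ^ 2 <= (1 + K0) * (16 / 9 * / x ^ 2) + K0 * (nu ^ 2 * (25 / 16 * l ^ 2))).
  { replace ((1 + Cmod r) * W ^ 2) with (W ^ 2 + Cmod r * W ^ 2) by ring.
    assert (K0 * W ^ 2 <= K0 * (16 / 9 * / x ^ 2)) by (apply Rmult_le_compat_l; lra).
    assert (K0 * (nu ^ 2 / W ^ 2) <= K0 * (nu ^ 2 * (25 / 16 * l ^ 2))) by (apply Rmult_le_compat_l; lra). lra. }
  rewrite Rmult_assoc.
  assert (Hix : 0 <= / x ^ 2).
  { apply Rlt_le, Rinv_0_lt_compat. rewrite <- pow2_abs. apply pow_lt. fold ax. lra. }
  assert (0 <= nu ^ 2 * l ^ 2) by (apply Rmult_le_pos; apply pow2_ge_0).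
  apply Rle_trans with (Ms * ((1 + K0) * (2 * (/ x ^ 2 + nu ^ 2 * l ^ 2)))); [|right; ring].
  apply Rmult_le_compat_l; [lra|]. eapply Rle_trans; [exact HrW2|].
  rewrite (Rmult_plus_distr_r 1 K0). rewrite (Rmult_plus_distr_r 1 K0).
  assert (0 <= K0 * / x ^ 2) by (apply Rmult_le_pos; lra).
  assert (0 <= K0 * (nu ^ 2 * l ^ 2)) by (apply Rmult_le_pos; lra). lra.
Qed.

Lemma fiber_orbit (b C0 d0 : R) (b03 b30 : C) (C1 : R) : 0 <= C0 -> 0 < d0 -> 0 <= C1 ->
  let B := (1 - b03)%C in
  exists J0 M1 kappa, 8 <= J0 /\ 0 < M1 /\ 0 < kappa /\
  forall (s x0 J nu l : R) (T : nat) (Z W : nat -> C),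
  Rabs s = 1 -> J0 <= J -> (forall t, (t <= T)%nat -> J <= s * (x0 + INR t) <= l) ->
  nu * l <= kappa -> INR T * (nu ^ 2 * l ^ 2) <= kappa ->
  (forall t, (t <= T)%nat -> Cmod (Z t) <= nu) ->
  (forall t, (t < T)%nat -> Cmod (Z t) < d0 -> Cmod (W t) < d0 ->
    Cmod (W (S t) - (W t + W t ^ 2 + b * Z t ^ 2 + b03 * W t ^ 3 + b30 * Z t ^ 3))
      <= C0 * (Cmod (Z t) + Cmod (W t)) ^ 4) ->
  let X t := Xc 1 (W t) in
  Cmod (X 0%nat - x0) <= Rabs x0 / 4 ->
  Cmod (X 0%nat - B * Clog (s * X 0%nat) - x0) <= C1 ->
  forall t, (t <= T)%nat -> W t <> 0 /\
    Cmod (X t - (x0 + INR t)%R) <= Rabs (x0 + INR t) / 4 /\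
    Cmod (X t - B * Clog (s * X t) - (X 0%nat - B * Clog (s * X 0%nat)) - INR t)
      <= M1 * (2 / J + INR T * (nu ^ 2 * l ^ 2)) /\
    Cmod (X t - (x0 + INR t)%R) <= C1 + 1 + Cmod B * (ln (2 * Rabs (x0 + INR t)) + PI).
Proof.
  intros HC0 Hd0 HC1 B.
  destruct (fiber_step b C0 d0 b03 b30 HC0 Hd0) as (M & X0 & de & HM & HX0 & Hde & Hstep).
  destruct (fatou_approx_orbit B M C1 HM HC1) as (J0 & M1 & ka & HJ0 & HM1 & Hka & Horb).
  exists (Rmax J0 X0), M1, (Rmin de ka).
  split; [eapply Rle_trans; [exact HJ0 | apply Rmax_l]|]. split; [exact HM1|].
  split; [apply Rmin_pos; assumption|].
  intros s x0 J nu l T Z W Hs HJ Hx Hnl HTl HZ HW X HXx HPsi t Ht.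
  pose proof (Rmax_l J0 X0). pose proof (Rmax_r J0 X0). pose proof (Rmin_l de ka). pose proof (Rmin_r de ka).
  assert (Habs : forall u, (u <= T)%nat -> Rabs (x0 + INR u) = s * (x0 + INR u)).
  { intros u Hu. rewrite <- (Rabs_pos_eq (s * (x0 + INR u))) by (pose proof (Hx u Hu); lra).
    rewrite Rabs_mult, Hs. ring. }
  assert (Hres : forall u, (u <= T)%nat ->
    Cmod (X u - (x0 + INR u)%R) <= Rabs (x0 + INR u) / 4 /\
    Cmod (X u - B * Clog (s * X u) - (X 0%nat - B * Clog (s * X 0%nat)) - INR u)
      <= M1 * (2 / J + INR T * (nu ^ 2 * l ^ 2)) /\
    Cmod (X u - (x0 + INR u)%R) <= C1 + 1 + Cmod B * (ln (2 * Rabs (x0 + INR u)) + PI)).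
  { apply Horb; try assumption; try lra.
    - apply Rmult_le_pos; apply pow2_ge_0.
    - intros u Hu. apply Hx. exact Hu.
    - intros u Hu HXu. unfold X. pose proof (Hx u ltac:(lia)) as Hxu. pose proof (Habs u ltac:(lia)) as Hau.
      apply (Hstep (Z u)).
      + lra.
      + apply HZ. lia.
      + lra.
      + exact HXu.
      + apply HW. exact Hu. }
  destruct (Hres t Ht) as (G1 & G2 & G3). split; [|auto].
  apply (Xc_near_neq_0 _ (x0 + INR t)); [|exact G1].
  pose proof (Habs t Ht) as Ha. pose proof (Hx t Ht) as Hxt. intros E. rewrite E, Rmult_0_r in Hxt. lra.
Qed.

(** * Continuity of skew products and of their iterates *)

Lemma C2_norm_le (x : C2) : @norm C_AbsRing C2 x <= Cmod (fst x) + Cmod (snd x).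
Proof.
  change (@norm C_AbsRing C2 x) with (sqrt (Cmod (fst x) ^ 2 + Cmod (snd x) ^ 2)).
  pose proof (Cmod_ge_0 (fst x)). pose proof (Cmod_ge_0 (snd x)).
  rewrite <- (sqrt_pow2 (Cmod (fst x) + Cmod (snd x))) by lra.
  apply sqrt_le_1_alt.
  assert (0 <= Cmod (fst x) * Cmod (snd x)) by (apply Rmult_le_pos; assumption). lra.
Qed.

Lemma C2_continuous (F : C2 -> C2) (x : C2) : @continuous C2 C2 F x <->
  forall eps, 0 < eps -> exists d, 0 < d /\ forall y : C2,
    Cmod (fst y - fst x) < d -> Cmod (snd y - snd x) < d ->
    Cmod (fst (F y) - fst (F x)) < eps /\ Cmod (snd (F y) - snd (F x)) < eps.
Proof.
  split.
  - intros H eps He.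
    apply (locally_C2 x (fun y => Cmod (fst (F y) - fst (F x)) < eps /\ Cmod (snd (F y) - snd (F x)) < eps)).
    apply (H (fun y : C2 => Cmod (fst y - fst (F x)) < eps /\ Cmod (snd y - snd (F x)) < eps)).
    apply locally_C2. exists eps. auto.
  - intros H Q HQ. apply locally_C2 in HQ. destruct HQ as (e & He & HQ).
    destruct (H e He) as (d & Hd & Hd'). apply locally_C2. exists d. split; [exact Hd|].
    intros y H1 H2. destruct (Hd' y H1 H2). apply HQ; assumption.
Qed.

Lemma iter_C2_continuous (F : C2 -> C2) (n : nat) (x : C2) :
  (forall y, @continuous C2 C2 F y) -> @continuous C2 C2 (Nat.iter n F) x.
Proof.
  intros HF. induction n as [|n IH].
  - apply C2_continuous. intros eps He. exists eps. auto.
  - simpl. apply (continuous_comp (Nat.iter n F) F); [exact IH | apply HF].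
Qed.

Section Skew.

Variables (P : C2 -> C2) (p : C -> C) (q : C -> C -> C).
Hypotheses (P_cont : forall x, @continuous C2 C2 P x) (P_skew : forall z w : C, P (z, w) = (p z, q z w)).

Lemma skew_base_continuous (z : C) : @continuous C_UniformSpace C_UniformSpace p z.
Proof.
  apply continuous_Cmod. intros eps He.
  destruct (proj1 (C2_continuous P (z, RtoC 0)) (P_cont _) eps He) as (d & Hd & H).
  exists d. split; [exact Hd|]. intros y Hy.
  destruct (H (y, RtoC 0)) as [H1 _]; [exact Hy| |].
  - simpl. replace (0 - 0)%C with (RtoC 0) by ring. rewrite Cmod_0. exact Hd.
  - rewrite !P_skew in H1. exact H1.
Qed.

Lemma skew_fiber_continuous (z w : C) : @continuous C_UniformSpace C_UniformSpace (q z) w.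
Proof.
  apply continuous_Cmod. intros eps He.
  destruct (proj1 (C2_continuous P (z, w)) (P_cont _) eps He) as (d & Hd & H).
  exists d. split; [exact Hd|]. intros y Hy.
  destruct (H (z, y)) as [_ H1]; [|exact Hy|].
  - simpl. replace (z - z)%C with (RtoC 0) by ring. rewrite Cmod_0. exact Hd.
  - rewrite !P_skew in H1. exact H1.
Qed.

Lemma skew_apply (x : C2) : P x = (p (fst x), q (fst x) (snd x)).
Proof. destruct x as [z w]. apply P_skew. Qed.

Lemma skew_iter_fst (j : nat) (z w : C) : fst (Nat.iter j P (z, w)) = Nat.iter j p z.
Proof.
  induction j as [|j IH]; [reflexivity|]. simpl. rewrite <- IH, skew_apply. reflexivity.
Qed.

Lemma skew_iter_S_snd (j : nat) (z w : C) :
  snd (Nat.iter (S j) P (z, w)) = q (Nat.iter j p z) (snd (Nat.iter j P (z, w))).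
Proof.
  simpl. rewrite <- (skew_iter_fst j z w), skew_apply. reflexivity.
Qed.

Hypothesis p_0 : p (RtoC 0) = RtoC 0.

Lemma base_iter_0 (j : nat) : Nat.iter j p (RtoC 0) = RtoC 0.
Proof. induction j as [|j IH]; [reflexivity|]. simpl. rewrite IH. exact p_0. Qed.

Lemma skew_iter_0 (j : nat) (w : C) : snd (Nat.iter j P (RtoC 0, w)) = Nat.iter j (q (RtoC 0)) w.
Proof.
  induction j as [|j IH]; [reflexivity|]. rewrite skew_iter_S_snd, IH, base_iter_0. reflexivity.
Qed.

(** The fiber over [0] is invariant and carries [q_0], so uniform continuity of [P^j] near the
    compact set [{0} x K] is enough. The number [j] of steps is fixed before the base coordinate is
    made small. *)
Lemma fiber_shadow (K : C -> Prop) (j : nat) (eps : R) : @compact_set C_UniformSpace K -> 0 < eps ->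
  exists d, 0 < d /\ forall z w : C, K w -> Cmod z < d ->
    Cmod (snd (Nat.iter j P (z, w)) - Nat.iter j (q (RtoC 0)) w) < eps.
Proof.
  intros HK He.
  set (G := fun w : C => (RtoC 0, w) : C2).
  assert (HG : forall w, @continuous C_UniformSpace C2 G w).
  { intros w Q HQ. apply locally_C2 in HQ. destruct HQ as (d & Hd & HQ). apply locally_Cmod.
    exists d. split; [exact Hd|]. intros y Hy. apply HQ; simpl; [|exact Hy].
    replace (0 - 0)%C with (RtoC 0) by ring. rewrite Cmod_0. exact Hd. }
  pose proof (compact_image G K HG HK) as HGK.
  assert (He2 : 0 < eps / 2) by lra.
  destruct (compact_unif_cont (Nat.iter j P) _ (fun x => iter_C2_continuous P j x P_cont) HGK (mkposreal _ He2))
    as (d & Hd).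
  exists d. split; [apply cond_pos|]. intros z w Hw Hz.
  specialize (Hd (RtoC 0, w) (z, w)).
  assert (Hb : ball ((RtoC 0, w) : C2) d (z, w)).
  { split; apply ball_C; simpl.
    - replace (z - 0)%C with z by ring. exact Hz.
    - replace (w - w)%C with (RtoC 0) by ring. rewrite Cmod_0. apply cond_pos. }
  specialize (Hd (ex_intro _ w (conj Hw eq_refl)) Hb).
  destruct Hd as [_ Hd]. apply ball_C_inv in Hd. rewrite <- skew_iter_0.
  simpl in Hd. change (Cmod (snd (Nat.iter j P (z, w)) - snd (Nat.iter j P (RtoC 0, w))) < eps).
  eapply Rlt_le_trans; [exact Hd|]. lra.
Qed.

End Skew.

Lemma skew_estimates (p : C -> C) (q : C -> C -> C) (a b b03 b30 : C) :
  @bigO_pow C_NormedModule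
      (fun z : C => p z - (z - z ^ 2 + a * z ^ 3))%C 4 ->
  @bigO_pow C2
      (fun x : C * C => let (z, w) := x in
        q z w - (w + w ^ 2 + b * z ^ 2 + b03 * w ^ 3 + b30 * z ^ 3))%C 4 ->
  p (RtoC 0) = RtoC 0 /\
  @bigO_pow C_NormedModule (fun z : C => p z - (z + -1 * z ^ 2 + a * z ^ 3))%C 4 /\
  @bigO_pow C_NormedModule (fun w : C => q (RtoC 0) w - (w + 1 * w ^ 2 + b03 * w ^ 3))%C 4 /\
  exists C0 d0, 0 <= C0 /\ 0 < d0 /\
    (forall z, Cmod z < d0 -> Cmod (p z - (z - z ^ 2 + a * z ^ 3)) <= C0 * Cmod z ^ 4) /\
    (forall z w, Cmod z < d0 -> Cmod w < d0 ->
      Cmod (q z w - (w + w ^ 2 + b * z ^ 2 + b03 * w ^ 3 + b30 * z ^ 3)) <= C0 * (Cmod z + Cmod w) ^ 4).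
Proof.
  intros (M1 & d1 & Hd1 & H1) (M2 & d2 & Hd2 & H2).
  set (C0 := Rabs M1 + Rabs M2). set (d0 := Rmin d1 (d2 / 2)).
  pose proof (Rabs_pos M1) as Hp1. pose proof (Rabs_pos M2) as Hp2.
  pose proof (Rle_abs M1) as Ha1. pose proof (Rle_abs M2) as Ha2.
  assert (HC0 : 0 <= C0) by (unfold C0; lra).
  assert (Hd0 : 0 < d0) by (apply Rmin_pos; lra).
  pose proof (Rmin_l d1 (d2 / 2)) as Hm1. pose proof (Rmin_r d1 (d2 / 2)) as Hm2. fold d0 in Hm1, Hm2.
  assert (Hp : forall z, Cmod z < d0 -> Cmod (p z - (z - z ^ 2 + a * z ^ 3)) <= C0 * Cmod z ^ 4).
  { intros z Hz. eapply Rle_trans; [apply (H1 z)|].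
    - change (Cmod z < d1). lra.
    - change (M1 * Cmod z ^ 4 <= C0 * Cmod z ^ 4).
      apply Rmult_le_compat_r; [apply pow_le, Cmod_ge_0 | unfold C0; lra]. }
  assert (Hq : forall z w, Cmod z < d0 -> Cmod w < d0 ->
      Cmod (q z w - (w + w ^ 2 + b * z ^ 2 + b03 * w ^ 3 + b30 * z ^ 3)) <= C0 * (Cmod z + Cmod w) ^ 4).
  { intros z w Hz Hw. pose proof (C2_norm_le (z, w)) as Hn. simpl fst in Hn. simpl snd in Hn.
    eapply Rle_trans; [apply (H2 (z, w)); lra|].
    apply Rle_trans with (Rabs M2 * (Cmod z + Cmod w) ^ 4).
    - apply Rle_trans with (Rabs M2 * @norm C_AbsRing C2 (z, w) ^ 4).
      + apply Rmult_le_compat_r; [apply pow_le, norm_ge_0 | lra].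
      + apply Rmult_le_compat_l; [lra|]. apply pow_incr. split; [apply norm_ge_0 | exact Hn].
    - apply Rmult_le_compat_r; [|unfold C0; lra]. apply pow_le.
      pose proof (Cmod_ge_0 z). pose proof (Cmod_ge_0 w). lra. }
  split; [|split; [|split; [|exists C0, d0; auto]]].
  - assert (H0 : Cmod 0 < d0) by (rewrite Cmod_0; exact Hd0).
    specialize (Hp _ H0). rewrite Cmod_0 in Hp.
    replace (p 0 - (0 - 0 ^ 2 + a * 0 ^ 3))%C with (p (RtoC 0)) in Hp by (simpl; ring).
    apply Cmod_eq_0. pose proof (Cmod_ge_0 (p 0)). simpl in Hp. lra.
  - exists C0, d0. split; [exact Hd0|]. intros z Hz.
    replace (p z - (z + -1 * z ^ 2 + a * z ^ 3))%C with (p z - (z - z ^ 2 + a * z ^ 3))%C by ring.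
    apply Hp, Hz.
  - exists C0, d0. split; [exact Hd0|]. intros w Hw.
    assert (H0 : Cmod 0 < d0) by (rewrite Cmod_0; exact Hd0).
    specialize (Hq _ w H0 Hw). rewrite Cmod_0, Rplus_0_l in Hq.
    replace (q (RtoC 0) w - (w + 1 * w ^ 2 + b03 * w ^ 3))%C with
      (q (RtoC 0) w - (w + w ^ 2 + b * 0 ^ 2 + b03 * w ^ 3 + b30 * 0 ^ 3))%C by (simpl; ring).
    exact Hq.
Qed.

(** * The length of the petal stages *)

Definition root4 (n : nat) : nat := Nat.sqrt (Nat.sqrt n).

Lemma root4_spec (n : nat) : INR (root4 n) ^ 4 <= INR n <= (INR (root4 n) + 1) ^ 4.
Proof.
  unfold root4. set (s := Nat.sqrt n). set (l := Nat.sqrt s).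
  assert (Hs : (s * s <= n <= (s + 1) * (s + 1))%nat).
  { pose proof (Nat.sqrt_spec n ltac:(lia)) as H. fold s in H. simpl in H. lia. }
  assert (Hl : (l * l <= s /\ s + 1 <= (l + 1) * (l + 1))%nat).
  { pose proof (Nat.sqrt_spec s ltac:(lia)) as H. fold l in H. simpl in H. lia. }
  assert (G1 : (l * l * (l * l) <= n)%nat) by nia.
  assert (G2 : (n <= (l + 1) * (l + 1) * ((l + 1) * (l + 1)))%nat) by nia.
  apply le_INR in G1. apply le_INR in G2. rewrite !mult_INR in G1, G2. rewrite !plus_INR in G2. simpl INR in G2.
  split; lra.
Qed.

(** From [m <= (L + 1) ^ 4 <= (2 L) ^ 4] one gets [ln m <= 4 ln (2 L)], which is small compared with
    [L]. *)
Lemma root4_scales (m : nat -> nat) : (forall x, eventually (fun k => x <= INR (m k))) ->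
  (forall x, eventually (fun k => x <= INR (root4 (m k)))) /\
  (forall x, eventually (fun k => x * ln (INR (m k)) <= INR (root4 (m k)))).
Proof.
  intros Hm.
  assert (HL : forall x, eventually (fun k => x <= INR (root4 (m k)))).
  { intros x. generalize (Hm ((Rabs x + 1) ^ 4 + 1)). apply filter_imp. intros k Hk.
    destruct (root4_spec (m k)) as [_ H]. destruct (Rle_dec x (INR (root4 (m k)))) as [G|G]; [exact G|].
    exfalso. assert (G2 : INR (root4 (m k)) + 1 <= Rabs x + 1) by (pose proof (Rle_abs x); lra).
    pose proof (pos_INR (root4 (m k))).
    assert ((INR (root4 (m k)) + 1) ^ 4 <= (Rabs x + 1) ^ 4) by (apply pow_incr; lra). lra. }
  split; [exact HL|]. intros x.
  pose proof (Rabs_pos x) as Hx. pose proof (Rle_abs x) as Hx2.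
  assert (He : 0 < / (4 * (Rabs x + 1))) by (apply Rinv_0_lt_compat; lra).
  destruct (log_affine_small 0 1 _ Rle_0_1 He) as (x0 & Hx0 & Hlog).
  generalize (filter_and _ _ (Hm 1) (HL x0)). apply filter_imp. intros k [G1 G2].
  specialize (Hlog _ G2). set (L := INR (root4 (m k))) in *.
  assert (Hln : 0 <= ln (INR (m k)) <= 4 * ln (2 * L)).
  { split; [rewrite <- ln_1; apply ln_le; lra|].
    replace (4 * ln (2 * L)) with (INR 4 * ln (2 * L)) by (simpl; ring).
    rewrite <- ln_pow by lra. apply ln_le; [lra|]. destruct (root4_spec (m k)) as [_ H]. fold L in H.
    eapply Rle_trans; [exact H|]. apply pow_incr. lra. }
  apply Rle_trans with (Rabs x * (4 * ln (2 * L))).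
  - apply Rle_trans with (Rabs x * ln (INR (m k))); [apply Rmult_le_compat_r; lra | apply Rmult_le_compat_l; lra].
  - apply Rle_trans with ((Rabs x + 1) * (4 * (/ (4 * (Rabs x + 1)) * L))).
    + apply Rmult_le_compat; try lra.
    + right. field. lra.
Qed.

Lemma Clog_near_scaled (B X : C) (x de e1 : R) : 0 < x -> Cmod (X - x) <= de * x -> de <= / 2 ->
  3 * de * Cmod B <= e1 -> Cmod (B * (Clog X - ln x)) <= e1.
Proof.
  intros Hx HX Hde He. eapply Rle_trans; [|exact He]. rewrite Cmod_mult.
  rewrite (Rmult_comm (3 * de)). apply Rmult_le_compat_l; [apply Cmod_ge_0|].
  assert (Hd : Cmod (X - x) <= x / 2).
  { eapply Rle_trans; [exact HX|]. apply Rle_trans with (/ 2 * x); [apply Rmult_le_compat_r; lra | lra]. }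
  eapply Rle_trans; [apply (Clog_near_R X x Hx Hd)|].
  apply Rmult_le_reg_r with x; [exact Hx|]. unfold Rdiv. rewrite Rmult_assoc, (Rmult_assoc _ (/ x)), Rinv_l by lra.
  rewrite Rmult_1_r, Rmult_assoc. apply Rmult_le_compat_l; lra.
Qed.

Section Transit.

Variables (P : C2 -> C2) (p : C -> C) (q : C -> C -> C) (a b03 b30 : C) (b C0 d0 : R).
Hypotheses (P_cont : forall x, @continuous C2 C2 P x) (P_skew : forall z w : C, P (z, w) = (p z, q z w))
  (p_0 : p (RtoC 0) = RtoC 0) (HC0 : 0 <= C0) (Hd0 : 0 < d0)
  (p_est : forall z, Cmod z < d0 -> Cmod (p z - (z - z ^ 2 + a * z ^ 3)) <= C0 * Cmod z ^ 4)
  (q_est : forall z w, Cmod z < d0 -> Cmod w < d0 ->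
      Cmod (q z w - (w + w ^ 2 + b * z ^ 2 + b03 * w ^ 3 + b30 * z ^ 3)) <= C0 * (Cmod z + Cmod w) ^ 4).
Let q0 := q (RtoC 0).
(** The index [k] only labels a sequence of transits, which need not come from consecutive terms of
    the admissible sequence; each transit has its own starting point [zk], [wk], with Fatou
    coordinates [ph], [phq]. *)
Variables (m N : nat -> nat) (sg : nat -> R) (zk wk ph phq : nat -> C) (K2 : C -> Prop) (Mp Mq : R).
Hypotheses (HMp : forall k, Cmod (ph k) <= Mp) (HMq : forall k, Cmod (phq k) <= Mq)
  (Hm : forall x, eventually (fun k => x <= INR (m k)))
  (HK2 : @compact_set C_UniformSpace K2) (HwK : forall k, K2 (wk k))
  (Hz : forall eps, 0 < eps -> exists n0, forall n k, (n0 <= n)%nat -> Nat.iter n p (zk k) <> 0 /\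
    Cmod (/ Nat.iter n p (zk k) - (INR n + (1 - a) * ln (INR n) + ph k)) < eps)
  (Hw : forall eps, 0 < eps -> exists n0, forall n k, (n0 <= n)%nat ->  Nat.iter n q0 (wk k) <> 0 /\
    Cmod (Xc 1 (Nat.iter n q0 (wk k)) - (INR n + (1 - b03) * ln (INR n) + phq k)) < eps).

(** Two clocks are used: [n] counts the iterations of the base since its start, while [j] in [W k j]
    counts those of [P] since time [m k]. *)
Let Z (k n : nat) : C := Nat.iter n p (zk k).
Let W (k j : nat) : C := snd (Nat.iter j P (Z k (m k), wk k) : C2).
Let l k := root4 (m k).
Let L k := INR (l k).

Lemma fiber_eq k j : W k (S j) = q (Z k (m k + j)) (W k j).
Proof.
  unfold W, Z. rewrite (skew_iter_S_snd P p q P_skew). f_equal.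
  rewrite (Nat.add_comm (m k) j), Nat.iter_add. reflexivity.
Qed.

Lemma base_small : eventually (fun k => forall n, (m k <= n)%nat -> Z k n <> 0 /\ Cmod (Z k n) <= 2 / INR (m k)).
Proof.
  destruct (Hz 1 Rlt_0_1) as (n0 & Hn0).
  destruct (log_affine_small (Mp + 1) (Cmod (1 - a)) (/ 2) (Cmod_ge_0 _) ltac:(lra)) as (x0 & Hx0 & Hlog).
  generalize (Hm (x0 + INR n0)). apply filter_imp. intros k Hk n Hn.
  pose proof (pos_INR n0) as H0.
  assert (Hmn : INR (m k) <= INR n) by (apply le_INR; exact Hn).
  destruct (Hn0 n k) as [G1 G2]; [apply INR_le; lra|]. fold (Z k n) in G1, G2. split; [exact G1|].
  specialize (Hlog (INR n) ltac:(lra)).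
  assert (Hln : 0 <= ln (INR n) <= ln (2 * INR n)) by (split; [rewrite <- ln_1|]; apply ln_le; lra).
  assert (G3 : Cmod (/ Z k n - INR n) <= / 2 * INR n).
  { eapply Rle_trans; [|exact Hlog].
    replace (/ Z k n - INR n)%C with ((/ Z k n - (INR n + (1 - a) * ln (INR n) + ph k)) + (1 - a) * ln (INR n) + ph k)%C by ring.
    assert (G : Cmod ((1 - a) * ln (INR n)) <= Cmod (1 - a) * ln (2 * INR n)).
    { rewrite Cmod_mult, Cmod_R, Rabs_pos_eq by lra. apply Rmult_le_compat_l; [apply Cmod_ge_0 | lra]. }
    eapply Rle_trans; [apply Cadd_le; [apply Cadd_le; [apply Rlt_le, G2 | exact G] | apply HMp]|]. lra. }
  pose proof (Cmod_rev (INR n) (/ Z k n)) as G4. rewrite Cmod_minus_sym, Cmod_R, Rabs_pos_eq in G4 by lra.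
  assert (E : Z k n = (/ / Z k n)%C) by (field; exact G1). rewrite E.
  replace (2 / INR (m k)) with (/ (INR (m k) / 2)) by (field; lra).
  apply Cinv_le; lra.
Qed.

Lemma scale_conditions x : eventually (fun k => 1 <= INR (m k) /\ 1 <= L k /\ L k ^ 4 <= INR (m k) /\ x <= L k /\ x <= INR (m k)
   /\ x * L k <= INR (m k) /\ x * ln (INR (m k)) <= L k).
Proof.
  destruct (root4_scales m Hm) as [H1 H2].
  generalize (filter_and _ _ (Hm (1 + Rabs x)) (filter_and _ _ (H1 (1 + Rabs x)) (H2 x))). apply filter_imp.
  intros k (G1 & G2 & G3). pose proof (Rle_abs x). pose proof (Rabs_pos x).
  destruct (root4_spec (m k)) as [G4 _]. fold (l k) (L k) in *. repeat split; try lra.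
  eapply Rle_trans; [|exact G4].
  apply Rle_trans with (L k * L k); [apply Rmult_le_compat_r; lra|].
  replace (L k * L k) with (L k ^ 2) by ring. apply Rle_pow; [lra | lia].
Qed.

(** The influence [m^-2] of the base on each of the [L] steps of a petal stage is amplified at most by [L^2]. *)
Lemma drift_small x : 0 < x -> eventually (fun k => 2 / INR (m k) * L k <= x /\
  L k * ((2 / INR (m k)) ^ 2 * L k ^ 2) <= x).
Proof.
  intros Hx. generalize (scale_conditions (4 / x)). apply filter_imp.
  intros k (G1 & G2 & G3 & G4 & G5 & G6 & G7).
  set (M := INR (m k)) in *. set (l0 := L k) in *.
  assert (HMi : 0 < / M) by (apply Rinv_0_lt_compat; lra).
  assert (G8 : 4 * l0 <= x * M).
  { replace (4 * l0) with (x * (4 / x * l0)) by (field; lra). apply Rmult_le_compat_l; lra. }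
  assert (G9 : 4 * l0 / M <= x).
  { apply Rmult_le_reg_r with M; [lra|]. unfold Rdiv. rewrite Rmult_assoc, Rinv_l by lra. lra. }
  assert (Hl : 0 <= l0 / M) by (apply Rdiv_le_0_compat; lra).
  split; [unfold Rdiv in *; lra|].
  eapply Rle_trans; [|exact G9].
  replace (l0 * ((2 / M) ^ 2 * l0 ^ 2)) with (4 * l0 / M * (l0 ^ 2 * / M)) by (field; lra).
  rewrite <- (Rmult_1_r (4 * l0 / M)) at 2. apply Rmult_le_compat_l; [unfold Rdiv in *; lra|].
  apply Rmult_le_reg_r with M; [lra|]. rewrite Rmult_assoc, Rinv_l by lra.
  assert (l0 ^ 2 <= l0 ^ 4) by (apply Rle_pow; [lra | lia]). lra.
Qed.

Let B := (1 - b03)%C.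

Lemma nat_above (x : R) : exists J, x <= INR J.
Proof.
  destruct (nfloor_ex (Rmax 0 x) (Rmax_l 0 x)) as (n & _ & Hn). exists (S n). rewrite S_INR.
  pose proof (Rmax_r 0 x). lra.
Qed.

(** For a fixed number [J] of steps the fiber orbit follows that of [q_0], whose position is known
    from the incoming Fatou coordinate. This supplies the initial value for the approximate Fatou
    coordinate. *)
Lemma entry_start (J : nat) (e1 : R) : 0 < e1 <= 1 -> 1 <= INR J ->
  (forall k, Nat.iter J q0 (wk k) <> 0 /\
    Cmod (Xc 1 (Nat.iter J q0 (wk k)) - (INR J + B * ln (INR J) + phq k)) < e1) ->
  Mq + 1 + Cmod B * ln (INR J) <= INR J ->
  eventually (fun k => Cmod (Xc 1 (W k J) - (INR J + B * ln (INR J) + phq k)) <= 2 * e1).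
Proof.
  intros He HJ HJq HJB. set (j := INR J) in *.
  assert (HlJ : 0 <= ln j) by (rewrite <- ln_1; apply ln_le; lra).
  assert (H1n : RtoC 1 <> 0) by (intros E; apply RtoC_inj in E; lra).
  assert (Hj2 : 1 <= j ^ 2) by (apply pow_R1_Rle; exact HJ).
  (* Both fiber coordinates are at least [1 / (4 j)] and [1 / (2 j)] in modulus, so passing to
     inverses multiplies distances by at most [8 j ^ 2]. *)
  set (d := e1 / (8 * j ^ 2)).
  assert (Hd : 0 < d) by (apply Rdiv_lt_0_compat; lra).
  assert (Hdj : d <= / (4 * j)).
  { unfold d, Rdiv. apply Rle_trans with (1 * / (4 * j)); [|lra].
    apply Rmult_le_compat; [lra | apply Rlt_le, Rinv_0_lt_compat; lra | lra |].
    apply Rinv_le_contravar; [lra|]. simpl. assert (j * 1 <= j * (j * 1)) by (apply Rmult_le_compat_l; lra). lra. }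
  destruct (fiber_shadow P p q P_cont P_skew p_0 K2 J d HK2 Hd) as (dz & Hdz & Hsh).
  assert (H3 : 0 < 3 / dz) by (apply Rdiv_lt_0_compat; lra).
  generalize (filter_and _ _ base_small (filter_and _ _ (Hm (3 / dz)) (Hm 1))). apply filter_imp. intros k (G1 & G2 & G2').
  destruct (G1 (m k) ltac:(lia)) as [_ G3].
  specialize (Hsh (Z k (m k)) (wk k) (HwK k)). fold (W k J) in Hsh. fold q0 in Hsh.
  assert (G4 : Cmod (W k J - Nat.iter J q0 (wk k)) < d).
  { apply Hsh. eapply Rle_lt_trans; [exact G3|]. apply Rlt_le_trans with (3 / INR (m k)).
    - unfold Rdiv. apply Rmult_lt_compat_r; [apply Rinv_0_lt_compat; lra | lra].
    - apply Rmult_le_reg_r with (INR (m k)); [lra|]. unfold Rdiv. rewrite Rmult_assoc, Rinv_l by lra.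
      apply (Rmult_le_compat_l dz) in G2; [|lra]. replace (dz * (3 / dz)) with 3 in G2 by (field; lra). lra. }
  destruct (HJq k) as [G5 G6]. set (wq := Nat.iter J q0 (wk k)) in *.
  assert (G7 : Cmod (Xc 1 wq) <= 2 * j).
  { replace (Xc 1 wq) with ((Xc 1 wq - (j + B * ln j + phq k)) + j + B * ln j + phq k)%C by ring.
    eapply Rle_trans; [apply Cadd_le; [apply Cadd_le; [apply Cadd_le; [apply Rlt_le, G6 | apply Rle_refl] | apply Rle_refl] | apply HMq]|].
    rewrite Cmod_mult, !Cmod_R, (Rabs_pos_eq j), (Rabs_pos_eq (ln j)) by lra. lra. }
  rewrite Xc_mod, Cmod_1, Rmult_1_l in G7 by assumption.
  assert (Hwq : 0 < Cmod wq) by (apply Cmod_gt_0; exact G5).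
  assert (G8 : / (2 * j) <= Cmod wq).
  { rewrite <- (Rinv_inv (Cmod wq)). apply Rinv_le_contravar; [apply Rinv_0_lt_compat; exact Hwq | exact G7]. }
  assert (G9 : / (4 * j) <= Cmod (W k J)).
  { pose proof (Cmod_rev wq (W k J)) as G. rewrite Cmod_minus_sym in G.
    replace (/ (2 * j)) with (/ (4 * j) + / (4 * j)) in G8 by (field; lra). lra. }
  assert (Hi4 : 0 < / (4 * j)) by (apply Rinv_0_lt_compat; lra).
  assert (HW0 : W k J <> 0) by (apply (Cneq_0 _ (/ (4 * j))); lra).
  assert (G10 : Cmod (Xc 1 (W k J) - Xc 1 wq) <= e1).
  { replace (Xc 1 (W k J) - Xc 1 wq)%C with ((W k J - wq) * / W k J * / wq)%C by (unfold Xc; field; auto).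
    apply Rle_trans with (d * / (/ (4 * j)) * / (/ (2 * j))).
    - apply Cmul_le; [apply Cmul_le; [lra | apply Cinv_le; lra]|].
      apply Cinv_le; [apply Rinv_0_lt_compat; lra | exact G8].
    - right. unfold d. field. lra. }
  replace (Xc 1 (W k J) - (j + B * ln j + phq k))%C with
    ((Xc 1 (W k J) - Xc 1 wq) + (Xc 1 wq - (j + B * ln j + phq k)))%C by ring.
  eapply Rle_trans; [apply Cadd_le; [exact G10 | apply Rlt_le, G6]|]. lra.
Qed.

(** Shadowing reaches a fixed time [J] only. From [J] to [L] the quantity [X - B Clog X] advances by
    [1] per step with a total error controlled by [1 / J] and by the base drift; [J] is chosen
    first, then [k] large. *)
Lemma entry_stage : o1 (fun k => Xc 1 (W k (l k)) - (L k + B * ln (L k) + phq k))%C.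
Proof.
  intros eps Heps. set (bm := Cmod B). assert (Hbm : 0 <= bm) by apply Cmod_ge_0.
  assert (HMq0 : 0 <= Mq) by (eapply Rle_trans; [apply Cmod_ge_0 | apply (HMq 0%nat)]).
  set (C1 := Mq + 4).
  destruct (fiber_orbit b C0 d0 b03 b30 C1 HC0 Hd0 ltac:(unfold C1; lra)) as (J0 & M1 & ka & HJ0 & HM1 & Hka & Horb).
  (* The final estimate spends [2 e1] on the orbit, [3 e1] on the initial value and [e1] on the last
     logarithm. *)
  set (e1 := Rmin 1 (eps / 8)).
  assert (He1 : 0 < e1) by (apply Rmin_pos; lra).
  pose proof (Rmin_l 1 (eps / 8)) as He11. pose proof (Rmin_r 1 (eps / 8)) as He12. fold e1 in He11, He12.
  set (de := Rmin (/ 4) (e1 / (3 * (bm + 1)))).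
  assert (Hde : 0 < de) by (apply Rmin_pos; [|apply Rdiv_lt_0_compat]; lra).
  assert (Hde1 : de <= / 4) by apply Rmin_l.
  assert (Hde2 : 3 * de * bm <= e1).
  { assert (G : de <= e1 / (3 * (bm + 1))) by apply Rmin_r.
    apply Rle_trans with (3 * (e1 / (3 * (bm + 1))) * (bm + 1)).
    - apply Rmult_le_compat; lra.
    - right. field. lra. }
  destruct (log_affine_small (Mq + 2 + (C1 + 1 + bm * PI)) bm de Hbm Hde) as (x0 & Hx0 & Hlog).
  destruct (Hw e1 He1) as (n0 & Hn0).
  destruct (nat_above (J0 + 2 * M1 / e1 + x0 + INR n0)) as (J & HJ).
  assert (Hpos : 0 < 2 * M1 / e1) by (apply Rdiv_lt_0_compat; lra). pose proof (pos_INR n0) as Hn00.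
  assert (HPI := PI_RGT_0). assert (HbP : 0 <= bm * PI) by (apply Rmult_le_pos; lra).
  set (j := INR J) in *.
  assert (Hlj : 0 <= ln j <= ln (2 * j)) by (split; [rewrite <- ln_1|]; apply ln_le; lra).
  pose proof (Hlog j ltac:(lra)) as HlogJ.
  assert (Hblj : bm * ln j <= bm * ln (2 * j)) by (apply Rmult_le_compat_l; lra).
  assert (Hbl0 : 0 <= bm * ln j) by (apply Rmult_le_pos; lra).
  assert (Hdj : de * j <= / 4 * j) by (apply Rmult_le_compat_r; lra).
  assert (Hst : eventually (fun k => Cmod (Xc 1 (W k J) - (j + B * ln j + phq k)) <= 2 * e1)).
  { apply entry_start; [lra | fold j; lra | | fold j bm; unfold C1 in *; lra].
    intros k. apply (Hn0 J k). apply INR_le. fold j. lra. }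
  set (ka1 := Rmin ka (e1 / M1)).
  assert (Hka1 : 0 < ka1) by (apply Rmin_pos; [|apply Rdiv_lt_0_compat]; lra).
  assert (Hka2 : ka1 <= ka) by apply Rmin_l.
  assert (Hka3 : M1 * ka1 <= e1).
  { apply Rle_trans with (M1 * (e1 / M1)); [apply Rmult_le_compat_l; [lra | apply Rmin_r] | right; field; lra]. }
  generalize (filter_and _ _ Hst (filter_and _ _ base_small (filter_and _ _ (drift_small ka1 Hka1)
    (filter_and _ _ (scale_conditions (2 / d0 + x0 + j)) (scale_conditions 1))))).
  apply filter_imp. intros k (G1 & G2 & (G3 & G4) & (G5 & _ & _ & G6 & _) & (_ & G7 & _)).
  assert (H2d : 0 < 2 / d0) by (apply Rdiv_lt_0_compat; lra).
  assert (HJl : (J <= l k)%nat) by (apply INR_le; fold j; fold (L k); lra).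
  set (T := (l k - J)%nat).
  assert (HT : INR T = L k - j) by (unfold T, j; rewrite minus_INR by exact HJl; reflexivity).
  set (nu := 2 / INR (m k)) in *.
  assert (Hnu : 0 < nu) by (apply Rdiv_lt_0_compat; lra).
  assert (Hnn : 0 <= nu ^ 2 * L k ^ 2) by (apply Rmult_le_pos; apply pow2_ge_0).
  assert (HTn : INR T * (nu ^ 2 * L k ^ 2) <= ka1).
  { eapply Rle_trans; [|exact G4]. apply Rmult_le_compat_r; lra. }
  set (X0 := Xc 1 (W k J)) in *.
  assert (HX0 : Cmod (X0 - j) <= de * j).
  { replace (X0 - j)%C with ((X0 - (j + B * ln j + phq k)) + B * ln j + phq k)%C by ring.
    eapply Rle_trans; [apply Cadd_le; [apply Cadd_le; [exact G1 | apply Rle_refl] | apply HMq]|].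
    rewrite Cmod_mult, Cmod_R, Rabs_pos_eq by lra. fold bm. unfold C1 in *. lra. }
  assert (Hlg0 : Cmod (B * (Clog X0 - ln j)) <= e1).
  { apply (Clog_near_scaled B X0 j de e1); [lra | exact HX0 | lra | fold bm; lra]. }
  assert (HPsi0 : Cmod (X0 - B * Clog X0 - (j + phq k)) <= 3 * e1).
  { replace (X0 - B * Clog X0 - (j + phq k))%C with
      ((X0 - (j + B * ln j + phq k)) - B * (Clog X0 - ln j))%C by ring.
    eapply Rle_trans; [apply Csub_le; [exact G1 | exact Hlg0]|]. lra. }
  destruct (Horb 1 j j nu (L k) T (fun t => Z k (m k + (J + t))%nat) (fun t => W k (J + t)%nat)) with (t := T)
    as (_ & _ & R2 & R3); clear Horb.
  - apply Rabs_R1.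
  - lra.
  - intros t Ht. apply le_INR in Ht. pose proof (pos_INR t). lra.
  - lra.
  - lra.
  - intros t Ht. apply G2. lia.
  - intros t Ht HZd HWd. rewrite Nat.add_succ_r, fiber_eq. apply q_est; assumption.
  - rewrite Nat.add_0_r. fold X0. rewrite (Rabs_pos_eq j) by lra. lra.
  - rewrite Nat.add_0_r. fold X0. replace (1 * X0)%C with X0 by ring.
    replace (X0 - (1 - b03) * Clog X0 - j)%C with ((X0 - B * Clog X0 - (j + phq k)) + phq k)%C by (unfold B; ring).
    eapply Rle_trans; [apply Cadd_le; [exact HPsi0 | apply HMq]|]. unfold C1. lra.
  - lia.
  - rewrite Nat.add_0_r in R2. fold X0 in R2. fold B in R2, R3. fold bm in R3.
    replace (J + T)%nat with (l k) in R2, R3 by (unfold T; lia).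
    set (X1 := Xc 1 (W k (l k))) in *.
    replace (1 * X1)%C with X1 in R2 by ring. replace (1 * X0)%C with X0 in R2 by ring.
    replace (j + INR T) with (L k) in R3 by lra. rewrite (Rabs_pos_eq (L k)) in R3 by lra.
    assert (HX1 : Cmod (X1 - L k) <= de * L k).
    { pose proof (Hlog (L k) ltac:(lra)). lra. }
    assert (Hlg1 : Cmod (B * (Clog X1 - ln (L k))) <= e1).
    { apply (Clog_near_scaled B X1 (L k) de e1); [lra | exact HX1 | lra | fold bm; lra]. }
    assert (HJ2 : M1 * (2 / j + INR T * (nu ^ 2 * L k ^ 2)) <= 2 * e1).
    { rewrite Rmult_plus_distr_l.
      assert (M1 * (INR T * (nu ^ 2 * L k ^ 2)) <= M1 * ka1) by (apply Rmult_le_compat_l; lra).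
      assert (M1 * (2 / j) <= e1).
      { apply Rmult_le_reg_r with j; [lra|]. replace (M1 * (2 / j) * j) with (e1 * (2 * M1 / e1)) by (field; lra).
        apply Rmult_le_compat_l; lra. }
      lra. }
    replace (X1 - (L k + B * ln (L k) + phq k))%C with
      ((X1 - B * Clog X1 - (X0 - B * Clog X0) - INR T) + (X0 - B * Clog X0 - (j + phq k))
        + B * (Clog X1 - ln (L k)))%C.
    2: { rewrite HT, RtoC_minus. ring. }
    eapply Rle_lt_trans; [apply Cadd_le; [apply Cadd_le; [exact R2 | exact HPsi0] | exact Hlg1]|]. lra.
Qed.

(** The mirror image of the entry stage, with [s = -1]: it starts at [X] about [- L] and stops [J]
    steps before the end, where [X] is about [- J]. The last [J] steps cannot be treated this way,
    since the coordinate would leave the region where the expansion holds. *)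
Lemma exit_stage (Lam : nat -> C) (ML : R) : (forall k, Cmod (Lam k) <= ML) ->
  eventually (fun k => (m k + 2 * l k <= N k)%nat) ->
  o1 (fun k => Xc 1 (W k (N k - l k - m k)) - (- L k + B * ln (L k) + Lam k))%C ->
  forall eps, 0 < eps -> exists J1, forall J, (J1 <= J)%nat -> eventually (fun k => (J + m k <= N k)%nat /\
    W k (N k - m k - J) <> 0 /\
    let X := Xc 1 (W k (N k - m k - J)) in
    Cmod (X + INR J) <= INR J / 4 /\ Cmod (X - B * Clog (- X) - (Lam k - INR J)) <= eps).
Proof.
  intros HLam HN HXe eps Heps. set (bm := Cmod B). assert (Hbm : 0 <= bm) by apply Cmod_ge_0.
  assert (HML0 : 0 <= ML) by (eapply Rle_trans; [apply Cmod_ge_0 | apply (HLam 0%nat)]).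
  set (C1 := ML + 4).
  assert (HC1 : 0 <= C1) by (unfold C1; lra).
  destruct (fiber_orbit b C0 d0 b03 b30 C1 HC0 Hd0 HC1) as (J0 & M1 & ka & HJ0 & HM1 & Hka & Horb).
  set (e1 := Rmin 1 (eps / 8)).
  assert (He1 : 0 < e1) by (apply Rmin_pos; lra).
  pose proof (Rmin_l 1 (eps / 8)) as He11. pose proof (Rmin_r 1 (eps / 8)) as He12. fold e1 in He11, He12.
  set (de := Rmin (/ 4) (e1 / (3 * (bm + 1)))).
  assert (Hde : 0 < de) by (apply Rmin_pos; [|apply Rdiv_lt_0_compat]; lra).
  assert (Hde1 : de <= / 4) by apply Rmin_l.
  assert (Hde2 : 3 * de * bm <= e1).
  { assert (G : de <= e1 / (3 * (bm + 1))) by apply Rmin_r.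
    apply Rle_trans with (3 * (e1 / (3 * (bm + 1))) * (bm + 1)).
    - apply Rmult_le_compat; lra.
    - right. field. lra. }
  destruct (log_affine_small (ML + 2 + (C1 + 1 + bm * PI)) bm de Hbm Hde) as (x0 & Hx0 & Hlog).
  destruct (nat_above (J0 + 2 * M1 / e1 + x0)) as (J1 & HJ1).
  exists J1. intros J HJJ. apply le_INR in HJJ.
  assert (Hpos : 0 < 2 * M1 / e1) by (apply Rdiv_lt_0_compat; lra).
  assert (HPI := PI_RGT_0). assert (HbP : 0 <= bm * PI) by (apply Rmult_le_pos; lra).
  set (j := INR J) in *.
  assert (HlogJ : forall x, j <= x -> 0 <= bm * ln x <= bm * ln (2 * x) /\
    (ML + 2 + (C1 + 1 + bm * PI)) + bm * ln (2 * x) <= de * x /\ de * x <= / 4 * x).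
  { intros x Hx. pose proof (Hlog x ltac:(lra)).
    assert (0 <= ln x <= ln (2 * x)) by (split; [rewrite <- ln_1|]; apply ln_le; lra).
    split; [split; [apply Rmult_le_pos; lra | apply Rmult_le_compat_l; lra]|]. split; [assumption|].
    apply Rmult_le_compat_r; lra. }
  set (ka1 := Rmin ka (e1 / M1)).
  assert (Hka1 : 0 < ka1) by (apply Rmin_pos; [|apply Rdiv_lt_0_compat]; lra).
  assert (Hka2 : ka1 <= ka) by apply Rmin_l.
  assert (Hka3 : M1 * ka1 <= e1).
  { apply Rle_trans with (M1 * (e1 / M1)); [apply Rmult_le_compat_l; [lra | apply Rmin_r] | right; field; lra]. }
  generalize (filter_and _ _ (HXe e1 He1) (filter_and _ _ base_small (filter_and _ _ (drift_small ka1 Hka1)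
    (filter_and _ _ (scale_conditions (x0 + j)) HN)))).
  apply filter_imp. intros k (G1 & G2 & (G3 & G4) & (G5 & _ & _ & G6 & _) & G7).
  assert (HJl : (J <= l k)%nat) by (apply INR_le; fold j; fold (L k); lra).
  split; [lia|].
  set (T := (l k - J)%nat). set (u0 := (N k - l k - m k)%nat) in *.
  assert (HT : INR T = L k - j) by (unfold T, j; rewrite minus_INR by exact HJl; reflexivity).
  set (nu := 2 / INR (m k)) in *.
  assert (Hnu : 0 < nu) by (apply Rdiv_lt_0_compat; lra).
  assert (Hnn : 0 <= nu ^ 2 * L k ^ 2) by (apply Rmult_le_pos; apply pow2_ge_0).
  assert (HTn : INR T * (nu ^ 2 * L k ^ 2) <= ka1).
  { eapply Rle_trans; [|exact G4]. apply Rmult_le_compat_r; lra. }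
  set (X0 := Xc 1 (W k u0)) in *.
  destruct (HlogJ (L k) ltac:(lra)) as (HL1 & HL2 & HL3).
  assert (HX0 : Cmod (X0 + L k) <= de * L k).
  { replace (X0 + L k)%C with ((X0 - (- L k + B * ln (L k) + Lam k)) + B * ln (L k) + Lam k)%C by ring.
    eapply Rle_trans; [apply Cadd_le; [apply Cadd_le; [apply Rlt_le, G1 | apply Rle_refl] | apply HLam]|].
    assert (Hln : 0 <= ln (L k)) by (rewrite <- ln_1; apply ln_le; lra).
    rewrite Cmod_mult, Cmod_R, Rabs_pos_eq by lra. fold bm. unfold C1 in *. lra. }
  assert (Hlg0 : Cmod (B * (Clog (- X0) - ln (L k))) <= e1).
  { apply (Clog_near_scaled B (- X0) (L k) de e1); [lra | | lra | fold bm; lra].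
    replace (- X0 - L k)%C with (- (X0 + L k))%C by ring. rewrite Cmod_opp. exact HX0. }
  assert (HPsi0 : Cmod (X0 - B * Clog (- X0) - (- L k + Lam k)) <= 2 * e1).
  { replace (X0 - B * Clog (- X0) - (- L k + Lam k))%C with
      ((X0 - (- L k + B * ln (L k) + Lam k)) - B * (Clog (- X0) - ln (L k)))%C by ring.
    eapply Rle_trans; [apply Csub_le; [apply Rlt_le, G1 | exact Hlg0]|]. lra. }
  destruct (Horb (-1) (- L k) j nu (L k) T (fun t => Z k (m k + (u0 + t))%nat) (fun t => W k (u0 + t)%nat)) with (t := T)
    as (R1 & R2 & R3 & R4); clear Horb.
  - rewrite Rabs_left; lra.
  - lra.
  - intros t Ht. apply le_INR in Ht. pose proof (pos_INR t) as Ht0. lra.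
  - lra.
  - lra.
  - intros t Ht. apply G2. lia.
  - intros t Ht HZd HWd. rewrite Nat.add_succ_r, fiber_eq. apply q_est; assumption.
  - rewrite Nat.add_0_r. fold X0. rewrite Rabs_Ropp, (Rabs_pos_eq (L k)) by lra.
    rewrite RtoC_opp. replace (X0 - - L k)%C with (X0 + L k)%C by ring. lra.
  - rewrite Nat.add_0_r. fold X0. replace (-1 * X0)%C with (- X0)%C by ring. rewrite RtoC_opp.
    replace (X0 - (1 - b03) * Clog (- X0) - - L k)%C with ((X0 - B * Clog (- X0) - (- L k + Lam k)) + Lam k)%C by (unfold B; ring).
    eapply Rle_trans; [apply Cadd_le; [exact HPsi0 | apply HLam]|]. unfold C1. lra.
  - lia.
  - rewrite Nat.add_0_r in R3. fold X0 in R3. fold B in R3, R4. fold bm in R4.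
    replace (u0 + T)%nat with (N k - m k - J)%nat in R1, R2, R3, R4 by (unfold u0, T; lia).
    split; [exact R1|].
    set (X1 := Xc 1 (W k (N k - m k - J))) in *. cbv zeta.
    replace (-1 * X1)%C with (- X1)%C in R3 by ring. replace (-1 * X0)%C with (- X0)%C in R3 by ring.
    replace (- L k + INR T) with (- j) in R2, R4 by lra.
    rewrite Rabs_Ropp, (Rabs_pos_eq j), RtoC_opp in R2, R4 by lra.
    replace (X1 - - j)%C with (X1 + j)%C in R2, R4 by ring.
    split; [exact R2|].
    assert (HJ2 : M1 * (2 / j + INR T * (nu ^ 2 * L k ^ 2)) <= 2 * e1).
    { rewrite Rmult_plus_distr_l.
      assert (M1 * (INR T * (nu ^ 2 * L k ^ 2)) <= M1 * ka1) by (apply Rmult_le_compat_l; lra).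
      assert (M1 * (2 / j) <= e1).
      { apply Rmult_le_reg_r with j; [lra|]. replace (M1 * (2 / j) * j) with (e1 * (2 * M1 / e1)) by (field; lra).
        apply Rmult_le_compat_l; lra. }
      lra. }
    replace (X1 - B * Clog (- X1) - (Lam k - j))%C with
      ((X1 - B * Clog (- X1) - (X0 - B * Clog (- X0)) - INR T) + (X0 - B * Clog (- X0) - (- L k + Lam k)))%C.
    2: { rewrite HT, RtoC_minus. ring. }
    eapply Rle_trans; [apply Cadd_le; [exact R3 | exact HPsi0]|]. lra.
Qed.

(** * The last steps and the outgoing parametrization *)

Variables (rq : R) (phi_o psi_o : C -> C).
Hypotheses (Hrq : 0 < rq) (Hphio : outgoing_fatou q0 1 b03 rq phi_o) (Hpsio : outgoing_inverse q0 1 rq phi_o psi_o).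

Lemma outgoing_inverse_iter j z : Nat.iter j q0 (psi_o z) = psi_o (z + INR j)%C.
Proof.
  induction j as [|j IH].
  - simpl. f_equal. ring.
  - change (Nat.iter (S j) q0 (psi_o z)) with (q0 (Nat.iter j q0 (psi_o z))).
    rewrite IH, (outgoing_inverse_equation _ _ _ _ _ Hpsio), S_INR, RtoC_plus. f_equal. ring.
Qed.

(** At the point [w] reached [J] steps before the end, the outgoing Fatou coordinate is about
    [Lam - J]. The orbit then shadows that of [q_0], and [q_0^J w = psi_o (phi_o w + J)] is close to
    [psi_o Lam] by continuity of [psi_o]. *)
Lemma exit_limit (Lam : nat -> C) (ML : R) : (forall k, Cmod (Lam k) <= ML) ->
  eventually (fun k => (m k + 2 * l k <= N k)%nat) ->
  o1 (fun k => Xc 1 (W k (N k - l k - m k)) - (- L k + B * ln (L k) + Lam k))%C ->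
  o1 (fun k => W k (N k - m k) - psi_o (Lam k))%C.
Proof.
  intros HLam HN HXe eps Heps.
  assert (HML0 : 0 <= ML) by (eapply Rle_trans; [apply Cmod_ge_0 | apply (HLam 0%nat)]).
  assert (Heps4 : 0 < eps / 4) by lra. assert (Heps2 : 0 < eps / 2) by lra.
  destruct (compact_unif_cont psi_o (fun z => Cmod z <= ML)
    (fun z => holomorphic_continuous psi_o z (outgoing_inverse_entire _ _ _ _ _ Hpsio z)) (compact_box ML)
    (mkposreal _ Heps4)) as (d & Hd).
  pose proof (cond_pos d) as Hdp.
  (* The order of choices matters: the modulus of continuity of [psi_o] fixes [e1], then [J] is
     taken large for the petal and the normalization, and only then must [k] be large for shadowing
     during [J] steps. *)
  set (e1 := d / 8). assert (He1 : 0 < e1) by (unfold e1; lra).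
  destruct (filterlim_Cmod _ _ (outgoing_normalized _ _ _ _ _ Hphio) e1 He1) as (dn & Hdn & Hnorm).
  destruct (exit_stage Lam ML HLam HN HXe e1 He1) as (J1 & HJ1).
  destruct (nat_above (INR J1 + 2 / dn + 2 + / rq)) as (J & HJ).
  assert (Hp1 : 0 < 2 / dn) by (apply Rdiv_lt_0_compat; lra).
  assert (Hp2 : 0 < / rq) by (apply Rinv_0_lt_compat; lra). pose proof (pos_INR J1) as Hp3.
  specialize (HJ1 J ltac:(apply INR_le; lra)). set (j := INR J) in *.
  destruct (fiber_shadow P p q P_cont P_skew p_0 (fun z => Cmod z <= 1) J (eps / 2) (compact_box 1) Heps2)
    as (dz & Hdz & Hsh).
  assert (Hp4 : 0 < 3 / dz) by (apply Rdiv_lt_0_compat; lra).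
  generalize (filter_and _ _ HJ1 (filter_and _ _ base_small (filter_and _ _ (Hm (3 / dz)) (Hm 1)))).
  apply filter_imp. intros k ((G1 & G2 & G3 & G4) & G5 & G6 & G7).
  set (w := W k (N k - m k - J)) in *. set (X := Xc 1 w) in *.
  assert (H1n : RtoC 1 <> 0) by (intros E; apply RtoC_inj in E; lra).
  assert (HwX : (1 / (1 * w) = - X)%C) by (unfold X, Xc; ring).
  assert (HRe : 3 / 4 * j <= Re (- X)).
  { pose proof (Re_close (- X) j) as G. replace (- X - j)%C with (- (X + j))%C in G by ring.
    rewrite Cmod_opp in G. lra. }
  assert (HXlo : 3 / 4 * j <= Cmod X).
  { pose proof (Re_le_Cmod (- X)) as G. rewrite Cmod_opp in G. apply Rabs_le_between in G. lra. }
  assert (HXw : Cmod X = / Cmod w).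
  { unfold X. rewrite Xc_mod, Cmod_1, Rmult_1_l by assumption. reflexivity. }
  assert (Hwm : 0 < Cmod w) by (apply Cmod_gt_0; exact G2).
  assert (Hwj : forall y, 0 < y -> 2 * / y <= j -> Cmod w < y).
  { intros y Hy Hyj. rewrite <- (Rinv_inv y), <- (Rinv_inv (Cmod w)), <- HXw.
    apply Rinv_lt_contravar.
    - apply Rmult_lt_0_compat; [apply Rinv_0_lt_compat; exact Hy | lra].
    - assert (0 < / y) by (apply Rinv_0_lt_compat; exact Hy). lra. }
  assert (Hwdn : Cmod w < dn) by (apply Hwj; [exact Hdn | unfold Rdiv in *; lra]).
  assert (Hw1 : Cmod w < 1) by (apply Hwj; lra).
  assert (Hpet : outgoing_petal 1 rq w).
  { unfold outgoing_petal. apply (disc_iff (1 * w) rq Hrq).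
    replace (1 * w)%C with w by ring. split; [exact G2|].
    replace (/ w)%C with (- X)%C by (rewrite <- HwX; field; auto).
    replace (/ (2 * rq)) with (/ 2 * / rq) by (field; lra). lra. }
  specialize (Hnorm w Hwdn Hpet). rewrite resit_1 in Hnorm. rewrite HwX in Hnorm.
  replace (- - X)%C with X in Hnorm by ring. fold B in Hnorm.
  assert (Hphi : Cmod (phi_o w + j - Lam k) < d / 2).
  { replace (phi_o w + j - Lam k)%C with ((phi_o w - (X - B * Clog (- X))) + (X - B * Clog (- X) - (Lam k - j)))%C by ring.
    eapply Rle_lt_trans; [apply Cadd_le; [apply Rlt_le, Hnorm | exact G4]|]. unfold e1. lra. }
  assert (Hpsi : Cmod (psi_o (phi_o w + j) - psi_o (Lam k)) < eps / 2).
  { assert (Hb : @ball C_UniformSpace (Lam k) d (phi_o w + j)%C) by (apply ball_C; lra).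
    specialize (Hd _ _ (HLam k) Hb). apply ball_C_inv in Hd. simpl in Hd. lra. }
  assert (Hq0 : Nat.iter J q0 w = psi_o (phi_o w + j)).
  { rewrite <- (outgoing_inverse_left _ _ _ _ _ Hpsio w Hpet) at 1. apply outgoing_inverse_iter. }
  set (n := (N k - J)%nat).
  destruct (G5 n ltac:(unfold n; lia)) as [_ HZn].
  assert (HWN : W k (N k - m k) = snd (Nat.iter J P (Z k n, w))).
  { unfold W at 1. replace (N k - m k)%nat with (J + (N k - m k - J))%nat by lia.
    rewrite Nat.iter_add. f_equal. f_equal.
    rewrite (surjective_pairing (Nat.iter (N k - m k - J) P (Z k (m k), wk k))).
    rewrite (skew_iter_fst P p q P_skew). unfold w, W, Z.
    rewrite <- Nat.iter_add. replace (N k - m k - J + m k)%nat with n by (unfold n; lia). reflexivity. }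
  rewrite HWN.
  assert (Hs : Cmod (snd (Nat.iter J P (Z k n, w)) - Nat.iter J q0 w) < eps / 2).
  { apply Hsh; [lra|]. eapply Rle_lt_trans; [exact HZn|]. apply Rlt_le_trans with (3 / INR (m k)).
    - unfold Rdiv. apply Rmult_lt_compat_r; [apply Rinv_0_lt_compat; lra | lra].
    - apply Rmult_le_reg_r with (INR (m k)); [lra|]. unfold Rdiv. rewrite Rmult_assoc, Rinv_l by lra.
      apply (Rmult_le_compat_l dz) in G6; [|lra]. replace (dz * (3 / dz)) with 3 in G6 by (field; lra). lra. }
  rewrite Hq0 in Hs.
  match goal with |- Cmod (?x - ?y) < _ => replace (x - y)%C with ((x - psi_o (phi_o w + j)) + (psi_o (phi_o w + j) - y))%C by ring end.
  eapply Rle_lt_trans; [apply Cmod_triangle|]. lra.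
Qed.

Variables (beta Ms : R).
Hypotheses (Hb : 1 / 4 < b) (Hbeta : ((b03 - a) * (alpha0 b - 1))%C = RtoC beta)
  (HN : forall k, INR (N k) = alpha0 b * INR (m k) + beta * ln (INR (m k)) + sg k)
  (Hsg : forall k, Rabs (sg k) <= Ms).

Let Lam k := (alpha0 b * phq k + (1 - alpha0 b) * ph k + (Gamma a b b03 b30 + sg k))%C.

(** The entry stage gives [Xs], hence the initial [eps]; [bulk_sum] transports it to the exit, and
    [bulk_limit] converts the result back into [X]. The boundary values of [Phi] are reached because
    the angles at the two ends tend to [0] and [PI]. *)
Lemma transit_limit : eventually (fun k => (m k + 2 * l k <= N k)%nat) /\
  o1 (fun k => Xc 1 (W k (N k - l k - m k)) - (- L k + B * ln (L k) + Lam k))%C.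
Proof.
  destruct (cst_c_pos b Hb) as [Hc Hbc].
  destruct (Gamma_integral_primitive b Hb) as (Phi & I0 & I1 & HPhi & HPhib & HI0 & HI1 & HGam).
  unfold Lam, Gamma, alpha0 in *. set (c := cst_c b) in *.
  assert (HMs0 : 0 <= Ms) by (eapply Rle_trans; [apply Rabs_pos | apply (Hsg 0%nat)]).
  assert (HMp0 : 0 <= Mp) by (eapply Rle_trans; [apply Cmod_ge_0 | apply (HMp 0%nat)]).
  set (mr := fun k => INR (m k)). set (Nr := fun k => INR (N k)). set (lam := fun k => ln (mr k)).
  set (al := exp (PI / c)) in *.
  assert (Hal : 1 < al) by (apply (al_gt_1 c Hc)).
  assert (S1 : eventually (fun k => 1 <= mr k)) by apply Hm.
  assert (S2 : eventually (fun k => 1 <= L k)).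
  { generalize (scale_conditions 1). apply filter_imp. intros k G; apply G. }
  assert (S3 : eventually (fun k => L k ^ 4 <= mr k)).
  { generalize (scale_conditions 1). apply filter_imp. intros k G; apply G. }
  assert (S4 : forall x, eventually (fun k => x <= L k)).
  { intros x. generalize (scale_conditions x). apply filter_imp. intros k G; apply G. }
  assert (S6 : forall x, eventually (fun k => x * lam k <= L k)).
  { intros x. generalize (scale_conditions x). apply filter_imp. intros k G; apply G. }
  assert (S7 : forall x, eventually (fun k => x * L k <= mr k)).
  { intros x. generalize (scale_conditions x). apply filter_imp. intros k G; apply G. }
  assert (S5 : eventually (fun k => 1 <= lam k <= L k)).
  { generalize (filter_and _ _ (S6 1) (Hm 3)). apply filter_imp. intros k [G1 G2].
    split; [|lra]. unfold lam, mr. rewrite <- (ln_exp 1). apply ln_le; [apply exp_pos|].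
    pose proof exp_le_3. lra. }
  destruct (transit_env c beta Ms Hc HMs0) as (Kt & mt & HKt & Hmt & Henv).
  assert (Hgap : eventually (fun k => (m k + 2 * l k <= N k)%nat)).
  { generalize (filter_and _ _ (Hm mt) (S7 (4 / (al - 1)))). apply filter_imp. intros k [G1 G2].
    destruct (Henv (mr k) (Nr k) (sg k) G1 (Hsg k) (HN k)) as (_ & _ & _ & G3 & _). fold al in G3.
    apply INR_le. rewrite plus_INR, mult_INR. fold (L k) (mr k) (Nr k). simpl (INR 2).
    apply (Rmult_le_compat_r ((al - 1) / 2)) in G2; [|lra].
    replace (4 / (al - 1) * L k * ((al - 1) / 2)) with (2 * L k) in G2 by (field; lra). lra. }
  split; [exact Hgap|].
  assert (Hth : eventually (fun k => 0 < transit_angle (mr k) (Nr k) (mr k + L k) < PI /\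
    0 < transit_angle (mr k) (Nr k) (Nr k - L k) < PI)).
  { generalize (filter_and _ _ (Hm mt) (filter_and _ _ Hgap (S4 2))). apply filter_imp. intros k (G1 & G2 & G4).
    destruct (Henv (mr k) (Nr k) (sg k) G1 (Hsg k) (HN k)) as (_ & _ & _ & _ & _ & _ & _ & G3).
    apply le_INR in G2. rewrite plus_INR, mult_INR in G2. fold (L k) (mr k) (Nr k) in G2. simpl (INR 2) in G2.
    assert (G5 : forall x, mr k + 1 <= x <= Nr k - 2 -> 0 < transit_angle (mr k) (Nr k) x < PI).
    { intros x Hx. destruct (G3 x Hx) as (_ & G5 & _ & _ & G6 & _). apply G6. lra. }
    split; apply G5; lra. }
  set (Zs := fun k => Z k (m k + l k)). set (Ze := fun k => Z k (N k - l k)). set (Xs := fun k => Xc 1 (W k (l k))).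
  assert (HNl : eventually (fun k => INR (N k - l k) = Nr k - L k)).
  { revert Hgap. apply filter_imp. intros k G. rewrite minus_INR by lia. reflexivity. }
  assert (HZs0 : eventually (fun k => Zs k <> 0)).
  { generalize base_small. apply filter_imp. intros k G. apply G. lia. }
  assert (HZe0 : eventually (fun k => Ze k <> 0)).
  { generalize (filter_and _ _ Hgap base_small). apply filter_imp. intros k [G1 G]. apply G. lia. }
  assert (HZs : o1 (fun k => / Zs k - ((mr k + L k)%R + (1 - a) * ln (mr k + L k) + ph k))%C).
  { intros eps He. destruct (Hz eps He) as (n0 & Hn0). generalize (Hm (INR n0)). apply filter_imp.
    intros k G. apply INR_le in G. specialize (Hn0 (m k + l k)%nat k ltac:(lia)).
    rewrite plus_INR in Hn0. apply Hn0. }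
  assert (HZe : o1 (fun k => / Ze k - ((Nr k - L k)%R + (1 - a) * ln (Nr k - L k) + ph k))%C).
  { intros eps He. destruct (Hz eps He) as (n0 & Hn0). generalize (filter_and _ _ (Hm (INR n0)) (filter_and _ _ Hgap HNl)).
    apply filter_imp. intros k (G & G2 & G3). apply INR_le in G. specialize (Hn0 (N k - l k)%nat k ltac:(lia)).
    rewrite G3 in Hn0. apply Hn0. }
  assert (HXs : o1 (fun k => Xs k - (L k + (1 - b03) * ln (L k) + phq k))%C) by apply entry_stage.
  assert (Eph : exists M, forall k, Cmod (ph k) <= M) by (exists Mp; exact HMp).
  assert (Ephq : exists M, forall k, Cmod (phq k) <= M) by (exists Mq; exact HMq).
  assert (Esg : exists M, forall k, Rabs (sg k) <= M) by (exists Ms; exact Hsg).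
  assert (Hlam : forall k, lam k = ln (mr k)) by reflexivity.
  destruct (entry_coordinate mr L S1 S2 S3 S4 c beta Nr lam sg Hc Hlam S5 HN Esg a b03 ph phq Zs Ze Xs
    Eph Ephq HZs0 HZs HZe HXs) as (epss & HE1 & HE2).
  destruct (proj2 (Xs_near_L mr L S2 S3 S4 lam Hlam S5 b03 phq Xs Ephq HXs)) as (MX & HMX & HXL).
  cbv beta in HE1, HE2.
  set (Ke := 1 + c * MX). assert (HKe : 0 <= Ke) by (unfold Ke; assert (0 <= c * MX) by (apply Rmult_le_pos; lra); lra).
  assert (Heps : eventually (fun k => Cmod (epss k) <= Ke * lam k / mr k)).
  { generalize (filter_and _ _ (HE2 1 Rlt_0_1) (filter_and _ _ HXL (filter_and _ _ S1 S5))). apply filter_imp.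
    intros k (G1 & G2 & G3 & G4).
    assert (G5 : Cmod (mr k * epss k) <= Ke * lam k).
    { replace (mr k * epss k)%C with ((mr k * epss k - c * (Xs k - L k)) + c * (Xs k - L k))%C by ring.
      eapply Rle_trans; [apply Cadd_le; [apply Rlt_le, G1 | apply Cmul_le; [apply Rle_refl | exact G2]]|].
      rewrite Cmod_R, Rabs_pos_eq by lra. unfold Ke. lra. }
    rewrite Cmod_mult, Cmod_R, Rabs_pos_eq in G5 by lra.
    apply Rmult_le_reg_l with (mr k); [lra|]. replace (mr k * (Ke * lam k / mr k)) with (Ke * lam k) by (field; lra).
    exact G5. }
  set (KPhi := Rabs I0 + Rabs I1).
  assert (HKP : 0 <= KPhi) by (unfold KPhi; pose proof (Rabs_pos I0); pose proof (Rabs_pos I1); lra).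
  assert (HPhiB : forall x, 0 < x < PI -> Rabs (Phi x) <= KPhi).
  { intros x Hx. specialize (HPhib x Hx). unfold KPhi. pose proof (Rle_abs I0). pose proof (Rle_abs (- I1)) as G.
    rewrite Rabs_Ropp in G. pose proof (Rabs_pos I0). pose proof (Rabs_pos I1). apply Rabs_le. lra. }
  destruct (bulk_sum a b03 b30 b c beta C0 Mp Ms Ke d0 KPhi Phi Hc Hbc HC0 HMp0 HMs0 HKe Hd0 HKP HPhi HPhiB)
    as (Mb & l0 & HMb & Hl0 & Hbulk).
  set (We := fun k => W k (N k - l k - m k)).
  set (the := fun k => transit_angle (mr k) (Nr k) (Nr k - L k)).
  set (ths := fun k => transit_angle (mr k) (Nr k) (mr k + L k)).
  set (pots := fun k => transit_pot a b03 b30 b c (mr k) Phi (mr k + L k) (ths k) (Zs k)).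
  set (pote := fun k => transit_pot a b03 b30 b c (mr k) Phi (Nr k - L k) (the k) (Ze k)).
  set (good := fun k e1 => transit_rel c (sin (the k)) (cos (the k)) (Ze k) (We k) e1 /\
    Cmod e1 <= Mb * lam k / mr k /\
    Cmod (e1 - epss k - (pote k - pots k)) <= Mb * (lam k / (mr k * L k) + lam k ^ 2 / mr k ^ 2)).
  assert (Hgood : eventually (fun k => exists e1, good k e1)).
  { destruct (Hz 1 Rlt_0_1) as (n0 & Hn0).
    assert (H3d : 0 < 3 / d0) by (apply Rdiv_lt_0_compat; lra).
    generalize (filter_and _ _ HE1 (filter_and _ _ Heps (filter_and _ _ (Hm (l0 + 3 / d0 + INR n0))
      (filter_and _ _ (S6 l0) (filter_and _ _ (S7 l0) (filter_and _ _ Hgap (filter_and _ _ HNl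
        (filter_and _ _ base_small S2)))))))).
    apply filter_imp. intros k (G1 & G2 & G3 & G4 & G5 & G6 & G7 & G8 & G9). fold (mr k) in G3. pose proof (pos_INR n0) as Hn00.
    assert (HZd : forall n, (m k <= n)%nat -> Cmod (Z k n) < d0).
    { intros n Hn. eapply Rle_lt_trans; [apply G8; exact Hn|]. fold (mr k).
      apply Rmult_lt_reg_r with (mr k); [lra|]. unfold Rdiv. rewrite Rmult_assoc, Rinv_l by lra.
      assert (d0 * (3 / d0) <= d0 * mr k) by (apply Rmult_le_compat_l; lra).
      replace (d0 * (3 / d0)) with 3 in H by (field; lra). lra. }
    destruct (Hbulk (m k) (N k) (l k) (sg k) (ph k) (Z k) (fun n => W k (n - m k))) with (eps0 := epss k)
      as (_ & e1 & R1 & R2 & R3).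
    - fold (mr k). lra.
    - exact G4.
    - exact G5.
    - apply Hsg.
    - apply HN.
    - apply HMp.
    - intros n Hn. destruct (Hn0 n k) as [A1 A2].
      + apply INR_le. assert (G10 : (m k <= n)%nat) by lia. apply le_INR in G10. fold (mr k) in G10. lra.
      + split; [exact A1 | apply Rlt_le, A2].
    - intros n Hn. apply p_est. apply HZd. lia.
    - intros n Hn A1 A2. replace (S n - m k)%nat with (S (n - m k)) by lia. rewrite fiber_eq.
      replace (m k + (n - m k))%nat with n by lia. apply q_est; assumption.
    - rewrite plus_INR. replace (m k + l k - m k)%nat with (l k) by lia.
      replace (W k (l k)) with (- / Xs k)%C; [exact G1|].
      unfold Xs, Xc. assert (HX0 : W k (l k) = RtoC 0 \/ W k (l k) <> 0) by apply classic.
      (* If the fiber coordinate is [0], both sides are [0] with the present inversion; otherwise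
         this is a field identity. *)
      destruct HX0 as [E | E]; [|field; repeat split; auto].
      rewrite E. unfold Cinv. apply injective_projections; simpl; unfold Rdiv; ring.
    - exact G2.
    - exists e1. rewrite G7 in R1, R3. rewrite plus_INR in R3. split; [exact R1|]. split; [exact R2 | exact R3]. }
  (* A good value exists only for large [k]. The sequence takes the default value [0] elsewhere,
     which does not affect eventual statements. *)
  destruct (choice (fun k e1 => (exists e, good k e) -> good k e1)) as (epse & Hepse).
  { intros k. destruct (classic (exists e, good k e)) as [(e & He) | H]; [exists e; auto | exists (RtoC 0); tauto]. }
  assert (Hge : eventually (fun k => good k (epse k))).
  { revert Hgood. apply filter_imp. intros k. apply Hepse. }
  assert (Hths : o1 (fun k => ths k)).
  { apply (o1_ext (fun k => (ths k - c * (L k * / mr k)%R) + c * (L k * / mr k)%R)%C); [exists 0%nat; intros; ring|].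
    apply o1_plus.
    - apply (bO_o1 mr L S1 S2 S3 S4 _ 2 2); [|lia]. eapply bO_ths; eassumption.
    - apply o1_scal. apply (bO_o1 mr L S1 S2 S3 S4 _ 1 1); [|lia]. apply bO_t; assumption. }
  assert (Hthe : o1 (fun k => (PI - the k)%R)).
  { apply (o1_ext (fun k => ((PI - the k)%R - (c / al)%R * (L k * / mr k)%R) + (c / al)%R * (L k * / mr k)%R)%C);
      [exists 0%nat; intros; ring|].
    apply o1_plus.
    - apply (bO_o1 mr L S1 S2 S3 S4 _ 2 2); [|lia]. eapply bO_the; eassumption.
    - apply o1_scal. apply (bO_o1 mr L S1 S2 S3 S4 _ 1 1); [|lia]. apply bO_t; assumption. }
  assert (HPs : o1 (fun k => Phi (ths k) - I0)%C).
  { intros eps He. destruct (HI0 eps He) as (d & Hd & G). generalize (filter_and _ _ Hth (Hths d Hd)).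
    apply filter_imp. intros k [G1 G2]. fold (ths k) in G1. rewrite Cmod_R in G2. rewrite <- RtoC_minus, Cmod_R.
    apply G. apply Rabs_lt_between in G2. lra. }
  assert (HPe : o1 (fun k => Phi (the k) - I1)%C).
  { intros eps He. destruct (HI1 eps He) as (d & Hd & G). generalize (filter_and _ _ Hth (Hthe d Hd)).
    apply filter_imp. intros k [G1 G2]. fold (the k) in G1. rewrite Cmod_R in G2. rewrite <- RtoC_minus, Cmod_R.
    apply G. apply Rabs_lt_between in G2. lra. }
  assert (Hb0 : b <> 0) by lra.
  assert (HbO : bO mr L epse 1 1).
  { exists Mb. split; [lra|]. generalize (filter_and _ _ Hge (filter_and _ _ S1 S5)). apply filter_imp.
    intros k ((_ & G1 & _) & G2 & G3). eapply Rle_trans; [exact G1|]. unfold scale. rewrite !pow_1.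
    unfold Rdiv. rewrite Rmult_assoc. apply Rmult_le_compat_l; [lra|]. rewrite Rmult_comm.
    apply Rmult_le_compat_l; [apply Rlt_le, Rinv_0_lt_compat|]; lra. }
  assert (HP2 : o1 (fun k => mr k * (epse k - epss k - (pote k - pots k)))%C).
  { intros eps He. generalize (filter_and _ _ Hge (filter_and _ _ S1 (filter_and _ _ S5 (filter_and _ _ S2
      (filter_and _ _ S3 (S6 ((2 * Mb + 1) / eps))))))).
    apply filter_imp. intros k ((_ & _ & G1) & G2 & G3 & G4 & G5 & G6).
    rewrite Cmod_mult, Cmod_R, Rabs_pos_eq by lra.
    apply (Rmult_le_compat_l eps) in G6; [|lra].
    replace (eps * ((2 * Mb + 1) / eps * lam k)) with ((2 * Mb + 1) * lam k) in G6 by (field; lra).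
    apply Rle_lt_trans with (mr k * (Mb * (lam k / (mr k * L k) + lam k ^ 2 / mr k ^ 2))); [apply Rmult_le_compat_l; lra|].
    replace (mr k * (Mb * (lam k / (mr k * L k) + lam k ^ 2 / mr k ^ 2))) with
      (Mb * (lam k / L k + lam k ^ 2 / mr k)) by (field; lra).
    assert (G7 : lam k ^ 2 / mr k <= lam k / L k).
    { apply Rle_trans with (L k ^ 2 / L k ^ 4).
      - unfold Rdiv. apply Rmult_le_compat; [apply pow2_ge_0 | apply Rlt_le, Rinv_0_lt_compat; lra | apply pow_incr; lra |].
        apply Rinv_le_contravar; [apply pow_lt; lra | exact G5].
      (* Here [lam <= L] and [L ^ 4 <= m] bound [lam ^ 2 / m] by [lam / L], which tends to [0]
         because [L] exceeds every multiple of [lam]. *)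
      - replace (L k ^ 2 / L k ^ 4) with (/ L k * / L k) by (field; lra). unfold Rdiv.
        apply Rmult_le_compat_r; [apply Rlt_le, Rinv_0_lt_compat; lra|].
        apply Rle_trans with 1; [|lra]. rewrite <- Rinv_1. apply Rinv_le_contravar; lra. }
    apply Rle_lt_trans with (Mb * (2 * (lam k / L k))); [apply Rmult_le_compat_l; lra|].
    apply Rmult_lt_reg_r with (L k); [lra|].
    replace (Mb * (2 * (lam k / L k)) * L k) with (2 * Mb * lam k) by (field; lra). lra. }
  assert (Hrel : eventually (fun k => transit_rel c (sin (the k)) (cos (the k)) (Ze k) (We k) (epse k))).
  { revert Hge. apply filter_imp. intros k G. apply G. }
  destruct (bulk_limit mr L S1 S2 S3 S4 c beta Nr lam sg Hc Hlam S5 HN Esg a b03 b30 b ph phq Zs Ze Xs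
    Eph HZe0 HZs HZe HXs Phi I0 I1 HPs HPe Hb0 Hbeta epss epse We HE2 HbO Hrel HP2) as [HW0 Hlim].
  revert Hlim. apply o1_ext. revert HW0. apply filter_imp. intros k G. fold (We k).
  rewrite HGam, RtoC_minus. fold al. unfold Xc, B.
  replace (- (1 / (1 * We k)))%C with (- / We k)%C by (field; exact G). ring.
Qed.

Lemma skew_transit_limit :
  o1 (fun k => W k (N k - m k) - psi_o (Lam k))%C /\ o1 (fun k => Z k (N k)).
Proof.
  destruct transit_limit as [Hgap Hlim]. split.
  - apply (exit_limit Lam (alpha0 b * Mq + Rabs (1 - alpha0 b) * Mp + (Cmod (Gamma a b b03 b30) + Ms))).
    + intros k. unfold Lam.
      assert (Hal : 0 < alpha0 b) by apply exp_pos.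
      apply Cadd_le; [apply Cadd_le | apply Cadd_le].
      * rewrite Cmod_mult, Cmod_R, Rabs_pos_eq by lra. apply Rmult_le_compat_l; [lra | apply HMq].
      * rewrite <- RtoC_minus, Cmod_mult, Cmod_R. apply Rmult_le_compat_l; [apply Rabs_pos | apply HMp].
      * lra.
      * rewrite Cmod_R. apply Hsg.
    + exact Hgap.
    + exact Hlim.
  - intros eps He. assert (Hp : 0 < 3 / eps) by (apply Rdiv_lt_0_compat; lra).
    generalize (filter_and _ _ Hgap (filter_and _ _ base_small (filter_and _ _ (Hm 1) (Hm (3 / eps))))). apply filter_imp.
    intros k (G1 & G2 & G3 & G4). destruct (G2 (N k) ltac:(lia)) as [_ G5]. eapply Rle_lt_trans; [exact G5|].
    apply Rmult_lt_reg_r with (INR (m k)); [lra|]. unfold Rdiv. rewrite Rmult_assoc, Rinv_l by lra.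
    assert (H : eps * (3 / eps) <= eps * INR (m k)) by (apply Rmult_le_compat_l; lra).
    replace (eps * (3 / eps)) with 3 in H by (field; lra). lra.
Qed.

End Transit.

(** * From sequences of transits to uniformity on compact sets *)

Lemma continuous_fst_C2 (x : C2) : @continuous C2 C_UniformSpace (fun y : C2 => fst y : C) x.
Proof.
  intros Q HQ. apply locally_Cmod in HQ. destruct HQ as (d & Hd & HQ). apply locally_C2.
  exists d. auto.
Qed.

Lemma continuous_snd_C2 (x : C2) : @continuous C2 C_UniformSpace (fun y : C2 => snd y : C) x.
Proof.
  intros Q HQ. apply locally_Cmod in HQ. destruct HQ as (d & Hd & HQ). apply locally_C2.
  exists d. auto.
Qed.

Lemma holomorphic2_continuous (F : C2 -> C2) : holomorphic2 F -> forall x, @continuous C2 C2 F x.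
Proof. intros H x. apply (@filterdiff_continuous C_AbsRing C2 C2 F x). apply H. Qed.

Lemma admissible_ge (alpha beta : R) (n : nat -> nat) (k : nat) : admissible alpha beta n -> (k <= n k)%nat.
Proof.
  intros (_ & H & _). induction k as [|k IH]; [lia|]. specialize (H k). lia.
Qed.

Theorem mainTheorem2 (P : C2 -> C2) (p : C -> C) (q : C -> C -> C)
  (a b03 b30 : C) (b beta0 : R)
  (P_holomorphic : holomorphic2 P)
  (P_skew : forall z w : C, P (z, w) = (p z, q z w))
  (p_expansion :
    @bigO_pow C_NormedModule
      (fun z : C => p z - (z - z ^ 2 + a * z ^ 3))%C 4)
  (q_expansion :
    @bigO_pow C2
      (fun x : C * C => let (z, w) := x in
        q z w - (w + w ^ 2 + b * z ^ 2 + b03 * w ^ 3 + b30 * z ^ 3))%C 4)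
  (b_gt : 1 / 4 < b)
  (beta0_eq : ((b03 - a) * (alpha0 b - 1))%C = RtoC beta0) :
  let q0 := q (RtoC 0) in
  exists r0 : R, 0 < r0 /\
  forall (rp rq : R), 0 < rp < r0 -> 0 < rq < r0 ->
  forall (phi_p phi_q phi_o psi_o : C -> C),
    incoming_fatou p (RtoC (-1)) a rp phi_p ->
    incoming_fatou q0 (RtoC 1) b03 rq phi_q ->
    outgoing_fatou q0 (RtoC 1) b03 rq phi_o ->
    outgoing_inverse q0 (RtoC 1) rq phi_o psi_o ->
  forall n : nat -> nat,
    admissible (alpha0 b) beta0 n ->
  forall K : C2 -> Prop,
    compact_set K ->
    (forall z w : C, K (z, w) ->
      basin p (RtoC (-1)) rp z /\ basin q0 (RtoC 1) rq w) ->
  forall eps : R, 0 < eps ->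
    eventually (fun k : nat => forall z w : C, K (z, w) ->
      @norm C_AbsRing C2
        (minus
          (Nat.iter (n (S k) - n k) P (Nat.iter (n k) p z, w) : C2)
          (RtoC 0,
           lavaurs psi_o phi_q phi_p (RtoC (alpha0 b))
             (Gamma a b b03 b30 + phase (alpha0 b) beta0 n k)%C z w)) < eps).
Proof.
  intros q0.
  pose proof (holomorphic2_continuous P P_holomorphic) as P_cont.
  destruct (skew_estimates p q a b b03 b30 p_expansion q_expansion)
    as (p_0 & p_exp & q0_exp & C0 & d0 & HC0 & Hd0 & p_est & q_est).
  assert (H1n : RtoC 1 <> 0) by (intros E; apply RtoC_inj in E; lra).
  assert (Hm1n : RtoC (-1) <> 0) by (intros E; apply RtoC_inj in E; lra).
  destruct (incoming_asymptotics p (-1) a Hm1n (skew_base_continuous P p q P_cont P_skew) p_exp)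
    as (r1 & Hr1 & Hp).
  destruct (incoming_asymptotics q0 1 b03 H1n (skew_fiber_continuous P p q P_cont P_skew 0) q0_exp)
    as (r2 & Hr2 & Hq).
  exists (Rmin r1 r2). split; [apply Rmin_pos; assumption|].
  intros rp rq Hrp Hrq phi_p phi_q phi_o psi_o Hphip Hphiq Hphio Hpsio n Hadm K HK HKb eps Heps.
  pose proof (Rmin_l r1 r2) as Hl. pose proof (Rmin_r r1 r2) as Hr.
  (* The asymptotics of the two Fatou coordinates are needed on compact subsets of each factor, so
     [K] is replaced by its two projections. *)
  pose proof (compact_image _ K continuous_fst_C2 HK) as HK1.
  pose proof (compact_image _ K continuous_snd_C2 HK) as HK2.
  set (K1 := fun y : C_UniformSpace => exists x : C2, K x /\ (fst x : C) = y) in HK1.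
  set (K2 := fun y : C_UniformSpace => exists x : C2, K x /\ (snd x : C) = y) in HK2.
  assert (HK1b : forall z, K1 z -> basin p (-1) rp z).
  { intros z ([z' w'] & Hx & <-). apply (HKb z' w'), Hx. }
  assert (HK2b : forall w, K2 w -> basin q0 1 rq w).
  { intros w ([z' w'] & Hx & <-). apply (HKb z' w'), Hx. }
  destruct (Hp rp ltac:(lra) phi_p Hphip K1 HK1 HK1b) as ((Mp & HMp) & Hpasym).
  destruct (Hq rq ltac:(lra) phi_q Hphiq K2 HK2 HK2b) as ((Mq & HMq) & Hqasym).
  (* If uniform convergence failed, there would be indices [kk j >= j] and points of [K] at which
     the error is at least [eps]. The limit along this sequence of transits, started at these
     points, contradicts it. *)
  apply NNPP. intros Hno.
  assert (Hbad : forall j, exists v : nat * (C * C), (j <= fst v)%nat /\ K (fst (snd v), snd (snd v)) /\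
    eps <= @norm C_AbsRing C2
        (minus
          (Nat.iter (n (S (fst v)) - n (fst v)) P (Nat.iter (n (fst v)) p (fst (snd v)), snd (snd v)) : C2)
          (RtoC 0,
           lavaurs psi_o phi_q phi_p (RtoC (alpha0 b))
             (Gamma a b b03 b30 + phase (alpha0 b) beta0 n (fst v))%C (fst (snd v)) (snd (snd v))))).
  { intros j. apply NNPP. intros Hj. apply Hno. exists j. intros k Hk z w Hzw.
    apply Rnot_le_lt. intros Hle. apply Hj. exists (k, (z, w)). auto. }
  apply choice in Hbad. destruct Hbad as (v & Hv).
  set (kk := fun j => fst (v j)). set (zk := fun j => fst (snd (v j))). set (wk := fun j => snd (snd (v j))).
  destruct (proj2 (proj2 Hadm)) as (Ms & HMs).
  assert (HzK : forall j, K1 (zk j)).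
  { intros j. exists (zk j, wk j). split; [apply Hv | reflexivity]. }
  assert (HwK : forall j, K2 (wk j)).
  { intros j. exists (zk j, wk j). split; [apply Hv | reflexivity]. }
  destruct (skew_transit_limit P p q a b03 b30 b C0 d0 P_cont P_skew p_0 HC0 Hd0 p_est q_est
    (fun j => n (kk j)) (fun j => n (S (kk j))) (fun j => phase (alpha0 b) beta0 n (kk j)) zk wk
    (fun j => phi_p (zk j)) (fun j => phi_q (wk j)) K2 Mp Mq) with (rq := rq) (phi_o := phi_o) (psi_o := psi_o)
    (beta := beta0) (Ms := Ms) as [HW HZ].
  - intros j. apply HMp, HzK.
  - intros j. apply HMq, HwK.
  - intros x. destruct (nat_above x) as (j0 & Hj0). exists j0. intros j Hj.
    eapply Rle_trans; [exact Hj0|]. apply le_INR.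
    pose proof (admissible_ge _ _ _ (kk j) Hadm). destruct (Hv j) as [G _]. fold (kk j) in G. lia.
  - exact HK2.
  - exact HwK.
  - intros e He. destruct (Hpasym e He) as (n0 & Hn0). exists n0. intros i j Hi.
    destruct (Hn0 i (zk j) Hi (HzK j)) as [G1 G2]. split; [exact G1|].
    set (zi := Nat.iter i p (zk j)) in *.
    replace (/ zi)%C with (Xc (-1) zi) by (unfold Xc; field; auto).
    replace (1 - a)%C with (resit (-1) a); [exact G2|]. unfold resit. field.
  - intros e He. destruct (Hqasym e He) as (n0 & Hn0). exists n0. intros i j Hi.
    destruct (Hn0 i (wk j) Hi (HwK j)) as [G1 G2]. split; [exact G1|].
    rewrite resit_1 in G2. exact G2.
  - apply Hrq.
  - exact Hphio.
  - exact Hpsio.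
  - exact b_gt.
  - exact beta0_eq.
  - intros j. unfold phase. ring.
  - intros j. apply HMs.
  - assert (He2 : 0 < eps / 2) by lra.
    destruct (filter_and _ _ (HW _ He2) (HZ _ He2)) as (j & Hj).
    destruct (Hj j (le_n j)) as [G1 G2]. destruct (Hv j) as (_ & _ & G3).
    fold (kk j) (zk j) (wk j) in G3.
    apply (Rle_not_lt _ _ G3). eapply Rle_lt_trans; [apply C2_norm_le|].
    set (x := Nat.iter (n (S (kk j)) - n (kk j)) P (Nat.iter (n (kk j)) p (zk j), wk j)) in *.
    assert (E : fst x = Nat.iter (n (S (kk j))) p (zk j)).
    { unfold x. rewrite (skew_iter_fst P p q P_skew), <- Nat.iter_add. f_equal.
      pose proof (proj1 (proj2 Hadm) (kk j)). lia. }
    pose proof (Rplus_lt_compat _ _ _ _ G2 G1) as G4.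
    replace (eps / 2 + eps / 2) with eps in G4 by field.
    eapply Rle_lt_trans; [|exact G4]. right. f_equal; f_equal.
    rewrite <- E. exact (minus_zero_r (G := C_AbelianGroup) (fst x)).
Qed.
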